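(* Let $\Omega \subseteq \mathbb{R}^N$ be an open and bounded Lipschitz domain and let $U \subseteq \mathbb{R}^N$ be an open set with $\Omega \Subset U$. Let $\varkappa > 0$ and let $1 \le p \le q \le p + \varkappa \max(1, p/N)$ with $1<q<\infty$. Let $a$ be a non-negative function satisfying $a = \sigma\omega$ on $\Omega$, where $\sigma \in \mathcal{Z}^{\varkappa}(\Omega)$ and $\omega \in A_q(U) \cap L^\infty(\Omega)$. Set $$\mathcal{F}[u;\Omega] = \int_\Omega \left(|\nabla u|^p + a(x)|\nabla u|^q\right)\,dx .$$ Then, for every $u_0 \in W^{1,1}(\Omega)$ such that $\mathcal{F}[u_0;\Omega] < \infty$, $$\inf_{u \in u_0 + W^{1,1}_0(\Omega)} \mathcal{F}[u;\Omega] = \inf_{u \in u_0 + C_c^\infty(\Omega)} \mathcal{F}[u;\Omega].$$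
   Context: $\Omega \Subset U$ means that $\overline{\Omega}$ is a compact subset of $U$. For an open set $V\subseteq\mathbb{R}^N$ and $\varkappa>0$, a non-negative function $\sigma$ on $V$ belongs to $\mathcal{Z}^{\varkappa}(V)$ if there is a constant $C$ such that $\sigma(x) \le C\left(\sigma(y) + |x-y|^{\varkappa}\right)$ for all $x,y \in V$. For $r \in (1,\infty)$ and an open set $V\subseteq\mathbb{R}^N$, a function $\omega : V \to [0,\infty)$ belongs to the local Muckenhoupt class $A_r(V)$ if $$\sup_{B \subseteq V} \left(\frac{1}{|B|}\int_B \omega \,dz\right)\left(\frac{1}{|B|}\int_B \omega^{-\frac{1}{r-1}}\,dz\right)^{r-1} < \infty,$$ where the supremum is over all balls $B$ contained in $V$ (and $\omega^{-1/(r-1)}=+\infty$ where $\omega=0$). $\omega\in L^\infty(\Omega)$ means that the restriction of $\omega$ to $\Omega$ is essentially bounded. $\mathcal{F}[u;\Omega]$ takes values in $[0,\infty]$. *)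

(* Defs.v *)
From HB Require Import structures.
From mathcomp Require Import all_boot all_order all_algebra.
From mathcomp Require Import all_classical all_reals all_analysis.

Set Implicit Arguments.
Unset Strict Implicit.
Unset Printing Implicit Defensive.

Import Order.TTheory GRing.Theory Num.Theory.
Import numFieldNormedType.Exports.

Local Open Scope classical_set_scope.
Local Open Scope ring_scope.

(* The product sigma-algebra is put on an alias, so that no sigma-algebra is
   inferred for the bare type 'rV[R]_n. *)
Definition borel_rV (R : realType) (n : nat) : Type := 'rV[R]_n.

Section borel_rV.
Context (R : realType) (n : nat).

Definition rV_coord (i : 'I_n) (x : borel_rV R n) : R := (x : 'rV[R]_n) ord0 i.

Let rV_set0 : g_sigma_preimage rV_coord set0.
Proof. exact: sigma_algebra0. Qed.

Let rV_setC A : g_sigma_preimage rV_coord A ->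
  g_sigma_preimage rV_coord (~` A).
Proof. exact: sigma_algebraC. Qed.

Let rV_bigcup (F : _^nat) : (forall i, g_sigma_preimage rV_coord (F i)) ->
  g_sigma_preimage rV_coord (\bigcup_i (F i)).
Proof. exact: sigma_algebra_bigcup. Qed.

HB.instance Definition _ := Choice.copy (borel_rV R n) 'rV[R]_n.
HB.instance Definition _ := isPointed.Build (borel_rV R n) (0 : 'rV[R]_n).
HB.instance Definition _ := @isMeasurable.Build default_measure_display
  (borel_rV R n) (g_sigma_preimage rV_coord) rV_set0 rV_setC rV_bigcup.

Lemma measurable_rV_coord i : measurable_fun [set: borel_rV R n] (rV_coord i).
Proof.
move=> _ Y mY; rewrite setTI; apply: sub_sigma_algebra => /=.
rewrite -bigcup_seq/=; exists i => /=; first by rewrite mem_index_enum.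
by exists Y => //; rewrite setTI.
Qed.

Lemma measurable_fun_rVP d (T : measurableType d) (f : T -> borel_rV R n) :
  (forall i, measurable_fun [set: T] (rV_coord i \o f)) ->
  measurable_fun [set: T] f.
Proof.
move=> mf; apply: (measurability
  (\big[setU/set0]_(i < n) preimage_set_system setT (rV_coord i) measurable)).
  by [].
move=> _ [B + <-]; rewrite -bigcup_seq => -[i _ [A mA <-]].
rewrite !setTI; have := mf i measurableT _ mA.
by rewrite setTI.
Qed.

End borel_rV.

Section rV_cons.
Context (R : realType) (n : nat).

Definition rV_cons (y : R * borel_rV R n) : borel_rV R n.+1 :=
  \row_(i < n.+1) if unlift ord0 i is Some j then rV_coord j y.2 else y.1.

Definition rV_uncons (x : borel_rV R n.+1) : R * borel_rV R n :=
  (rV_coord ord0 x, \row_(j < n) rV_coord (lift ord0 j) x).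

Lemma rV_consK : cancel rV_cons rV_uncons.
Proof.
move=> [a v]; rewrite /rV_uncons /rV_coord/= mxE unlift_none; congr pair.
by apply/rowP => j; rewrite !mxE liftK.
Qed.

Lemma measurable_rV_cons : measurable_fun setT rV_cons.
Proof.
apply: measurable_fun_rVP => i; rewrite /comp /rV_coord.
under eq_fun do rewrite mxE.
case: unliftP => [j|] _ /=; last exact: measurable_fst.
exact: (measurableT_comp (measurable_rV_coord j) measurable_snd).
Qed.

Lemma measurable_rV_uncons : measurable_fun setT rV_uncons.
Proof.
apply/measurable_fun_pairP; split; first exact: measurable_rV_coord.
apply: measurable_fun_rVP => i.
rewrite (_ : _ \o _ = rV_coord (lift ord0 i)); first exact: measurable_rV_coord.
by apply/funext => x; rewrite /= {1}/rV_coord mxE.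
Qed.

End rV_cons.

(* Iterated product of the one-dimensional Lebesgue measure. *)
Fixpoint borel_lebesgue (R : realType) (n : nat) :
    set (borel_rV R n) -> \bar R :=
  match n with
  | 0 => \d_ ((0 : 'rV[R]_0) : borel_rV R 0)
  | m.+1 => pushforward (@lebesgue_measure R \x @borel_lebesgue R m)%E
                        (@rV_cons R m)
  end.

(* The sigma-finite structure of a product of sigma-finite measures is not
   inferred by canonical structures. *)
Section with_sigma_finite.
Context d (T : measurableType d) (R : realType).
Variables (mu : {measure set T -> \bar R}) (mu_sf : sigma_finite setT mu).

Definition with_sigma_finite of sigma_finite setT mu : set T -> \bar R := mu.

HB.instance Definition _ := Measure.copy (with_sigma_finite mu_sf) mu.
HB.instance Definition _ := @Measure_isSigmaFinite.Build _ _ _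
  (with_sigma_finite mu_sf) mu_sf.

End with_sigma_finite.

Section borel_lebesgue_measure.
Local Open Scope ereal_scope.

Let product_sigma_finite d d' (T : measurableType d) (T' : measurableType d')
    (R : realType) (mu : {sigma_finite_measure set T -> \bar R})
    (nu : {sigma_finite_measure set T' -> \bar R}) :
  sigma_finite setT (mu \x nu).
Proof.
have /sigma_finiteP[F [TF ndF mF]] := sigma_finiteT mu.
have /sigma_finiteP[G [TG ndG mG]] := sigma_finiteT nu.
exists (fun n => F n `*` G n).
  rewrite -setXTT TF TG predeqE => -[x y]; split; last first.
    by move=> [n _ []/= ? ?]; split; exists n.
  move=> [/= [n _ Fnx] [k _ Gky]]; exists (maxn n k) => //; split.
    by move: x Fnx; exact/subsetPset/ndF/leq_maxl.
  by move: y Gky; exact/subsetPset/ndG/leq_maxr.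
move=> k; have [? ?] := mF k; have [? ?] := mG k.
split; first exact: measurableX.
by rewrite product_measure1E// lte_mul_pinfty// ge0_fin_numE.
Qed.

Let pushforward_sigma_finite d d' (T : measurableType d)
    (T' : measurableType d') (R : realType)
    (mu : {measure set T -> \bar R}) (f : T -> T') (g : T' -> T) :
  sigma_finite setT mu -> measurable_fun setT f -> measurable_fun setT g -> cancel f g ->
  exists nu : {sigma_finite_measure set T' -> \bar R}, pushforward mu f = nu.
Proof.
move=> [F TF mF] mf mg fK.
pose nu := measure_function_pushforward__canonical__measure_function_Measure
  mu mf.
suff nu_sf : sigma_finite setT nu by exists (with_sigma_finite nu_sf).
exists (fun k => g @^-1` F k); first by rewrite -preimage_bigcup -TF.
move=> k; have [mFk Fkoo] := mF k; split.
  by rewrite -[X in measurable X]setTI; exact: mg.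
rewrite /= /pushforward -comp_preimage (_ : _ \o _ = id)//.
by apply/funext => y; exact: fK.
Qed.

Lemma borel_lebesgue_sigma_finite_measure (R : realType) n :
  exists mu : {sigma_finite_measure set (borel_rV R n) -> \bar R},
    @borel_lebesgue R n = mu.
Proof.
elim: n => [|n [mu muE]].
  by exists (\d_ ((0%R : 'rV[R]_0) : borel_rV R 0)).
have [nu nuE] := pushforward_sigma_finite
  (product_sigma_finite (@lebesgue_measure R) mu)
  (@measurable_rV_cons R n) (@measurable_rV_uncons R n) (@rV_consK R n).
by exists nu; rewrite -nuE /= muE.
Qed.

Context (R : realType) (n : nat).

Let borel_lebesgue0 : @borel_lebesgue R n set0 = 0.
Proof. by have [mu ->] := borel_lebesgue_sigma_finite_measure R n. Qed.

Let borel_lebesgue_ge0 A : 0 <= @borel_lebesgue R n A.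
Proof. by have [mu ->] := borel_lebesgue_sigma_finite_measure R n. Qed.

Let borel_lebesgue_sigma_additive : semi_sigma_additive (@borel_lebesgue R n).
Proof.
have [mu ->] := borel_lebesgue_sigma_finite_measure R n.
exact: measure_semi_sigma_additive.
Qed.

HB.instance Definition _ := isMeasure.Build _ _ _ (@borel_lebesgue R n)
  borel_lebesgue0 borel_lebesgue_ge0 borel_lebesgue_sigma_additive.

Let borel_lebesgue_sigma_finite : sigma_finite setT (@borel_lebesgue R n).
Proof.
have [mu ->] := borel_lebesgue_sigma_finite_measure R n.
exact: sigma_finiteT.
Qed.

HB.instance Definition _ := @Measure_isSigmaFinite.Build _ _ _
  (@borel_lebesgue R n) borel_lebesgue_sigma_finite.

End borel_lebesgue_measure.

(* The sigma-algebra of lebesgue_space is that of the Lebesgue measurable sets,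
   and lebesgue_rV, the completion of borel_lebesgue, is Lebesgue measure. *)
Definition lebesgue_space (R : realType) (n : nat) :=
  caratheodory_type (@borel_lebesgue R n)^*%mu.

Definition lebesgue_rV (R : realType) (n : nat) :
    set (lebesgue_space R n) -> \bar R :=
  @completed_measure_extension _ _ _ (@borel_lebesgue R n).
Arguments lebesgue_rV : clear implicits.

HB.instance Definition _ (R : realType) (n : nat) :=
  Measure.on (lebesgue_rV R n).

Section euclidean.
Context (R : realType) (n : nat).

(* The library norm `|x| on 'rV[R]_n is the sup norm. *)
Definition enorm (x : 'rV[R]_n) : R := Num.sqrt (\sum_(i < n) x ord0 i ^+ 2).

Definition eball (x : 'rV[R]_n) (r : R) : set 'rV[R]_n :=
  [set y | enorm (y - x) < r].

Definition compactly_contained (A B : set 'rV[R]_n) : Prop :=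
  compact (closure A) /\ closure A `<=` B.

(* Near each boundary point, in coordinates obtained by a translation and an
   orthogonal map, A is the strict epigraph, in the direction of the i-th
   coordinate, of a Lipschitz function of the other coordinates. *)
Definition lipschitz_domain (A : set 'rV[R]_n) : Prop :=
  forall x0, (closure A `\` A°) x0 ->
    exists (r : R) (Q : 'M[R]_n) (i : 'I_n) (g : 'rV[R]_n.-1 -> R),
      [/\ 0 < r, Q *m Q^T = 1%:M, lipschitz g &
        forall x, eball x0 r x ->
          let y := (x - x0) *m Q in A x <-> g (col' i y) < y ord0 i].

End euclidean.

Section sobolev.
Context (R : realType) (n : nat).
Implicit Types (V : set 'rV[R]_n) (u v phi : 'rV[R]_n -> R).
Implicit Types g : 'rV[R]_n -> 'rV[R]_n.

Definition pderiv (i : 'I_n) u : 'rV[R]_n -> R := 'D_(delta_mx ord0 i) u.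

Definition smooth u : Prop := forall s : seq 'I_n,
  continuous (foldr pderiv u s) /\
  forall x i, derivable (foldr pderiv u s) x (delta_mx ord0 i).

(* Test functions on V, extended by 0 to the whole space. *)
Definition Cc_infty V : set ('rV[R]_n -> R) :=
  [set phi | [/\ smooth phi, compact (closure [set x | phi x != 0]) &
                 closure [set x | phi x != 0] `<=` V]].

Definition weak_gradient V u g : Prop :=
  (forall i, (lebesgue_rV R n).-integrable V (fun x => (g x ord0 i)%:E)) /\
  forall phi i, Cc_infty V phi ->
    (\int[lebesgue_rV R n]_(x in V) (u x * pderiv i phi x)%:E =
     - \int[lebesgue_rV R n]_(x in V) (g x ord0 i * phi x)%:E)%E.

(* Functions on V are represented by functions on the whole space, whose values
   outside V are irrelevant. *)
Definition W11 V : set ('rV[R]_n -> R) :=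
  [set u | (lebesgue_rV R n).-integrable V (EFin \o u) /\
           exists g, weak_gradient V u g].

(* A representative of the weak gradient, unique almost everywhere on V when
   u \in W11 V. *)
Definition wgrad V u : 'rV[R]_n -> 'rV[R]_n :=
  xget (fun=> 0) [set g | weak_gradient V u g].

Definition W11_norm V u : \bar R :=
  (\int[lebesgue_rV R n]_(x in V) `|u x|%:E +
   \int[lebesgue_rV R n]_(x in V) (enorm (wgrad V u x))%:E)%E.

(* Closure of Cc_infty V in W11 V. *)
Definition W11_0 V : set ('rV[R]_n -> R) :=
  [set v | W11 V v /\ forall eps : R, 0 < eps ->
     exists2 phi, Cc_infty V phi & (W11_norm V (v \- phi)%R < eps%:E)%E].

End sobolev.

Section weights.
Context (R : realType) (n : nat).

Definition lebesgue_measurable_fun (V : set 'rV[R]_n) (f : 'rV[R]_n -> R) :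
    Prop :=
  measurable_fun (V : set (lebesgue_space R n)) (f : lebesgue_space R n -> R).

Definition Zclass (kappa : R) (V : set 'rV[R]_n) : set ('rV[R]_n -> R) :=
  [set s | (forall x, V x -> 0 <= s x) /\
     exists C : R, forall x y, V x -> V y ->
       s x <= C * (s y + enorm (x - y) `^ kappa)].

Definition ball_average (x : 'rV[R]_n) (r : R) (f : 'rV[R]_n -> \bar R) :
    \bar R :=
  ((fine (lebesgue_rV R n (eball x r)))^-1%:E *
   \int[lebesgue_rV R n]_(z in eball x r) f z)%E.

(* The library sets 0 `^ s = 0 also for s < 0, whence the case distinction. *)
Definition dual_weight (r : R) (w : 'rV[R]_n -> R) (z : 'rV[R]_n) : \bar R :=
  if w z == 0 then +oo%E else (w z `^ (- (r - 1)^-1))%:E.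

(* In \bar R, 0 * +oo = 0. *)
Definition Muckenhoupt (r : R) (V : set 'rV[R]_n) : set ('rV[R]_n -> R) :=
  [set w | [/\ lebesgue_measurable_fun V w,
    (forall x, V x -> 0 <= w x) &
    (ereal_sup [set e : \bar R | exists x rho, [/\ (0 < rho)%R,
       eball x rho `<=` V &
       e = ball_average x rho (EFin \o w) *
           (ball_average x rho (dual_weight r w)) `^ (r - 1)]] < +oo)%E]].

Definition ess_bounded (V : set 'rV[R]_n) (w : 'rV[R]_n -> R) : Prop :=
  exists M : R, {ae lebesgue_rV R n, forall x, V x -> `|w x| <= M}.

Definition energy (p q : R) (a : 'rV[R]_n -> R) (V : set 'rV[R]_n)
    (u : 'rV[R]_n -> R) : \bar R :=
  (\int[lebesgue_rV R n]_(x in V)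
     (enorm (wgrad V u x) `^ p + a x * enorm (wgrad V u x) `^ q)%:E)%E.

End weights.

(* Main.v *)
(* Passing to Borel representatives, a is comparable to w b^q, where w = omega and b is
   an inf-convolution of sigma^(1/q), so that b(x) <= C (b(y) + |x - y|^(kappa/q)).
   Let v in W_0^{1,1}(Omega) have finite energy.
   1. v may be taken bounded: k sin (v / k) converges to v in energy by dominated convergence.
   2. Cover the closure of Omega by finitely many balls in which Omega can be pushed into
      itself along a vector e, and peel v off one ball at a time with cutoffs.
   3. In such a ball, mollify with a kernel of size t centred at - t e; the result lies in
      C_c^oo(Omega).  The A_q condition makes averages over cubes of size t bounded in L^q(w).
      Where b(x) >> t^(kappa/q), b is almost constant on the support of the kernel and moves
      inside the convolution; elsewhere w (b |S_t g|)^q <= C t^kappa |S_t g|^q, and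
      |S_t g| <= C t^(- beta), with beta = 1 from the boundedness of v or beta = N / p from
      Hoelder's inequality, gives t^kappa |S_t g|^(q - p) <= C since beta (q - p) <= kappa.
   4. By convexity F[u0 + phi] <= (1 - l)^(1 - q) F[u0 + v] + l^(1 - q) E, where E is the
      energy of the gradient of phi - v, and the first factor is as close to 1 as desired. *)

Require Import Defs.
From mathcomp Require Import all_boot all_order all_algebra.
From mathcomp Require Import all_classical all_reals all_analysis.
From mathcomp Require Import measurable_realfun lra.

Set Implicit Arguments.
Unset Strict Implicit.
Unset Printing Implicit Defensive.

Import Order.TTheory GRing.Theory Num.Theory.
Import numFieldNormedType.Exports.

Local Open Scope classical_set_scope.
Local Open Scope ring_scope.

(** * Lebesgue measure on row vectors *)

(** The [A_q] condition controls [w] but not the product [w b^q], so [b] has to be carried through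
    the convolution separately; writing the coefficient as [w b^q] makes [b |g|] the quantity that
    is averaged in [L^q(w)]. A mollification involves a single scale, so Jensen's inequality and
    Tonelli's theorem take the place of a maximal function. Zeros of the weight are avoided by
    working with [w + eps], uniformly in [eps]. Uniform energy bounds do not give convergence. The
    gradient is therefore cut at a height [j]: the bounded part converges in L1, hence in energy,
    and the remainder has small energy both before and after mollification. The maximum of 1 and
    [p / N] is 1 / beta for the smaller of the two exponents beta. Zero trace enters only through
    [wdiff]: the extension by zero has a weak gradient on the whole space, so mollifying commutes
    with differentiating up to the boundary. A sine truncates smoothly, and its chain rule passes to
    the limit in L1. The analysis takes place on [borel_lebesgue], whose product form gives
    translation invariance; the completed measure is reached through representatives. *)

Section borel_rV_theory.
Context (R : realType).

Lemma lebesgue_measure_shift (h : R) (A : set (measurableTypeR R)) :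
  measurable A ->
  lebesgue_measure ((fun x : measurableTypeR R => x + h : measurableTypeR R) @^-1` A) =
  lebesgue_measure A.
Proof.
move=> mA.
have mh : measurable_fun setT
    (fun x : measurableTypeR R => x + h : measurableTypeR R).
  exact: (@measurable_funD _ _ _ _ id (cst h)).
pose nu := measure_function_pushforward__canonical__measure_function_Measure
  (@lebesgue_measure R) mh.
rewrite -[LHS]/(nu A); apply/esym/lebesgue_measure_unique => //= _ [[a b]] _ <-.
rewrite /pushforward (_ : _ @^-1` _ = `]a - h, b - h]%classic).
  rewrite !lebesgue_measure_itv/= !lte_fin ltrD2r.
  by case: ifP => // _; rewrite -!EFinB; congr EFin; lra.
by apply/seteqP; split => x /=; rewrite !in_itv/= ltrBlDr lerBrDr.
Qed.

Lemma ge0_integral_lebesgue_shift (h : R) (g : measurableTypeR R -> \bar R) :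
  measurable_fun setT g -> (forall x, 0 <= g x)%E ->
  (\int[lebesgue_measure]_x g (x + h)%R = \int[lebesgue_measure]_x g x)%E.
Proof.
move=> mg g0.
have mh : measurable_fun setT
    (fun x : measurableTypeR R => x + h : measurableTypeR R).
  exact: (@measurable_funD _ _ _ _ id (cst h)).
transitivity (\int[pushforward lebesgue_measure
    (fun x : measurableTypeR R => x + h : measurableTypeR R)%R]_y g y)%E.
  by rewrite (ge0_integral_pushforward mh).
by apply: eq_measure_integral => B mB _; exact: lebesgue_measure_shift.
Qed.

Context (n : nat).
Notation X := (borel_rV R n).
Notation mu := (@borel_lebesgue R n).

Lemma measurable_box (x : 'rV[R]_n) (r : R) :
  measurable ([set y : X | forall i, `|x ord0 i - rV_coord i y| < r]).
Proof.
rewrite (_ : mkset _ = \bigcap_(i in [set: 'I_n])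
    (rV_coord i @^-1` (ball (x ord0 i) r))); last first.
  by apply/seteqP; split => [y /= + i _|y /= + i]; [apply|move/(_ i I)].
apply: fin_bigcap_measurable => // i _.
rewrite -[X in measurable X]setTI.
by apply: (@measurable_rV_coord R n i) => //; exact: measurable_ball.
Qed.

(** The library [ball] on row vectors is a sup-norm ball, that is, a cube. Its measure is explicit
    for an iterated product, which is why cubes rather than Euclidean balls carry the estimates. *)
Lemma ball_box (x : 'rV[R]_n) (r : R) : 0 < r ->
  ball x r = [set y | forall i, `|x ord0 i - rV_coord i y| < r].
Proof.
move=> r0; apply/seteqP; split => y.
  by case=> _ + i; move=> /(_ ord0 i).
by move=> H; split=> // i j; rewrite (ord1 i); exact: H.
Qed.

Lemma measurable_ball_rV (x : 'rV[R]_n) (r : R) :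
  measurable (ball x r : set X).
Proof.
have [r0|r0] := ltP 0 r; first by rewrite ball_box//; exact: measurable_box.
rewrite (_ : ball x r = set0)//.
by apply/seteqP; split => // y []; rewrite ltNge r0.
Qed.

(** The sigma-algebra is generated by the coordinates, so an open set has to be exhausted by
    countably many measurable sets: the cubes with rational centre and radius [m.+1%:R^-1] that it
    contains. *)
Lemma open_borel (A : set 'rV[R]_n) : open A -> measurable (A : set X).
Proof.
move=> oA.
pose F k : set X := match @unpickle ('rV[rat]_n * nat)%type k with
  | Some (v, m) => let B := ball (map_mx ratr v : 'rV[R]_n) m.+1%:R^-1 in
     if `[< B `<=` A >] then B else set0
  | None => set0 end.
rewrite (_ : A = \bigcup_k F k).
  apply: bigcupT_measurable => k; rewrite /F.
  case: unpickle => // -[v m] /=; case: asboolP => // _.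
  exact: measurable_ball_rV.
apply/seteqP; split => [x Ax|x [k _]]; last first.
  by rewrite /F; case: unpickle => // -[v m] /=; case: asboolP => // BA; apply: BA.
have /nbhs_ballP[e /= e0 eA] := open_nbhs_nbhs (conj oA Ax).
near \oo => m.
have m0 : 0 < m.+1%:R^-1 :> R by rewrite invr_gt0.
have mq i : exists q : rat, `|x ord0 i - ratr q| < m.+1%:R^-1.
  have [q] : exists q : rat, ratr q \in `]x ord0 i - m.+1%:R^-1, x ord0 i + m.+1%:R^-1[.
    by apply: rat_in_itvoo; rewrite ltrD2l (lt_trans _ m0)// oppr_lt0.
  by rewrite in_itv/= => qx; exists q; rewrite distrC ltr_distl.
pose v : 'rV[rat]_n := \row_i projT1 (cid (mq i)).
have vx : ball (map_mx ratr v : 'rV[R]_n) m.+1%:R^-1 x.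
  by split=> // i j; rewrite !mxE (ord1 i) /ball/= distrC; case: cid.
exists (pickle (v, m)) => //; rewrite /F pickleK /=; case: asboolP => //; case.
move=> y vy; apply: eA.
(* Re-centring the rational cube at [x] doubles its radius, hence the size required of [m]. *)
have: ball x (m.+1%:R^-1 + m.+1%:R^-1) y by apply: ball_triangle vy; exact: ball_sym.
apply: le_ball.
rewrite -mulr2n -[_ *+ 2]mulr_natl.
rewrite ler_pdivrMr// -ler_pdivrMl//.
rewrite (@le_trans _ _ m%:R) ?ler_nat//.
by near: m; exact: nbhs_infty_ger.
Unshelve. all: by end_near. Qed.

Lemma continuous_borel (f : 'rV[R]_n -> R) : continuous f ->
  measurable_fun [set: X] f.
Proof.
move=> cf; apply: (measurability _ (RGenOpens.measurableE R)).
move=> _ [_ [a [b ->]] <-]; rewrite setTI; apply: open_borel.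
by apply: open_comp => // x _; exact: cf.
Qed.

Lemma measurable_shift (h : 'rV[R]_n) :
  measurable_fun [set: X] (fun x : X => (x : 'rV[R]_n) + h : X).
Proof.
apply: measurable_fun_rVP => i.
rewrite (_ : _ \o _ = fun x => rV_coord i x + h ord0 i); last first.
  by apply/funext => x; rewrite /= /rV_coord mxE.
apply: measurable_funD => //; exact: measurable_rV_coord.
Qed.

Lemma measurable_add2 :
  measurable_fun [set: X * X] (fun z : X * X => (z.1 : 'rV[R]_n) + z.2 : X).
Proof.
apply: measurable_fun_rVP => i.
rewrite (_ : _ \o _ = fun x => rV_coord i x.1 + rV_coord i x.2); last first.
  by apply/funext => x; rewrite /= /rV_coord mxE.
by apply: measurable_funD; apply: measurableT_comp => //; exact: measurable_rV_coord.
Qed.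

Lemma measurable_sub2 :
  measurable_fun [set: X * X] (fun z : X * X => (z.2 : 'rV[R]_n) - z.1 : X).
Proof.
apply: measurable_fun_rVP => i.
rewrite (_ : _ \o _ = fun x => rV_coord i x.2 - rV_coord i x.1); last first.
  by apply/funext => x; rewrite /= /rV_coord !mxE.
by apply: measurable_funB; apply: measurableT_comp => //; exact: measurable_rV_coord.
Qed.

End borel_rV_theory.

Section borel_lebesgue_theory.
Context (R : realType).

Lemma borel_lebesgueS n (A : set (borel_rV R n.+1)) :
  borel_lebesgue A =
  (\int[lebesgue_measure]_x borel_lebesgue (xsection (@rV_cons R n @^-1` A) x))%E.
Proof. by []. Qed.

(** Induction on the dimension: [rV_cons] splits a translation into a shift of the first coordinate
    and a shift of each section. The sections are handled by induction, the outer integral by the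
    one-dimensional case. *)
Lemma borel_lebesgue_shift n (h : 'rV[R]_n) (A : set (borel_rV R n)) :
  measurable A ->
  borel_lebesgue ((fun x : borel_rV R n => (x : 'rV[R]_n) + h : borel_rV R n) @^-1` A) =
  borel_lebesgue A.
Proof.
elim: n h A => [|n IH] h A mA.
  congr borel_lebesgue; apply/seteqP; split => x /=;
   by rewrite (_ : ((x : 'rV[R]_0) + h)%R = x)//; apply/rowP => -[].
have mA' : measurable (@rV_cons R n @^-1` A).
  by rewrite -[X in measurable X]setTI; exact: measurable_rV_cons.
pose h0 := h ord0 ord0; pose h' : 'rV[R]_n := \row_j h ord0 (lift ord0 j).
rewrite !borel_lebesgueS.
transitivity (\int[lebesgue_measure]_x
   borel_lebesgue (xsection (@rV_cons R n @^-1` A) (x + h0)%R))%E.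
  apply: eq_integral => x _.
  rewrite -(IH h' (xsection (@rV_cons R n @^-1` A) (x + h0)%R)); last first.
    exact: measurable_xsection.
  congr borel_lebesgue; apply/seteqP.
  have E v : ((rV_cons (x, v) : 'rV_n.+1) + h)%R =
      rV_cons (x + h0, ((v : 'rV_n) + h')%R : borel_rV R n)%R.
    by apply/rowP => i; rewrite !mxE; case: unliftP => [j|] ->//=; rewrite /rV_coord !mxE.
  by split => v; rewrite /xsection /= !inE /= E.
pose g x : \bar R := borel_lebesgue (xsection (@rV_cons R n @^-1` A) x).
have mg : measurable_fun setT g by exact: measurable_fun_xsection.
apply: (ge0_integral_lebesgue_shift h0 mg) => x; exact: measure_ge0.
Qed.

Lemma borel_lebesgue_box n (x : 'rV[R]_n) (r : R) : (0 < r)%R ->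
  borel_lebesgue [set y : borel_rV R n | forall i, (`|x ord0 i - rV_coord i y| < r)%R]
  = ((r *+ 2) ^+ n)%:E.
Proof.
move=> r0; elim: n x => [|n IH] x.
  rewrite /= (_ : mkset _ = setT) ?diracT//.
  by apply/seteqP; split => // y _ [].
pose x' : 'rV[R]_n := \row_j x ord0 (lift ord0 j).
rewrite /= /pushforward.
rewrite (_ : _ @^-1` _ = ball (x ord0 ord0) r `*`
   [set y : borel_rV R n | forall i, (`|x' ord0 i - rV_coord i y| < r)%R]); last first.
  apply/seteqP; split => -[a v] /=.
    move=> H; split=> /=.
      by have := H ord0; rewrite /rV_coord mxE unlift_none.
    by move=> i; have := H (lift ord0 i); rewrite /rV_coord !mxE liftK.
  move=> [/= H0 H] i; rewrite /rV_coord mxE; case: unliftP => [j|] ->//=.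
  by have := H j; rewrite /rV_coord !mxE.
rewrite product_measure1E//=; last 2 first.
- exact: measurable_ball.
- exact: measurable_box.
by rewrite IH exprS EFinM lebesgue_measure_ball// ltW.
Qed.

Context (n : nat).
Notation X := (borel_rV R n).
Notation mu := (@borel_lebesgue R n).

Lemma borel_lebesgue_ball (x : 'rV[R]_n) (r : R) : 0 < r ->
  mu (ball x r : set X) = ((r *+ 2) ^+ n)%:E.
Proof. by move=> r0; rewrite ball_box// borel_lebesgue_box. Qed.

Lemma ge0_integral_shift (h : 'rV[R]_n) (f : X -> \bar R) :
  measurable_fun setT f -> (forall x, 0 <= f x)%E ->
  (\int[mu]_x f (((x : 'rV[R]_n) + h)%R : X) = \int[mu]_x f x)%E.
Proof.
move=> mf f0.
transitivity (\int[pushforward mu (fun x : X => ((x : 'rV[R]_n) + h)%R : X)]_y f y)%E.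
  by rewrite (ge0_integral_pushforward (measurable_shift h)).
have mh := @measurable_shift R n h.
by apply: eq_measure_integral => B mB _; exact: (borel_lebesgue_shift h mB).
Qed.

Lemma integrable_shift (h : 'rV[R]_n) (f : X -> \bar R) :
  mu.-integrable setT f ->
  mu.-integrable setT (fun x : X => f (((x : 'rV[R]_n) + h)%R : X)).
Proof.
move=> /integrableP[mf fi]; apply/integrableP; split.
  by apply: measurableT_comp mf _; exact: measurable_shift.
have mf' : measurable_fun setT (abse \o f) by exact: measurableT_comp.
have E := ge0_integral_shift h mf' (fun=> abse_ge0 _).
by move: fi; rewrite -E.
Qed.

Lemma integral_shift (h : 'rV[R]_n) (f : X -> \bar R) :
  measurable_fun setT f ->
  (\int[mu]_x f (((x : 'rV[R]_n) + h)%R : X) = \int[mu]_x f x)%E.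
Proof.
move=> mf; rewrite integralE [RHS]integralE; congr (_ - _)%E.
  rewrite -(ge0_integral_shift h (measurable_funepos mf) (funepos_ge0 _)).
  by apply: eq_integral => x _; rewrite !funeposE.
rewrite -(ge0_integral_shift h (measurable_funeneg mf) (funeneg_ge0 _)).
by apply: eq_integral => x _; rewrite !funenegE.
Qed.

End borel_lebesgue_theory.

(** * L1 norms and dominated convergence *)

Section integral_tools.
Context d (T : measurableType d) (R : realType).
Variable mu : {measure set T -> \bar R}.
Local Open Scope ereal_scope.

(** Extended-real valued, so that estimates can be chained without integrability side conditions;
    finiteness is extracted only where real integrals are compared. *)
Definition L1norm (f : T -> R) : \bar R := \int[mu]_x (`|f x|%R)%:E.

Lemma measurable_normE (f : T -> R) : measurable_fun setT f ->
  measurable_fun setT (fun x => (`|f x|%R)%:E).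
Proof. by move=> mf; apply/measurable_EFinP; exact: measurableT_comp. Qed.

Lemma L1norm_ge0 f : 0 <= L1norm f.
Proof. by apply: integral_ge0 => x _; rewrite lee_fin. Qed.

Lemma L1norm_le (f g : T -> R) :
  measurable_fun setT f -> measurable_fun setT g ->
  (forall x, `|f x| <= `|g x|)%R -> L1norm f <= L1norm g.
Proof.
move=> mf mg fg; apply: ge0_le_integral => //.
- exact: measurable_normE.
- exact: measurable_normE.
- by move=> x _; rewrite lee_fin.
Qed.

Lemma L1norm_triangle (f g h : T -> R) :
  measurable_fun setT f -> measurable_fun setT g -> measurable_fun setT h ->
  (forall x, `|h x| <= `|f x| + `|g x|)%R -> L1norm h <= L1norm f + L1norm g.
Proof.
move=> mf mg mh H; rewrite /L1norm -ge0_integralD//; last 2 first.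
- exact: measurable_normE.
- exact: measurable_normE.
apply: ge0_le_integral => //.
- exact: measurable_normE.
- by apply: emeasurable_funD; exact: measurable_normE.
- by move=> x _; rewrite -EFinD lee_fin.
Qed.

Lemma L1normZ (c : R) (f : T -> R) : measurable_fun setT f ->
  L1norm (fun x => c * f x)%R = `|c|%:E * L1norm f.
Proof.
move=> mf; rewrite /L1norm -ge0_integralZl//; last exact: measurable_normE.
by apply: eq_integral => x _; rewrite normrM EFinM.
Qed.

Lemma integrable_L1norm (f : T -> R) :
  mu.-integrable setT (EFin \o f) <->
  measurable_fun setT f /\ L1norm f < +oo.
Proof.
split=> [/integrableP[/measurable_EFinP mf fi]//|[mf fi]].
by apply/integrableP; split=> //; exact/measurable_EFinP.
Qed.

Lemma cvge0_near (u : nat -> \bar R) (eps : R) : (0 < eps)%R ->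
  u @ \oo --> 0 -> \forall n \near \oo, u n <= eps%:E.
Proof.
move=> e0 /fine_cvgP[ufin /cvgrPdist_le/(_ _ e0) ucv]; near=> n.
have un : u n \is a fin_num by near: n.
have ule : (`|0 - fine (u n)| <= eps)%R by near: n.
by rewrite -(fineK un) lee_fin (le_trans (ler_norm _))// -normrN -sub0r.
Unshelve. all: by end_near. Qed.

Lemma dominated_L1norm_near (f_ : nat -> T -> R) (g : T -> R) (eps : R) :
  (0 < eps)%R -> (forall n, measurable_fun setT (f_ n)) ->
  mu.-integrable setT (EFin \o g) -> (forall n x, `|f_ n x| <= g x)%R ->
  (forall x, f_ ^~ x @ \oo --> 0%R) ->
  \forall n \near \oo, L1norm (f_ n) <= eps%:E.
Proof.
move=> e0 mf ig fg f0.
have [] := @dominated_convergence _ _ _ mu setT measurableT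
  (fun n x => (f_ n x)%:E) (cst 0) (EFin \o g).
- by move=> n; exact/measurable_EFinP.
- exact: measurable_cst.
- apply: aeW => x _; exact: (cvg_comp _ _ (f0 x)).
- exact: ig.
- by apply: aeW => x n _; rewrite lee_fin.
move=> _ + _; move=> /(cvge0_near e0); apply: filterS => n; apply: le_trans.
by rewrite le_eqVlt; apply/orP; left; apply/eqP; apply: eq_integral => x _; rewrite sube0.
Qed.

(** Dominated convergence for the part of [f] outside sets that eventually contain each point. It
    serves alike for truncation by height, by balls and by inner cores. *)
Lemma L1norm_tail (f : T -> R) (A : nat -> set T) (eps : R) : (0 < eps)%R ->
  mu.-integrable setT (EFin \o f) -> (forall n, measurable (A n)) ->
  (forall x, \forall n \near \oo, A n x) ->
  \forall n \near \oo, L1norm (fun x => f x * \1_(~` A n) x)%R <= eps%:E.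
Proof.
move=> e0 fi mA Ax.
have /integrable_L1norm[mf _] := fi.
apply: (@dominated_L1norm_near _ (fun x => `|f x|%R)) => //.
- move=> n; apply: measurable_funM => //.
  by apply: measurable_indic; exact: measurableC.
- exact: integrable_norm.
- by move=> n x; rewrite normrM ler_piMr// ger0_norm// indicE; case: (_ \in _).
- move=> x; apply/cvgrPdist_le => e e1; near=> n.
  have An : A n x by near: n; exact: Ax.
  by rewrite indicE memNset ?mulr0 ?subrr ?normr0 ?ltW//=; apply.
Unshelve. all: by end_near. Qed.

Lemma integrable_indic_lty (A : set T) : measurable A -> mu A < +oo ->
  mu.-integrable setT (EFin \o (\1_A : T -> R)).
Proof.
move=> mA Aoo; apply/integrable_L1norm; split; first exact: measurable_indic.
rewrite /L1norm; under eq_integral do rewrite ger0_norm//.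
by rewrite integral_indic// setIT.
Qed.

End integral_tools.
Arguments L1norm {d T R} mu f%_ring_scope.

(** * Continuity of translations in L1 *)

Section translation_continuity.
Import HBSimple.
Context (R : realType) (n : nat).
Notation X := (borel_rV R n).
Notation mu := (@borel_lebesgue R n).
Implicit Types f g : X -> R.

Definition small_vec (d : R) (h : 'rV[R]_n) := forall i, `|h ord0 i| < d.

(** Open sets are stable under intersection, so with them as generators the pi-lambda argument below
    can start from open sets. *)
Lemma borel_rV_sigma_open :
  @measurable _ (borel_rV R n) = <<s (open : set (set 'rV[R]_n)) >>.
Proof.
apply/seteqP; split; last first.
  by apply: smallest_sub; [exact: sigma_algebra_measurable|exact: open_borel].
apply: smallest_sub; first exact: smallest_sigma_algebra.
rewrite -bigcup_seq => _ [i _ [B mB <-]]; rewrite setTI.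
have mc : measurable_fun setT
    ((fun x => rV_coord i x) : g_sigma_algebraType (open : set (set 'rV[R]_n)) -> R).
  apply: (measurability _ (RGenOpens.measurableE R)).
  move=> _ [_ [a [b ->]] <-]; rewrite setTI; apply: sub_sigma_algebra.
  by apply: open_comp => // x _; exact: coord_continuous.
by rewrite -[X in <<s _ >> X]setTI; exact: mc.
Qed.

Definition translation_continuous f := forall eps : R, 0 < eps ->
  exists2 d : R, 0 < d & forall h, small_vec d h ->
    (L1norm mu (fun x : X => f ((x : 'rV[R]_n) + h)%R - f x)%R <= eps%:E)%E.

Lemma measurable_shiftf f (h : 'rV[R]_n) : measurable_fun setT f ->
  measurable_fun setT (fun x : X => f ((x : 'rV[R]_n) + h)).
Proof. by move=> mf; apply: measurableT_comp mf _; exact: measurable_shift. Qed.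

Lemma L1norm_shift f (h : 'rV[R]_n) : measurable_fun setT f ->
  L1norm mu (fun x : X => f ((x : 'rV[R]_n) + h)) = L1norm mu f.
Proof.
move=> mf; apply: (ge0_integral_shift h (f := fun x => (`|f x|)%:E)) => //.
exact: measurable_normE.
Qed.

Lemma translation_continuousD f g : measurable_fun setT f -> measurable_fun setT g ->
  translation_continuous f -> translation_continuous g ->
  translation_continuous (f \+ g).
Proof.
move=> mf mg tf tg eps e0.
have e2 : 0 < eps / 2 by rewrite divr_gt0.
have [d1 d10 H1] := tf _ e2; have [d2 d20 H2] := tg _ e2.
exists (Num.min d1 d2); first by rewrite lt_min d10.
move=> h hd; rewrite (splitr eps) EFinD.
have h1 : small_vec d1 h by move=> i; have := hd i; rewrite lt_min => /andP[].
have h2 : small_vec d2 h by move=> i; have := hd i; rewrite lt_min => /andP[].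
apply: le_trans (leeD (H1 _ h1) (H2 _ h2)).
apply: L1norm_triangle; try by apply: measurable_funB => //; exact: measurable_shiftf.
  apply: measurable_funB; last exact: measurable_funD.
  by apply: (measurable_shiftf h (f := f \+ g)); exact: measurable_funD.
by move=> x /=; rewrite opprD addrACA ler_normD.
Qed.

Lemma translation_continuousZ (c : R) f : measurable_fun setT f ->
  translation_continuous f -> translation_continuous (fun x => c * f x).
Proof.
move=> mf tf eps e0.
have c1 : 0 < `|c| + 1 by rewrite ltr_wpDl.
have [d d0 H] := tf (eps / (`|c| + 1)) (divr_gt0 e0 c1).
exists d => // h hd.
under eq_fun do rewrite -mulrBr.
rewrite L1normZ; last by apply: measurable_funB => //; exact: measurable_shiftf.
apply: (@le_trans _ _ (`|c|%:E * (eps / (`|c| + 1))%:E)%E).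
  by apply: lee_pmul => //; [exact: L1norm_ge0|exact: H].
by rewrite -EFinM lee_fin mulrCA ler_piMr ?ltW// ltr_pdivrMr// mul1r ltrDl.
Qed.

Lemma translation_continuous_lim f : measurable_fun setT f ->
  (forall eps : R, 0 < eps -> exists g, [/\ measurable_fun setT g,
     translation_continuous g & (L1norm mu (f \- g)%R <= eps%:E)%E]) ->
  translation_continuous f.
Proof.
move=> mf H eps e0.
have e3 : 0 < eps / 3 by rewrite divr_gt0.
have [g [mg tg fg]] := H _ e3; have [d d0 Hd] := tg _ e3.
exists d => // h hd.
have mfg : measurable_fun setT (f \- g) by exact: measurable_funB.
have -> : eps = eps / 3 + (eps / 3 + eps / 3) by lra.
rewrite 2!EFinD.
have mgh : measurable_fun setT (fun x : X => g ((x : 'rV[R]_n) + h)%R - g x)%R.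
  by apply: measurable_funB => //; exact: measurable_shiftf.
have mfh : measurable_fun setT (fun x : X => f ((x : 'rV[R]_n) + h)%R - f x)%R.
  by apply: measurable_funB => //; exact: measurable_shiftf.
have ms := measurable_shiftf h mfg.
apply: (@le_trans _ _ (L1norm mu (fun x : X => ((f \- g) ((x : 'rV[R]_n) + h))%R) +
   (L1norm mu (fun x : X => (g ((x : 'rV[R]_n) + h) - g x)%R) + L1norm mu (f \- g)%R))%E).
  apply: (@le_trans _ _ (L1norm mu (fun x : X => ((f \- g) ((x : 'rV[R]_n) + h))%R) +
     L1norm mu (fun x : X => (g ((x : 'rV[R]_n) + h) - g x - (f \- g) x)%R))%E).
    apply: L1norm_triangle => //; first exact: measurable_funB.
    move=> x; rewrite (_ : f _ - f x = (f \- g) ((x : 'rV[R]_n) + h) +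
      (g ((x : 'rV[R]_n) + h) - g x - (f \- g) x)); first exact: ler_normD.
    by rewrite /=; lra.
  apply: leeD => //; apply: L1norm_triangle => //; first exact: measurable_funB.
  by move=> x; exact: ler_normB.
apply: leeD; first by rewrite L1norm_shift.
by apply: leeD => //; exact: Hd.
Qed.

(** For positive [r], the points at sup-distance at least [r] from the complement of [D]. As the
    complement of a union of open cubes it is measurable whatever [D] is. *)
Definition inner_core (D : set 'rV[R]_n) (r : R) : set 'rV[R]_n :=
  ~` \bigcup_(y in ~` D) ball y r.

Lemma measurable_inner_core D r : measurable (inner_core D r : set X).
Proof.
apply: measurableC; apply: open_borel; apply: bigcup_open => y _.
have [r0|r0] := ltP 0 r; first exact: ball_open.
rewrite (_ : ball y r = set0); first exact: open0.
by apply/seteqP; split => // z []; rewrite ltNge r0.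
Qed.

(** A shift shorter than 1/(k+1) keeps the inner core [A k] inside [D]. The two indicators therefore
    agree on [A k], and by translation invariance the integral of their difference is at most twice
    the measure of [D] minus [A k]. *)
Lemma translation_continuous_open (D : set 'rV[R]_n) : open D ->
  (mu (D : set X) < +oo)%E -> translation_continuous \1_(D : set X).
Proof.
move=> oD Doo eps e0.
have mD := open_borel oD.
pose A k := inner_core D k.+1%:R^-1.
have mA k : measurable (A k : set X) by exact: measurable_inner_core.
have ADi k : A k `<=` D.
  move=> x Ax; apply: contrapT => nDx; apply: Ax; exists x => //.
  by apply: ballxx; rewrite invr_gt0.
have Ax x : D x -> \forall k \near \oo, A k x.
  move=> Dx; have /nbhs_ballP[e /= ee eD] := open_nbhs_nbhs (conj oD Dx).
  near=> k; move=> [y nDy yx]; apply: nDy; apply: eD; apply: ball_sym.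
  apply: le_ball yx; rewrite invf_ple ?posrE//.
  rewrite (@le_trans _ _ k%:R) ?ler_nat//.
  by near: k; exact: nbhs_infty_ger.
have e2 : 0 < eps / 2 by rewrite divr_gt0.
have iD : mu.-integrable setT (EFin \o (\1_(D : set X) : X -> R)).
  exact: integrable_indic_lty.
(* Adding the complement of [D] makes these sets absorb every point, as [L1norm_tail] requires; the
   part of [D] outside [B k] is [D] minus [A k]. *)
pose B k : set X := A k `|` ~` D.
have := @L1norm_tail _ _ _ mu \1_(D : set X) B _ e2 iD.
case.
- by move=> k; apply: measurableU => //; exact: measurableC.
- move=> x; have [Dx|nDx] := pselect (D x).
    by near=> k; left; near: k; exact: Ax.
  by near=> k; right.
move=> k _ /(_ k (leqnn k)) Hk.
exists k.+1%:R^-1; first by rewrite invr_gt0.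
move=> h hd; rewrite (splitr eps) EFinD.
have mDh : measurable_fun setT (fun x : X => \1_(D : set X) ((x : 'rV[R]_n) + h) : R).
  by apply: measurable_shiftf; exact: measurable_indic.
pose u : X -> R := fun x => \1_(D : set X) x * \1_(~` B k) x.
have mu_ : measurable_fun setT u.
  apply: measurable_funM; first exact: measurable_indic.
  by apply: measurable_indic; apply: measurableC; apply: measurableU => //; exact: measurableC.
have uD x : u x = \1_(D : set X) x - \1_(A k : set X) x.
  rewrite /u !indicE in_setC.
  have [Ak|nAk] := pselect (A k x).
    have -> : x \in B k by apply: mem_set; left.
    by rewrite (mem_set Ak) (mem_set (ADi _ _ Ak)) mulr0 subrr.
  rewrite (memNset nAk) subr0.
  have [Dx|nDx] := pselect (D x); last by rewrite (memNset nDx) mul0r.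
  by rewrite (mem_set Dx) memNset ?mulr1// => -[].
have key x : `|\1_(D : set X) ((x : 'rV[R]_n) + h) - \1_(D : set X) x| <=
   u x + (\1_(D : set X) ((x : 'rV[R]_n) + h) - \1_(A k : set X) x) :> R.
  rewrite uD; have [Ak|nAk] := pselect (A k x).
    have Dxh : D ((x : 'rV[R]_n) + h).
      apply: contrapT => nD; apply: Ak; exists (x + h) => //.
      rewrite ball_box ?invr_gt0// => i; rewrite /rV_coord mxE addrAC subrr add0r.
      exact: hd.
    by rewrite !indicE (mem_set Dxh) (mem_set Ak) (mem_set (ADi _ _ Ak)) !subrr normr0 addr0.
  rewrite !indicE (memNset nAk) !subr0.
  by apply: le_trans (ler_normB _ _) _; rewrite !ger0_norm// addrC.
have Hsum : (L1norm mu (fun x : X => \1_(D : set X) ((x : 'rV[R]_n) + h) - \1_(D : set X) x)%R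
   + L1norm mu (\1_(A k : set X) : X -> R) <= L1norm mu u + L1norm mu (\1_(D : set X) : X -> R))%E.
  have mI : measurable_fun setT (\1_(D : set X) : X -> R) by exact: measurable_indic.
  rewrite -(L1norm_shift h mI).
  rewrite /L1norm -!ge0_integralD//; try exact: measurable_normE.
  - apply: ge0_le_integral => //.
    + by move=> x _; rewrite adde_ge0// lee_fin.
    + by apply: emeasurable_funD; apply: measurable_normE => //; apply: measurable_funB.
    + by apply: emeasurable_funD; exact: measurable_normE.
    + move=> x _; rewrite -!EFinD lee_fin.
      have u0 : 0 <= u x by rewrite /u mulr_ge0.
      have E1 : `|\1_(A k : set X) x| = \1_(A k : set X) x :> R by rewrite ger0_norm.
      have E2 : `|\1_(D : set X) ((x : 'rV[R]_n) + h)| =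
        \1_(D : set X) ((x : 'rV[R]_n) + h) :> R by rewrite ger0_norm.
      by rewrite E1 E2 (ger0_norm u0); have := key x; lra.
  - by apply: measurable_normE; apply: measurable_funB => //; exact: measurable_indic.
have indA (S : set X) : measurable S -> L1norm mu (\1_S : X -> R) = mu S.
  move=> mS; rewrite /L1norm; under eq_integral do rewrite ger0_norm//.
  by rewrite integral_indic// setIT.
have Dle : (mu (D : set X) <= L1norm mu u + mu (A k : set X))%E.
  rewrite -indA// -(indA (A k))//; apply: L1norm_triangle => //; try exact: measurable_indic.
  by move=> x; rewrite uD (le_trans _ (ler_normD _ _))// subrK.
(* Finiteness allows the measure of [A k] to be cancelled from both sides. *)
have Afin : mu (A k : set X) \is a fin_num.
  rewrite ge0_fin_numE//; apply: le_lt_trans Doo.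
  by apply: le_measure; rewrite ?inE//; exact: mD.
move: Hsum; rewrite !indA// => Hsum.
have H2 : (L1norm mu u + L1norm mu u <= (eps / 2)%:E + (eps / 2)%:E)%E by apply: leeD.
apply: le_trans H2; rewrite -(leeD2rE _ _ Afin) -[X in (_ <= X)%E]addeA; apply: (le_trans Hsum).
exact: leeD.
Unshelve. all: by end_near. Qed.

(** Pi-lambda theorem starting from open sets. Intersecting with a fixed ball keeps all measures
    finite, so complements follow by linearity and countable disjoint unions by an L1 limit. *)
Lemma translation_continuous_bounded (r : R) (A : set X) : measurable A ->
  translation_continuous \1_(A `&` (ball 0 r : set 'rV[R]_n)).
Proof.
have [r0|r0] := ltP 0 r; last first.
  move=> _; rewrite (_ : ball 0 r = set0); last first.
    by apply/seteqP; split => // z []; rewrite ltNge r0.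
  rewrite setI0 => eps e0; exists 1 => // h _.
  rewrite /L1norm integral0_eq ?lee_fin ?ltW// => x _.
  by rewrite !indicE !in_set0 subrr normr0.
set B : set X := ball 0 r.
have mB : measurable B by exact: measurable_ball_rV.
have Boo : (mu B < +oo)%E by rewrite borel_lebesgue_ball// ltry.
have tB : translation_continuous \1_B.
  by apply: translation_continuous_open => //; exact: ball_open.
move=> mA.
have oB : open (B : set 'rV[R]_n) by exact: ball_open.
clearbody B; move: (mA); rewrite borel_rV_sigma_open => sA.
have mI S : measurable S -> measurable_fun setT (\1_(S `&` B) : X -> R).
  by move=> mS; apply: measurable_indic; exact: measurableI.
move: A sA {mA}; apply: (@dynkin_induction _ _ _
    (fun A => translation_continuous \1_(A `&` B)) borel_rV_sigma_open).
- exact: openI.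
- by rewrite setTI.
- move=> A oA; apply: translation_continuous_open.
    exact: openI.
  by apply: le_lt_trans Boo; apply: le_measure; rewrite ?inE//; apply: measurableI => //; exact: open_borel.
- move=> S mS tS.
  have -> : \1_(~` S `&` B) = (\1_B : X -> R) \+ (fun x => (-1) * \1_(S `&` B) x).
    apply/funext => x; rewrite /= !indicE !in_setI in_setC.
    by case: (x \in S); case: (x \in B) => /=; rewrite ?mulr1 ?mulr0 ?addr0 ?subrr.
  have tSB : translation_continuous (fun x => (-1) * \1_(S `&` B) x).
    by apply: translation_continuousZ => //; exact: mI.
  apply: (translation_continuousD _ _ tB tSB); first exact: measurable_indic.
  by apply: measurable_funM => //; exact: mI.
- move=> F mF tF H.
  have mUF : measurable (\bigcup_k F k) by exact: bigcupT_measurable.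
  apply: translation_continuous_lim; first exact: mI.
  move=> eps e0; pose G m : set X := \big[setU/set0]_(i < m) F i.
  have mG m : measurable (G m) by exact: bigsetU_measurable.
  have tG m : translation_continuous \1_(G m `&` B).
    elim: m => [|m IH].
      rewrite /G big_ord0 set0I => e e1; exists 1 => // h _.
      rewrite /L1norm integral0_eq ?lee_fin ?ltW// => x _.
      by rewrite !indicE !in_set0 subrr normr0.
    have -> : \1_(G m.+1 `&` B) = (\1_(G m `&` B) : X -> R) \+ \1_(F m `&` B).
      apply/funext => x; rewrite /G big_ord_recr/= -/(G m) !indicE !in_setI in_setU.
      have [xG|xG] := boolP (x \in G m); have [xF|xF] := boolP (x \in F m);
        case: (x \in B) => //=; rewrite ?addr0 ?add0r//.
      exfalso; move: xG xF; rewrite !inE /G -bigcup_mkord => -[k /= km Fk] Fm.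
      have /trivIsetP/(_ k m I I) := tF; rewrite ltn_eqF// => /(_ isT).
      by move/seteqP => -[+ _] => /(_ x (conj Fk Fm)).
    apply: (translation_continuousD _ _ IH (H m)); exact: mI.
  have iU : mu.-integrable setT (EFin \o (\1_(\bigcup_k F k `&` B) : X -> R)).
    apply: integrable_indic_lty; first exact: measurableI.
    by apply: le_lt_trans Boo; apply: le_measure; rewrite ?inE//; exact: measurableI.
  have := @L1norm_tail _ _ _ mu _ (fun m => G m `|` ~` (\bigcup_k F k)) _ e0 iU.
  case.
  + by move=> m; apply: measurableU => //; exact: measurableC.
  + move=> x; have [[k _ Fk]|nF] := pselect ((\bigcup_k F k) x); last first.
      by near=> m; right.
    near=> m; left; rewrite /G -bigcup_mkord; exists k => //=.
    by near: m; exact: nbhs_infty_gt.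
  move=> m _ /(_ m (leqnn m)) Hm; exists \1_(G m `&` B); split => //; first exact: mI.
  apply: le_trans Hm; apply: L1norm_le.
  + by apply: measurable_funB; exact: mI.
  + apply: measurable_funM; first exact: mI.
    by apply: measurable_indic; apply: measurableC; apply: measurableU => //; exact: measurableC.
  + move=> x; rewrite setCU setCK /= !indicE !in_setI in_setC.
    have GF : x \in G m -> x \in \bigcup_k F k.
      by rewrite !inE /G -bigcup_mkord => -[k _ Fk]; exists k.
    case: (x \in G m) GF => [->//|_]; first by rewrite subrr normr0.
    by case: (x \in B); case: (x \in \bigcup_k F k);
      rewrite /= ?(mulr0, mulr1, mul0r, subr0, normr0, normr1).
Unshelve. all: by end_near. Qed.

(** The property is linear and closed under L1 limits, and it holds for indicators of bounded Borel
    sets, hence for simple functions cut off to a large ball; these are dense. *)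
Lemma integrable_translation_continuous f : mu.-integrable setT (EFin \o f) ->
  translation_continuous f.
Proof.
move=> fi; have /integrable_L1norm[mf foo] := fi.
pose B k : set X := ball (0 : 'rV[R]_n) k%:R.
have mB k : measurable (B k) by exact: measurable_ball_rV.
apply: translation_continuous_lim => // eps e0.
have e2 : 0 < eps / 2 by rewrite divr_gt0.
have := @L1norm_tail _ _ _ mu f B _ e2 fi.
case => //.
  move=> x; near=> k.
  have xk : \sum_i `|rV_coord i x| < k%:R by near: k; exact: nbhs_infty_gtr.
  rewrite /B ball_box ?(le_lt_trans _ xk) ?sumr_ge0// => i.
  rewrite mxE sub0r normrN (le_lt_trans _ xk)// (bigD1 i)//= lerDl.
  by rewrite sumr_ge0.
move=> k _ /(_ k (leqnn k)) Hk.
have [g [gi _ /(cvge0_near e2)]] := approximation_sfun_integrable measurableT fi.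
case=> m _ /(_ m (leqnn m)) /= Hm.
have mg : measurable_fun setT (g m : X -> R) by [].
have mIB : measurable_fun setT (\1_(B k) : X -> R) by exact: measurable_indic.
exists (fun x => g m x * \1_(B k) x); split.
- exact: measurable_funM.
- rewrite (_ : (fun x => _) = (fun x => \sum_(y \in range (g m)) y * \1_((g m) @^-1` [set y] `&` B k) x)); last first.
    apply/funext => x; rewrite {1}(fimfunE (g m) x).
    rewrite !fsbig_finite//= mulr_suml; apply: eq_bigr => y _.
    by rewrite indicI mulrA.
  rewrite (_ : (fun x => _) =
      (fun x => \sum_(y <- finmap.enum_fset (fset_set (range (g m)))) y * \1_((g m) @^-1` [set y] `&` B k) x)); last first.
    by apply/funext => x; rewrite fsbig_finite.
  elim: (finmap.enum_fset _) => [|y s IH].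
    move=> e e1; exists 1 => // h _; rewrite /L1norm integral0_eq ?lee_fin ?ltW// => x _.
    by rewrite !big_nil subrr normr0.
  rewrite (_ : (fun x => _) = (fun x => y * \1_((g m) @^-1` [set y] `&` B k) x)
     \+ (fun x => \sum_(j <- s) j * \1_((g m) @^-1` [set j] `&` B k) x)); last first.
    by apply/funext => x; rewrite big_cons.
  have mS z : measurable ((g m) @^-1` [set z]) by exact: measurable_sfunP.
  have mz z : measurable_fun setT (\1_((g m) @^-1` [set z] `&` B k) : X -> R).
    by apply: measurable_indic; exact: measurableI.
  apply: translation_continuousD => //.
  + by apply: measurable_funM.
  + by apply: measurable_sum => z; exact: measurable_funM.
  + by apply: translation_continuousZ => //; exact: translation_continuous_bounded.
- rewrite (splitr eps) EFinD.
  apply: (@le_trans _ _ (L1norm mu (fun x => f x * \1_(~` B k) x)%R +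
      L1norm mu (fun x => f x - g m x)%R)%E); last exact: leeD.
  apply: L1norm_triangle.
  + by apply: measurable_funM => //; apply: measurable_indic; exact: measurableC.
  + exact: measurable_funB.
  + by apply: measurable_funB => //; exact: measurable_funM.
  + move=> x /=; rewrite !indicE in_setC; case: (x \in B k) => /=.
      by rewrite !mulr1 mulr0 normr0 add0r.
    by rewrite mulr1 mulr0 subr0 lerDl.
Unshelve. all: by end_near. Qed.

End translation_continuity.

(** * Smooth functions and mollification *)

Section directional.
Context (R : realType).

Lemma MVT_between (f df : R -> R) (a b : R) :
  (forall x : R, is_derive x 1 f (df x)) ->
  exists2 c, `|c - a| <= `|b - a| & f b - f a = df c * (b - a).
Proof.
move=> H.
have cf : continuous f.
  by move=> x; apply/differentiable_continuous/derivable1_diffP; have [] := H x.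
have [ab|ba] := leP a b.
  have [c] := MVT_segment ab (fun x _ => H x) (continuous_subspaceT cf).
  rewrite in_itv/= => /andP[ac cb] E; exists c => //.
  by rewrite !ger0_norm ?subr_ge0// lerD2r.
have [c] := MVT_segment (ltW ba) (fun x _ => H x) (continuous_subspaceT cf).
rewrite in_itv/= => /andP[bc ca] E; exists c.
  by rewrite !ler0_norm ?subr_le0 ?(ltW ba)// !opprB lerD2l lerN2.
by rewrite -opprB E -mulrN opprB.
Qed.

Context (n : nat).
Notation V := ('rV[R]_n).
Local Notation e i := (delta_mx ord0 i : V).
Implicit Types u v : V -> R.

Lemma is_derive_line u (x w : V) (t d : R) :
  is_derive t 1 (fun s : R => u (s *: w + x)) d <-> is_derive (t *: w + x) w u d.
Proof.
have E : (fun h : R => h^-1 *: ((fun s : R => u (s *: w + x)) \o shift t) (h *: 1) -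
       h^-1 *: (fun s : R => u (s *: w + x)) t) =
    (fun h => h^-1 *: (u \o shift (t *: w + x)) (h *: w) - h^-1 *: u (t *: w + x)).
  apply/funext => h /=; rewrite /shift/= [h *: 1]mulr1 scalerDl addrA; congr (_ - _).
have E' : (fun h : R => h^-1 *: (((fun s : R => u (s *: w + x)) \o shift t) (h *: 1) -
       (fun s : R => u (s *: w + x)) t)) =
    (fun h => h^-1 *: ((u \o shift (t *: w + x)) (h *: w) - u (t *: w + x))).
  by apply/funext => h; have := congr1 (@^~ h) E; rewrite !scalerBr.
by split=> -[H1 H2]; apply: DeriveDef; move: H1 H2; rewrite /derivable /derive E'.
Qed.

Lemma is_derive_line0 u (x w : V) (d : R) :
  is_derive (0 : R) 1 (fun s : R => u (s *: w + x)) d <-> is_derive x w u d.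
Proof. by rewrite is_derive_line scale0r add0r. Qed.

Lemma is_derive_pderiv u i x : derivable u x (e i) -> is_derive x (e i) u (pderiv i u x).
Proof. by move=> H; apply: DeriveDef. Qed.

Lemma pderiv_increment u i x (t : R) :
  (forall y, derivable u y (e i)) ->
  exists2 c, `|c| <= `|t| & u (t *: e i + x) - u x = pderiv i u (c *: e i + x) * t.
Proof.
move=> du.
have H (s : R) : is_derive s 1 (fun s : R => u (s *: e i + x)) (pderiv i u (s *: e i + x)).
  by apply/is_derive_line; exact: is_derive_pderiv.
have [c c1 c2] := MVT_between 0 t H.
by exists c; [move: c1; rewrite !subr0|move: c2; rewrite scale0r add0r subr0].
Qed.

Lemma pderiv_lipschitz u i x (t K : R) :
  (forall y, derivable u y (e i)) -> (forall y, `|pderiv i u y| <= K) ->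
  `|u (t *: e i + x) - u x| <= K * `|t|.
Proof.
move=> du HK; have [c _ ->] := pderiv_increment x t du.
by rewrite normrM ler_wpM2r.
Qed.

(** Two mean value steps, the second from [x] to the intermediate point. The bound is uniform in
    [x], so difference quotients of a kernel converge uniformly. *)
Lemma pderiv_taylor u i x (t K : R) :
  (forall y, derivable u y (e i)) -> (forall y, derivable (pderiv i u) y (e i)) ->
  (forall y, `|pderiv i (pderiv i u) y| <= K) ->
  `|u (t *: e i + x) - u x - t * pderiv i u x| <= K * t ^+ 2.
Proof.
move=> du ddu HK; have [c ct ->] := pderiv_increment x t du.
rewrite [t * _]mulrC -mulrBl normrM.
apply: (@le_trans _ _ (K * `|c| * `|t|)).
  by rewrite ler_wpM2r//; exact: pderiv_lipschitz.
have K0 : 0 <= K by apply: le_trans (HK 0).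
by rewrite -mulrA ler_wpM2l// -real_normK ?num_real// expr2 ler_wpM2r.
Qed.

(** The class of multipliers and test functions: cutoffs, mollified functions and translated kernels
    all belong to it, and it imposes nothing on the support. *)
Definition C1b u := [/\ continuous u, (forall x i, derivable u x (e i)),
  (forall i, continuous (pderiv i u)) &
  exists K : R, (forall x, `|u x| <= K) /\ (forall i x, `|pderiv i u x| <= K)].

Lemma lipschitz_increment u (h x : V) (K : R) :
  (forall x i, derivable u x (e i)) -> (forall i y, `|pderiv i u y| <= K) ->
  `|u (h + x) - u x| <= K * \sum_i `|h ord0 i|.
Proof.
move=> du HK; rewrite {1}(matrix_sum_delta h) big_ord1.
elim/big_rec2: _ => [|i y z _ IH]; first by rewrite add0r subrr normr0 mulr0.
rewrite -addrA mulrDr.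
rewrite (_ : _ - u x = u (h ord0 i *: e i + (z + x)) - u (z + x) + (u (z + x) - u x)); last by lra.
by apply: le_trans (ler_normD _ _) _; apply: lerD => //; exact: pderiv_lipschitz.
Qed.

Lemma C1bM u v : C1b u -> C1b v ->
  C1b (fun x => u x * v x) /\
  forall i x, pderiv i (fun x => u x * v x) x = pderiv i u x * v x + u x * pderiv i v x.
Proof.
move=> [cu du cdu [K [K1 K2]]] [cv dv cdv [L [L1 L2]]].
have E i x : pderiv i (fun x => u x * v x) x = pderiv i u x * v x + u x * pderiv i v x.
  by rewrite /pderiv (deriveM (du x i) (dv x i)) addrC; congr (_ + _); rewrite mulrC.
have E' i : pderiv i (fun x => u x * v x) =
    (fun x => pderiv i u x * v x + u x * pderiv i v x) by apply/funext => x; exact: E.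
split; [split|exact: E].
- by move=> x; apply: continuousM; [exact: cu|exact: cv].
- by move=> x i; exact: derivableM.
- move=> i; rewrite E' => x; exact: (cvgD (cvgM (cdu i x) (cv x)) (cvgM (cu x) (cdv i x))).
- have K0 : 0 <= K by apply: le_trans (K1 0).
  have L0 : 0 <= L by apply: le_trans (L1 0).
  exists (K * L + K * L); split=> [x|i x].
    by rewrite normrM (@le_trans _ _ (K * L)) ?ler_pM ?lerDl ?mulr_ge0.
  by rewrite E (le_trans (ler_normD _ _))// lerD// normrM ler_pM.
Qed.

Definition bsmooth u := forall s : seq 'I_n,
  [/\ continuous (foldr (@pderiv R n) u s),
      forall x i, derivable (foldr (@pderiv R n) u s) x (e i) &
      exists K : R, forall x, `|foldr (@pderiv R n) u s x| <= K].

Lemma bsmooth_smooth u : bsmooth u -> smooth u.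
Proof. by move=> H s; have [] := H s. Qed.

Lemma bsmooth_pderiv u i : bsmooth u -> bsmooth (pderiv i u).
Proof. by move=> H s; have := H (rcons s i); rewrite foldr_rcons. Qed.

Lemma bsmooth_C1b u : bsmooth u -> C1b u.
Proof.
move=> H; have [c d [K HK]] := H [::].
have [L HL] : exists L : R, forall i x, `|pderiv i u x| <= L.
  have H1 i : {L | forall x, `|pderiv i u x| <= L}.
    by apply: cid; have [_ _] := H [:: i].
  exists (\sum_i sval (H1 i)) => i x; have L0 j : 0 <= sval (H1 j).
    by apply: le_trans (svalP (H1 j) 0).
  by rewrite (bigD1 i)//= (le_trans (svalP (H1 i) x))// lerDl sumr_ge0.
split=> //; first by move=> i; have [] := H [:: i].
exists (Num.max K L); split=> [x|i x]; rewrite le_max; first by rewrite HK.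
by rewrite HL orbT.
Qed.

(** Coinduction principle: a family of continuous, derivable functions closed under partial
    derivatives consists of smooth functions. Later smoothness proofs exhibit such a family instead
    of inducting on words of derivatives. *)
Lemma smooth_coind (S : set (V -> R)) :
  (forall f, S f -> [/\ continuous f, (forall x i, derivable f x (e i)) &
     forall i, S (pderiv i f)]) -> forall f, S f -> smooth f.
Proof.
move=> H f Sf s; suff /H[] : S (foldr (@pderiv R n) f s) by [].
by elim: s => //= i s IH; have [_ _] := H _ IH; exact.
Qed.

Lemma bsmooth_coind (S : set (V -> R)) :
  (forall f, S f -> [/\ continuous f, (forall x i, derivable f x (e i)),
     (exists K : R, forall x, `|f x| <= K) & forall i, S (pderiv i f)]) ->
  forall f, S f -> bsmooth f.
Proof.
move=> H f Sf s; suff /H[] : S (foldr (@pderiv R n) f s) by [].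
by elim: s => //= i s IH; have [_ _ _] := H _ IH; exact.
Qed.

Lemma pderivN u i x : derivable u x (e i) ->
  pderiv i (fun x => - u x) x = - pderiv i u x.
Proof. exact: deriveN. Qed.

Lemma bsmoothN u : bsmooth u -> bsmooth (fun x => - u x).
Proof.
move=> bu; apply: (@bsmooth_coind [set f | exists2 g, bsmooth g & f = fun x => - g x]).
  move=> _ [g bg ->]; have [c d [K HK]] := bg [::]; split.
  - by move=> x; apply: continuousN; exact: c.
  - by move=> x i; exact: derivableN.
  - by exists K => x; rewrite normrN.
  - move=> i; exists (pderiv i g); first exact: bsmooth_pderiv.
    by apply/funext => x; rewrite pderivN.
by exists u.
Qed.

Lemma smoothD u v : smooth u -> smooth v -> smooth (fun x => u x + v x).
Proof.
move=> su sv; apply: (@smooth_coind [set f | exists g h,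
  [/\ smooth g, smooth h & f = fun x => g x + h x]]); last by exists u, v.
move=> _ [g [h [sg sh ->]]].
have [cg dg] := sg [::]; have [ch dh] := sh [::]; split.
- by move=> x; apply: continuousD; [exact: cg|exact: ch].
- by move=> x i; exact: derivableD.
- move=> i; exists (pderiv i g), (pderiv i h); split.
  + by move=> s; have := sg (rcons s i); rewrite foldr_rcons.
  + by move=> s; have := sh (rcons s i); rewrite foldr_rcons.
  + by apply/funext => x; rewrite /pderiv (deriveD (dg x i) (dh x i)).
Qed.

(** The function and its partial derivatives are continuous and vanish off a compact set, hence are
    bounded. *)
Lemma Cc_infty_C1b D u : Cc_infty D u -> C1b u.
Proof.
move=> [su cpt _].
have bnd (f : V -> R) : continuous f -> (forall x, ~ closure [set x | u x != 0] x -> f x = 0) ->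
    exists K : R, forall x, `|f x| <= K.
  move=> cf f0.
  have : compact (f @` closure [set x | u x != 0]).
    by apply: continuous_compact cpt; exact: continuous_subspaceT.
  move=> /compact_bounded[M [Mr HM]]; exists (Num.max 0 (M + 1)) => x.
  rewrite le_max; have [cx|ncx] := pselect (closure [set x | u x != 0] x).
    by rewrite (HM (M + 1)) ?orbT ?ltrDl//; exists x.
  by rewrite f0// normr0 lexx.
have [cu du] := su [::].
have ou : open (~` closure [set x | u x != 0]) by apply: closed_openC; exact: closed_closure.
have dz i x : ~ closure [set x | u x != 0] x -> pderiv i u x = 0.
  move=> nx; rewrite /pderiv.
  have H : \forall y \near x, (cst 0 : V -> R) y = u y.
    near=> y.
    have : (~` closure [set x | u x != 0]) y by near: y; exact: open_nbhs_nbhs.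
    by move=> ny /=; apply/esym/eqP/negPn/negP => uy; apply: ny; exact: subset_closure.
  by have [_ ->] := near_eq_is_derive H (is_derive_cst 0 x (e i)).
have [K HK] : exists K : R, forall x, `|u x| <= K.
  apply: bnd => // x nx; apply/eqP/negPn/negP => ux; apply: nx; exact: subset_closure.
have [L HL] : exists L : R, forall i x, `|pderiv i u x| <= L.
  have H1 i : {L | forall x, `|pderiv i u x| <= L}.
    apply: cid; apply: bnd; last by move=> x; exact: dz.
    by have [] := su [:: i].
  exists (\sum_i sval (H1 i)) => i x; have L0 j : 0 <= sval (H1 j).
    by apply: le_trans (svalP (H1 j) 0).
  by rewrite (bigD1 i)//= (le_trans (svalP (H1 i) x))// lerDl sumr_ge0.
split=> //; first by move=> i; have [] := su [:: i].
exists (Num.max K L); split=> [x|i x]; rewrite le_max; first by rewrite HK.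
by rewrite HL orbT.
Unshelve. all: by end_near. Qed.

End directional.

Section integrable_real.
Context d (T : measurableType d) (R : realType) (mu : {measure set T -> \bar R}).
Implicit Types f g : T -> R.

Lemma integrable_addr f g : mu.-integrable setT (EFin \o f) ->
  mu.-integrable setT (EFin \o g) -> mu.-integrable setT (EFin \o (fun x => f x + g x)).
Proof.
by move=> fi gi; have := integrableD measurableT fi gi; exact: eq_integrable.
Qed.

Lemma integrable_subr f g : mu.-integrable setT (EFin \o f) ->
  mu.-integrable setT (EFin \o g) -> mu.-integrable setT (EFin \o (fun x => f x - g x)).
Proof.
by move=> fi gi; have := integrableB measurableT fi gi; exact: eq_integrable.
Qed.

Lemma integrable_mulr (c : R) f : mu.-integrable setT (EFin \o f) ->
  mu.-integrable setT (EFin \o (fun x => c * f x)).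
Proof.
by move=> fi; have := integrableZl measurableT c fi; exact: eq_integrable.
Qed.

End integrable_real.

(** * Integration by parts and mollification *)

Section mollification.
Context (R : realType) (n : nat).
Notation X := (borel_rV R n).
Notation V := ('rV[R]_n).
Notation mu := (@borel_lebesgue R n).
Local Notation e i := (delta_mx ord0 i : V).
Implicit Types u v k : V -> R.

Lemma ball_line (x : V) i (t d : R) : `|t| < d -> ball x d (t *: e i + x).
Proof.
move=> td; rewrite ball_box; last exact: le_lt_trans td.
move=> j; rewrite /rV_coord !mxE opprD addrCA subrr addr0 normrN /= normrM.
by apply: le_lt_trans td; rewrite ler_piMr//; case: (j == i); rewrite ?normr1 ?normr0.
Qed.

Lemma diffquot_near u i x (eps : R) : C1b u -> 0 < eps ->
  exists2 d : R, 0 < d & forall t, t != 0 -> `|t| < d ->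
    `|t^-1 * (u (t *: e i + x) - u x) - pderiv i u x| <= eps.
Proof.
move=> [cu du cdu _] e0.
have /cvgrPdist_le/(_ _ e0)/nbhs_ballP[d /= d0 dP] := cdu i x.
exists d => // t t0 td; have [c ct ->] := pderiv_increment x t (du^~ i).
rewrite [_ * t]mulrC mulKf// distrC; apply: dP; apply: ball_line.
exact: le_lt_trans td.
Qed.

Definition bsupp u := exists2 r : R, 0 < r & forall x, ~ ball 0 r x -> u x = 0.

Lemma zero_outside_line u i (x : V) (t d r : R) :
  (forall x, ~ ball 0 r x -> u x = 0) -> ~ ball 0 (r + d) x -> `|t| < d ->
  u (t *: e i + x) = 0.
Proof.
move=> ur nx td; apply: ur => H; apply: nx; apply: ball_triangle H _.
by apply: ball_sym; exact: ball_line.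
Qed.

Lemma zero_outside_le u (x : V) (d r : R) :
  (forall x, ~ ball 0 r x -> u x = 0) -> ~ ball 0 (r + d) x -> 0 <= d ->
  u x = 0.
Proof.
by move=> ur nx d0; apply: ur => H; apply: nx; apply: le_ball H; rewrite lerDl.
Qed.

Lemma pderiv_zero_outside u i (r d : R) : C1b u -> 0 < d ->
  (forall x, ~ ball 0 r x -> u x = 0) -> forall x, ~ ball 0 (r + d) x -> pderiv i u x = 0.
Proof.
move=> Cu d0 ur x xr; apply/eqP; rewrite -normr_le0; apply/ler_addgt0Pr => eps e0.
rewrite add0r; have [d' d'0 dP] := diffquot_near i x Cu e0.
pose t := Num.min (d' / 2) (d / 2).
have t0 : 0 < t by rewrite lt_min !divr_gt0.
have td' : `|t| < d' by rewrite gtr0_norm// gt_min; apply/orP; left; lra.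
have td : `|t| < d by rewrite gtr0_norm// gt_min; apply/orP; right; lra.
have := dP t (lt0r_neq0 t0) td'.
rewrite (zero_outside_line i ur xr td) (zero_outside_le ur xr (ltW d0)).
by rewrite subr0 mulr0 sub0r normrN.
Qed.

Lemma pderiv_bsupp u i : C1b u -> bsupp u -> bsupp (pderiv i u).
Proof.
move=> Cu [r r0 ur]; exists (r + 1); first by rewrite addr_gt0.
exact: pderiv_zero_outside ur.
Qed.

Lemma C1b_measurable u : C1b u -> measurable_fun [set: X] u.
Proof. by case=> cu _ _ _; exact: continuous_borel. Qed.

Lemma pderiv_measurable u i : C1b u -> measurable_fun [set: X] (pderiv i u).
Proof. by case=> _ _ cu _; apply: continuous_borel; exact: cu. Qed.

Lemma L1norm_bounded_on (u : X -> R) (A : set X) (K : R) :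
  measurable_fun setT u -> measurable A -> (forall x, ~ A x -> u x = 0) ->
  (forall x, `|u x| <= K) -> (L1norm mu u <= K%:E * mu A)%E.
Proof.
move=> mf mA uA uK; have K0 : 0 <= K by apply: le_trans (uK 0).
rewrite /L1norm (_ : mu A = \int[mu]_x (\1_A x)%:E)%E; last by rewrite integral_indic// setIT.
rewrite -ge0_integralZl//; last first.
  by apply/measurable_EFinP; exact: measurable_indic.
apply: ge0_le_integral => //.
- exact: measurable_normE.
- by apply/measurable_EFinP; apply: measurable_funM => //; exact: measurable_indic.
- move=> x _; rewrite -EFinM lee_fin indicE; have [Ax|nAx] := pselect (A x).
    by rewrite mem_set// mulr1.
  by rewrite memNset// mulr0 uA// normr0.
Qed.

Lemma bounded_on_integrable (u : X -> R) (A : set X) (K : R) :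
  measurable_fun setT u -> measurable A -> (forall x, ~ A x -> u x = 0) ->
  (forall x, `|u x| <= K) -> (mu A < +oo)%E -> mu.-integrable setT (EFin \o u).
Proof.
move=> mf mA uA uK Aoo; apply/integrable_L1norm; split => //.
apply: le_lt_trans (L1norm_bounded_on mf mA uA uK) _.
by apply: lte_mul_pinfty => //; rewrite lee_fin; apply: le_trans (uK 0).
Qed.

Lemma bsupp_integrable (u : X -> R) (K : R) : measurable_fun setT u -> bsupp u ->
  (forall x, `|u x| <= K) -> mu.-integrable setT (EFin \o u).
Proof.
move=> mf [r r0 ur] uK; apply: (bounded_on_integrable mf _ ur uK).
  exact: measurable_ball_rV.
by rewrite borel_lebesgue_ball// ltry.
Qed.

Lemma C1b_integrable u : C1b u -> bsupp u -> mu.-integrable setT (EFin \o (u : X -> R)).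
Proof.
move=> Cu bu; have [_ _ _ [K [K1 _]]] := Cu.
by apply: bsupp_integrable bu K1; exact: C1b_measurable.
Qed.

Lemma pderiv_integrable u i : C1b u -> bsupp u ->
  mu.-integrable setT (EFin \o (pderiv i u : X -> R)).
Proof.
move=> Cu bu; have [_ _ _ [K [_ K2]]] := Cu.
by apply: (@bsupp_integrable _ K) => //; [exact: pderiv_measurable|exact: pderiv_bsupp].
Qed.

Lemma normr_Rintegral_L1norm (f : X -> R) : mu.-integrable setT (EFin \o f) ->
  (`|\int[mu]_x f x|%:E <= L1norm mu f)%E.
Proof.
move=> fi; rewrite -[leRHS]fineK.
  by rewrite lee_fin; exact: le_normr_Rintegral.
by rewrite ge0_fin_numE ?L1norm_ge0//; have /integrable_L1norm[] := fi.
Qed.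

Lemma Rintegral_shift (h : V) (f : X -> R) : measurable_fun setT f ->
  \int[mu]_x f ((x : V) + h) = \int[mu]_x f x.
Proof.
move=> mf; rewrite /Rintegral; congr fine.
by apply: (integral_shift h (f := EFin \o f)); exact/measurable_EFinP.
Qed.

(** Difference quotients have integral zero by translation invariance, and they converge to the
    derivative in L1 by dominated convergence. *)
Lemma Rintegral_pderiv u i : C1b u -> bsupp u -> \int[mu]_x pderiv i u x = 0.
Proof.
move=> Cu bu; apply/eqP; rewrite -normr_le0; apply/ler_addgt0Pr => eps e0.
rewrite add0r -lee_fin.
have [cu du cdu [K [K1 K2]]] := Cu.
have iu := C1b_integrable Cu bu; have idu := pderiv_integrable i Cu bu.
have mu0 := C1b_measurable Cu; have mdu := pderiv_measurable i Cu.
pose t m : R := m.+1%:R^-1.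
have t0 m : 0 < t m by rewrite invr_gt0.
pose q m : X -> R := fun x => (t m)^-1 * (u ((x : V) + t m *: e i) - u x).
have qE m (x : V) : q m x = (t m)^-1 * (u (t m *: e i + x) - u x).
  by rewrite /q [x + _]addrC.
have iq m : mu.-integrable setT (EFin \o q m).
  have := integrableZl measurableT (t m)^-1
    (integrableB measurableT (integrable_shift (t m *: e i) iu) iu).
  by apply: eq_integrable.
have q0 m : \int[mu]_x q m x = 0.
  rewrite RintegralZl//; last first.
    by have := integrableB measurableT (integrable_shift (t m *: e i) iu) iu; apply: eq_integrable.
  rewrite RintegralB//; last exact: (integrable_shift (t m *: e i) iu).
  by rewrite (Rintegral_shift _ mu0) subrr mulr0.
have [r r0 ur] := bu.
have : \forall m \near \oo, (L1norm mu (q m \- pderiv i u)%R <= eps%:E)%E.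
  (* The steps [t m] are at most 1, so the ball of radius [r + 2] contains the supports of all the
     difference quotients and of the derivative. *)
  apply: (@dominated_L1norm_near _ _ _ _ _
     (fun x => (K + K) * \1_(ball (0 : V) (r + 2) : set X) x)) => //.
  - by move=> m; apply: measurable_funB => //; have /integrable_L1norm[] := iq m.
  - apply: (@bounded_on_integrable _ (ball (0:V) (r + 2) : set X) (K + K)).
    + apply: measurable_funM => //; apply: measurable_indic; exact: measurable_ball_rV.
    + exact: measurable_ball_rV.
    + by move=> x nx; rewrite indicE memNset ?mulr0.
    + move=> x; have K0 : 0 <= K by apply: le_trans (K1 0).
      rewrite normrM ger0_norm ?addr_ge0// ler_piMr ?addr_ge0// ger0_norm// indicE.
    + by rewrite borel_lebesgue_ball ?ltry// addr_gt0.
  - move=> m x /=; have [xB|xB] := pselect (ball (0 : V) (r + 2) x).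
      rewrite indicE mem_set// mulr1; apply: le_trans (ler_normB _ _) _; apply: lerD => //.
      rewrite qE; have [c _ ->] := pderiv_increment x (t m) (du^~ i).
      by rewrite [_ * t m]mulrC mulKf// gt_eqF.
    rewrite indicE memNset// mulr0 qE.
    have t2 : `|t m| < 2.
      by rewrite gtr0_norm// (@le_lt_trans _ _ 1) ?ltr1n// invf_le1 ?ler1n.
    rewrite (zero_outside_line i ur xB t2) (zero_outside_le ur xB)//.
    by rewrite (pderiv_zero_outside i Cu _ ur xB)// !subr0 mulr0 normr0.
  - move=> x; apply/cvgrPdist_le => e1 e10.
    have [d d0 dP] := diffquot_near i x Cu e10.
    near=> m; rewrite sub0r normrN /= qE; apply: dP; first by rewrite gt_eqF.
    rewrite gtr0_norm// /t invf_plt ?posrE// (@lt_le_trans _ _ m%:R) ?ler_nat//.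
    by near: m; exact: nbhs_infty_gtr.
case=> m _ /(_ m (leqnn m)); apply: le_trans.
have iqd : mu.-integrable setT (EFin \o (q m \- pderiv i u)%R) by exact: integrable_subr.
have := normr_Rintegral_L1norm iqd.
by rewrite RintegralB// q0 sub0r normrN.
Unshelve. all: by end_near. Qed.

Lemma Rintegral_by_parts u v i : C1b u -> bsupp u -> C1b v ->
  \int[mu]_x (u x * pderiv i v x) = - \int[mu]_x (pderiv i u x * v x).
Proof.
move=> Cu bu Cv; have [Cuv E] := C1bM Cu Cv.
have buv : bsupp (fun x => u x * v x).
  by have [r r0 H] := bu; exists r => // x /H ->; rewrite mul0r.
have := Rintegral_pderiv i Cuv buv.
have [_ _ _ [K [K1 K2]]] := Cu; have [_ _ _ [L [L1 L2]]] := Cv.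
rewrite (@eq_Rintegral _ _ _ _ _ (fun x : X => pderiv i u x * v x + u x * pderiv i v x)); last first.
  by move=> x _; rewrite E.
rewrite RintegralD//; first by move=> H; lra.
- apply: (@bsupp_integrable _ (K * L)).
  + by apply: measurable_funM; [exact: pderiv_measurable|exact: C1b_measurable].
  + by have [r r0 H] := pderiv_bsupp i Cu bu; exists r => // x /H ->; rewrite mul0r.
  + by move=> x; rewrite normrM ler_pM.
- apply: (@bsupp_integrable _ (K * L)).
  + by apply: measurable_funM; [exact: C1b_measurable|exact: pderiv_measurable].
  + by have [r r0 H] := bu; exists r => // x /H ->; rewrite mul0r.
  + by move=> x; rewrite normrM ler_pM.
Qed.

(** A correlation rather than a convolution: a kernel centred at [c] reads [v] near [x + c], and
    differentiation in [x] reaches the kernel with a minus sign. A kernel centred at [- t e] thus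
    moves the support of [v] by [t e]. *)
Definition moll k (v : V -> R) (x : V) : R := \int[mu]_y (k ((y : V) - x) * v y).

Lemma integrable_bounded_mul (g v : X -> R) (K : R) : measurable_fun setT g ->
  (forall x, `|g x| <= K) -> mu.-integrable setT (EFin \o v) ->
  mu.-integrable setT (EFin \o (fun x => g x * v x)).
Proof.
move=> mg gK iv; apply: (@integrableMr _ _ _ mu setT measurableT g (EFin \o v)) => //.
by exists K; split; [exact: num_real|move=> M KM x _; exact: le_trans (gK x) (ltW KM)].
Qed.

Lemma normr_Rintegral_mul (g v : X -> R) (K : R) : measurable_fun setT g ->
  (forall x, `|g x| <= K) -> mu.-integrable setT (EFin \o v) ->
  `|\int[mu]_x (g x * v x)| <= K * fine (L1norm mu v).
Proof.
move=> mg gK iv; have K0 : 0 <= K by apply: le_trans (gK 0).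
have /integrable_L1norm[mv voo] := iv.
have vfin : L1norm mu v \is a fin_num by rewrite ge0_fin_numE// L1norm_ge0.
rewrite -lee_fin EFinM fineK//.
apply: le_trans (normr_Rintegral_L1norm (integrable_bounded_mul mg gK iv)) _.
rewrite -[K]ger0_norm// -L1normZ//; apply: L1norm_le.
- exact: measurable_funM.
- exact: measurable_funM.
- by move=> x; rewrite !normrM ler_wpM2r// [leRHS]ger0_norm.
Qed.

Lemma measurable_reflect k (x : V) : continuous k ->
  measurable_fun setT (fun y : X => k ((y : V) - x)).
Proof.
by move=> ck; apply: (measurable_shiftf (- x) (f := k)); exact: continuous_borel.
Qed.

Lemma moll_continuous k v : C1b k -> mu.-integrable setT (EFin \o (v : X -> R)) ->
  continuous (moll k v).
Proof.
move=> Ck iv; suff H : forall x : V, {for x, continuous (moll k v)} by exact: H.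
move=> x; have [ck dk cdk [K [K1 K2]]] := Ck.
apply: (@cvgrPdist_le _ _ _ (nbhs x) (nbhs_filter x) (moll k v) (moll k v x)).2.
move=> eps e0; set L := fine (L1norm mu v); have L0 : 0 <= L by rewrite fine_ge0// L1norm_ge0.
have K0 : 0 <= K by apply: le_trans (K1 0).
pose M := K * n%:R * L + 1; have M0 : 0 < M by rewrite ltr_wpDl// !mulr_ge0.
apply/nbhs_ballP; exists (eps / M); first by rewrite /= divr_gt0.
move=> z /= xz; rewrite /moll -RintegralB//; last 2 first.
- exact: (integrable_bounded_mul (measurable_reflect x ck) (fun y => K1 _) iv).
- exact: (integrable_bounded_mul (measurable_reflect z ck) (fun y => K1 _) iv).
rewrite (@eq_Rintegral _ _ _ _ _ (fun y : X => (k ((y : V) - x) - k ((y : V) - z)) * v y)); last first.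
  by move=> y _; rewrite mulrBl.
apply: le_trans (normr_Rintegral_mul (K := K * (n%:R * (eps / M))) _ _ iv) _.
- by apply: measurable_funB; exact: measurable_reflect.
- move=> y; rewrite (_ : (y : V) - x = (z - x) + (y - z)); last first.
    by rewrite [RHS]addrC addrA subrK.
  apply: le_trans (lipschitz_increment _ _ dk K2) _; rewrite ler_wpM2l//.
  have -> : n%:R * (eps / M) = \sum_(i < n) (eps / M) by rewrite sumr_const card_ord mulr_natl.
  apply: ler_sum => i _; move: xz; rewrite ball_box ?divr_gt0// => /(_ i)/ltW.
  by rewrite !mxE distrC.
- rewrite -/L (_ : _ * L = eps * ((K * n%:R * L) / M)); last by lra.
  by rewrite ler_piMr ?ltW// ltr_pdivrMr// mul1r /M ltrDl.
Qed.

(** All the regularity sits on the kernel: by [pderiv_taylor] its difference quotients have a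
    uniform error of order [h], which an integrable [v] tolerates. *)
Lemma moll_pderiv k v i x : bsmooth k -> mu.-integrable setT (EFin \o (v : X -> R)) ->
  is_derive x (e i) (moll k v) (moll (fun z => - pderiv i k z) v x).
Proof.
move=> bk iv; have [ck dk cdk [K [K1 K2]]] := bsmooth_C1b bk.
have Cdk := bsmooth_C1b (bsmooth_pderiv i bk).
have [_ ddk _ [K' [K1' K2']]] := Cdk.
set L := fine (L1norm mu v); have L0 : 0 <= L by rewrite fine_ge0// L1norm_ge0.
have K'0 : 0 <= K' by apply: le_trans (K1' 0).
have ik z : mu.-integrable setT (EFin \o (fun y : X => k ((y : V) - z) * v y)).
  exact: (integrable_bounded_mul (measurable_reflect z ck) (fun y => K1 _) iv).
have idk : mu.-integrable setT (EFin \o (fun y : X => - pderiv i k ((y : V) - x) * v y)).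
  apply: (@integrable_bounded_mul (fun y : X => - pderiv i k ((y : V) - x)) v K') => //.
    by apply: measurableT_comp => //; apply: measurable_reflect; exact: cdk.
  by move=> y; rewrite normrN.
have cv : (fun h : R => h^-1 *: ((moll k v \o shift x) (h *: e i) - moll k v x)) @ 0^'
    --> moll (fun z => - pderiv i k z) v x.
  apply/cvgrPdist_le => eps e0.
  near=> h.
  have h0 : h != 0 by near: h; exact: nbhs_dnbhs_neq.
  rewrite /= /shift /moll -RintegralB//.
  rewrite [_ *: _](_ : _ = \int[mu]_y (h^-1 * (k ((y : V) - (h *: e i + x)) * v y - k ((y : V) - x) * v y))); last first.
    by rewrite RintegralZl//; exact: (integrableB _ (ik _) (ik _)).
  rewrite -RintegralB//; last first.
    have := integrableZl measurableT (h^-1) (integrableB measurableT (ik (h *: e i + x)) (ik x)).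
    by apply: eq_integrable.
  rewrite (@eq_Rintegral _ _ _ _ _ (fun y : X => (- pderiv i k ((y : V) - x) -
     h^-1 * (k ((y : V) - (h *: e i + x)) - k ((y : V) - x))) * v y)); last first.
    by move=> y _; rewrite -mulrBl mulrA -mulrBl.
  apply: le_trans (normr_Rintegral_mul (K := K' * `|h|) _ _ iv) _.
  + apply: measurable_funB.
      by apply: measurableT_comp => //; apply: measurable_reflect; exact: cdk.
    by apply: measurable_funM => //; apply: measurable_funB; exact: measurable_reflect.
  + move=> y; have := @pderiv_taylor _ _ k i (y - x) (- h) K' (dk^~ i) (ddk^~ i) (K2' i).
    rewrite (_ : - h *: e i + (y - x) = y - (h *: e i + x)); last first.
      by rewrite opprD addrCA scaleNr.
    set A := k _; set B := k _; set D := pderiv i k _ => H.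
    rewrite (_ : - D - _ = - (h^-1 * (A - B - - h * D))); last first.
      by have := mulKf h0 D; lra.
    rewrite normrN normrM normfV mulrC ler_pdivrMr ?normr_gt0//.
    by apply: le_trans H _; rewrite sqrrN -[in leRHS]mulrA -expr2 real_normK ?num_real.
  + rewrite -/L mulrAC; apply: (@le_trans _ _ ((K' * L + 1) * `|h|)).
      by rewrite ler_wpM2r// lerDl.
    rewrite mulrC -ler_pdivlMr ?ltr_wpDl ?mulr_ge0//.
    near: h; apply: dnbhs0_le; rewrite divr_gt0// ltr_wpDl// mulr_ge0//.
apply: DeriveDef; first by apply/cvg_ex; eexists; exact: cv.
exact/cvg_lim.
Unshelve. all: by end_near. Qed.

Lemma moll_bsmooth k v : bsmooth k -> mu.-integrable setT (EFin \o (v : X -> R)) ->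
  bsmooth (moll k v).
Proof.
move=> bk iv; apply: (@bsmooth_coind _ _ [set f | exists2 g, bsmooth g & f = moll g v]);
  last by exists k.
move=> _ [g bg ->]; have Cg := bsmooth_C1b bg; split.
- exact: moll_continuous.
- by move=> x i; have [] := moll_pderiv i x bg iv.
- have [cg _ _ [K [K1 _]]] := Cg.
  exists (K * fine (L1norm mu v)) => x; apply: normr_Rintegral_mul => //.
  exact: measurable_reflect.
- move=> i; exists (fun z => - pderiv i g z).
    by apply: bsmoothN; exact: bsmooth_pderiv.
  by apply/funext => x; have [_] := moll_pderiv i x bg iv.
Qed.

End mollification.

(** * Smooth bump functions *)

Section bump.
Context (R : realType).
Implicit Types (t : R) (Q : {poly R}) (m : nat).

(** The numerator [Q] and the exponent [m] are kept as parameters because the family is then closed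
    under differentiation, the standard bump being [Q = 1], [m = 0]. *)
Definition bump Q m t : R :=
  if `|t| < 1 then Q.[t] * (1 - t ^+ 2)^-1 ^+ m * expR (- (1 - t ^+ 2)^-1) else 0.

(** Numerator of the derivative over the common denominator [(1 - t^2)^(m+2)]: the three terms come
    from [Q], from the power and from the exponential. *)
Definition bump_deriv Q m : {poly R} :=
  Q^`() * (1 - 'X^2) ^+ 2 + (m%:R * 2) *: ('X * Q * (1 - 'X^2)) - 2 *: ('X * Q).

(** One term of the exponential series, of degree [m + 2], is retained. With [y = 1 / (1 - t^2)] the
    two spare powers give the quadratic decay at the endpoints that makes the derivative vanish
    there. *)
Lemma exp_decay m (y : R) : 0 < y -> y ^+ m * expR (- y) <= m.+2`!%:R * y ^- 2.
Proof.
move=> y0; have := @expR_ge1Dxn R y m.+1 (ltW y0).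
rewrite expRN => H; rewrite ler_pdivrMr ?expR_gt0// mulrAC ler_pdivlMr ?exprn_gt0//.
rewrite -exprD addn2 -ler_pdivrMl ?ltr0n ?fact_gt0// mulrC.
by apply: le_trans H; rewrite lerDr.
Qed.

Lemma sqr_lt1 t : `|t| < 1 -> 0 < 1 - t ^+ 2.
Proof.
move=> t1; rewrite subr_gt0 -real_normK ?num_real//.
by rewrite -[ltRHS](expr1n _ 2) ltr_pXn2r ?nnegrE.
Qed.

Lemma horner_bounded Q : exists K : R, forall t, `|t| <= 1 -> `|Q.[t]| <= K.
Proof.
have : compact ((fun t => Q.[t]) @` `[-1, 1]%classic).
  apply: continuous_compact; last exact: segment_compact.
  by apply: continuous_subspaceT; exact: continuous_horner.
move=> /compact_bounded[M [Mr HM]]; exists (M + 1) => t t1.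
apply: (HM (M + 1)); first by rewrite ltrDl.
by exists t => //=; rewrite in_itv/= -ler_norml.
Qed.

Lemma bump_decay Q m : exists2 C : R, 0 <= C & forall t,
  `|bump Q m t| <= C * (`|t| < 1)%R%:R * (1 - t ^+ 2) ^+ 2.
Proof.
have [K HK] := horner_bounded Q.
have K0 : 0 <= K by apply: le_trans (HK 0 _); rewrite ?normr0 ?ler01.
exists (K * m.+2`!%:R); first by rewrite mulr_ge0.
move=> t; rewrite /bump; case: ifPn => [t1|_]; last by rewrite normr0 mulr0 mul0r.
have u0 := sqr_lt1 t1; rewrite mulr1 -!mulrA normrM ler_pM//; first exact/HK/ltW.
rewrite ger0_norm ?mulr_ge0 ?exprn_ge0 ?invr_ge0 ?expR_ge0 ?(ltW u0)//.
have := @exp_decay m (1 - t ^+ 2)^-1; rewrite invr_gt0 => /(_ u0).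
by rewrite -exprVn invrK.
Qed.

Lemma bump_bounded Q m : exists K : R, forall t, `|bump Q m t| <= K.
Proof.
have [C C0 H] := bump_decay Q m; exists C => t; apply: le_trans (H t) _.
case: (ltrP `|t| 1) => t1; rewrite ?mulr0 ?mul0r// mulr1 ler_piMr//.
by rewrite exprn_ile1// ?(ltW (sqr_lt1 t1))// lerBlDr lerDl sqr_ge0.
Qed.

(** Isolated because of the truncated predecessor: for [m = 0] both sides vanish through the factor
    [m%:R]. *)
Lemma scale_pred_expr m (t Y : R) :
  (m%:R * Y ^+ m.-1) *: (2 * t * Y ^+ 2) = 2 * t * (m%:R * Y ^+ m.+1).
Proof.
case: m => [|m]; first by rewrite !mul0r scale0r mulr0.
have -> : Y ^+ m.+2 = Y ^+ m * Y ^+ 2 by rewrite -exprD addn2.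
rewrite [m.+1.-1]/=; move: (Y ^+ m) m.+1%:R => Z k.
by transitivity (k * Z * (2 * t * Y ^+ 2)); [by []|lra].
Qed.

Lemma is_derive_bump_in Q m t : `|t| < 1 ->
  is_derive t 1 (bump Q m) (bump (bump_deriv Q m) m.+2 t).
Proof.
move=> t1; have u0 := sqr_lt1 t1.
pose g : R -> R := fun s => 1 - s ^+ 2.
have gE : g = cst 1 - id ^+ 2 by apply/funext.
have dg : is_derive t 1 g (- (2 * t)).
  rewrite gE; apply: is_derive_eq.
  by rewrite sub0r /= expr1 scaler1.
have dy : is_derive t 1 (fun s => (g s)^-1) (2 * t * (g t)^-1 ^+ 2).
  apply: is_derive_eq; first by apply: is_deriveV => //; rewrite gt_eqF.
  transitivity (g t ^- 2 * (2 * t)); first exact: mulrNN.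
  by rewrite -exprVn mulrC.
pose y : R -> R := fun s => (g s)^-1.
have dE : is_derive t 1 (expR \o (- y)) (expR (- y t) * - (2 * t * y t ^+ 2)).
  by apply: is_derive1_comp.
have dQ := is_derive_poly Q t.
have dym : is_derive t 1 (y ^+ m) ((m%:R * y t ^+ m.-1) *: (2 * t * y t ^+ 2)).
  exact: is_deriveX.
have dall := is_deriveM (is_deriveM dQ dym) dE.
have near_t : \forall s \near t, (horner Q * y ^+ m * (expR \o - y)) s = bump Q m s.
  near=> s; suff s1 : `|s| < 1 by rewrite /bump s1 !fctE.
  near: s; have : open [set s : R | `|s| < 1].
    rewrite (_ : mkset _ = ball 0 1); first exact: ball_open.
    by apply/funext => s; rewrite /ball/= sub0r normrN.
  by move=> o; apply: open_nbhs_nbhs; split.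
have HQ : (bump_deriv Q m).[t] = Q^`().[t] * (g t * g t) +
    m%:R * 2 * (t * Q.[t] * g t) - 2 * (t * Q.[t]).
  by rewrite /bump_deriv !hornerE /g; lra.
refine (is_derive_eq (near_eq_is_derive near_t dall) _).
rewrite /bump t1 HQ !fctE -/(g t) -/(y t).
have uy : g t * y t = 1 by rewrite /y mulfV// gt_eqF.
set Y := y t; set E := expR _; set q := Q.[t]; set q' := _.[t].
have F2 : g t * Y ^+ m.+2 = Y ^+ m.+1 by rewrite [Y ^+ m.+2]exprS mulrA uy mul1r.
have F1 : g t * Y ^+ m.+1 = Y ^+ m by rewrite exprS mulrA uy mul1r.
have -> : (q' * (g t * g t) + m%:R * 2 * (t * q * g t) - 2 * (t * q)) * Y ^+ m.+2 * E =
  (q' * (g t * (g t * Y ^+ m.+2)) + m%:R * 2 * t * q * (g t * Y ^+ m.+2) - 2 * t * q * Y ^+ m.+2) * E.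
  lra.
rewrite F2 F1.
rewrite scale_pred_expr.
rewrite [Y ^+ m.+2]exprS [Y ^+ m.+1]exprS /GRing.scale /=; lra.
Unshelve. all: by end_near. Qed.

Lemma is_derive_bump_out Q m t : 1 < `|t| -> is_derive t 1 (bump Q m) 0.
Proof.
move=> t1; suff H : \forall s \near t, (cst 0 : R -> R) s = bump Q m s.
  exact: near_eq_is_derive H (is_derive_cst _ _ _).
near=> s; rewrite /bump ifF//; apply/negbTE; rewrite -leNgt ltW//.
near: s; have : open [set s : R | 1 < `|s|].
  apply: (@open_comp _ _ (fun x : R => `|x|) [set y | 1 < y]); last exact: open_gt.
  by move=> x _; exact: norm_continuous.
by move=> o; apply: open_nbhs_nbhs; split.
Unshelve. all: by end_near. Qed.

Lemma is_derive_bump_bd Q m t : `|t| = 1 -> is_derive t 1 (bump Q m) 0.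
Proof.
move=> t1; have [C C0 HC] := bump_decay Q m.
have b0 : bump Q m t = 0 by rewrite /bump t1 ltxx.
have cv : (fun h : R => h^-1 *: ((bump Q m \o shift t) (h *: 1) - bump Q m t)) @ 0^' --> (0 : R).
  apply/cvgrPdist_le => eps e0; near=> h.
  have h0 : h != 0 by near: h; exact: nbhs_dnbhs_neq.
  have h1 : `|h| <= 1 by near: h; apply: dnbhs0_le.
  have hC : `|h| <= eps / (9 * C + 1).
    by near: h; apply: dnbhs0_le; rewrite divr_gt0// ltr_wpDl// mulr_ge0.
  rewrite b0 subr0 sub0r normrN /= /shift [h *: 1]mulr1 [_ *: _]/(_ * _) normrM normfV.
  rewrite mulrC ler_pdivrMr ?normr_gt0//; apply: le_trans (HC _) _.
  (* Since [t^2 = 1], the inner expression is [- h (h + 2 t)], of absolute value at most [3 |h|]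
     when [|h| <= 1]. *)
  have hh : (1 - (h + t) ^+ 2) ^+ 2 <= 9 * h ^+ 2.
    have t2 : t ^+ 2 = 1 by rewrite -real_normK ?num_real// t1 expr1n.
    have -> : 1 - (h + t) ^+ 2 = - h * (h + 2 * t).
      have -> : (h + t) ^+ 2 = h ^+ 2 + 2 * h * t + t ^+ 2 by lra.
      by rewrite t2; lra.
    rewrite exprMn sqrrN mulrC ler_wpM2r ?sqr_ge0//.
    rewrite -real_normK ?num_real// (_ : 9 = 3 ^+ 2); last by lra.
    rewrite ler_pXn2r ?nnegrE// (le_trans (ler_normD _ _))// normrM t1.
    by rewrite [`|2|]ger0_norm//; lra.
  apply: (@le_trans _ _ (C * (9 * h ^+ 2))).
    rewrite -mulrA ler_wpM2l//; case: (_ < _); rewrite ?mul1r//.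
    by rewrite mul0r mulr_ge0// sqr_ge0.
  rewrite -real_normK ?num_real// expr2 !mulrA ler_wpM2r//.
  have H1 : (9 * C + 1) * `|h| <= eps by rewrite mulrC -ler_pdivlMr// ltr_wpDl// mulr_ge0.
  by apply: le_trans H1; rewrite ler_wpM2r//; lra.
apply: DeriveDef; first by apply/cvg_ex; eexists; exact: cv.
exact/cvg_lim.
Unshelve. all: by end_near. Qed.

Lemma is_derive_bump Q m t :
  is_derive t 1 (bump Q m) (bump (bump_deriv Q m) m.+2 t).
Proof.
case: (ltgtP `|t| 1) => t1; first exact: is_derive_bump_in.
- have -> : bump (bump_deriv Q m) m.+2 t = 0 by rewrite /bump ltNge ltW.
  exact: is_derive_bump_out.
- have -> : bump (bump_deriv Q m) m.+2 t = 0 by rewrite /bump t1 ltxx.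
  exact: is_derive_bump_bd.
Qed.

End bump.

Section tensor.
Context (R : realType) (n : nat).
Notation V := ('rV[R]_n).
Notation e i := (delta_mx ord0 i : V).

Definition tensor (F : 'I_n -> R -> R) (x : V) : R := \prod_i F i (x ord0 i).

Lemma is_derive_tensor (F : 'I_n -> R -> R) j (dF : R -> R) x :
  (forall t : R, is_derive t 1 (F j) (dF t)) ->
  is_derive x (e j) (tensor F) (tensor (fun i => if i == j then dF else F i) x).
Proof.
move=> dFj; apply/is_derive_line0.
pose c := \prod_(i | i != j) F i (x ord0 i).
have -> : (fun s : R => tensor F (s *: e j + x)) = (c \*: (F j \o shift (x ord0 j))).
  apply/funext => s; rewrite /tensor (bigD1 j)//= mulrC; congr (_ * _).
    apply: eq_bigr => i ij; rewrite !mxE eqxx (negbTE ij) mulr0 add0r//.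
  by rewrite !mxE !eqxx mulr1.
have -> : tensor (fun i => if i == j then dF else F i) x = c *: (dF (x ord0 j) * 1).
  transitivity (c * dF (x ord0 j)); last by rewrite mulr1.
  rewrite /tensor (bigD1 j)//= eqxx mulrC; congr (_ * _).
  by apply: eq_bigr => i /negbTE ->.
apply: is_deriveZ; apply: is_derive1_comp; first by rewrite /shift/= add0r; exact: dFj.
by rewrite -[X in is_derive _ _ _ X]addr0; apply: is_deriveD.
Qed.

(** A partial derivative of a product of one-variable functions is again such a product, with one
    factor differentiated. It is thus enough that each factor ranges over a family of bounded
    functions closed under derivatives. *)
Lemma tensor_bsmooth (P : 'I_n -> set (R -> R)) :
  (forall i f, P i f -> [/\ exists K : R, forall t, `|f t| <= K &
    exists2 df, P i df & forall t : R, is_derive t 1 f (df t)]) ->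
  forall F, (forall i, P i (F i)) -> bsmooth (tensor F).
Proof.
move=> HP F PF.
apply: (@bsmooth_coind _ _ [set f | exists2 G, (forall i, P i (G i)) & f = tensor G]); last by exists F.
move=> _ [G PG ->]; split.
- move=> x; apply: continuous_big; first exact: mul_continuous.
  move=> i _ {}x; apply: (@continuous_comp _ _ _ (fun z : V => z ord0 i) (G i)).
    exact: coord_continuous.
  have [_ [df _ /(_ (x ord0 i))[dG _]]] := HP _ _ (PG i).
  exact/differentiable_continuous/derivable1_diffP.
- move=> x i; have [_ [df _ dG]] := HP _ _ (PG i).
  by have [] := is_derive_tensor x dG.
- have H i : {K : R | forall t, `|G i t| <= K} by apply: cid; have [] := HP _ _ (PG i).
  exists (\prod_i sval (H i)) => x; rewrite normr_prod; apply: ler_prod => i _.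
  by rewrite normr_ge0 (svalP (H i)).
- move=> i; have [_ [df Pdf dG]] := HP _ _ (PG i).
  exists (fun j => if j == i then df else G j).
    by move=> j; case: eqP => [->|].
  by apply/funext => x; have [_] := is_derive_tensor x dG.
Qed.

End tensor.

Section mollifier.
Context (R : realType) (n : nat).
Notation X := (borel_rV R n).
Notation V := ('rV[R]_n).
Notation mu := (@borel_lebesgue R n).
Notation e i := (delta_mx ord0 i : V).
Implicit Types (c z : V) (a : R).

Definition scaled_bump (Q : {poly R}) m (c a t : R) : R := bump Q m ((t - c) / a).

Lemma is_derive_scaled_bump Q m (c a t : R) :
  is_derive t 1 (scaled_bump Q m c a) (scaled_bump (a^-1 *: bump_deriv Q m) m.+2 c a t).
Proof.
have -> : scaled_bump (a^-1 *: bump_deriv Q m) m.+2 c a t =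
    bump (bump_deriv Q m) m.+2 ((t - c) / a) * a^-1.
  rewrite /scaled_bump /bump; case: ifP => _; last by rewrite mul0r.
  by rewrite hornerZ -!mulrA [LHS]mulrC -!mulrA.
have -> : scaled_bump Q m c a = bump Q m \o (fun s => (s - c) / a) by [].
apply: is_derive1_comp; first exact: is_derive_bump.
have -> : (fun s => (s - c) / a) = (a^-1 \*: (id - cst c)).
  by apply/funext => s; rewrite mulrC.
by apply: is_derive_eq; rewrite subr0 [LHS]mulr1.
Qed.

Definition cube_bump c a : V -> R := tensor (fun i => scaled_bump 1 0 (c ord0 i) a).

Lemma scaled_bump_bounded Q m (c a : R) :
  exists K : R, forall t, `|scaled_bump Q m c a t| <= K.
Proof. by have [K HK] := bump_bounded Q m; exists K => t; exact: HK. Qed.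

Lemma cube_bump_bsmooth c a : bsmooth (cube_bump c a).
Proof.
apply: (@tensor_bsmooth _ _ (fun i => [set f | exists Q m, f = scaled_bump Q m (c ord0 i) a])).
  move=> i _ [Q [m ->]]; split; first exact: scaled_bump_bounded.
  exists (scaled_bump (a^-1 *: bump_deriv Q m) m.+2 (c ord0 i) a); first by eexists; eexists.
  by move=> t; exact: is_derive_scaled_bump.
by move=> i; exists 1, 0%N.
Qed.

Lemma bump10_ge0 (t : R) : 0 <= bump 1 0 t.
Proof. by rewrite /bump; case: ifP => // _; rewrite hornerC mul1r expr0 mul1r expR_ge0. Qed.

Lemma bump10_le1 (t : R) : bump 1 0 t <= 1.
Proof.
rewrite /bump; case: ifP => // t1; rewrite hornerC mul1r expr0 mul1r.
by rewrite expR_le1 oppr_le0 invr_ge0 ltW// sqr_lt1.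
Qed.

(** On this range [1 / (1 - t^2)] is at most 4/3, which is rounded up to 2. *)
Lemma bump10_ge (t : R) : `|t| <= 1 / 2 -> expR (- 2) <= bump 1 0 t.
Proof.
move=> t2; have t1 : `|t| < 1 by apply: le_lt_trans t2 _; lra.
rewrite /bump t1 hornerC mul1r expr0 mul1r ler_expR lerN2.
have : t ^+ 2 <= 1 / 4.
  rewrite -real_normK ?num_real// (_ : 1 / 4 = (1 / 2) ^+ 2); last by lra.
  by rewrite ler_pXn2r ?nnegrE//; lra.
move=> h; rewrite invf_ple ?posrE ?sqr_lt1//; lra.
Qed.

Lemma cube_bump_ge0 c a z : 0 <= cube_bump c a z.
Proof. by apply: prodr_ge0 => i _; exact: bump10_ge0. Qed.

Lemma cube_bump_le1 c a z : cube_bump c a z <= 1.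
Proof. by apply: prodr_ile1 => i _; rewrite bump10_ge0 bump10_le1. Qed.

Lemma cube_bump_neq0 c a z i : 0 < a -> cube_bump c a z != 0 ->
  `|z ord0 i - c ord0 i| < a.
Proof.
move=> a0; rewrite ltNge; apply: contra => za.
rewrite /cube_bump /tensor (bigD1 i)//= {1}/scaled_bump /bump ifF ?mul0r//.
by apply/negbTE; rewrite -leNgt normrM normfV (gtr0_norm a0) ler_pdivlMr// mul1r.
Qed.

Lemma cube_bump_ge c a z : 0 < a -> (forall i, `|z ord0 i - c ord0 i| <= a / 2) ->
  expR (- 2) ^+ n <= cube_bump c a z.
Proof.
move=> a0 H; rewrite -[X in _ ^+ X]card_ord -prodr_const; apply: ler_prod => i _.
rewrite expR_ge0 bump10_ge// normrM normfV (gtr0_norm a0) ler_pdivrMr//.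
by rewrite mul1r mulrC.
Qed.

Lemma cube_bump_integrable c a : 0 < a ->
  mu.-integrable setT (EFin \o (cube_bump c a : X -> R)).
Proof.
move=> a0; have Cb := bsmooth_C1b (cube_bump_bsmooth c a).
apply: (@bounded_on_integrable _ _ _ (ball c a : set X) 1).
- exact: C1b_measurable.
- exact: measurable_ball_rV.
- move=> x nx; apply/eqP/negPn/negP => /(cube_bump_neq0) H; apply: nx.
  by rewrite ball_box// => i; rewrite distrC; exact: H.
- by move=> x; rewrite ger0_norm ?cube_bump_le1 ?cube_bump_ge0.
- by rewrite [X in (X < _)%E](borel_lebesgue_ball c a0) ltry.
Qed.

Lemma cube_bump_integral c a : 0 < a ->
  (expR (- 2) * a) ^+ n <= \int[mu]_z cube_bump c a z.
Proof.
move=> a0; have Cb := bsmooth_C1b (cube_bump_bsmooth c a).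
set A : set X := ball c (a / 2).
have a2 : 0 < a / 2 by rewrite divr_gt0.
have mA : measurable A by exact: measurable_ball_rV.
rewrite /Rintegral -lee_fin fineK; last first.
  exact: integrable_fin_num (cube_bump_integrable c a0).
rewrite exprMn EFinM.
rewrite (_ : (a ^+ n)%:E = (\int[mu]_x (\1_A x)%:E)%E); last first.
  rewrite integral_indic// setIT [RHS](borel_lebesgue_ball c a2).
  by rewrite -[_ / _ *+ 2]mulr_natr divfK.
rewrite -ge0_integralZl//; last first.
  by apply/measurable_EFinP; exact: measurable_indic.
apply: ge0_le_integral => //.
- by apply/measurable_EFinP; apply: measurable_funM => //; exact: measurable_indic.
- by apply/measurable_EFinP; exact: C1b_measurable.
- move=> x _; rewrite -EFinM lee_fin indicE; have [Ax|nAx] := pselect (A x).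
    rewrite mem_set// mulr1 cube_bump_ge// => i; move: Ax; rewrite /A ball_box// => /(_ i)/ltW.
    by rewrite distrC.
  by rewrite memNset// mulr0 cube_bump_ge0.
Qed.

Lemma cube_bump_pderiv : exists2 K : R, 0 <= K & forall c a i z, 0 < a ->
  `|pderiv i (cube_bump c a) z| <= K / a.
Proof.
have [K HK] := bump_bounded (bump_deriv (1 : {poly R}) 0) 2.
have K0 : 0 <= K by apply: le_trans (HK 0).
exists K => // c a i z a0.
have := @is_derive_tensor R n (fun i => scaled_bump 1 0 (c ord0 i) a) i _ z
  (fun t => is_derive_scaled_bump 1 0 (c ord0 i) a t).
move=> [_ E]; rewrite /pderiv [X in `|X|]E.
rewrite /tensor (bigD1 i)//= eqxx normrM -[leRHS]mulr1 ler_pM//.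
  rewrite /scaled_bump /bump; case: ifP => t1; last by rewrite normr0 divr_ge0// ltW.
  have := HK ((z ord0 i - c ord0 i) / a); rewrite /bump t1.
  rewrite hornerZ -!mulrA => H; rewrite normrM (gtr0_norm (_ : 0 < a^-1)) ?invr_gt0//.
  by rewrite mulrC ler_wpM2r// invr_ge0 ltW.
rewrite normr_prod; apply: prodr_ile1 => j /negbTE ->.
by rewrite normr_ge0 ger0_norm ?bump10_le1 ?bump10_ge0.
Qed.

Lemma bsmoothZ (l : R) (u : V -> R) : bsmooth u -> bsmooth (fun x => l * u x).
Proof.
move=> bu; apply: (@bsmooth_coind _ _ [set f | exists2 g, bsmooth g & f = fun x => l * g x]).
  move=> _ [g bg ->]; have [c d [K HK]] := bg [::]; split.
  - by move=> x; apply: continuousM; [exact: cst_continuous|exact: c].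
  - by move=> x i; exact: derivableZ (d x i).
  - by exists (`|l| * K) => x; rewrite normrM ler_wpM2l.
  - move=> i; exists (pderiv i g); first exact: bsmooth_pderiv.
    by apply/funext => x; exact: deriveZ (d x i).
by exists u.
Qed.

(** A normalised kernel at scale [a] around [c]. One constant [C], chosen before [c] and [a], serves
    for all kernels; this uniformity is what yields estimates independent of the scale. *)
Record mollifier (C : R) (c : V) (a : R) (k : V -> R) : Prop := Mollifier {
  mollifier_smooth : bsmooth k ;
  mollifier_ge0 : forall z, 0 <= k z ;
  mollifier_supp : forall z i, k z != 0 -> `|z ord0 i - c ord0 i| < a ;
  mollifier_int : (\int[mu]_z (k z)%:E = 1)%E ;
  mollifier_le : forall z, k z <= C * a ^- n ;
  mollifier_pderiv : forall i z, `|pderiv i k z| <= C * a ^- n / a }.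

Lemma mollifier_exists : exists2 C : R, 0 < C &
  forall c a, 0 < a -> exists k, mollifier C c a k.
Proof.
have [K K0 HK] := cube_bump_pderiv.
have E0 : 0 < expR (- 2) ^+ n :> R by rewrite exprn_gt0// expR_gt0.
(* The denominator comes from the lower bound of the integral; [K + 1] dominates both 1, for the
   size of the kernel, and [K], for its derivatives. *)
exists ((K + 1) / expR (- 2) ^+ n); first by rewrite divr_gt0// ltr_wpDl.
move=> c a a0; pose I := \int[mu]_z cube_bump c a z.
have an0 : 0 < a ^+ n by rewrite exprn_gt0.
have I1 : expR (- 2) ^+ n * a ^+ n <= I by rewrite -exprMn; exact: cube_bump_integral.
have I0 : 0 < I by apply: lt_le_trans I1; rewrite mulr_gt0.
have Iinv : I^-1 <= (expR (- 2) ^+ n)^-1 * a ^- n.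
  by rewrite -invfM lef_pV2// posrE// mulr_gt0.
have bb := cube_bump_bsmooth c a.
exists (fun z => I^-1 * cube_bump c a z); split.
- exact: bsmoothZ.
- by move=> z; rewrite mulr_ge0 ?cube_bump_ge0 ?invr_ge0 ?ltW.
- by move=> z i; rewrite mulf_eq0 negb_or => /andP[_]; exact: cube_bump_neq0.
- under eq_integral do rewrite EFinM.
  rewrite ge0_integralZl//; last 3 first.
  + by apply/measurable_EFinP; apply: C1b_measurable; exact: bsmooth_C1b.
  + by move=> z _; rewrite lee_fin cube_bump_ge0.
  + by rewrite lee_fin invr_ge0 ltW.
  rewrite -(fineK (integrable_fin_num measurableT (cube_bump_integrable c a0))).
  by rewrite -EFinM mulVf// gt_eqF.
- move=> z; apply: (@le_trans _ _ (I^-1 * 1)).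
    by rewrite ler_wpM2l ?cube_bump_le1 ?invr_ge0 ?ltW.
  rewrite mulr1; apply: le_trans Iinv _; rewrite ler_wpM2r ?invr_ge0 ?(ltW an0)//.
  by rewrite ler_peMl ?lerDr// invr_ge0 ltW.
- move=> i z; have [_ d _] := bb [::].
  rewrite (_ : pderiv i _ z = I^-1 * pderiv i (cube_bump c a) z); last exact: deriveZ (d z i).
  rewrite normrM ger0_norm ?invr_ge0 ?(ltW I0)//.
  apply: (@le_trans _ _ (((expR (- 2) ^+ n)^-1 * a ^- n) * (K / a))).
    by apply: ler_pM => //; [rewrite invr_ge0 ltW|exact: HK].
  have P0 : 0 <= (expR (- 2) ^+ n)^-1 * a ^- n / a.
    by rewrite !mulr_ge0// invr_ge0 ltW.
  have : K * ((expR (- 2) ^+ n)^-1 * a ^- n / a) <= (K + 1) * ((expR (- 2) ^+ n)^-1 * a ^- n / a).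
    by rewrite ler_wpM2r// lerDl.
  by rewrite !mulrA ![_ * K]mulrC !mulrA.
Qed.

End mollifier.

(** * Mollification in L1 and the fundamental lemma of the calculus of variations *)

Section mollification_L1.
Context (R : realType) (n : nat).
Notation X := (borel_rV R n).
Notation V := ('rV[R]_n).
Notation mu := (@borel_lebesgue R n).
Local Notation e i := (delta_mx ord0 i : V).
Implicit Types (u v k : V -> R).

Lemma mollifier_integrable (C : R) (c : V) (a : R) k : mollifier C c a k ->
  mu.-integrable setT (EFin \o (k : X -> R)).
Proof.
move=> [sk k0 _ ki _ _]; apply/integrable_L1norm; split.
  by apply: C1b_measurable; exact: bsmooth_C1b.
rewrite /L1norm; under eq_integral do rewrite ger0_norm//.
by rewrite ki ltry.
Qed.

Lemma mollE k v x : C1b k -> mu.-integrable setT (EFin \o (v : X -> R)) ->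
  moll k v x = \int[mu]_z (k z * v (x + (z : V))).
Proof.
move=> Ck /integrable_L1norm[mv _].
rewrite /moll -[RHS](@Rintegral_shift _ _ (- x)
  (fun z : X => k z * v (x + (z : V)))).
  by apply: eq_Rintegral => y _; rewrite addrCA subrr addr0.
apply: measurable_funM; first exact: C1b_measurable.
rewrite (_ : (fun _ => _) = (fun z : X => v ((z : V) + x))).
  exact: measurable_shiftf.
by apply/funext => z; rewrite addrC.
Qed.

(** The kernel is a probability density, so [moll k v x - v x] is an average of [v (x + z) - v x];
    Tonelli turns its L1 norm into an average of L1 norms of shifted differences, with [z] in the
    support of [k]. *)
Lemma moll_L1_le v (C : R) (c : V) (a eps : R) k :
  mu.-integrable setT (EFin \o (v : X -> R)) -> mollifier C c a k -> 0 <= eps ->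
  (forall h : V, (forall i, `|h ord0 i - c ord0 i| < a) ->
    (L1norm mu (fun x : X => v ((x : V) + h) - v x)%R <= eps%:E)%E) ->
  (L1norm mu (fun x : X => moll k v x - v x)%R <= eps%:E)%E.
Proof.
move=> iv mk e0 Heps; have ik := mollifier_integrable mk.
have [sk k0 ks ki _ _] := mk; have Ck := bsmooth_C1b sk.
have [ck _ _ [K [K1 _]]] := Ck.
have /integrable_L1norm[mv _] := iv; have mk' := C1b_measurable Ck.
pose F (p : X * X) : \bar R := (k p.2 * `|v ((p.1 : V) + p.2) - v p.1|)%:E.
have mF : measurable_fun setT F.
  apply/measurable_EFinP; apply: measurable_funM; first exact: measurableT_comp.
  apply: measurableT_comp => //; apply: measurable_funB; last exact: measurableT_comp.
  exact: (measurableT_comp mv (@measurable_add2 R n)).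
have F0 p : (0 <= F p)%E by rewrite lee_fin mulr_ge0.
have ivs x : mu.-integrable setT (EFin \o (fun z : X => v (x + (z : V)))).
  have := integrable_shift x iv; apply: eq_integrable => // z _.
  by rewrite /= [x + _]addrC.
have ptw (x : X) : ((`|moll k v x - v x|)%:E <= \int[mu]_z F (x, z))%E.
  rewrite mollE//.
  have i1 : mu.-integrable setT (EFin \o (fun z : X => k z * v ((x : V) + z))).
    exact: (integrable_bounded_mul mk' K1 (ivs x)).
  have i2 : mu.-integrable setT (EFin \o (fun z : X => v x * k z)) by exact: integrable_mulr.
  have -> : v x = \int[mu]_z (v x * k z).
    by rewrite RintegralZl// /Rintegral ki /= mulr1.
  rewrite -RintegralB//.
  apply: le_trans (normr_Rintegral_L1norm (integrable_subr i1 i2)) _.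
  rewrite le_eqVlt; apply/orP; left; apply/eqP; apply: eq_integral => z _.
  by rewrite [v x * _]mulrC -mulrBr normrM ger0_norm.
apply: (@le_trans _ _ (\int[mu]_x \int[mu]_z F (x, z))%E).
  apply: ge0_le_integral => //.
  - apply: measurable_normE; apply: measurable_funB => //.
    by apply: C1b_measurable; apply: bsmooth_C1b; exact: moll_bsmooth.
  - exact: (measurable_fun_fubini_tonelli_F (m2 := mu) F mF F0).
rewrite fubini_tonelli//.
apply: (@le_trans _ _ (\int[mu]_z (eps%:E * (k z)%:E))%E); last first.
  rewrite ge0_integralZl//; first by rewrite ki mule1.
  - by apply/measurable_EFinP.
  - by move=> z _; rewrite lee_fin.
apply: ge0_le_integral => //.
- by move=> z _; apply: integral_ge0.
- exact: (measurable_fun_fubini_tonelli_G (m1 := mu) F mF F0).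
- by apply/measurable_EFinP; apply: measurable_funM.
- move=> z _; rewrite /F /=.
  under eq_integral do rewrite EFinM.
  have mz : measurable_fun setT (fun x : X => v ((x : V) + z) - v x).
    by apply: measurable_funB => //; exact: measurable_shiftf.
  rewrite ge0_integralZl//; [|exact: measurable_normE|by rewrite lee_fin].
  rewrite muleC; have [->|kz] := eqVneq (k z) 0; first by rewrite !mule0.
  by apply: lee_wpmul2r; [rewrite lee_fin|apply: Heps => i; exact: ks].
Qed.

Lemma moll_L1_near v (eps : R) : mu.-integrable setT (EFin \o (v : X -> R)) ->
  0 < eps -> exists2 d : R, 0 < d & forall (C : R) c a k, mollifier C c a k ->
    (forall i, `|c ord0 i| + a <= d) ->
    (L1norm mu (fun x : X => moll k v x - v x)%R <= eps%:E)%E.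
Proof.
move=> iv e0; have [d d0 Hd] := integrable_translation_continuous iv e0.
exists d => // C c a k mk ca; apply: (moll_L1_le iv mk (ltW e0)) => h ha.
apply: Hd => i; apply: lt_le_trans (ca i).
rewrite -[h ord0 i](subrK (c ord0 i)) addrC (le_lt_trans (ler_normD _ _))//.
by rewrite ltrD2l.
Qed.

Lemma pderiv_shift i u (h x : V) : (forall y, derivable u y (e i)) ->
  is_derive x (e i) (fun y => u (y + h)) (pderiv i u (x + h)).
Proof.
move=> du; apply/is_derive_line0.
have -> : (fun s : R => u (s *: e i + x + h)) = (fun s : R => u (s *: e i + (x + h))).
  by apply/funext => s; rewrite addrA.
by apply/is_derive_line0; exact: is_derive_pderiv.
Qed.

Lemma bsmooth_shift u (h : V) : bsmooth u -> bsmooth (fun y => u (y + h)).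
Proof.
move=> bu; apply: (@bsmooth_coind _ _ [set f | exists2 g, bsmooth g & f = fun y => g (y + h)]).
  move=> _ [g bg ->]; have [c d [K HK]] := bg [::]; split.
  - suff H : forall x : V, {for x, continuous (fun y : V => g (y + h))} by exact: H.
    move=> x; rewrite (continuous_shift (fun y : V => g (y + h)) x).
    have -> : (fun y : V => g (y + h)) \o shift x = g \o shift (x + h).
      by apply/funext => y; rewrite /= /shift addrA.
    by rewrite -(continuous_shift g); exact: c.
  - by move=> x i; have [] := pderiv_shift h x (d^~ i).
  - by exists K => x; exact: HK.
  - move=> i; exists (pderiv i g); first exact: bsmooth_pderiv.
    by apply/funext => x; have [_] := pderiv_shift h x (d^~ i).
by exists u.
Qed.

Lemma pderiv_shiftE i u (h x : V) : bsmooth u ->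
  pderiv i (fun y => u (y + h)) x = pderiv i u (x + h).
Proof. by move=> /(_ [::])[_ d _]; have [_] := pderiv_shift h x (d^~ i). Qed.

Lemma closed_cube (x : V) (r : R) : closed [set y : V | forall i, `|y ord0 i - x ord0 i| <= r].
Proof.
rewrite (_ : mkset _ = \bigcap_i [set y : V | `|y ord0 i - x ord0 i| <= r]).
  apply: closed_bigI => i _.
  apply: (@closed_comp _ _ (fun y : V => `|y ord0 i - x ord0 i|) [set z | z <= r]); last exact: closed_le.
  move=> y _; apply: (@continuous_comp _ _ _ (fun y : V => y ord0 i - x ord0 i) (fun z : R => `|z|)); last exact: norm_continuous.
  by apply: continuousB; [exact: coord_continuous|exact: cst_continuous].
by apply/seteqP; split => [y /= H i _|y H i]; [exact: H|exact: (H i I)].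
Qed.

Lemma compact_cube (x : V) (r : R) : compact [set y : V | forall i, `|y ord0 i - x ord0 i| <= r].
Proof.
have -> : [set y : V | forall i, `|y ord0 i - x ord0 i| <= r] =
   [set y : V | forall i, `[x ord0 i - r, x ord0 i + r]%classic (y ord0 i)].
  by apply/seteqP; split => y H i; have := H i; rewrite /= in_itv/= ler_distl.
apply: (@rV_compact _ _ (fun i => `[x ord0 i - r, x ord0 i + r]%classic)) => i.
exact: segment_compact.
Qed.

Lemma mollifier_Cc_infty (D : set V) (C : R) (c : V) (a : R) k (x : V) :
  mollifier C c a k ->
  (forall y : V, (forall i, `|y ord0 i - x ord0 i - c ord0 i| <= a) -> D y) ->
  Cc_infty D (fun y => k (y - x)).
Proof.
move=> mk HD; have [sk k0 ks ki _ _] := mk.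
have sub : closure [set y | k (y - x) != 0] `<=`
    [set y : V | forall i, `|y ord0 i - (x + c) ord0 i| <= a].
  rewrite [X in _ `<=` X](proj1 (closure_id _) (@closed_cube (x + c) a)).
  apply: closureS => y /= /ks H i; have := H i.
  by rewrite !mxE opprD addrA => /ltW.
split.
- by apply: bsmooth_smooth; exact: (bsmooth_shift (- x)).
- apply: subclosed_compact sub; [exact: closed_closure|exact: compact_cube].
- by move=> y /sub H; apply: HD => i; have := H i; rewrite mxE opprD addrA.
Qed.

(** At a point of an inner core a small translated kernel is a test function, so the mollification
    of [g] vanishes there while being L1-close to [g]. Inner cores then exhaust [D]. *)
Lemma integral_mul_Cc_infty_eq0 (D : set V) (g : X -> R) : open D ->
  mu.-integrable setT (EFin \o g) ->
  (forall phi, Cc_infty D phi -> \int[mu]_x (g x * phi x) = 0) ->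
  L1norm mu (fun x => g x * \1_(D : set X) x) = 0%E.
Proof.
move=> oD ig H; have mD := open_borel oD.
have [C C0 moll_ex] := mollifier_exists R n.
have /integrable_L1norm[mg _] := ig.
have core r : 0 < r ->
    L1norm mu (fun x => g x * \1_(inner_core D r : set X) x) = 0%E.
  move=> r0; apply/eqP; rewrite eq_le L1norm_ge0 andbT; apply/lee_addgt0Pr => eps e0.
  rewrite add0e; have [d d0 Hd] := moll_L1_near ig e0.
  pose a := Num.min d (r / 2).
  have a0 : 0 < a by rewrite lt_min d0 divr_gt0.
  have [k mk] := moll_ex 0 _ a0.
  have /(Hd _ _ _ _ mk) : forall i, `|(0 : V) ord0 i| + a <= d.
    by move=> i; rewrite mxE normr0 add0r ge_min lexx.
  have [sk _ _ _ _ _] := mk.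
  apply: le_trans; apply: L1norm_le.
  - by apply: measurable_funM => //; apply: measurable_indic; exact: measurable_inner_core.
  - apply: measurable_funB => //; apply: C1b_measurable; apply: bsmooth_C1b.
    exact: moll_bsmooth.
  - move=> x; rewrite indicE; have [Dx|nDx] := pselect (inner_core D r x); last first.
      by rewrite memNset// mulr0 normr0.
    rewrite mem_set// mulr1 (_ : moll k g x = 0) ?sub0r ?normrN//.
    rewrite /moll -[RHS](H (fun y => k (y - x))).
      by apply: eq_Rintegral => y _; rewrite mulrC.
    apply: (mollifier_Cc_infty mk) => y Hy; apply: contrapT => nDy; apply: Dx.
    exists y => //; rewrite ball_box// => i; have := Hy i; rewrite mxE subr0.
    move=> /le_lt_trans; apply; rewrite gt_min; apply/orP; right; lra.
apply/eqP; rewrite eq_le L1norm_ge0 andbT; apply/lee_addgt0Pr => eps e0.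
rewrite add0e.
have igD : mu.-integrable setT (EFin \o (fun x => g x * \1_(D : set X) x)).
  apply: (@eq_integrable _ _ _ mu setT measurableT (EFin \o (fun x => \1_(D : set X) x * g x))).
    by move=> x _; rewrite /= mulrC.
  apply: (@integrable_bounded_mul _ _ _ _ 1) => //.
  by move=> x; rewrite ger0_norm// indicE; case: (x \in _).
have mI (m : nat) : measurable (inner_core D m.+1%:R^-1 `|` ~` D : set X).
  by apply: measurableU; [exact: measurable_inner_core|exact: measurableC].
have := L1norm_tail e0 igD mI; case.
  move=> x; have [Dx|nDx] := pselect (D x); last by near=> m; right.
  have /nbhs_ballP[r /= r0 rD] := open_nbhs_nbhs (conj oD Dx).
  near=> m; left; move=> [y nDy yx]; apply: nDy; apply: rD; apply: ball_sym.
  apply: le_ball yx; rewrite invf_ple ?posrE//.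
  rewrite (@le_trans _ _ m%:R) ?ler_nat//.
  by near: m; exact: nbhs_infty_ger.
move=> m _ /(_ m (leqnn m)) Hk.
have c0 := core m.+1%:R^-1 _; rewrite invr_gt0 ltr0Sn in c0.
rewrite -[leRHS]add0e -(c0 isT); apply: le_trans (leeD (lexx _) Hk).
apply: L1norm_triangle.
- by apply: measurable_funM => //; apply: measurable_indic; exact: measurable_inner_core.
- by apply: measurable_funM; [apply: measurable_funM => //; exact: measurable_indic|apply: measurable_indic; exact: measurableC].
- by apply: measurable_funM => //; exact: measurable_indic.
- move=> x; rewrite !indicE !in_setC in_setU !in_setC.
  case: (x \in D) => /=; last by rewrite mulr0 normr0 addr_ge0.
  by case: (x \in _); rewrite /= ?(mulr0, mulr1, normr0, addr0, add0r).
Unshelve. all: by end_near. Qed.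

End mollification_L1.

(** * Weak derivatives *)

Section trig_lipschitz.
Context (R : realType).
Implicit Types x y : R.

Lemma sin_lipschitz x y : `|sin x - sin y| <= `|x - y|.
Proof.
have [c _ ->] := @MVT_between R sin cos y x (fun t => is_derive_sin t).
by rewrite normrM ler_piMl// cos_max.
Qed.

Lemma cos_lipschitz x y : `|cos x - cos y| <= `|x - y|.
Proof.
have [c _ ->] := @MVT_between R cos (fun t => - sin t) y x (fun t => is_derive_cos t).
by rewrite normrM normrN ler_piMl// sin_max.
Qed.

End trig_lipschitz.

Section weak_derivatives.
Context (R : realType) (n : nat).
Notation X := (borel_rV R n).
Notation V := ('rV[R]_n).
Notation mu := (@borel_lebesgue R n).
Local Notation e i := (delta_mx ord0 i : V).
Implicit Types (u v k : V -> R) (G : 'I_n -> V -> R).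

(* The weak gradient on the whole space, tested against all C1 functions with
   bounded derivatives: this is how the zero extension of a function with
   vanishing trace on a bounded set behaves. *)
Definition wdiff v G := [/\ mu.-integrable setT (EFin \o (v : X -> R)),
  forall i, mu.-integrable setT (EFin \o (G i : X -> R)) &
  forall phi i, C1b phi -> \int[mu]_x (v x * pderiv i phi x) =
    - \int[mu]_x (G i x * phi x)].

(** The translated kernel is tested against [v] wherever its support lies. This is possible because
    [wdiff] admits all [C1b] functions and not only those supported in a domain. *)
Lemma wdiff_moll v G k i x : wdiff v G -> bsmooth k ->
  pderiv i (moll k v) x = moll k (G i) x.
Proof.
move=> [iv iG H] bk; have [_ E] := moll_pderiv i x bk iv.
rewrite /pderiv [LHS]E.
have bk' := bsmooth_shift (- x) bk.
have := H _ i (bsmooth_C1b bk').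
rewrite (@eq_Rintegral _ _ _ _ _ (fun y : X => v y * pderiv i k ((y : V) - x))); last first.
  by move=> y _; rewrite (pderiv_shiftE _ _ _ bk).
move=> H'; rewrite /moll; transitivity (- \int[mu]_y (v y * pderiv i k ((y : V) - x))).
  have Ck := bsmooth_C1b (bsmooth_pderiv i bk).
  have [ck _ _ [K [K1 _]]] := Ck.
  have : mu.-integrable setT (EFin \o (fun y : X => pderiv i k ((y : V) - x) * v y)).
    exact: (integrable_bounded_mul (measurable_reflect x ck) (fun y => K1 _) iv).
  move=> /(RintegralZl (-1) measurableT).
  rewrite mulN1r => E1; rewrite (@eq_Rintegral _ _ _ _ _ (fun y : X => -1 * (pderiv i k ((y : V) - x) * v y))).
    by rewrite E1; congr (- _); apply: eq_Rintegral => y _; rewrite mulrC.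
  by move=> y _; rewrite mulN1r mulNr.
by rewrite H' opprK; apply: eq_Rintegral => y _; rewrite mulrC.
Qed.

Lemma wdiffM v G u : wdiff v G -> C1b u ->
  wdiff (fun x => u x * v x) (fun i x => u x * G i x + pderiv i u x * v x).
Proof.
move=> [iv iG H] Cu; have [cu du cdu [K [K1 K2]]] := Cu.
have mu0 := C1b_measurable Cu; have mdu i := pderiv_measurable i Cu.
have i1 i : mu.-integrable setT (EFin \o (fun x : X => u x * G i x)).
  exact: (integrable_bounded_mul mu0 K1 (iG i)).
have i2 i : mu.-integrable setT (EFin \o (fun x : X => pderiv i u x * v x)).
  exact: (integrable_bounded_mul (mdu i) (K2 i) iv).
split.
- exact: (integrable_bounded_mul mu0 K1 iv).
- by move=> i; exact: integrable_addr.
- move=> phi i Cphi; have [Cuphi E] := C1bM Cu Cphi.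
  have [_ _ _ [L [L1 L2]]] := Cphi.
  have mphi := C1b_measurable Cphi; have mdphi := pderiv_measurable i Cphi.
  have j1 : mu.-integrable setT (EFin \o (fun x : X => phi x * (u x * G i x))).
    exact: (integrable_bounded_mul mphi L1 (i1 i)).
  have j2 : mu.-integrable setT (EFin \o (fun x : X => phi x * (pderiv i u x * v x))).
    exact: (integrable_bounded_mul mphi L1 (i2 i)).
  have j3 : mu.-integrable setT (EFin \o (fun x : X => u x * v x)).
    exact: (integrable_bounded_mul mu0 K1 iv).
  have j4 : mu.-integrable setT (EFin \o (fun x : X => pderiv i phi x * (u x * v x))).
    exact: (integrable_bounded_mul mdphi (L2 i) j3).
  have := H _ i Cuphi.
  rewrite (@eq_Rintegral _ _ _ _ _ (fun x : X => pderiv i phi x * (u x * v x) + phi x * (pderiv i u x * v x))); last first.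
    by move=> x _; rewrite E; lra.
  rewrite RintegralD// => H1.
  rewrite [LHS](@eq_Rintegral _ _ _ _ _ (fun x : X => pderiv i phi x * (u x * v x))); last first.
    by move=> x _; rewrite mulrC.
  rewrite [in RHS](@eq_Rintegral _ _ _ _ _ (fun x : X => phi x * (u x * G i x) + phi x * (pderiv i u x * v x))); last first.
    by move=> x _; lra.
  rewrite RintegralD// opprD.
  have E3 : \int[mu]_x (G i x * (u x * phi x)) = \int[mu]_x (phi x * (u x * G i x)).
    by apply: eq_Rintegral => x _; lra.
  by move: H1; rewrite E3; lra.
Qed.

Lemma C1b_sin (K0 : R) u : 0 < K0 -> C1b u ->
  C1b (fun x => K0 * sin (u x / K0)) /\
  forall i x, pderiv i (fun x => K0 * sin (u x / K0)) x = cos (u x / K0) * pderiv i u x.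
Proof.
move=> K00 [cu du cdu [K [K1 K2]]].
have D i x : is_derive x (e i) (fun x => K0 * sin (u x / K0)) (cos (u x / K0) * pderiv i u x).
  apply/is_derive_line0.
  have du0 := (is_derive_line0 _ _ _ _).2 (is_derive_pderiv (du x i)).
  set w := fun s : R => u (s *: e i + x) in du0 *.
  have -> : (fun s => K0 * sin (w s / K0)) = (K0 \*: (sin \o (K0^-1 \*: w))).
    by apply/funext => s; rewrite /= [w s / K0]mulrC.
  have w0 : w 0 = u x by rewrite /w scale0r add0r.
  have dw := is_deriveZ K0^-1 du0.
  refine (is_derive_eq (is_deriveZ K0 (is_derive1_comp (is_derive_sin _) dw)) _).
  rewrite /= w0 [K0^-1 *: u x]mulrC.
  change (K0 * (cos (u x / K0) * (K0^-1 * pderiv i u x)) = cos (u x / K0) * pderiv i u x).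
  rewrite mulrCA; congr (_ * _).
  by rewrite mulrA mulfV ?mul1r// gt_eqF.
have E i x : pderiv i (fun x => K0 * sin (u x / K0)) x = cos (u x / K0) * pderiv i u x.
  by have [_] := D i x.
have E' i : pderiv i (fun x => K0 * sin (u x / K0)) = (fun x => cos (u x / K0) * pderiv i u x).
  by apply/funext => x; exact: E.
have cuK : continuous (fun x => u x / K0).
  by move=> x; exact: (cvgM (cu x) (cvg_cst _)).
split; [split|exact: E].
- move=> x; have cs : continuous (sin \o (fun x => u x / K0)).
    by move=> z; apply: continuous_comp; [exact: cuK|exact: continuous_sin].
  exact: (cvgM (cvg_cst K0) (cs x)).
- by move=> x i; have [] := D i x.
- move=> i; rewrite E' => x; have cs : continuous (cos \o (fun x => u x / K0)).
    by move=> z; apply: continuous_comp; [exact: cuK|exact: continuous_cos].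
  exact: (cvgM (cs x) (cdu i x)).
- exists (Num.max K0 K); split=> [x|i x]; rewrite le_max.
    by rewrite normrM (gtr0_norm K00) ler_piMr ?(ltW K00)// sin_max.
  apply/orP; right; rewrite E normrM; apply: le_trans (K2 i x).
  by rewrite ler_piMl// cos_max.
Qed.

Lemma moll_zero_outside (C a r : R) k v : mollifier C 0 a k ->
  mu.-integrable setT (EFin \o (v : X -> R)) -> 0 < a ->
  (forall x, ~ ball 0 r x -> v x = 0) -> forall x, ~ ball 0 (r + a) x -> moll k v x = 0.
Proof.
move=> mk iv a0 vr x nx; have [sk _ ks _ _ _] := mk.
rewrite /moll /Rintegral integral0_eq// => y _; congr EFin.
have [->|kz] := eqVneq (k ((y : V) - x)) 0; first by rewrite mul0r.
rewrite vr ?mulr0// => yr; apply: nx; apply: ball_triangle yr _.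
apply: ball_sym; rewrite ball_box// => i; have := ks _ i kz.
by rewrite !mxE subr0 distrC.
Qed.

(** For the mollified [v] this is the classical chain rule and integration by parts. In the limit,
    the difference of cosines times [G i] is controlled by the Lipschitz bound where [|G i| <= m],
    and by the L1 tail of [G i] elsewhere. *)
Lemma wdiff_sin (K0 : R) v G : 0 < K0 -> wdiff v G -> bsupp v ->
  wdiff (fun x => K0 * sin (v x / K0)) (fun i x => cos (v x / K0) * G i x).
Proof.
move=> K00 wv [r r0 vr]; have [iv iG H] := wv.
have /integrable_L1norm[mv voo] := iv.
have mvK : measurable_fun setT (fun x : X => v x / K0) by exact: measurable_funM.
have msin : measurable_fun setT (fun x : X => K0 * sin (v x / K0)).
  apply: measurable_funM => //; apply: measurableT_comp mvK.
  exact: continuous_measurable_fun (@continuous_sin R).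
have mcos : measurable_fun setT (fun x : X => cos (v x / K0)).
  apply: measurableT_comp mvK.
  exact: continuous_measurable_fun (@continuous_cos R).
have sin_le (x : R) : `|K0 * sin (x / K0)| <= `|x|.
  have := sin_lipschitz (x / K0) 0; rewrite sin0 !subr0 !normrM normfV (gtr0_norm K00).
  by rewrite ler_pdivlMr// mulrC.
have is_ : mu.-integrable setT (EFin \o (fun x : X => K0 * sin (v x / K0))).
  apply/integrable_L1norm; split=> //; apply: le_lt_trans voo.
  by apply: L1norm_le => // x; exact: sin_le.
have ic i : mu.-integrable setT (EFin \o (fun x : X => cos (v x / K0) * G i x)).
  by apply: (integrable_bounded_mul mcos _ (iG i)) => x; exact: cos_max.
split=> // phi i Cphi.
have [_ _ _ [L0 [L01 L02]]] := Cphi.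
pose L := L0 + 1.
have L00 : 0 <= L0 by apply: le_trans (L01 0).
have Lp : 0 < L by rewrite ltr_wpDl.
have L1 x : `|phi x| <= L by rewrite (le_trans (L01 x))// lerDl.
have L2 x : `|pderiv i phi x| <= L by rewrite (le_trans (L02 i x))// lerDl.
have mphi := C1b_measurable Cphi; have mdphi := pderiv_measurable i Cphi.
apply/eqP; rewrite -subr_eq0 opprK -normr_le0; apply/ler_addgt0Pr => eps0 e00.
(* The functions contribute one [eps] and the gradients four, each multiplied by the bound [L] on
   the test function and its derivative. *)
rewrite add0r; pose eps := eps0 / (L * 5).
have e0 : 0 < eps by rewrite divr_gt0// mulr_gt0.
have /integrable_L1norm[mG _] := iG i.
pose A m : set X := [set x | `|G i x| <= m%:R].
have mA m : measurable (A m).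
  have mN : measurable_fun setT (fun x : X => `|G i x|) by exact: measurableT_comp.
  have -> : A m = setT `&` (fun x : X => `|G i x|) @^-1` `]-oo, m%:R].
    by rewrite setTI; apply/seteqP; split=> x /=; rewrite /A/= in_itv.
  by apply: mN => //; exact: measurable_itv.
have := L1norm_tail e0 (iG i) mA; case.
  by move=> x; near=> m; near: m; exact: nbhs_infty_ger.
move=> m _ /(_ m (leqnn m)) Hm.
(* On the set where [|G i| <= m], the Lipschitz bound for the cosine multiplies the L1 error of [v]
   by [m / K0]. *)
pose eps' := eps / (1 + m%:R / K0).
have d1 : 0 < 1 + m%:R / K0 by rewrite ltr_pwDl// divr_ge0// ltW.
have e'0 : 0 < eps' by rewrite divr_gt0.
have e'e : eps' <= eps by rewrite ler_pdivrMr// ler_peMr ?(ltW e0)// lerDl divr_ge0// ltW.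
have [d dd Hd] := moll_L1_near iv e'0; have [d' dd' Hd'] := moll_L1_near (iG i) e'0.
pose a := Num.min d d'; have a0 : 0 < a by rewrite lt_min dd.
have [C C0 moll_ex] := mollifier_exists R n.
have [k mk] := moll_ex 0 _ a0; have [sk _ _ _ _ _] := mk.
have {}Hd : (L1norm mu (fun x : X => moll k v x - v x)%R <= eps'%:E)%E.
  by apply: (Hd _ _ _ _ mk) => j; rewrite mxE normr0 add0r ge_min lexx.
have {}Hd' : (L1norm mu (fun x : X => moll k (G i) x - G i x)%R <= eps'%:E)%E.
  by apply: (Hd' _ _ _ _ mk) => j; rewrite mxE normr0 add0r ge_min lexx orbT.
have bvk := moll_bsmooth sk iv; have Cvk := bsmooth_C1b bvk.
have bGk := moll_bsmooth sk (iG i); have CGk := bsmooth_C1b bGk.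
have [Cs Es] := C1b_sin K00 Cvk.
have vk0 := moll_zero_outside mk iv a0 vr.
have bs : bsupp (fun x => K0 * sin (moll k v x / K0)).
  by exists (r + a); [rewrite addr_gt0|move=> x /vk0 ->; rewrite mul0r sin0 mulr0].
have := Rintegral_by_parts i Cs bs Cphi.
rewrite [in RHS](@eq_Rintegral _ _ _ _ _ (fun x : X => cos (moll k v x / K0) * moll k (G i) x * phi x)); last first.
  by move=> x _; rewrite Es (wdiff_moll i x wv sk).
have mvk := C1b_measurable Cvk; have mGk := C1b_measurable CGk.
pose uk x := K0 * sin (moll k v x / K0); pose Hk x := cos (moll k v x / K0) * moll k (G i) x.
have muk : measurable_fun setT (uk : X -> R) by exact: C1b_measurable.
have mck : measurable_fun setT (fun x : X => cos (moll k v x / K0)).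
  apply: (measurableT_comp (continuous_measurable_fun (@continuous_cos R))).
  exact: measurable_funM.
have iuk : mu.-integrable setT (EFin \o (uk : X -> R)) by exact: C1b_integrable.
have iGk : mu.-integrable setT (EFin \o (moll k (G i) : X -> R)).
  have idf : mu.-integrable setT (EFin \o (fun x : X => moll k (G i) x - G i x)).
    by apply/integrable_L1norm; split; [exact: measurable_funB|exact: le_lt_trans Hd' (ltry _)].
  by apply: eq_integrable (integrable_addr idf (iG i)) => // x _; rewrite /= subrK.
have iHk : mu.-integrable setT (EFin \o (Hk : X -> R)).
  by apply: (integrable_bounded_mul mck _ iGk) => x; exact: cos_max.
pose u x := K0 * sin (v x / K0); pose Hi x := cos (v x / K0) * G i x.
rewrite -/(u) => E0.
have E1 : \int[mu]_x (u x * pderiv i phi x) = \int[mu]_x (uk x * pderiv i phi x) +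
    \int[mu]_x (pderiv i phi x * (u x - uk x)).
  rewrite -RintegralD//.
  - apply: eq_Rintegral => x _.
    by rewrite mulrBr [_ * uk x]mulrC addrC subrK mulrC.
  - apply: eq_integrable (integrable_bounded_mul mdphi L2 iuk) => // x _.
    by rewrite /= mulrC.
  - exact: (integrable_bounded_mul mdphi L2 (integrable_subr is_ iuk)).
have E2 : \int[mu]_x (Hi x * phi x) = \int[mu]_x (Hk x * phi x) +
    \int[mu]_x (phi x * (Hi x - Hk x)).
  rewrite -RintegralD//.
  - apply: eq_Rintegral => x _.
    by rewrite mulrBr [_ * Hk x]mulrC addrC subrK mulrC.
  - apply: eq_integrable (integrable_bounded_mul mphi L1 iHk) => // x _.
    by rewrite /= mulrC.
  - exact: (integrable_bounded_mul mphi L1 (integrable_subr (ic i) iHk)).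
rewrite E1 E2 -/uk in E0 *.
have N1 := normr_Rintegral_mul mdphi L2 (integrable_subr is_ iuk).
have N2 := normr_Rintegral_mul mphi L1 (integrable_subr (ic i) iHk).
have B1 : fine (L1norm mu (fun x : X => u x - uk x)%R) <= eps.
  rewrite -lee_fin fineK.
    apply: le_trans (le_trans Hd _); last by rewrite lee_fin.
    apply: L1norm_le; [exact: measurable_funB|exact: measurable_funB|].
    move=> x; rewrite /u /uk -mulrBr normrM gtr0_norm// mulrC -ler_pdivlMr//.
    apply: le_trans (sin_lipschitz _ _) _.
    by rewrite -mulrBl normrM normfV (gtr0_norm K00) distrC.
  have /integrable_L1norm[_] := integrable_subr is_ iuk.
  by rewrite ge0_fin_numE// L1norm_ge0.
have B2 : fine (L1norm mu (fun x : X => Hi x - Hk x)%R) <= eps * 4.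
  rewrite -lee_fin fineK; last first.
    have /integrable_L1norm[_] := integrable_subr (ic i) iHk.
    by rewrite ge0_fin_numE// L1norm_ge0.
  have mB : measurable_fun setT (fun x : X => G i x * \1_(~` A m) x).
    by apply: measurable_funM => //; apply: measurable_indic; exact: measurableC.
  have mvv : measurable_fun setT (fun x : X => moll k v x - v x) by exact: measurable_funB.
  have mGG : measurable_fun setT (fun x : X => moll k (G i) x - G i x) by exact: measurable_funB.
  have step : (L1norm mu (fun x : X => Hi x - Hk x)%R <=
    L1norm mu (fun x : X => moll k (G i) x - G i x)%R +
    (L1norm mu (fun x : X => m%:R / K0 * (moll k v x - v x))%R +
     L1norm mu (fun x : X => 2 * (G i x * \1_(~` A m) x))%R))%E.
    apply: (@le_trans _ _ (L1norm mu (fun x : X => moll k (G i) x - G i x)%R +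
       L1norm mu (fun x : X => (cos (moll k v x / K0) - cos (v x / K0)) * G i x)%R)%E).
      apply: L1norm_triangle => //.
      + by apply: measurable_funM => //; exact: measurable_funB.
      + apply: measurable_funB; first exact: measurable_funM.
        exact: measurable_funM.
      + move=> x; rewrite (_ : Hi x - Hk x = - (cos (moll k v x / K0) * (moll k (G i) x - G i x) +
          (cos (moll k v x / K0) - cos (v x / K0)) * G i x)); last by rewrite /Hi /Hk; clear; lra.
        rewrite normrN; apply: le_trans (ler_normD _ _) _; rewrite lerD2r normrM ler_piMl//.
        exact: cos_max.
    apply: leeD => //; apply: L1norm_triangle.
    + exact: measurable_funM.
    + exact: measurable_funM.
    + by apply: measurable_funM => //; exact: measurable_funB.
    + move=> x; rewrite indicE in_setC; have [Ax|nAx] := pselect (A m x).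
        rewrite (mem_set Ax) /= !mulr0 normr0 addr0 !normrM.
        rewrite [`|m%:R|]ger0_norm// mulrC -!mulrA ler_pM//.
        apply: le_trans (cos_lipschitz _ _) _.
        by rewrite -mulrBl normrM mulrC.
      rewrite (memNset nAx) /= !mulr1; apply: (@le_trans _ _ `|2 * G i x|); last by rewrite lerDr.
      rewrite !normrM ler_wpM2r// (le_trans (ler_normB _ _))// [`|2|]ger0_norm//.
      have := cos_max (moll k v x / K0); have := cos_max (v x / K0); clear; lra.
  apply: (le_trans step).
  have mK0 : 0 <= m%:R / K0 by rewrite divr_ge0// ltW.
  have N2p : 0 <= 2 :> R by [].
  rewrite (L1normZ _ _ mvv) (L1normZ _ _ mB) (ger0_norm mK0) (ger0_norm N2p).
  have -> : eps * 4 = eps + (eps + 2 * eps) by clear; lra.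
  rewrite !(EFinD eps); apply: leeD; first by apply: le_trans Hd' _; rewrite lee_fin.
  apply: leeD.
    apply: (@le_trans _ _ ((m%:R / K0)%:E * eps'%:E)%E).
      by apply: lee_wpmul2l => //; rewrite lee_fin divr_ge0// ltW.
    rewrite -EFinM lee_fin /eps' mulrA ler_pdivrMr// mulrC ler_wpM2l ?(ltW e0)//.
    by rewrite lerDr.
  by rewrite EFinM; apply: lee_wpmul2l.
have P1 : L * fine (L1norm mu (fun x : X => u x - uk x)%R) <= L * eps by rewrite ler_wpM2l// ltW.
have P2 : L * fine (L1norm mu (fun x : X => Hi x - Hk x)%R) <= L * (eps * 4) by rewrite ler_wpM2l// ltW.
rewrite (_ : eps0 = L * eps + L * (eps * 4)); last first.
  have := mulfVK (lt0r_neq0 (mulr_gt0 Lp (ltr0n R 5))) eps0; rewrite -/eps.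
  by move=> H5; rewrite -[LHS]H5 /eps; clear; lra.
apply: le_trans (lerD (le_trans N1 P1) (le_trans N2 P2)).
rewrite E0 addrACA addNr add0r; exact: ler_normD.
Unshelve. all: by end_near. Qed.

End weak_derivatives.

(** * Muckenhoupt weights and averages over cubes *)

Section powR_convexity.
Context (R : realType).
Implicit Types x y h m r l : R.

(** The convex function [h^r] lies above its tangent at [m]. This is Young's inequality with
    exponents [r] and [r / (r - 1)], and it underlies both convexity and Jensen's inequality
    here. *)
Lemma powR_tangent h m r : 0 <= h -> 0 <= m -> 1 <= r ->
  r * m `^ (r - 1) * h <= h `^ r + (r - 1) * m `^ r.
Proof.
move=> h0 m0; rewrite le_eqVlt => /predU1P[<-|r1].
  by rewrite subrr powRr0 !mul1r mul0r addr0 powRr1.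
have r0 : 0 < r by apply: lt_trans r1.
have q0 : 0 < r / (r - 1) by rewrite divr_gt0// subr_gt0.
have rn0 : r != 0 by rewrite gt_eqF.
have r1n0 : r - 1 != 0 by rewrite gt_eqF// subr_gt0.
have := conjugate_powR h0 (powR_ge0 m (r - 1)) r0 q0.
rewrite -powRrM mulrCA mulfV// mulr1 invf_div => H.
have {}H := H _; rewrite -(ler_pM2l r0) in H.
rewrite -mulrA [_ `^ _ * h]mulrC; apply: le_trans (H _) _.
  by rewrite -{1}[r^-1]mul1r -mulrDl addrC subrK mulfV.
by rewrite mulrDr mulrCA mulfV// mulr1 [_ `^ _ * (_ / _)]mulrA mulrCA mulfV// mulr1 [_ * (r - 1)]mulrC.
Qed.

(** Convexity for [x + y = (1 - l) (x / (1 - l)) + l (y / l)], through the tangent at [x + y]. For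
    small [l] the first factor is close to 1, which keeps the sharp constant in front of the energy
    being approximated. *)
Lemma powR_split l x y r : 0 < l < 1 -> 0 <= x -> 0 <= y -> 1 <= r ->
  (x + y) `^ r <= (1 - l) `^ (1 - r) * x `^ r + l `^ (1 - r) * y `^ r.
Proof.
move=> /andP[l0 l1] x0 y0 r1; have m0 : 0 <= x + y by rewrite addr_ge0.
have l1' : 0 < 1 - l by rewrite subr_gt0.
have a0 : 0 <= x / (1 - l) by rewrite divr_ge0// ltW.
have b0 : 0 <= y / l by rewrite divr_ge0// ltW.
have E (s z : R) : 0 < s -> 0 <= z -> s `^ (1 - r) * z `^ r = s * (z / s) `^ r.
  move=> s0 z0; rewrite powRM// ?invr_ge0 ?ltW// -[s^-1]powR_inv1 ?ltW//.
  rewrite -powRrM mulN1r powRD ?(gt_eqF s0) ?implybT// powRr1 ?ltW//.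
  by rewrite mulrA mulrAC.
rewrite !E//.
have H1 := powR_tangent a0 m0 r1; have H2 := powR_tangent b0 m0 r1.
rewrite -(ler_pM2l l1') in H1; rewrite -(ler_pM2l l0) in H2.
have := lerD H1 H2.
set A := _ `^ r; set B := (y / l) `^ r; set T := r * _.
have -> : (1 - l) * (T * (x / (1 - l))) + l * (T * (y / l)) = T * (x + y).
  have d1 : (1 - l) * (x / (1 - l)) = x by rewrite mulrC divfK// gt_eqF.
  have d2 : l * (y / l) = y by rewrite mulrC divfK// gt_eqF.
  by rewrite mulrCA d1 mulrCA d2 mulrDr.
rewrite /T -mulrA [_ `^ _ * _]mulrC mulr_powRB1 ?(lt_le_trans _ r1)//.
lra.
Qed.

Lemma powR_add_le x y r : 0 <= x -> 0 <= y -> 1 <= r ->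
  (x + y) `^ r <= 2 `^ (r - 1) * (x `^ r + y `^ r).
Proof.
move=> x0 y0 r1; have h : 0 < (2^-1 : R) < 1 by lra.
have -> : 2 `^ (r - 1) = 2^-1 `^ (1 - r) :> R.
  by rewrite -[2^-1]powR_inv1// -powRrM mulN1r opprB.
have := powR_split h x0 y0 r1; rewrite (_ : 1 - 2^-1 = 2^-1 :> R); last by lra.
by rewrite mulrDr.
Qed.

End powR_convexity.

Section jensen.
Context d (T : measurableType d) (R : realType).
Variable mu : {measure set T -> \bar R}.

(** Jensen's inequality for the measure with density [k] and mass at most [M]: the tangent
    inequality at [I / M] is integrated against [k]. The right-hand side may be infinite. *)
Lemma L1norm_jensen (h k : T -> R) (r M : R) : 1 <= r -> 0 < M ->
  measurable_fun setT h -> measurable_fun setT k ->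
  (forall x, 0 <= h x) -> (forall x, 0 <= k x) ->
  (L1norm mu k <= M%:E)%E -> (L1norm mu (fun x => h x * k x)%R < +oo)%E ->
  ((fine (L1norm mu (fun x => h x * k x)%R) `^ r)%:E <=
   (M `^ (r - 1))%:E * L1norm mu (fun x => h x `^ r * k x)%R)%E.
Proof.
move=> r1 M0 mh mk h0 k0 kM hkoo.
have rgt0 : 0 < r by apply: lt_le_trans r1.
set I := fine _; have IE : L1norm mu (fun x => h x * k x) = I%:E.
  by rewrite fineK// ge0_fin_numE// L1norm_ge0.
have I0 : 0 <= I by rewrite fine_ge0// L1norm_ge0.
have mhr : measurable_fun setT (fun x => h x `^ r * k x).
  by apply: measurable_funM => //; exact: (measurableT_comp (measurable_powR _)).
have [Joo|Joo] := leP +oo%E (L1norm mu (fun x => h x `^ r * k x)).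
  move: Joo; rewrite leye_eq => /eqP ->.
  by rewrite gt0_muley ?leey// lte_fin powR_gt0.
have JE : L1norm mu (fun x => h x `^ r * k x) = (fine (L1norm mu (fun x => h x `^ r * k x)))%:E.
  by rewrite fineK// ge0_fin_numE// L1norm_ge0.
set J := fine _ in JE; rewrite JE -EFinM lee_fin.
have J0 : 0 <= J by rewrite fine_ge0// L1norm_ge0.
pose m := I / M; have m0 : 0 <= m by rewrite divr_ge0// ltW.
have IM : I = m * M by rewrite mulfVK// gt_eqF.
have rm0 : 0 <= r * m `^ (r - 1) by rewrite mulr_ge0 ?powR_ge0// ltW.
have r1m : 0 <= (r - 1) * m `^ r by rewrite mulr_ge0 ?powR_ge0// subr_ge0.
have mhk : measurable_fun setT (fun x => h x * k x) by exact: measurable_funM.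
have : (L1norm mu (fun x => (r * m `^ (r - 1)) * (h x * k x))%R <=
    L1norm mu (fun x => h x `^ r * k x)%R + L1norm mu (fun x => ((r - 1) * m `^ r) * k x)%R)%E.
  apply: L1norm_triangle => //; [exact: measurable_funM|exact: measurable_funM|] => x.
  rewrite !ger0_norm ?mulr_ge0 ?powR_ge0 ?subr_ge0 ?(ltW rgt0)//.
  by rewrite mulrA -mulrDl ler_wpM2r// powR_tangent.
rewrite L1normZ// L1normZ// !ger0_norm// IE JE -EFinM => H.
have : ((r * m `^ (r - 1) * I)%:E <= (J + (r - 1) * m `^ r * M)%:E)%E.
  apply: le_trans H _; rewrite EFinD leeD2l// [leRHS]EFinM; apply: lee_wpmul2l => //.
rewrite lee_fin {1}IM mulrA -[r * _ * m]mulrA [_ `^ _ * m]mulrC mulr_powRB1// => H1.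
have {}H1 : m `^ r * M <= J by move: H1; lra.
rewrite IM powRM ?(ltW M0)// -(mulr_powRB1 (ltW M0) rgt0) mulrA mulrC.
by rewrite ler_wpM2l// powR_ge0.
Qed.

End jensen.

Section cube_integral.
Context (R : realType) (n : nat).
Notation X := (borel_rV R n).
Notation V := ('rV[R]_n).
Notation mu := (@borel_lebesgue R n).
Implicit Types (f g w : X -> R) (x y : X) (r rho : R).

Lemma measurable_L1norm2 (F : X * X -> R) : measurable_fun setT F ->
  measurable_fun setT (fun x => L1norm mu (fun y => F (x, y))).
Proof.
move=> mF; have mF' : measurable_fun setT (fun z : X * X => (`|F z|)%:E).
  by apply/measurable_EFinP; exact: measurableT_comp.
exact: (measurable_fun_fubini_tonelli_F (m2 := mu) _ mF' (fun z => normr_ge0 _)).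
Qed.

(** Tonelli in the form of a Schur test: a kernel whose integral in one variable dominates [f] and
    in the other is dominated by [g]. *)
Lemma L1norm_fubini_le (F : X * X -> R) f g : measurable_fun setT F ->
  measurable_fun setT f -> measurable_fun setT g ->
  (forall x, ((`|f x|)%:E <= L1norm mu (fun y => F (x, y)))%E) ->
  (forall y, (L1norm mu (fun x => F (x, y)) <= (`|g y|)%:E)%E) ->
  (L1norm mu f <= L1norm mu g)%E.
Proof.
move=> mF mf mg Hf Hg.
pose F' (z : X * X) := (`|F z|)%:E.
have mF' : measurable_fun setT F' by apply/measurable_EFinP; exact: measurableT_comp.
have F0 z : (0 <= F' z)%E by rewrite lee_fin.
apply: (@le_trans _ _ (\int[mu]_x \int[mu]_y F' (x, y))%E).
  apply: ge0_le_integral => //; first exact: measurable_normE.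
  exact: (measurable_fun_fubini_tonelli_F (m2 := mu) F' mF' F0).
rewrite fubini_tonelli//; apply: ge0_le_integral => //.
- by move=> y _; apply: integral_ge0.
- exact: (measurable_fun_fubini_tonelli_G (m1 := mu) F' mF' F0).
- exact: measurable_normE.
- by move=> y _; exact: Hg.
Qed.

(** Unnormalised integral of [|f|] over a cube. [fine] would send an infinite value to 0, so uses of
    it as an integral go through [cube_intE] or [cube_int_boundedE], which supply finiteness. *)
Definition cube_int rho f x : R :=
  fine (L1norm mu (fun y : X => \1_(ball (0 : V) rho : set X) ((y : V) - x) * f y)).

Lemma measurable_cube_ind rho : measurable_fun setT
  (fun z : X * X => \1_(ball (0 : V) rho : set X) ((z.2 : V) - z.1) : R).
Proof.
apply: measurableT_comp (@measurable_sub2 R n).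
by apply: measurable_indic; exact: measurable_ball_rV.
Qed.

Lemma measurable_cube_ind1 rho x : measurable_fun setT
  (fun y : X => \1_(ball (0 : V) rho : set X) ((y : V) - x) : R).
Proof.
apply: (measurable_shiftf (- x) (f := \1_(ball (0 : V) rho : set X))).
by apply: measurable_indic; exact: measurable_ball_rV.
Qed.

Lemma cube_ind_ge0 rho (z : X) : 0 <= \1_(ball (0 : V) rho : set X) z :> R.
Proof. by rewrite indicE. Qed.

Lemma cube_indE rho (z : V) : 0 < rho ->
  \1_(ball (0 : V) rho : set X) z = [forall i, `|z ord0 i| < rho]%:R :> R.
Proof.
move=> r0; rewrite indicE; congr (_ %:R); congr nat_of_bool; apply/idP/forallP.
  by move/set_mem; rewrite ball_box// => H i; have := H i; rewrite mxE sub0r normrN.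
by move=> H; apply/mem_set; rewrite ball_box// => i; rewrite mxE sub0r normrN; exact: H.
Qed.

Lemma measurable_cube_int rho f : measurable_fun setT f ->
  measurable_fun setT (cube_int rho f).
Proof.
move=> mf; apply: measurableT_comp => //.
apply: (@measurable_L1norm2 (fun z : X * X =>
  \1_(ball (0 : V) rho : set X) ((z.2 : V) - z.1) * f z.2)).
by apply: measurable_funM; [exact: measurable_cube_ind|exact: measurableT_comp].
Qed.

Lemma cube_int_ge0 rho f x : 0 <= cube_int rho f x.
Proof. by rewrite fine_ge0// L1norm_ge0. Qed.

Lemma cube_int_le_vol rho f x (M : R) : 0 < rho -> measurable_fun setT f ->
  (forall y, `|f y| <= M) ->
  (L1norm mu (fun y : X => \1_(ball (0 : V) rho : set X) ((y : V) - x) * f y)%R <=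
   (M * (rho *+ 2) ^+ n)%:E)%E.
Proof.
move=> r0 mf fM; rewrite EFinM -(borel_lebesgue_ball x r0).
apply: L1norm_bounded_on; last 1 first.
- move=> y; rewrite normrM ger0_norm ?cube_ind_ge0// (le_trans _ (fM y))//.
  by rewrite ler_piMl// indicE; case: (_ \in _).
- by apply: measurable_funM => //; exact: measurable_cube_ind1.
- exact: measurable_ball_rV.
- move=> y nxy; rewrite indicE memNset ?mul0r// => H; apply: nxy; move: H.
  by rewrite !ball_box// => H i; have := H i; rewrite /rV_coord !mxE sub0r normrN distrC.
Qed.

Lemma cube_intE rho f x : mu.-integrable setT (EFin \o f) ->
  L1norm mu (fun y : X => \1_(ball (0 : V) rho : set X) ((y : V) - x) * f y) =
  (cube_int rho f x)%:E.
Proof.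
move=> /integrable_L1norm[mf foo]; rewrite fineK// ge0_fin_numE ?L1norm_ge0//.
apply: le_lt_trans foo; apply: L1norm_le => //.
  by apply: measurable_funM => //; exact: measurable_cube_ind1.
by move=> y; rewrite normrM ger0_norm ?cube_ind_ge0// ler_piMl// indicE; case: (_ \in _).
Qed.

Lemma cube_int_boundedE rho f x (M : R) : 0 < rho -> measurable_fun setT f ->
  (forall y, `|f y| <= M) ->
  L1norm mu (fun y : X => \1_(ball (0 : V) rho : set X) ((y : V) - x) * f y) =
  (cube_int rho f x)%:E.
Proof.
move=> r0 mf fM; rewrite fineK// ge0_fin_numE ?L1norm_ge0//.
exact: le_lt_trans (cube_int_le_vol x r0 mf fM) (ltry _).
Qed.

End cube_integral.

Section muckenhoupt_average.
Context (R : realType) (n : nat).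
Notation X := (borel_rV R n).
Notation V := ('rV[R]_n).
Notation mu := (@borel_lebesgue R n).
Variables (D : set V) (w : X -> R) (q A rho0 M : R).
Hypotheses (oD : open D) (mw : measurable_fun setT w) (w0 : forall x, 0 <= w x).
Hypotheses (wM : forall x, D x -> w x <= M) (q1 : 1 < q) (A0 : 0 < A).
Let s := (q - 1)^-1.
Notation indD := (\1_(D : set X) : X -> R).

(** Adding [eps] keeps the negative power in the dual weight finite where [w] vanishes; the factor
    [indD] restricts all integrals to [D], since cubes around points of [D] may leave it. *)
Definition regular_weight (eps : R) (x : X) := indD x * (w x + eps).
Definition dual_regular_weight (eps : R) (x : X) := indD x * (w x + eps) `^ (- s).

(** The [A_q] inequality over small cubes, uniform in [eps]. The integrals are not averaged, whence
    the power of [rho ^+ n] on the right. *)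
Definition cube_muckenhoupt := forall eps x rho, 0 < eps -> eps <= 1 -> D x ->
  0 < rho -> rho < rho0 -> cube_int rho (regular_weight eps) x *
  cube_int rho (dual_regular_weight eps) x `^ (q - 1) <= A * (rho ^+ n) `^ q.

Hypothesis wA : cube_muckenhoupt.

Let mD : measurable_fun setT indD.
Proof. by apply: measurable_indic; exact: open_borel. Qed.

Lemma measurable_regular_weight eps : measurable_fun setT (regular_weight eps).
Proof. by apply: measurable_funM => //; exact: measurable_funD. Qed.

Lemma measurable_dual_regular_weight eps : measurable_fun setT (dual_regular_weight eps).
Proof.
apply: measurable_funM => //; apply: (measurableT_comp (measurable_powR _)).
exact: measurable_funD.
Qed.

Lemma regular_weight_le eps x : 0 < eps -> `|regular_weight eps x| <= `|M| + eps.
Proof.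
move=> e0; rewrite /regular_weight indicE; have [Dx|nDx] := pselect (D x).
  rewrite mem_set// mul1r ger0_norm ?addr_ge0 ?(ltW e0)// lerD2r.
  by apply: le_trans (wM Dx) (ler_norm _).
by rewrite memNset// mul0r normr0 addr_ge0// ltW.
Qed.

Lemma dual_regular_weight_le eps x : 0 < eps -> `|dual_regular_weight eps x| <= eps `^ (- s).
Proof.
move=> e0; rewrite ger0_norm ?mulr_ge0 ?powR_ge0//.
rewrite (@le_trans _ _ ((w x + eps) `^ (- s)))//.
  by rewrite ler_piMl ?powR_ge0// indicE; case: (_ \in _).
have s0 : 0 <= s by rewrite invr_ge0 subr_ge0 ltW.
rewrite !powRN lef_pV2 ?posrE ?powR_gt0 ?ltr_wpDl//.
by rewrite ge0_ler_powR ?nnegrE ?(ltW e0) ?addr_ge0 ?(ltW e0)// lerDr.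
Qed.

(** Jensen's inequality needs a positive mass. Around [x] there is a small cube inside [D] on which
    [w] is bounded, so the dual weight is bounded below. *)
Lemma dual_cube_int_gt0 eps rho x : 0 < eps -> 0 < rho -> D x ->
  0 < cube_int rho (dual_regular_weight eps) x.
Proof.
move=> e0 rho_gt0 Dx.
have /nbhs_ballP[r /= r0 rD] := open_nbhs_nbhs (conj oD Dx).
pose r' := Num.min r rho; have r'0 : 0 < r' by rewrite lt_min r0.
have mk := measurable_dual_regular_weight eps.
rewrite -lte_fin -(cube_int_boundedE x rho_gt0 mk (fun y => dual_regular_weight_le y e0)).
have K0 : 0 < (`|M| + eps) `^ (- s) by rewrite powR_gt0// ltr_wpDl.
apply: (@lt_le_trans _ _ (L1norm mu (fun y : X => (`|M| + eps) `^ (- s) * \1_(ball x r' : set X) y))).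
  rewrite L1normZ; last by apply: measurable_indic; exact: measurable_ball_rV.
  rewrite mule_gt0 ?lte_fin ?normr_gt0 ?gt_eqF//.
  rewrite /L1norm; under eq_integral do rewrite ger0_norm ?indicE//.
  rewrite integral_indic//; last exact: measurable_ball_rV.
  have E := borel_lebesgue_ball x r'0.
  by rewrite setIT [X in (0 < X)%E]E lte_fin exprn_gt0// mulrn_wgt0.
apply: L1norm_le.
- by apply: measurable_funM => //; apply: measurable_indic; exact: measurable_ball_rV.
- by apply: measurable_funM => //; exact: measurable_cube_ind1.
- move=> y; rewrite [X in `|_ * X|]indicE; have [xy|nxy] := pselect (ball x r' y); last first.
    by rewrite memNset// mulr0 normr0.
  have Dy : D y by apply: rD; apply: le_ball xy; rewrite ge_min lexx.
  rewrite mem_set// mulr1 (_ : \1__ _ = 1) ?mul1r; last first.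
    rewrite cube_indE// (_ : [forall _, _])//; apply/forallP => i.
    move: xy; rewrite ball_box// => /(_ i); rewrite !mxE distrC => /lt_le_trans; apply.
    by rewrite ge_min lexx orbT.
  rewrite /dual_regular_weight indicE mem_set// mul1r.
  rewrite [X in X <= _]ger0_norm ?powR_ge0// [X in _ <= X]ger0_norm ?powR_ge0//.
  have s0 : 0 <= s by rewrite invr_ge0 subr_ge0 ltW.
  rewrite !powRN lef_pV2 ?posrE ?powR_gt0 ?ltr_wpDl//.
  rewrite ge0_ler_powR ?nnegrE ?addr_ge0 ?(ltW e0)// lerD2r.
  by apply: le_trans (wM Dy) (ler_norm _).
Qed.

(** Hoelder against the dual weight bounds the q-th power of the integral over the cube at [x] by
    [kap x ^ (q - 1)] times the integral of [f^q (w + eps)]. After exchanging the order of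
    integration, the [A_q] inequality at [y] with radius [2 rho] absorbs the weights. *)
Lemma cube_average_weight_bounded eps rho (f : X -> R) (B : R) :
  0 < eps -> eps <= 1 -> 0 < rho -> rho *+ 2 < rho0 ->
  measurable_fun setT f -> (forall x, 0 <= f x <= B) -> (forall x, ~ D x -> f x = 0) ->
  (L1norm mu (fun x => regular_weight eps x * cube_int rho f x `^ q)%R <=
   (A * ((rho *+ 2) ^+ n) `^ q)%:E * L1norm mu (fun x => f x `^ q * (w x + eps))%R)%E.
Proof.
move=> e0 e1 rho_gt0 rho_lt mf fB fD.
have q0 : 0 < q by apply: lt_trans q1.
have f0 x : 0 <= f x by have /andP[] := fB x.
have W0 x : 0 < w x + eps by rewrite ltr_wpDl.
have mW : measurable_fun setT (fun x => w x + eps) by exact: measurable_funD.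
have mk := measurable_dual_regular_weight eps.
have mr := measurable_regular_weight eps.
pose kap := cube_int rho (dual_regular_weight eps).
have mkap : measurable_fun setT kap by exact: measurable_cube_int.
have fB' y : `|f y| <= B by rewrite ger0_norm//; have /andP[] := fB y.
have mfq : measurable_fun setT (fun y => f y `^ q).
  exact: (measurableT_comp (measurable_powR _)).
pose c2 := A * ((rho *+ 2) ^+ n) `^ q.
have c20 : 0 <= c2 by rewrite mulr_ge0 ?powR_ge0// ltW.
pose F (z : X * X) := (regular_weight eps z.1 * kap z.1 `^ (q - 1)) *
   (\1_(ball (0 : V) rho : set X) ((z.2 : V) - z.1) * (f z.2 `^ q * (w z.2 + eps))).
rewrite -/c2 -(ger0_norm c20) -L1normZ; last exact: measurable_funM.
have scale (a b c : R) (L : \bar R) : 0 <= a -> 0 <= b -> 0 <= c -> (b%:E <= c%:E * L)%E ->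
    ((`|a * b|)%:E <= (`|a * c|)%:E * L)%E.
  move=> a0 b0 c0 H; rewrite !ger0_norm ?mulr_ge0// !EFinM -muleA.
  by apply: lee_wpmul2l.
have degenerate (b : R) (L : \bar R) : (0 <= L)%E -> ((`|0 * b|)%:E <= L)%E.
  by rewrite mul0r normr0.
have conclude (a b c d : R) : 0 <= a -> 0 <= b -> 0 <= c -> 0 <= d -> c * b <= d ->
    ((`|a * b|)%:E * c%:E <= (`|d * a|)%:E)%E.
  move=> a0 b0 c0 d0 H; rewrite !ger0_norm ?mulr_ge0// -EFinM lee_fin -mulrA mulrC.
  by rewrite ler_wpM2r// mulrC.
have le_of_ereal (u v : \bar R) (a b : R) : u = a%:E -> v = b%:E -> (u <= v)%E -> a <= b.
  by move=> -> ->; rewrite lee_fin.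
have compare (a b c c2' h1 h2 : R) : 0 <= a -> 0 <= b -> 0 <= c -> 0 <= c2' -> 0 <= h2 ->
    (h1 = 0 \/ [/\ h1 = 1, h2 = 1 & c <= c2']) ->
    `|a * c `^ (q - 1) * (h1 * b)| <= `|(b * c2' `^ (q - 1)) * (h2 * a)|.
  move=> a0 b0 c0 c20' h20 [->|[-> -> cc]]; first by rewrite mul0r mulr0 normr0.
  rewrite !mul1r !ger0_norm ?mulr_ge0 ?powR_ge0// -mulrA mulrC ler_wpM2r//.
  by rewrite mulrC ler_wpM2l// ge0_ler_powR ?nnegrE// subr_ge0 ltW.
apply: (@L1norm_fubini_le _ _ F).
- apply: measurable_funM; first apply: measurable_funM.
  + exact: (measurableT_comp mr).
  + apply: (measurableT_comp (measurable_powR _)).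
    exact: (measurableT_comp mkap).
  + apply: measurable_funM; first exact: measurable_cube_ind.
    apply: measurable_funM; first exact: (measurableT_comp mfq).
    exact: (measurableT_comp mW).
- apply: measurable_funM => //; apply: (measurableT_comp (measurable_powR _)).
  exact: measurable_cube_int.
- by do 2! apply: measurable_funM => //.
- move=> x; rewrite /F /=.
  have [Dx|nDx] := pselect (D x); last first.
    have -> : regular_weight eps x = 0 by rewrite /regular_weight indicE memNset// mul0r.
    by apply: degenerate; exact: L1norm_ge0.
  have mi := measurable_cube_ind1 rho x.
  have mrest : measurable_fun setT (fun y : X => \1_(ball (0 : V) rho : set X) ((y : V) - x) * (f y `^ q * (w y + eps))).
    by do 2! apply: measurable_funM => //.
  rewrite (L1normZ mu _ mrest).
  have kap0 : 0 < kap x by exact: dual_cube_int_gt0.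
  (* On [D], [f = h (w + eps)^(- s)]: Jensen is applied to [h] for the measure whose density is the
     dual weight. Since [s q - s = 1], the integrand [h^q] turns back into [f^q (w + eps)]. *)
  pose h (y : X) := f y * (w y + eps) `^ s.
  pose k (y : X) := \1_(ball (0 : V) rho : set X) ((y : V) - x) * dual_regular_weight eps y.
  have mh : measurable_fun setT h.
    by apply: measurable_funM => //; exact: (measurableT_comp (measurable_powR _)).
  have mk' : measurable_fun setT k by exact: measurable_funM.
  have h0 y : 0 <= h y by rewrite mulr_ge0// powR_ge0.
  have k0 y : 0 <= k y by rewrite !mulr_ge0// ?powR_ge0// cube_ind_ge0.
  have kE : L1norm mu k = (kap x)%:E.
    by apply: cube_int_boundedE => //; exact: (fun y => dual_regular_weight_le y e0).
  have hkE : (fun y => h y * k y) = (fun y => \1_(ball (0 : V) rho : set X) ((y : V) - x) * f y).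
    apply/funext => y; rewrite /h /k /dual_regular_weight.
    have [Dy|nDy] := pselect (D y); last by rewrite fD// !mul0r mulr0.
    have iD : indD y = 1 by rewrite indicE mem_set.
    by rewrite iD mul1r powRN mulrCA mulfK// gt_eqF// powR_gt0.
  have hkq : (fun y => h y `^ q * k y) =
      (fun y => \1_(ball (0 : V) rho : set X) ((y : V) - x) * (f y `^ q * (w y + eps))).
    apply/funext => y; rewrite /h /k /dual_regular_weight.
    have [Dy|nDy] := pselect (D y); last first.
      by rewrite fD// mul0r powR0 ?gt_eqF// !mul0r mulr0.
    have iD : indD y = 1 by rewrite indicE mem_set.
    rewrite iD mul1r powRM ?powR_ge0// mulrCA; congr (_ * _).
    rewrite -mulrA; congr (_ * _); rewrite -powRrM -powRD ?(gt_eqF (W0 y)) ?implybT//.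
    have -> : s * q - s = 1.
      by rewrite -[X in _ - X]mulr1 -mulrBr mulVf// subr_eq0 gt_eqF.
    by rewrite powRr1// ltW.
  have := @L1norm_jensen _ _ _ mu h k q (kap x) (ltW q1) kap0 mh mk' h0 k0.
  rewrite kE hkE hkq (cube_int_boundedE x rho_gt0 mf fB') => /(_ (lexx _) (ltry _)) J.
  rewrite /= in J.
  have r0 : 0 <= regular_weight eps x by rewrite mulr_ge0// ltW.
  by apply: scale => //; exact: powR_ge0.
- move=> y; rewrite /F /=.
  have [Dy|nDy] := pselect (D y); last first.
    rewrite fD// powR0 ?gt_eqF// !mul0r mulr0 normr0 /L1norm integral0_eq// => x _.
    by rewrite mulr0 mulr0 normr0.
  have Dr2 : 0 < rho *+ 2 by rewrite mulrn_wgt0.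
  (* For [x] within [rho] of [y], the cube of radius [rho] at [x] lies in the cube of radius [2 rho]
     at [y]. *)
  pose kap2 := cube_int (rho *+ 2) (dual_regular_weight eps) y.
  have mi2 := measurable_cube_ind1 (rho *+ 2) y.
  have mr2 : measurable_fun setT (fun x : X => \1_(ball (0 : V) (rho *+ 2) : set X) ((x : V) - y) * regular_weight eps x).
    exact: measurable_funM.
  apply: (@le_trans _ _ (L1norm mu (fun x : X => (f y `^ q * (w y + eps) * kap2 `^ (q - 1)) *
      (\1_(ball (0 : V) (rho *+ 2) : set X) ((x : V) - y) * regular_weight eps x))%R)).
    apply: L1norm_le; last 1 first.
    + move=> x; apply: compare.
      * by rewrite mulr_ge0// ltW.
      * by rewrite mulr_ge0 ?powR_ge0// ltW.
      * exact: cube_int_ge0.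
      * exact: cube_int_ge0.
      * exact: cube_ind_ge0.
      have [xy|/negbTE nxy] := boolP [forall i, `|((y : V) - x) ord0 i| < rho]; last first.
        by left; rewrite cube_indE// nxy.
      right; split.
      * by rewrite cube_indE// xy.
      * rewrite cube_indE// (_ : [forall _, _])//.
        apply/forallP => i; have /forallP/(_ i) := xy; rewrite !mxE distrC => /lt_trans; apply.
        by rewrite mulr2n ltrDl.
      apply: le_of_ereal; first exact: (cube_int_boundedE x rho_gt0 mk (fun y => dual_regular_weight_le y e0)).
        exact: (cube_int_boundedE y Dr2 mk (fun y => dual_regular_weight_le y e0)).
      apply: L1norm_le; [apply: measurable_funM => //; exact: measurable_cube_ind1|exact: measurable_funM|].
      move=> z; rewrite !normrM ler_wpM2r//.
      rewrite [X in X <= _]ger0_norm ?cube_ind_ge0// [X in _ <= X]ger0_norm ?cube_ind_ge0//.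
      rewrite [X in X <= _]cube_indE// [X in _ <= X]cube_indE//.
      have [xz|//] := boolP [forall i, `|((z : V) - x) ord0 i| < rho].
      rewrite (_ : [forall _, _])//; apply/forallP => i.
      have /forallP/(_ i) := xz; have /forallP/(_ i) := xy; rewrite !mxE distrC => H1 H2.
      rewrite -[_ - _](subrKA (x ord0 i)) (le_lt_trans (ler_normD _ _))// mulr2n.
      by rewrite ltrD.
    + apply: measurable_funM; first apply: measurable_funM => //.
        exact: (measurableT_comp (measurable_powR _)).
      apply: measurable_funM => //.
      exact: (measurableT_comp (measurable_cube_ind rho) (pair2_measurable y)).
    + exact: measurable_funM.
  rewrite (L1normZ mu _ mr2) (cube_int_boundedE y Dr2 mr (fun z => regular_weight_le z e0)).
  apply: conclude; last exact: wA.
  + by rewrite mulr_ge0 ?powR_ge0// ltW.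
  + exact: powR_ge0.
  + exact: cube_int_ge0.
  + exact: c20.
Qed.

End muckenhoupt_average.

Section cube_average.
Context (R : realType) (n : nat).
Notation X := (borel_rV R n).
Notation V := ('rV[R]_n).
Notation mu := (@borel_lebesgue R n).
Variables (D : set V) (w : X -> R) (q A rho0 M : R).
Hypotheses (oD : open D) (mw : measurable_fun setT w) (w0 : forall x, 0 <= w x).
Hypotheses (wM : forall x, D x -> w x <= M) (q1 : 1 < q) (A0 : 0 < A).
Hypotheses (Doo : (mu (D : set X) < +oo)%E) (wA : cube_muckenhoupt D w q A rho0).
Notation indD := (\1_(D : set X) : X -> R).

Let mD : measurable_fun setT indD.
Proof. by apply: measurable_indic; exact: open_borel. Qed.

(** Removes [eps] and the boundedness of [f]. The bounded part is estimated with an [eps] depending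
    on its bound; the remaining part has small L1 norm, so it raises every cube integral by at most
    [del]. *)
Lemma cube_average_weight rho (f : X -> R) : 0 < rho -> rho *+ 2 < rho0 ->
  mu.-integrable setT (EFin \o f) -> (forall x, 0 <= f x) -> (forall x, ~ D x -> f x = 0) ->
  (L1norm mu (fun x => indD x * w x * cube_int rho f x `^ q)%R <=
   (2 `^ (q - 1) * (A * ((rho *+ 2) ^+ n) `^ q))%:E * L1norm mu (fun x => f x `^ q * w x)%R)%E.
Proof.
move=> r0 r1 fi f0 fD; have /integrable_L1norm[mf foo] := fi.
have q0 : 0 < q by apply: lt_trans q1.
set c2 := A * _; have c20 : 0 < c2.
  by rewrite mulr_gt0// powR_gt0// exprn_gt0// mulrn_wgt0.
pose c1 : R := 2 `^ (q - 1); have c10 : 0 < c1 by rewrite powR_gt0.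
rewrite -/c1; set J := L1norm mu (fun x => f x `^ q * w x).
have muD : mu (D : set X) = (fine (mu (D : set X)))%:E.
  by rewrite fineK// ge0_fin_numE.
set vD := fine _ in muD; have vD0 : 0 <= vD by rewrite fine_ge0.
have M'0 : 0 < `|M| + 1 by rewrite ltr_wpDl.
apply/lee_addgt0Pr => eta eta0.
(* Chosen so that the constant [del], raised to the power q and integrated over [D] against [w],
   costs at most half of [eta]. *)
pose del := (eta / 2 / (c1 * ((`|M| + 1) * (vD + 1)))) `^ q^-1.
have d0' : 0 < eta / 2 / (c1 * ((`|M| + 1) * (vD + 1))).
  by rewrite !divr_gt0// !mulr_gt0// ltr_wpDl.
have del0 : 0 < del by rewrite powR_gt0.
have delq : c1 * (`|M| + 1) * (vD + 1) * del `^ q = eta / 2.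
  have -> : del `^ q = eta / 2 / (c1 * ((`|M| + 1) * (vD + 1))).
    by rewrite -powRrM mulVf ?gt_eqF// powRr1// ltW.
  by rewrite -[c1 * _ * _]mulrA mulrC divfK// gt_eqF// !mulr_gt0// ltr_wpDl.
pose B m : set X := [set x | f x <= m%:R].
have mB m : measurable (B m).
  have -> : B m = setT `&` f @^-1` `]-oo, m%:R].
    by rewrite setTI; apply/seteqP; split=> x /=; rewrite /B/= in_itv.
  by apply: mf => //; exact: measurable_itv.
have := L1norm_tail del0 fi mB; case.
  by move=> x; near=> m; near: m; exact: nbhs_infty_ger.
move=> m _ /(_ m (leqnn m)) Hm.
pose f1 x := f x * \1_(B m) x; pose f2 x := f x * \1_(~` B m) x.
have mf1 : measurable_fun setT f1 by apply: measurable_funM => //; exact: measurable_indic.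
have mf2 : measurable_fun setT f2.
  by apply: measurable_funM => //; apply: measurable_indic; exact: measurableC.
have f1B x : 0 <= f1 x <= m%:R.
  rewrite /f1 indicE; have [Bx|nBx] := pselect (B m x); first by rewrite mem_set// mulr1 f0.
  by rewrite memNset// mulr0 lexx/=.
have f12 x : f x = f1 x + f2 x.
  rewrite /f1 /f2 !indicE in_setC; case: (x \in _) => /=; lra.
have f1D x : ~ D x -> f1 x = 0 by move=> /fD; rewrite /f1 => ->; rewrite mul0r.
have f2i : mu.-integrable setT (EFin \o f2).
  by apply/integrable_L1norm; split => //; exact: le_lt_trans Hm (ltry _).
have cub x : cube_int rho f x <= cube_int rho f1 x + del.
  rewrite -lee_fin -cube_intE// EFinD.
  have f1b y : `|f1 y| <= m%:R by have /andP[? ?] := f1B y; rewrite ger0_norm.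
  rewrite -(cube_int_boundedE x r0 mf1 f1b).
  apply: (@le_trans _ _ (L1norm mu (fun y : X => \1_(ball (0 : V) rho : set X) ((y : V) - x) * f1 y)%R + L1norm mu f2)%E).
    apply: L1norm_triangle => //.
    - by apply: measurable_funM => //; exact: measurable_cube_ind1.
    - by apply: measurable_funM => //; exact: measurable_cube_ind1.
    - move=> y; rewrite f12 mulrDr (le_trans (ler_normD _ _))// lerD2l normrM ler_piMl//.
      by rewrite ger0_norm ?cube_ind_ge0// indicE; case: (_ \in _).
  exact: leeD.
(* An [eps] below [t] makes the term created by replacing [w] with [w + eps] cost at most the other
   half of [eta]. *)
pose t := eta / 2 / (c1 * (c2 * (m%:R `^ q * (vD + 1)) + 1)).
have t0 : 0 < t.
  rewrite !divr_gt0// mulr_gt0// ltr_wpDl// !mulr_ge0 ?powR_ge0 ?addr_ge0//; exact: ltW.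
have tE : c1 * (c2 * (t * (m%:R `^ q * vD))) <= eta / 2.
  have -> : eta / 2 = t * (c1 * (c2 * (m%:R `^ q * (vD + 1)) + 1)).
    rewrite divfK// gt_eqF// mulr_gt0// ltr_wpDl// !mulr_ge0 ?powR_ge0 ?addr_ge0//; exact: ltW.
  rewrite [c2 * (t * _)]mulrCA [c1 * (t * _)]mulrCA.
  rewrite ler_wpM2l ?(ltW t0)// ler_wpM2l ?(ltW c10)//.
  rewrite -[leLHS]addr0 lerD// ler_wpM2l ?(ltW c20)// ler_wpM2l ?powR_ge0// lerDl//.
pose eps := Num.min 1 t; have e0 : 0 < eps by rewrite lt_min t0 andbT.
have e1 : eps <= 1 by rewrite ge_min lexx.
have et : eps <= t by rewrite ge_min lexx orbT.
have H1 := cube_average_weight_bounded oD mw w0 wM q1 A0 wA e0 e1 r0 r1 mf1 f1B f1D.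
have mc1 : measurable_fun setT (fun x => cube_int rho f1 x `^ q).
  by apply: (measurableT_comp (measurable_powR _)); exact: measurable_cube_int.
have mrw := measurable_regular_weight oD mw eps.
have mcf : measurable_fun setT (fun x => cube_int rho f x `^ q).
  by apply: (measurableT_comp (measurable_powR _)); exact: measurable_cube_int.
have mfq (g : X -> R) : measurable_fun setT g -> measurable_fun setT (fun y => g y `^ q).
  by move=> mg; exact: (measurableT_comp (measurable_powR _)).
have pt (h u e c d g M' : R) : 0 <= u -> 0 <= e -> 0 <= c -> 0 <= g -> 0 <= d -> g <= c + d ->
    h = 0 \/ h = 1 /\ u <= M' ->
    `|h * u * g `^ q| <= `|c1 * (h * (u + e) * c `^ q)| + `|(c1 * M' * d `^ q) * h|.
  move=> u0 e0' c0 f0' d0 fcd [->|[-> uM]]; first by rewrite !mul0r !mulr0 normr0 addr0.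
  have M'0' : 0 <= M' by apply: le_trans uM.
  rewrite !mul1r mulr1 !ger0_norm ?mulr_ge0 ?powR_ge0 ?addr_ge0 ?(ltW c10)//.
  apply: (@le_trans _ _ (u * (c1 * (c `^ q + d `^ q)))).
    rewrite ler_wpM2l//; apply: le_trans (powR_add_le c0 d0 (ltW q1)).
    by rewrite ge0_ler_powR ?nnegrE ?addr_ge0 ?(ltW q0).
  rewrite mulrCA -mulrA -mulrDr ler_wpM2l ?(ltW c10)// mulrDr lerD//.
    by rewrite ler_wpM2r ?powR_ge0// lerDl.
  by rewrite ler_wpM2r ?powR_ge0.
have mrf : measurable_fun setT (fun x => regular_weight D w eps x * cube_int rho f1 x `^ q).
  exact: (measurable_funM mrw mc1).
have step1 : (L1norm mu (fun x => indD x * w x * cube_int rho f x `^ q)%R <=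
    L1norm mu (fun x => c1 * (regular_weight D w eps x * cube_int rho f1 x `^ q))%R +
    L1norm mu (fun x => (c1 * (`|M| + 1) * del `^ q) * indD x)%R)%E.
  apply: L1norm_triangle.
  - exact: (measurable_funM (measurable_cst c1) mrf).
  - exact: (measurable_funM (measurable_cst _) mD).
  - exact: (measurable_funM (measurable_funM mD mw) mcf).
  - move=> x; apply: pt => //; [exact: ltW|exact: cube_int_ge0|exact: cube_int_ge0|exact: ltW|].
    rewrite indicE; have [Dx|nDx] := pselect (D x); last by left; rewrite memNset.
    right; rewrite mem_set//; split => //; apply: le_trans (wM Dx) _.
    by rewrite (le_trans (ler_norm _))// lerDl.
have step2 : (L1norm mu (fun x => f1 x `^ q * (w x + eps))%R <=
    J + L1norm mu (fun x => (eps * m%:R `^ q) * indD x)%R)%E.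
  apply: L1norm_triangle.
  - by apply: measurable_funM => //; exact: mfq.
  - exact: measurable_funM.
  - by apply: measurable_funM; [exact: mfq|exact: measurable_funD].
  - move=> x; have [Dx|nDx] := pselect (D x); last first.
      by rewrite f1D// fD// powR0 ?gt_eqF// !mul0r normr0 add0r.
    have -> : indD x = 1 by rewrite indicE mem_set.
    have /andP[f10 f1m] := f1B x.
    have f1f : f1 x <= f x by rewrite /f1 ler_piMr// indicE; case: (_ \in _).
    rewrite mulr1 !ger0_norm ?mulr_ge0 ?powR_ge0 ?addr_ge0 ?(ltW e0)//.
    rewrite mulrDr lerD//.
      by rewrite ler_wpM2r// ge0_ler_powR ?nnegrE ?(ltW q0).
    by rewrite mulrC ler_wpM2l ?(ltW e0)// ge0_ler_powR ?nnegrE ?(ltW q0).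
have ID : L1norm mu indD = vD%:E.
  rewrite /L1norm; under eq_integral do rewrite ger0_norm ?indicE//.
  rewrite integral_indic; [by rewrite setIT|exact: measurableT|exact: open_borel].
apply: (le_trans step1); rewrite (L1normZ mu c1 mrf).
rewrite (L1normZ mu _ mD) ID (ger0_norm (ltW c10)) ger0_norm; last first.
  by rewrite !mulr_ge0 ?powR_ge0// ltW.
rewrite L1normZ// ID ger0_norm ?mulr_ge0 ?powR_ge0 ?(ltW e0)// -EFinM in step2.
rewrite [(c1 * c2)%:E]EFinM -muleA.
apply: (@le_trans _ _ (c1%:E * (c2%:E * J) + (eta / 2)%:E + (eta / 2)%:E)%E); last first.
  by rewrite -addeA -EFinD (_ : eta / 2 + eta / 2 = eta)//; lra.
apply: leeD; last first.
  rewrite -EFinM lee_fin -delq -!mulrA ler_wpM2l ?(ltW c10)//.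
  by rewrite ler_wpM2l ?(ltW M'0)// mulrC ler_wpM2r ?powR_ge0// lerDl.
apply: (@le_trans _ _ (c1%:E * (c2%:E * (J + (eps * m%:R `^ q * vD)%:E)))%E).
  apply: lee_wpmul2l; first by rewrite lee_fin ltW.
  apply: (le_trans H1); apply: lee_wpmul2l; first by rewrite lee_fin ltW.
  exact: step2.
rewrite ge0_muleDr ?L1norm_ge0//; last by rewrite lee_fin !mulr_ge0 ?powR_ge0// ltW.
rewrite ge0_muleDr; last 2 first.
- by rewrite mule_ge0 ?L1norm_ge0// lee_fin ltW.
- by rewrite mule_ge0// lee_fin ?(ltW c20)// !mulr_ge0 ?powR_ge0// ltW.
apply: leeD => //; rewrite -!EFinM lee_fin (le_trans _ tE)//.
rewrite ler_wpM2l ?(ltW c10)// ler_wpM2l ?(ltW c20)// -mulrA ler_wpM2r//.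
by rewrite mulr_ge0// powR_ge0.
Unshelve. all: by end_near. Qed.

End cube_average.

(** * Energy of mollified functions *)

Section mollification_powers.
Context (R : realType) (n : nat).
Notation X := (borel_rV R n).
Notation V := ('rV[R]_n).
Notation mu := (@borel_lebesgue R n).
Variables (C a rho : R) (c : V) (k : V -> R).
Hypotheses (mk : mollifier C c a k) (C0 : 0 < C) (a0 : 0 < a).
Hypotheses (rho0 : 0 < rho) (ca : forall i, `|c ord0 i| + a <= rho).
Implicit Types (g : V -> R) (x : V).

Let N := C * a ^- n.

Let N0 : 0 < N.
Proof. by rewrite mulr_gt0// invr_gt0 exprn_gt0. Qed.

Let Ck : C1b k.
Proof. by apply: bsmooth_C1b; have [] := mk. Qed.

Let k0 z : 0 <= k z. Proof. by have [] := mk. Qed.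

Let kN z : k z <= N. Proof. by have [] := mk. Qed.

Let mks x : measurable_fun setT (fun y : X => k ((y : V) - x)).
Proof. by apply: measurable_reflect; have [] := Ck. Qed.

Lemma mollifier_le_cube z : k z <= N * \1_(ball (0 : V) rho : set X) z.
Proof.
have [kz0|kz] := eqVneq (k z) 0; first by rewrite kz0 mulr_ge0 ?cube_ind_ge0// ltW.
rewrite cube_indE// (_ : [forall _, _]) ?mulr1//; apply/forallP => i.
have [_ _ /(_ z i kz) H _ _ _] := mk.
rewrite -[z ord0 i](subrK (c ord0 i)) (le_lt_trans (ler_normD _ _))//.
by apply: lt_le_trans (ca i); rewrite addrC ltrD2l.
Qed.

Lemma L1norm_mollifier_shift x : L1norm mu (fun y : X => k ((y : V) - x)) = 1%E.
Proof.
have [_ _ _ ki _ _] := mk; rewrite /L1norm; under eq_integral do rewrite ger0_norm//.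
rewrite -ki; apply: (@ge0_integral_shift _ _ (- x) (fun z : X => (k z)%:E)) => //.
by apply/measurable_EFinP; exact: C1b_measurable.
Qed.

Lemma mollifier_mul_integrable g x : mu.-integrable setT (EFin \o (g : X -> R)) ->
  mu.-integrable setT (EFin \o (fun y : X => k ((y : V) - x) * g y)).
Proof.
move=> ig; apply: (integrable_bounded_mul (mks x) _ ig) => y.
by rewrite ger0_norm//; exact: kN.
Qed.

Lemma moll_le_L1norm g x : mu.-integrable setT (EFin \o (g : X -> R)) ->
  ((`|moll k g x|)%:E <= L1norm mu (fun y : X => k ((y : V) - x) * g y)%R)%E.
Proof. by move=> /(mollifier_mul_integrable x); exact: normr_Rintegral_L1norm. Qed.

Lemma moll_jensen p g x : 1 <= p -> mu.-integrable setT (EFin \o (g : X -> R)) ->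
  ((`|moll k g x| `^ p)%:E <= L1norm mu (fun y : X => `|g y| `^ p * k ((y : V) - x))%R)%E.
Proof.
move=> p1 ig; have /integrable_L1norm[mg _] := ig.
have mng : measurable_fun setT (fun y : X => `|g y|) by exact: measurableT_comp.
have E : L1norm mu (fun y : X => `|g y| * k ((y : V) - x)) =
    L1norm mu (fun y : X => k ((y : V) - x) * g y).
  by apply: eq_integral => y _; rewrite mulrC !normrM normr_id.
have /integrable_L1norm[_ foo] := mollifier_mul_integrable x ig.
have := @L1norm_jensen _ _ _ mu (fun y : X => `|g y|) (fun y : X => k ((y : V) - x)) p 1
  p1 ltr01 mng (mks x) (fun y => normr_ge0 _) (fun y => k0 _).
rewrite L1norm_mollifier_shift E powR1 mul1e => /(_ (lexx _) foo).
apply: le_trans; rewrite lee_fin ge0_ler_powR ?nnegrE ?fine_ge0 ?L1norm_ge0//.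
  by apply: le_trans p1.
by rewrite -lee_fin fineK ?ge0_fin_numE ?L1norm_ge0// moll_le_L1norm.
Qed.

(** The source of the exponent beta = N / p: the kernel bound is of order [a ^- n], so the
    mollification is at most of order [a^(- n / p)]. *)
Lemma moll_sup_Lp p g x : 1 <= p -> mu.-integrable setT (EFin \o (g : X -> R)) ->
  ((`|moll k g x| `^ p)%:E <= N%:E * L1norm mu (fun y : X => `|g y| `^ p)%R)%E.
Proof.
move=> p1 ig; have /integrable_L1norm[mg _] := ig.
have mgp : measurable_fun setT (fun y : X => `|g y| `^ p).
  by apply: (measurableT_comp (measurable_powR _)); exact: measurableT_comp.
apply: le_trans (moll_jensen x p1 ig) _.
rewrite -{1}(ger0_norm (ltW N0)) -L1normZ//; apply: L1norm_le.
- exact: measurable_funM.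
- exact: measurable_funM.
- by move=> y; rewrite mulrC normrM [X in _ <= X]normrM ler_wpM2r// !ger0_norm// ltW.
Qed.

(** Jensen for the probability density [k], followed by Tonelli: integrating in [x] first leaves the
    translation-invariant integral of [|g|^p] times [k z]. *)
Lemma moll_Lp p g : 1 <= p -> mu.-integrable setT (EFin \o (g : X -> R)) ->
  (L1norm mu (fun x : X => `|moll k g x| `^ p)%R <= L1norm mu (fun x : X => `|g x| `^ p)%R)%E.
Proof.
move=> p1 ig; have /integrable_L1norm[mg _] := ig.
have mgp : measurable_fun setT (fun y : X => `|g y| `^ p).
  by apply: (measurableT_comp (measurable_powR _)); exact: measurableT_comp.
have mS : measurable_fun setT (fun x : X => `|moll k g x| `^ p).
  apply: (measurableT_comp (measurable_powR _)); apply: measurableT_comp => //.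
  apply: C1b_measurable; apply: bsmooth_C1b; apply: moll_bsmooth => //.
  by have [] := mk.
set I := L1norm mu (fun x : X => `|g x| `^ p).
have [Ioo|Ioo] := leP +oo%E I; first by move: Ioo; rewrite leye_eq => /eqP ->; rewrite leey.
have IE : I = (fine I)%:E by rewrite fineK// ge0_fin_numE// L1norm_ge0.
have I0 : 0 <= fine I by rewrite fine_ge0// L1norm_ge0.
have kI : L1norm mu (fun z : X => fine I * k z) = I.
  rewrite L1normZ; last exact: C1b_measurable.
  have := L1norm_mollifier_shift 0; under eq_fun do rewrite subr0.
  by move=> ->; rewrite mule1 ger0_norm.
rewrite -kI; have mkk : measurable_fun setT (k : X -> R) by exact: C1b_measurable.
apply: (@L1norm_fubini_le _ _ (fun z : X * X => k z.2 * `|g ((z.1 : V) + z.2)| `^ p)).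
- apply: measurable_funM; first exact: (measurableT_comp mkk).
  exact: (measurableT_comp mgp (@measurable_add2 R n)).
- exact: mS.
- by apply: measurable_funM.
- move=> x; rewrite ger0_norm ?powR_ge0//; apply: le_trans (moll_jensen x p1 ig) _.
  rewrite /L1norm -(@ge0_integral_shift _ _ (- x) (fun z : X => (`|k z * `|g ((x : V) + z)| `^ p|)%:E)).
  + rewrite le_eqVlt; apply/orP; left; apply/eqP; apply: eq_integral => y _.
    by rewrite mulrC addrCA subrr addr0.
  + apply/measurable_EFinP; apply: measurableT_comp => //; apply: measurable_funM => //.
    rewrite (_ : (fun _ => _) = (fun z : X => `|g ((z : V) + x)| `^ p)).
      exact: (measurable_shiftf x (f := fun z : X => `|g z| `^ p)).
    by apply/funext => z; rewrite addrC.
  + by move=> z; rewrite lee_fin.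
- move=> z /=; rewrite (@L1normZ _ _ _ mu (k z) (fun x : X => `|g ((x : V) + z)| `^ p)).
    rewrite (@L1norm_shift _ _ (fun x : X => `|g x| `^ p) z mgp) -/I {1}IE -EFinM lee_fin.
    by rewrite mulrC normrM (ger0_norm I0).
  exact: (measurable_shiftf z (f := fun z : X => `|g z| `^ p)).
Qed.

End mollification_powers.

Section energy_of_mollification.
Context (R : realType) (n : nat).
Notation X := (borel_rV R n).
Notation V := ('rV[R]_n).
Notation mu := (@borel_lebesgue R n).
Variables (D : set V) (w b : X -> R) (p q A rho0 M Mb Cb kb : R).
Hypotheses (oD : open D) (mw : measurable_fun setT w) (w0 : forall x, 0 <= w x).
Hypotheses (wM : forall x, D x -> w x <= M) (p1 : 1 <= p) (pq : p <= q) (q1 : 1 < q) (A0 : 0 < A).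
Hypotheses (Doo : (mu (D : set X) < +oo)%E) (wA : cube_muckenhoupt D w q A rho0).
Hypotheses (mb : measurable_fun setT b) (b0 : forall x, 0 <= b x).
Hypotheses (bM : forall x, D x -> b x <= Mb) (Cb0 : 0 < Cb) (kb0 : 0 <= kb).
Hypothesis (bZ : forall (x y : V) (rho : R), D x -> D y -> 0 < rho ->
  (forall i, `|x ord0 i - y ord0 i| < rho) -> b x <= Cb * (b y + rho `^ kb)).
Notation indD := (\1_(D : set X) : X -> R).
Implicit Types (g : V -> R).

Let mD : measurable_fun setT indD.
Proof. by apply: measurable_indic; exact: open_borel. Qed.

Let q0 : 0 < q. Proof. exact: lt_trans q1. Qed.

Lemma weight_mul_integrable g : mu.-integrable setT (EFin \o (g : X -> R)) ->
  (forall x, ~ D x -> g x = 0) -> mu.-integrable setT (EFin \o (fun x : X => b x * `|g x|)).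
Proof.
move=> ig gD; have /integrable_L1norm[mg _] := ig.
have mbD : measurable_fun setT (fun x : X => b x * indD x) by exact: measurable_funM.
have bDM x : `|b x * indD x| <= `|Mb|.
  rewrite indicE; have [Dx|nDx] := pselect (D x); last by rewrite memNset// mulr0 normr0.
  rewrite mem_set// mulr1 ger0_norm//; exact: le_trans (bM Dx) (ler_norm _).
have ing : mu.-integrable setT (EFin \o (fun x : X => `|g x|)) by exact: integrable_norm ig.
apply: eq_integrable (integrable_bounded_mul mbD bDM ing) => // x _.
rewrite /= indicE; have [Dx|nDx] := pselect (D x); first by rewrite mem_set// mulr1.
by rewrite gD// normr0 !mulr0.
Qed.

Section one_mollifier.
Variables (C a rho : R) (c : V) (k : V -> R).
Hypotheses (mk : mollifier C c a k) (C0 : 0 < C) (a0 : 0 < a).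
Hypotheses (rho_gt0 : 0 < rho) (ca : forall i, `|c ord0 i| + a <= rho).

(* If b x is much larger than rho ^ kb, then b is comparable to b x on the whole
   support of k (. - x), and b x can be moved inside the convolution. *)
Lemma weight_moll_le g x : mu.-integrable setT (EFin \o (g : X -> R)) ->
  (forall x, ~ D x -> g x = 0) -> D x ->
  b x * `|moll k g x| <= 2 * Cb *
    (C * a ^- n * cube_int rho (fun y => b y * `|g y|) x + rho `^ kb * `|moll k g x|).
Proof.
move=> ig gD Dx; have ibg := weight_mul_integrable ig gD.
have N0 : 0 < C * a ^- n by rewrite mulr_gt0// invr_gt0 exprn_gt0.
have C2 : 0 < 2 * Cb by rewrite mulr_gt0.
have [bx|bx] := leP (b x) (2 * Cb * rho `^ kb).
  rewrite mulrDr -[leLHS]add0r lerD//.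
    by rewrite mulr_ge0 ?(ltW C2)// mulr_ge0 ?(ltW N0)// cube_int_ge0.
  by rewrite mulrA ler_wpM2r.
rewrite mulrDr -[leLHS]addr0 lerD//; last first.
  by rewrite mulr_ge0 ?(ltW C2)// mulr_ge0 ?powR_ge0.
have [sk k0 ks _ _ _] := mk; have Ck := bsmooth_C1b sk.
have mks : measurable_fun setT (fun y : X => k ((y : V) - x)).
  by apply: measurable_reflect; have [] := Ck.
have mi := measurable_cube_ind1 rho x.
have /integrable_L1norm[mg _] := ig; have /integrable_L1norm[mbg _] := ibg.
have K0 : 0 <= 2 * Cb * (C * a ^- n) by rewrite mulr_ge0// ltW.
rewrite mulrA -lee_fin [leRHS]EFinM -(cube_intE rho x ibg) EFinM.
apply: (@le_trans _ _ ((b x)%:E * L1norm mu (fun y : X => k ((y : V) - x) * g y)%R)%E).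
  by apply: lee_wpmul2l; [rewrite lee_fin|exact: (moll_le_L1norm mk)].
rewrite -{1}(ger0_norm (b0 x)) -{1}(ger0_norm K0) -!L1normZ; [|exact: measurable_funM..].
apply: L1norm_le; [by do ! apply: measurable_funM|apply: measurable_funM => //; exact: measurable_funM|].
move=> y; rewrite normrM [X in X * _]ger0_norm//.
have [kz0|kz] := eqVneq (k ((y : V) - x)) 0; first by rewrite kz0 mul0r normr0 mulr0.
have [Dy|nDy] := pselect (D y); last by rewrite gD// mulr0 normr0 mulr0.
have xy i : `|(x : V) ord0 i - (y : V) ord0 i| < rho.
  have H := ks _ i kz; rewrite distrC; rewrite !mxE in H.
  rewrite -[_ - _](subrK (c ord0 i)) (le_lt_trans (ler_normD _ _))//.
  by apply: lt_le_trans (ca i); rewrite addrC ltrD2l.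
(* Here the [rho ^ kb] term of [bZ] is at most half of [b x] and is absorbed on the left. *)
have bxy : b x <= 2 * Cb * b y.
  have := bZ Dx Dy rho_gt0 xy; move: bx; rewrite mulrDr; lra.
have H := mollifier_le_cube mk C0 a0 rho_gt0 ca ((y : V) - x).
have core (B B' K' N' i G : R) : 0 <= B -> 0 <= K' -> B <= 2 * Cb * B' -> K' <= N' * i ->
    B * `|K' * G| <= `|2 * Cb * N' * (i * (B' * `|G|))|.
  move=> B0 K'0 BB KN; rewrite normrM (ger0_norm K'0); apply: le_trans (ler_norm _).
  have -> : 2 * Cb * N' * (i * (B' * `|G|)) = (2 * Cb * B') * (N' * i * `|G|) by lra.
  by apply: ler_pM => //; [rewrite mulr_ge0|rewrite ler_wpM2r].
exact: core.
Qed.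

End one_mollifier.

(** The count of exponents: [Z^q S^(q - p)] carries the power [kb q - be (q - p)] of [t], which is
    nonnegative, and [t <= 1]. This is where the gap between [p] and [q] is paid for. *)
Lemma powR_weight_split (B S T N Z K L t be : R) : 0 <= B -> 0 <= S -> 0 <= T -> 0 <= N ->
  0 <= K -> 0 < L -> 0 < t -> t <= 1 -> be * (q - p) <= kb * q ->
  Z = (t * L) `^ kb -> S <= K * t `^ (- be) ->
  B * S <= 2 * Cb * (N * T + Z * S) ->
  (B * S) `^ q <= (2 * Cb) `^ q * 2 `^ (q - 1) * N `^ q * T `^ q +
    (2 * Cb) `^ q * 2 `^ (q - 1) * L `^ (kb * q) * K `^ (q - p) * S `^ p.
Proof.
move=> B0 S0 T0 N0 K0 L0 t0 t1 beq ZE SK BS.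
have C2 : 0 <= 2 * Cb by rewrite mulr_ge0// ltW.
have Z0 : 0 <= Z by rewrite ZE powR_ge0.
apply: (@le_trans _ _ ((2 * Cb * (N * T + Z * S)) `^ q)).
  have r0 : 0 <= 2 * Cb * (N * T + Z * S) by rewrite mulr_ge0// addr_ge0// mulr_ge0.
  by apply: ge0_ler_powR => //; rewrite ?nnegrE ?mulr_ge0// ltW.
rewrite powRM ?addr_ge0 ?mulr_ge0//.
set c2 := (2 * Cb) `^ q; have c20 : 0 <= c2 by exact: powR_ge0.
rewrite -!mulrA -mulrDr ler_wpM2l//.
apply: le_trans (powR_add_le (mulr_ge0 N0 T0) (mulr_ge0 Z0 S0) (ltW q1)) _.
rewrite -mulrDr ler_wpM2l ?powR_ge0// !powRM// lerD2l.
have -> : S `^ q = S `^ (q - p) * S `^ p.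
  by rewrite -powRD ?subrK// (gt_eqF q0).
rewrite mulrA [L `^ _ * (_ * _)]mulrA ler_wpM2r ?powR_ge0//.
apply: (@le_trans _ _ (Z `^ q * (K * t `^ (- be)) `^ (q - p))).
  by rewrite ler_wpM2l ?powR_ge0// ge0_ler_powR ?nnegrE ?subr_ge0// mulr_ge0// powR_ge0.
rewrite ZE -powRrM !powRM ?(ltW t0) ?(ltW L0) ?powR_ge0// -powRrM.
rewrite [t `^ _ * _]mulrC -!mulrA ler_wpM2l ?powR_ge0//.
rewrite mulrCA ler_piMr ?powR_ge0// -powRD ?(gt_eqF t0) ?implybT//.
rewrite mulNr; rewrite -[leRHS](powRr0 t) ger_powR ?t0//.
  by rewrite subr_ge0.
exact: ltW.
Qed.

Lemma energy_moll (C c L t K be : R) (e : V) (k : V -> R) g :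
  mollifier C (- (t *: e)) (t * c) k -> 0 < C -> 0 < c -> 0 < L -> 0 < t -> t <= 1 ->
  (forall i, `|e ord0 i| + c <= L) -> (t * L) *+ 2 < rho0 ->
  0 <= K -> be * (q - p) <= kb * q ->
  mu.-integrable setT (EFin \o (g : X -> R)) -> (forall x, ~ D x -> g x = 0) ->
  (forall x, `|moll k g x| <= K * t `^ (- be)) ->
  (L1norm mu (fun x : X => indD x * (w x * (b x * `|moll k g x|) `^ q))%R <=
   ((2 * Cb) `^ q * 2 `^ (q - 1) * (2 `^ (q - 1) * A) * (C * (L *+ 2 / c) ^+ n) `^ q)%:E *
     L1norm mu (fun x : X => w x * (b x * `|g x|) `^ q)%R +
   ((2 * Cb) `^ q * 2 `^ (q - 1) * L `^ (kb * q) * K `^ (q - p) * `|M|)%:E *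
     L1norm mu (fun x : X => `|g x| `^ p)%R)%E.
Proof.
move=> mk C0 c0 L0 t0 t1 eL tL K0 beq ig gD gK.
have tc0 : 0 < t * c by rewrite mulr_gt0.
have tL0 : 0 < t * L by rewrite mulr_gt0.
have ca i : `|(- (t *: e)) ord0 i| + t * c <= t * L.
  by rewrite !mxE normrN normrM (gtr0_norm t0) -mulrDr ler_wpM2l// ltW.
have ibg := weight_mul_integrable ig gD.
have /integrable_L1norm[mg _] := ig; have /integrable_L1norm[mbg _] := ibg.
have p0 : 0 <= p by apply: le_trans p1.
set c2 := (2 * Cb) `^ q * 2 `^ (q - 1); have c20 : 0 <= c2 by rewrite mulr_ge0// powR_ge0.
set cc := c2 * L `^ (kb * q) * K `^ (q - p).
have cc0 : 0 <= cc by rewrite !mulr_ge0// powR_ge0.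
set N := C * (t * c) ^- n; have N0 : 0 < N by rewrite mulr_gt0// invr_gt0 exprn_gt0.
have sk : bsmooth k by case: mk.
have mS : measurable_fun setT (fun x : X => `|moll k g x|).
  apply: measurableT_comp => //; apply: C1b_measurable; apply: bsmooth_C1b.
  exact: moll_bsmooth.
have mpow (r : R) (f : X -> R) : measurable_fun setT f -> measurable_fun setT (fun x => f x `^ r).
  by move=> mf; exact: (measurableT_comp (measurable_powR _)).
pose T := cube_int (t * L) (fun y : X => b y * `|g y|).
have mT : measurable_fun setT T by exact: measurable_cube_int.
have mbS : measurable_fun setT (fun x : X => b x * `|moll k g x|) by exact: measurable_funM.
have H1 : (L1norm mu (fun x : X => indD x * (w x * (b x * `|moll k g x|) `^ q))%R <=
    L1norm mu (fun x : X => c2 * N `^ q * (indD x * w x * T x `^ q))%R +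
    L1norm mu (fun x : X => cc * `|M| * `|moll k g x| `^ p)%R)%E.
  have core (h u B S T' M' : R) : 0 <= u -> 0 <= B -> 0 <= S -> 0 <= T' -> 0 <= M' ->
      h = 0 \/ [/\ h = 1, u <= M' &
        (B * S) `^ q <= c2 * N `^ q * T' `^ q + cc * S `^ p] ->
      `|h * (u * (B * S) `^ q)| <= `|c2 * N `^ q * (h * u * T' `^ q)| + `|cc * M' * S `^ p|.
    move=> u0 B0 S0 T0 M'0 [->|[-> uM H]]; first by rewrite mul0r normr0 addr_ge0.
    rewrite !mul1r !ger0_norm ?mulr_ge0 ?powR_ge0//.
    apply: le_trans (ler_wpM2l u0 H) _; rewrite mulrDr lerD//; first by rewrite mulrCA.
    by rewrite mulrA ler_wpM2r ?powR_ge0// mulrC ler_wpM2l.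
  apply: L1norm_triangle.
  - by apply: measurable_funM => //; apply: measurable_funM; [exact: measurable_funM|exact: mpow].
  - by apply: measurable_funM => //; exact: mpow.
  - by apply: measurable_funM => //; apply: measurable_funM => //; exact: mpow.
  - move=> x; apply: core => //; first exact: cube_int_ge0.
    rewrite indicE; have [Dx|nDx] := pselect (D x); last by left; rewrite memNset.
    right; rewrite mem_set//; split => //; first exact: le_trans (wM Dx) (ler_norm _).
    apply: (@powR_weight_split _ _ _ _ ((t * L) `^ kb) K L t be) => //; first exact: cube_int_ge0.
      exact: ltW.
    exact: (weight_moll_le mk C0 tc0 tL0 ca ig gD Dx).
apply: (le_trans H1); rewrite L1normZ; last first.
  by apply: measurable_funM; [exact: measurable_funM|exact: mpow].
rewrite L1normZ; last exact: mpow.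
have cM0 : 0 <= cc * `|M| by rewrite mulr_ge0.
have cN0 : 0 <= c2 * N `^ q by rewrite mulr_ge0// powR_ge0.
rewrite (ger0_norm cM0) (ger0_norm cN0); apply: leeD; last first.
  by apply: lee_wpmul2l; [rewrite lee_fin mulr_ge0|exact: (moll_Lp mk p1 ig)].
have H2 := cube_average_weight oD mw w0 wM q1 A0 Doo wA tL0 tL ibg
  (fun y => mulr_ge0 (b0 y) (normr_ge0 _)) _.
apply: (@le_trans _ _ ((c2 * N `^ q)%:E * ((2 `^ (q - 1) * (A * ((t * L *+ 2) ^+ n) `^ q))%:E *
   L1norm mu (fun x : X => (b x * `|g x|) `^ q * w x)%R))%E).
  apply: lee_wpmul2l; first by rewrite lee_fin mulr_ge0// powR_ge0.
  by apply: H2 => x /gD ->; rewrite normr0 mulr0.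
rewrite muleA -EFinM le_eqVlt; apply/orP; left; apply/eqP; congr (_ * _)%E; last first.
  by apply: eq_integral => x _; rewrite mulrC.
(* The kernel bound is of order [t ^- n] and the volume of the cube of order [t ^+ n], so [t]
   cancels. *)
congr EFin; have NE : N `^ q * ((t * L *+ 2) ^+ n) `^ q = (C * (L *+ 2 / c) ^+ n) `^ q.
  rewrite -powRM ?(ltW N0) ?exprn_ge0// ?mulrn_wge0 ?(ltW tL0)//; congr (_ `^ q).
  rewrite /N -mulrA; congr (C * _); rewrite -exprVn -exprMn; congr (_ ^+ n).
  by rewrite invfM -mulrnAr mulrACA mulVf ?gt_eqF// mul1r mulrC.
by rewrite -NE; lra.
Qed.

End energy_of_mollification.

(** * Convergence in energy of a mollified gradient component *)

Section local_approximation.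
Context (R : realType) (n : nat).
Notation X := (borel_rV R n).
Notation V := ('rV[R]_n).
Notation mu := (@borel_lebesgue R n).
Variables (D : set V) (w b : X -> R) (p q A rho0 M Mb Cb kb : R).
Hypotheses (oD : open D) (mw : measurable_fun setT w) (w0 : forall x, 0 <= w x).
Hypotheses (wM : forall x, D x -> w x <= M) (p1 : 1 <= p) (pq : p <= q) (q1 : 1 < q) (A0 : 0 < A).
Hypotheses (Doo : (mu (D : set X) < +oo)%E) (wA : cube_muckenhoupt D w q A rho0).
Hypotheses (mb : measurable_fun setT b) (b0 : forall x, 0 <= b x).
Hypotheses (bM : forall x, D x -> b x <= Mb) (Cb0 : 0 < Cb) (kb0 : 0 <= kb).
Hypothesis (bZ : forall (x y : V) (rho : R), D x -> D y -> 0 < rho ->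
  (forall i, `|x ord0 i - y ord0 i| < rho) -> b x <= Cb * (b y + rho `^ kb)).
Notation indD := (\1_(D : set X) : X -> R).
Implicit Types (g f : V -> R).

Let mD : measurable_fun setT indD.
Proof. by apply: measurable_indic; exact: open_borel. Qed.

Let q0 : 0 < q. Proof. exact: lt_trans q1. Qed.
Let p0 : 0 < p. Proof. exact: lt_le_trans p1. Qed.

(** The integrand for a scalar [s]: the approximation is carried out for one partial derivative at a
    time. It is used again with another weight and [b = 1] for the original energy. *)
Definition phase (x : X) (s : R) : R := `|s| `^ p + w x * (b x * `|s|) `^ q.

Lemma phase_ge0 x s : 0 <= phase x s.
Proof. by rewrite addr_ge0 ?mulr_ge0 ?powR_ge0. Qed.

Lemma phase0 x : phase x 0 = 0.
Proof. by rewrite /phase normr0 mulr0 !powR0 ?gt_eqF// mulr0 addr0. Qed.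

Lemma measurable_phase f : measurable_fun setT (f : X -> R) ->
  measurable_fun setT (fun x : X => phase x (f x)).
Proof.
move=> mf; have mnf : measurable_fun setT (fun x : X => `|f x|) by exact: measurableT_comp.
apply: measurable_funD; first exact: (measurableT_comp (measurable_powR _)).
apply: measurable_funM => //; apply: (measurableT_comp (measurable_powR _)).
exact: measurable_funM.
Qed.

Lemma phase_le x s u : `|s| <= `|u| -> phase x s <= phase x u.
Proof.
move=> su; rewrite lerD//; first by apply: ge0_ler_powR => //; exact: ltW.
apply: ler_wpM2l => //; apply: ge0_ler_powR; rewrite ?nnegrE ?mulr_ge0 ?(ltW q0)//.
exact: ler_wpM2l.
Qed.

(** [powR_split] applied to both powers; since [p <= q] and the bases are at most 1, the factors
    with exponent [1 - q] dominate those with [1 - p]. *)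
Lemma phase_split l x s u v : 0 < l < 1 -> `|s| <= `|u| + `|v| ->
  phase x s <= (1 - l) `^ (1 - q) * phase x u + l `^ (1 - q) * phase x v.
Proof.
move=> l01 suv; have /andP[l0 l1] := l01.
have l1' : 0 < 1 - l <= 1 by rewrite subr_gt0 l1 lerBlDr lerDl ltW.
have l01' : 0 < l <= 1 by rewrite l0 ltW.
apply: (@le_trans _ _ ((`|u| + `|v|) `^ p + w x * (b x * (`|u| + `|v|)) `^ q)).
  rewrite -{1 2}[`|u| + `|v|]ger0_norm ?addr_ge0//; apply: phase_le.
  by rewrite [leRHS]ger0_norm// addr_ge0.
have H1 := powR_split l01 (normr_ge0 u) (normr_ge0 v) p1.
have bu : 0 <= b x * `|u| by exact: mulr_ge0.
have bv : 0 <= b x * `|v| by exact: mulr_ge0.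
have H2 := ler_wpM2l (w0 x) (powR_split l01 bu bv (ltW q1)).
rewrite -mulrDr in H2.
apply: le_trans (lerD H1 H2) _; rewrite /phase !mulrDr.
have e1 : (1 - l) `^ (1 - p) <= (1 - l) `^ (1 - q) by rewrite ger_powR ?lerD2l ?lerN2.
have e2 : l `^ (1 - p) <= l `^ (1 - q) by rewrite ger_powR ?lerD2l ?lerN2.
have := ler_wpM2r (powR_ge0 `|u| p) e1; have := ler_wpM2r (powR_ge0 `|v| p) e2.
lra.
Qed.

Lemma phase_add x s u v : `|s| <= `|u| + `|v| ->
  phase x s <= 2 `^ (q - 1) * (phase x u + phase x v).
Proof.
move=> suv; have h : 0 < (2^-1 : R) < 1 by lra.
have := phase_split x h suv; rewrite (_ : 1 - 2^-1 = 2^-1 :> R); last by lra.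
have -> : 2^-1 `^ (1 - q) = 2 `^ (q - 1) :> R.
  by rewrite -[2^-1]powR_inv1// -powRrM mulN1r opprB.
by rewrite -(mulrDr (2 `^ (q - 1)) (phase x u)).
Qed.

(** On bounded values of [s] the integrand is at most linear in [|s|], so L1 convergence of
    uniformly bounded functions implies convergence in energy. *)
Lemma phase_bounded x s (B : R) : D x -> `|s| <= B ->
  phase x s <= (B `^ (p - 1) + `|M| * `|Mb| `^ q * B `^ (q - 1)) * `|s|.
Proof.
move=> Dx sB; have B0 : 0 <= B by apply: le_trans sB.
rewrite mulrDl lerD//.
  rewrite -(mulr_powRB1 (normr_ge0 s) p0) mulrC ler_wpM2r//.
  by apply: ge0_ler_powR; rewrite ?nnegrE ?subr_ge0.
rewrite powRM// -(mulr_powRB1 (normr_ge0 s) q0).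
have -> : w x * (b x `^ q * (`|s| * `|s| `^ (q - 1))) = w x * b x `^ q * `|s| `^ (q - 1) * `|s| by lra.
rewrite ler_wpM2r//; apply: ler_pM; rewrite ?mulr_ge0 ?powR_ge0//; last first.
  by apply: ge0_ler_powR; rewrite ?nnegrE ?subr_ge0// ltW.
apply: ler_pM; rewrite ?powR_ge0//; first exact: le_trans (wM Dx) (ler_norm _).
apply: ge0_ler_powR; rewrite ?nnegrE ?(ltW q0)//.
exact: le_trans (bM Dx) (ler_norm _).
Qed.

Lemma mollD k f g x : C1b k -> mu.-integrable setT (EFin \o (f : X -> R)) ->
  mu.-integrable setT (EFin \o (g : X -> R)) ->
  moll k (fun y => f y + g y) x = moll k f x + moll k g x.
Proof.
move=> [ck _ _ [K [K1 _]]] jf jg; have mks := measurable_reflect x ck.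
rewrite /moll -RintegralD//.
- by apply: eq_Rintegral => y _; rewrite mulrDr.
- exact: (integrable_bounded_mul mks (fun y => K1 _) jf).
- exact: (integrable_bounded_mul mks (fun y => K1 _) jg).
Qed.

Lemma moll_sup (C a B : R) (c : V) k g x : mollifier C c a k ->
  mu.-integrable setT (EFin \o (g : X -> R)) -> (forall x, `|g x| <= B) -> `|moll k g x| <= B.
Proof.
move=> mk ig gB; rewrite -lee_fin; apply: le_trans (moll_le_L1norm mk x ig) _.
have /integrable_L1norm[mg _] := ig.
have B0 : 0 <= B by apply: le_trans (gB 0).
have mks : measurable_fun setT (fun y : X => k ((y : V) - x)).
  by apply: measurable_reflect; have [/bsmooth_C1b[]] := mk.
rewrite -[leRHS]mule1 -(L1norm_mollifier_shift mk x) -(ger0_norm B0) -L1normZ//.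
apply: L1norm_le; [exact: measurable_funM|exact: measurable_funM|].
by move=> y; rewrite !normrM mulrC ler_wpM2r// (ger0_norm B0).
Qed.

Notation cut g j := (fun x => g x * \1_(~` [set y : X | `|g y| <= j]) x).

Variables (C c L : R) (e : V).
Hypotheses (C0 : 0 < C) (c0 : 0 < c) (L0 : 0 < L) (eL : forall i, `|e ord0 i| + c <= L) (rho0_gt0 : 0 < rho0).

(** Cut [g] at a height [j] where its tail has small energy. The bounded part is handled by L1
    convergence and [phase_bounded], the tail by [energy_moll], whose pointwise hypothesis is only
    available for the tail and for [t] small depending on [j]. *)
Lemma local_approx g (be K : R) : mu.-integrable setT (EFin \o (g : X -> R)) ->
  (forall x, ~ D x -> g x = 0) -> (L1norm mu (fun x : X => phase x (g x)) < +oo)%E ->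
  0 <= K -> be * (q - p) <= kb * q ->
  (forall j : nat, exists2 d : R, 0 < d & forall t k, 0 < t -> t < d ->
     mollifier C (- (t *: e)) (t * c) k -> forall x, `|moll k (cut g j%:R) x| <= K * t `^ (- be)) ->
  forall eps : R, 0 < eps -> exists2 d : R, 0 < d & forall t k, 0 < t -> t < d ->
    mollifier C (- (t *: e)) (t * c) k ->
    (L1norm mu (fun x : X => indD x * phase x (moll k g x - g x))%R <= eps%:E)%E.
Proof.
move=> ig gD goo K0 beq Hb eps e0; have /integrable_L1norm[mg _] := ig.
pose c1 := (2 * Cb) `^ q * 2 `^ (q - 1) * (2 `^ (q - 1) * A) * (C * (L *+ 2 / c) ^+ n) `^ q.
pose c2 := (2 * Cb) `^ q * 2 `^ (q - 1) * L `^ (kb * q) * K `^ (q - p) * `|M|.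
have c10 : 0 <= c1 by rewrite !mulr_ge0 ?powR_ge0// ltW.
have c20 : 0 <= c2 by rewrite !mulr_ge0 ?powR_ge0.
pose K2 : R := 2 `^ (q - 1); have K20 : 0 < K2 by rewrite powR_gt0.
(* In [2 + c1 + c2], one unit is for the p-power of the mollified tail, one for the tail itself, and
   [c1 + c2] for the weighted part; [K2] appears once for each use of the quasi-triangle
   inequality. *)
pose e1 := eps / 2 / (K2 * (K2 * (2 + c1 + c2))).
have c12 : 0 < 2 + c1 + c2 by rewrite -addrA ltr_wpDr// addr_ge0.
have e10 : 0 < e1 by rewrite !divr_gt0// !mulr_gt0.
have mph := measurable_phase mg.
have iph : mu.-integrable setT (EFin \o (fun x : X => phase x (g x))).
  by apply/integrable_L1norm.
pose B (j : nat) : set X := [set y : X | `|g y| <= j%:R].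
have mB j : measurable (B j).
  have mN : measurable_fun setT (fun x : X => `|g x|) by exact: measurableT_comp.
  have -> : B j = setT `&` (fun x : X => `|g x|) @^-1` `]-oo, j%:R].
    by rewrite setTI; apply/seteqP; split=> x /=; rewrite /B/= in_itv.
  by apply: mN => //; exact: measurable_itv.
have := L1norm_tail e10 iph mB; case.
  by move=> x; near=> j; near: j; exact: nbhs_infty_ger.
move=> j _ /(_ j (leqnn j)) Hj.
pose g1 x := g x * \1_(B j) x; pose g2 x := g x * \1_(~` B j) x.
have mI1 : measurable_fun setT (\1_(B j) : X -> R) by exact: measurable_indic.
have mI2 : measurable_fun setT (\1_(~` B j) : X -> R) by apply: measurable_indic; exact: measurableC.
have mg1 : measurable_fun setT (g1 : X -> R) by exact: measurable_funM.
have mg2 : measurable_fun setT (g2 : X -> R) by exact: measurable_funM.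
have indle (E : set X) x : `|\1_E x : R| <= 1 by rewrite indicE; case: (_ \in _); rewrite ?normr1 ?normr0.
have ig1 : mu.-integrable setT (EFin \o (g1 : X -> R)).
  by apply: eq_integrable (integrable_bounded_mul mI1 (indle _) ig) => // x _; rewrite /= mulrC.
have ig2 : mu.-integrable setT (EFin \o (g2 : X -> R)).
  by apply: eq_integrable (integrable_bounded_mul mI2 (indle _) ig) => // x _; rewrite /= mulrC.
have g12 x : g x = g1 x + g2 x.
  rewrite /g1 /g2 !indicE in_setC; case: (x \in _) => /=; lra.
have g2D x : ~ D x -> g2 x = 0 by move=> /gD; rewrite /g2 => ->; rewrite mul0r.
have g1B x : `|g1 x| <= j.+1%:R.
  rewrite /g1 indicE; have [Bx|nBx] := pselect (B j x); last by rewrite memNset// mulr0 normr0.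
  by rewrite mem_set// mulr1 (le_trans Bx)// ler_nat.
have ph2 : (L1norm mu (fun x : X => phase x (g2 x)) <= e1%:E)%E.
  apply: le_trans Hj; rewrite le_eqVlt; apply/orP; left; apply/eqP.
  apply: eq_integral => x _; congr (`|_|%:E); rewrite /g2 indicE.
  by case: (x \in _); rewrite /= ?mulr1// !mulr0 phase0.
have p2 : (L1norm mu (fun x : X => `|g2 x| `^ p)%R <= e1%:E)%E.
  apply: le_trans ph2; apply: L1norm_le.
  - by apply: (measurableT_comp (measurable_powR _)); exact: measurableT_comp.
  - exact: measurable_phase.
  - move=> x; rewrite (ger0_norm (powR_ge0 _ _)) (ger0_norm (phase_ge0 _ _)) lerDl.
    by rewrite mulr_ge0// powR_ge0.
have q2 : (L1norm mu (fun x : X => w x * (b x * `|g2 x|) `^ q)%R <= e1%:E)%E.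
  apply: le_trans ph2; apply: L1norm_le.
  - apply: measurable_funM => //; apply: (measurableT_comp (measurable_powR _)).
    by apply: measurable_funM => //; exact: measurableT_comp.
  - exact: measurable_phase.
  - move=> x; have H : 0 <= w x * (b x * `|g2 x|) `^ q by rewrite mulr_ge0// powR_ge0.
    by rewrite (ger0_norm H) (ger0_norm (phase_ge0 _ _)) lerDr powR_ge0.
pose BB : R := j.+1%:R + j.+1%:R.
pose Cj := BB `^ (p - 1) + `|M| * `|Mb| `^ q * BB `^ (q - 1).
have Cj0 : 0 <= Cj by rewrite addr_ge0 ?mulr_ge0 ?powR_ge0.
pose del := eps / 2 / (K2 * (Cj + 1)).
have Cj1 : 0 < Cj + 1 by rewrite ltr_wpDl.
have del0 : 0 < del by rewrite !divr_gt0// mulr_gt0.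
have [d1 d10 Hd1] := moll_L1_near ig1 del0.
have [d2 d20 Hd2] := Hb j.
(* Four smallness conditions: [t <= 1], the range of the pointwise bound, doubled cubes below the
   scale [rho0], and kernels within the L1 modulus of continuity of [g1]. *)
pose d := Num.min (Num.min 1 d2) (Num.min (rho0 / (L * 2)) (d1 / L)).
have L2 : 0 < L * 2 by rewrite mulr_gt0.
exists d; first by rewrite !lt_min ltr01 d20 !divr_gt0.
move=> t k t0; rewrite !lt_min => /andP[/andP[t1 td2] /andP[trho td1]] mk.
have sk : bsmooth k by case: mk.
have mS f : mu.-integrable setT (EFin \o (f : X -> R)) -> measurable_fun setT (moll k f : X -> R).
  by move=> jf; apply: C1b_measurable; apply: bsmooth_C1b; exact: moll_bsmooth.
have mS1 := mS _ ig1; have mS2 := mS _ ig2; have mSg := mS _ ig.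
have tc0 : 0 < t * c by rewrite mulr_gt0.
have H1 : (L1norm mu (fun x : X => moll k g1 x - g1 x)%R <= del%:E)%E.
  apply: (Hd1 _ _ _ _ mk) => i; rewrite !mxE normrN normrM (gtr0_norm t0) -mulrDr.
  apply: le_trans (ler_wpM2l (ltW t0) (eL i)) _.
  by rewrite -ler_pdivlMr// ltW.
have H2 := energy_moll oD mw w0 wM p1 pq q1 A0 Doo wA mb b0 bM Cb0 bZ
  mk C0 c0 L0 t0 (ltW t1) eL _ K0 beq ig2 g2D (Hd2 t k t0 td2 mk).
have {}H2 : (L1norm mu (fun x : X => indD x * (w x * (b x * `|moll k g2 x|) `^ q))%R <= ((c1 + c2) * e1)%:E)%E.
  apply: le_trans (H2 _) _.
    by rewrite -mulr_natr -mulrA -ltr_pdivlMr.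
  rewrite [(c1 + c2) * _]mulrDl EFinD (EFinM c1) (EFinM c2).
  by apply: leeD; apply: lee_wpmul2l.
have H3 := le_trans (moll_Lp mk p1 ig2) p2.
have msub f h : measurable_fun setT (f : X -> R) -> measurable_fun setT (h : X -> R) ->
    measurable_fun setT (fun x : X => f x - h x) by exact: measurable_funB.
have mnorm f (r : R) : measurable_fun setT (f : X -> R) -> measurable_fun setT (fun x : X => `|f x| `^ r).
  by move=> mf; apply: (measurableT_comp (measurable_powR _)); exact: measurableT_comp.
have mbS : measurable_fun setT (fun x : X => (b x * `|moll k g2 x|) `^ q).
  apply: (measurableT_comp (measurable_powR _)).
  by apply: measurable_funM => //; exact: measurableT_comp.
have S2 : (L1norm mu (fun x : X => indD x * phase x (moll k g2 x))%R <= ((1 + c1 + c2) * e1)%:E)%E.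
  rewrite -[1 + c1 + c2]addrA mulrDl mul1r EFinD; apply: le_trans (leeD H3 H2).
  apply: L1norm_triangle.
  - exact: mnorm.
  - by apply: measurable_funM => //; exact: measurable_funM.
  - by apply: measurable_funM => //; exact: measurable_phase.
  - move=> x; rewrite /phase mulrDr (le_trans (ler_normD _ _))// lerD2r normrM ler_piMl//.
have S1 : (L1norm mu (fun x : X => indD x * phase x (moll k g1 x - g1 x))%R <= (Cj * del)%:E)%E.
  apply: (@le_trans _ _ (L1norm mu (fun x : X => Cj * (moll k g1 x - g1 x))%R)); last first.
    rewrite L1normZ; last exact: msub.
    by rewrite (ger0_norm Cj0) EFinM; apply: lee_wpmul2l.
  apply: L1norm_le.
  - by apply: measurable_funM => //; apply: measurable_phase; exact: msub.
  - by apply: measurable_funM => //; exact: msub.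
  - move=> x; rewrite indicE; have [Dx|nDx] := pselect (D x); last by rewrite memNset// mul0r normr0.
    rewrite mem_set// mul1r (ger0_norm (phase_ge0 _ _)) normrM (ger0_norm Cj0).
    apply: phase_bounded => //; apply: le_trans (ler_normB _ _) _; apply: lerD => //.
    exact: (moll_sup x mk ig1 g1B).
have gE : (fun x => moll k g x - g x) = (fun x => (moll k g1 x - g1 x) + (moll k g2 x - g2 x)).
  apply/funext => x; rewrite (_ : moll k g x = moll k g1 x + moll k g2 x).
    by rewrite {1}g12 opprD addrACA.
  rewrite -(mollD x (bsmooth_C1b sk) ig1 ig2); congr (moll k _ x).
  by apply/funext => y; exact: g12.
have indD01 x : 0 <= indD x <= 1 by rewrite indicE; case: (_ \in _); rewrite /= ?lexx ?ler01.
have core1 (i F F1 F2 : R) : 0 <= i <= 1 -> 0 <= F -> 0 <= F1 -> 0 <= F2 -> F <= K2 * (F1 + F2) ->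
    `|i * F| <= `|K2 * (i * F1)| + `|K2 * (i * F2)|.
  move=> /andP[i0 _] F0 F10 F20 H; rewrite !ger0_norm ?mulr_ge0 ?(ltW K20)//.
  by rewrite -!mulrDr mulrCA ler_wpM2l.
have core2 (i F F1 F2 : R) : 0 <= i <= 1 -> 0 <= F -> 0 <= F1 -> 0 <= F2 -> F <= K2 * (F1 + F2) ->
    `|K2 * (i * F)| <= `|K2 * (K2 * (i * F1))| + `|K2 * (K2 * F2)|.
  move=> /andP[i0 i1] F0 F10 F20 H; rewrite !ger0_norm ?mulr_ge0 ?(ltW K20)//.
  rewrite -mulrDr ler_wpM2l ?(ltW K20)// -mulrDr; apply: le_trans (ler_wpM2l i0 H) _.
  by rewrite mulrCA ler_wpM2l ?(ltW K20)// mulrDr lerD2l ler_piMl.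
apply: (@le_trans _ _ (L1norm mu (fun x : X => K2 * (indD x * phase x (moll k g1 x - g1 x)))%R +
  (L1norm mu (fun x : X => K2 * (K2 * (indD x * phase x (moll k g2 x))))%R +
   L1norm mu (fun x : X => K2 * (K2 * phase x (g2 x)))%R))%E); last first.
  rewrite !L1normZ; try by do ? [apply: measurable_funM => //|apply: measurable_phase => //|exact: msub].
  rewrite (gtr0_norm K20).
  apply: (@le_trans _ _ (K2%:E * (Cj * del)%:E + (K2%:E * (K2%:E * ((1 + c1 + c2) * e1)%:E) +
      K2%:E * (K2%:E * e1%:E)))%E).
    have K2e : (0 <= K2%:E)%E by rewrite lee_fin ltW.
    by apply: leeD; [exact: lee_wpmul2l|apply: leeD; do 2! apply: lee_wpmul2l => //].
  rewrite -!EFinM -!EFinD lee_fin.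
  have E1 : K2 * (K2 * (2 + c1 + c2)) * e1 = eps / 2.
    by rewrite mulrC divfK// gt_eqF// !mulr_gt0.
  have E2 : K2 * (Cj + 1) * del = eps / 2 by rewrite mulrC divfK// gt_eqF// mulr_gt0.
  have E3 : 0 <= K2 * del by rewrite mulr_ge0// ltW.
  move: E1 E2; rewrite !mulrDr !mulrDl; lra.
apply: (@le_trans _ _ (L1norm mu (fun x : X => K2 * (indD x * phase x (moll k g1 x - g1 x)))%R +
  L1norm mu (fun x : X => K2 * (indD x * phase x (moll k g2 x - g2 x)))%R)%E).
  apply: L1norm_triangle.
  - by do ? [apply: measurable_funM => //|apply: measurable_phase => //|exact: msub].
  - by do ? [apply: measurable_funM => //|apply: measurable_phase => //|exact: msub].
  - by do ? [apply: measurable_funM => //|apply: measurable_phase => //|exact: msub].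
  - move=> x; rewrite (congr1 (fun h => h x) gE); apply: core1; rewrite ?phase_ge0 ?indD01//.
    by apply: phase_add; exact: ler_normD.
apply: leeD => //; apply: L1norm_triangle.
- by do ? [apply: measurable_funM => //|apply: measurable_phase => //|exact: msub].
- by do ? [apply: measurable_funM => //|apply: measurable_phase => //|exact: msub].
- by do ? [apply: measurable_funM => //|apply: measurable_phase => //|exact: msub].
- move=> x; apply: core2; rewrite ?phase_ge0 ?indD01//.
  by apply: phase_add; exact: ler_normB.
Unshelve. all: by end_near. Qed.

(** The p-norm does not increase under cutting, so the bound is uniform in [j]. *)
Lemma cut_bound_Lp g : mu.-integrable setT (EFin \o (g : X -> R)) ->
  (L1norm mu (fun x : X => `|g x| `^ p)%R < +oo)%E ->
  exists2 K : R, 0 <= K & forall (j t : R) k, 0 < t -> mollifier C (- (t *: e)) (t * c) k ->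
    forall x, `|moll k (cut g j) x| <= K * t `^ (- (n%:R / p)).
Proof.
move=> ig goo; have /integrable_L1norm[mg _] := ig.
set I := L1norm mu (fun x : X => `|g x| `^ p) in goo.
have IE : I = (fine I)%:E by rewrite fineK// ge0_fin_numE// L1norm_ge0.
have I0 : 0 <= fine I by rewrite fine_ge0// L1norm_ge0.
have Cc0 : 0 <= C * c ^- n * fine I by rewrite !mulr_ge0 ?invr_ge0 ?exprn_ge0// ltW.
exists ((C * c ^- n * fine I) `^ p^-1); first exact: powR_ge0.
move=> j t k t0 mk x; have tc0 : 0 < t * c by rewrite mulr_gt0.
have mB : measurable (~` [set y : X | `|g y| <= j] : set X).
  apply: measurableC; have mN : measurable_fun setT (fun x : X => `|g x|) by exact: measurableT_comp.
  have -> : [set y : X | `|g y| <= j] = setT `&` (fun x : X => `|g x|) @^-1` `]-oo, j].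
    by rewrite setTI; apply/seteqP; split=> y /=; rewrite in_itv.
  by apply: mN => //; exact: measurable_itv.
have mI : measurable_fun setT (\1_(~` [set y : X | `|g y| <= j]) : X -> R) by exact: measurable_indic.
have indle y : `|\1_(~` [set y : X | `|g y| <= j]) y : R| <= 1.
  by rewrite indicE; case: (_ \in _); rewrite ?normr1 ?normr0.
have ic : mu.-integrable setT (EFin \o (cut g j : X -> R)).
  by apply: eq_integrable (integrable_bounded_mul mI indle ig) => // y _; rewrite /= mulrC.
have /integrable_L1norm[mc _] := ic.
have H := moll_sup_Lp mk C0 tc0 x p1 ic.
have {}H : `|moll k (cut g j) x| `^ p <= C * (t * c) ^- n * fine I.
  rewrite -lee_fin; apply: (le_trans H); rewrite [leRHS]EFinM -IE; apply: lee_wpmul2l.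
    by rewrite lee_fin mulr_ge0 ?(ltW C0)// invr_ge0 exprn_ge0// ltW.
  apply: L1norm_le.
  - by apply: (measurableT_comp (measurable_powR _)); exact: measurableT_comp.
  - by apply: (measurableT_comp (measurable_powR _)); exact: measurableT_comp.
  - move=> y; rewrite (ger0_norm (powR_ge0 _ _)) [leRHS](ger0_norm (powR_ge0 _ _)).
    apply: ge0_ler_powR; rewrite ?nnegrE ?(ltW p0)//.
    by rewrite normrM ler_piMr.
have pn0 : p != 0 by rewrite gt_eqF.
rewrite -[leLHS](powRr1 (normr_ge0 _)) -[X in _ `^ X <= _](mulfV pn0) powRrM.
have -> : (C * c ^- n * fine I) `^ p^-1 * t `^ (- (n%:R / p)) = (C * (t * c) ^- n * fine I) `^ p^-1.
  have -> : - (n%:R / p) = - n%:R * p^-1 by rewrite mulNr.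
  rewrite powRrM powR_invn ?(ltW t0)// -powRM ?invr_ge0 ?exprn_ge0 ?(ltW t0)//.
  by congr (_ `^ _); rewrite exprMn invfM; lra.
by apply: ge0_ler_powR => //; rewrite ?nnegrE ?powR_ge0 ?invr_ge0 ?(ltW p0)// !mulr_ge0 ?invr_ge0 ?exprn_ge0// ltW.
Qed.

(** The gradient bound holds for all of [g]. Removing the part below height [j] changes the
    mollification by at most [j], which is less than [1 / t] once [t < 1 / (j + 1)]; hence
    [K + 1]. *)
Lemma cut_bound_gradient g (K : R) : mu.-integrable setT (EFin \o (g : X -> R)) -> 0 <= K ->
  (forall t k, 0 < t -> mollifier C (- (t *: e)) (t * c) k -> forall x, `|moll k g x| <= K / t) ->
  forall j : nat, exists2 d : R, 0 < d & forall t k, 0 < t -> t < d ->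
    mollifier C (- (t *: e)) (t * c) k -> forall x, `|moll k (cut g j%:R) x| <= (K + 1) * t `^ (- 1).
Proof.
move=> ig K0 HK j; exists j.+1%:R^-1 => [|t k t0 tj mk x]; first by rewrite invr_gt0.
have /integrable_L1norm[mg _] := ig.
pose B : set X := [set y : X | `|g y| <= j%:R].
have mB : measurable B.
  have mN : measurable_fun setT (fun x : X => `|g x|) by exact: measurableT_comp.
  have -> : B = setT `&` (fun x : X => `|g x|) @^-1` `]-oo, j%:R].
    by rewrite setTI; apply/seteqP; split=> y /=; rewrite /B /= in_itv.
  by apply: mN => //; exact: measurable_itv.
have mI : measurable_fun setT (\1_B : X -> R) by exact: measurable_indic.
have mIN : measurable_fun setT (fun x => - \1_B x : R) by exact: measurableT_comp.
have indle y : `|- \1_B y : R| <= 1.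
  by rewrite normrN indicE; case: (_ \in _); rewrite ?normr1 ?normr0.
have i1 : mu.-integrable setT (EFin \o (fun y : X => - \1_B y * g y)).
  exact: (integrable_bounded_mul mIN indle ig).
have cutE : cut g j%:R = (fun y => g y + (- \1_B y * g y)).
  by apply/funext => y; rewrite !indicE in_setC; case: (y \in _) => /=; lra.
have sk : bsmooth k by case: mk.
rewrite cutE (mollD x (bsmooth_C1b sk) ig i1) (le_trans (ler_normD _ _))// mulrDl.
rewrite powR_inv1 ?(ltW t0)// mul1r lerD//; first exact: HK.
apply: (@le_trans _ _ j.+1%:R); last by rewrite -[leLHS]invrK lef_pV2 ?posrE ?invr_gt0// ltW.
apply: (moll_sup x mk i1) => y; rewrite indicE; have [By|nBy] := pselect (B y).
  by rewrite mem_set// mulN1r normrN (le_trans By)// ler_nat.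
by rewrite memNset// oppr0 mul0r normr0.
Qed.

End local_approximation.

(** * Approximation up to the boundary *)

Section cutoff.
Context (R : realType) (n : nat).
Notation X := (borel_rV R n).
Notation V := ('rV[R]_n).
Notation mu := (@borel_lebesgue R n).
Local Notation e i := (delta_mx ord0 i : V).
Implicit Types (u v k : V -> R).

Lemma pderiv_near_cst u (c : R) i (x : V) : (\forall y \near x, u y = c) -> pderiv i u x = 0.
Proof.
move=> H; have H' : \forall y \near x, (cst c : V -> R) y = u y.
  by apply: filterS H => y ->.
by rewrite /pderiv; have [_ ->] := near_eq_is_derive H' (is_derive_cst c x (e i)).
Qed.

Lemma ball_cube_triangle (x y z : V) (r a : R) : 0 < a -> ball z r x ->
  (forall i, `|(y - x) ord0 i| < a) -> ball z (r + a) y.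
Proof.
move=> a0 zx H; apply: ball_triangle zx _; rewrite ball_box// => i.
by have := H i; rewrite !mxE /rV_coord distrC.
Qed.

Lemma moll_eq0 k v (x : V) : (forall y, k (y - x) != 0 -> v y = 0) -> moll k v x = 0.
Proof.
move=> H; rewrite /moll /Rintegral integral0_eq// => y _; congr EFin.
by have [->|/H ->] := eqVneq (k ((y : V) - x)) 0; rewrite ?mul0r ?mulr0.
Qed.

(** The indicator of the ball of radius [3 r / 2], mollified at scale [r / 2]. *)
Lemma cutoff_exists (z : V) (r : R) : 0 < r -> exists chi : V -> R,
  [/\ C1b chi, forall x, 0 <= chi x <= 1, forall x, ball z r x -> chi x = 1 &
      forall x, ~ ball z (r *+ 2) x -> chi x = 0].
Proof.
move=> r0; pose s := r / 2; have s0 : 0 < s by rewrite divr_gt0.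
have [C C0 moll_ex] := mollifier_exists R n; have [k mk] := moll_ex 0 _ s0.
have [sk k0 ks ki _ _] := mk; have ik := mollifier_integrable mk.
pose B : set X := ball z (r + s).
have mB : measurable B by exact: measurable_ball_rV.
have iB : mu.-integrable setT (EFin \o (\1_B : X -> R)).
  have E := borel_lebesgue_ball z (addr_gt0 r0 s0).
  by apply: integrable_indic_lty => //; rewrite [X in (X < _)%E]E ltry.
have mks (x : V) : measurable_fun setT (fun y : X => k ((y : V) - x)).
  by apply: measurable_reflect; have [] := bsmooth_C1b sk.
have iks (x : V) : mu.-integrable setT (EFin \o (fun y : X => k ((y : V) - x))).
  exact: (integrable_shift (- x) ik).
have int1 (x : V) : \int[mu]_y k ((y : V) - x) = 1.
  rewrite (Rintegral_shift (- x) (f := k)); first by rewrite /Rintegral ki.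
  by apply: C1b_measurable; exact: bsmooth_C1b.
have cube (y x : V) : k (y - x) != 0 -> forall i, `|(y - x) ord0 i| < s.
  by move=> /ks H i; have := H i; rewrite [X in _ - X]mxE subr0.
exists (moll k \1_B); split.
- by apply: bsmooth_C1b; exact: moll_bsmooth.
- move=> x; apply/andP; split.
    by apply: Rintegral_ge0 => y _; rewrite mulr_ge0// indicE.
  apply: le_trans (ler_norm _) _; apply: (moll_sup x mk iB) => y.
  by rewrite indicE; case: (_ \in _); rewrite ?normr1 ?normr0.
- move=> x zx; rewrite /moll -(int1 x); apply: eq_Rintegral => y _.
  have [->|/cube H] := eqVneq (k ((y : V) - x)) 0; first by rewrite mul0r.
  by rewrite indicE mem_set ?mulr1//; exact: ball_cube_triangle H.
- move=> x nzx; apply: moll_eq0 => y /cube H; rewrite indicE memNset// => zy; apply: nzx.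
  have -> : r *+ 2 = r + s + s by rewrite mulr2n -addrA -splitr.
  by apply: ball_cube_triangle zy _ => // i; have := H i; rewrite !mxE distrC.
Qed.

Lemma pderiv_cst (c : R) i (x : V) : pderiv i (fun=> c) x = 0.
Proof. by apply: (@pderiv_near_cst _ c); near=> y. Unshelve. all: by end_near. Qed.

Lemma C1b_onem u : C1b u -> C1b (fun x => 1 - u x) /\
  forall i x, pderiv i (fun x => 1 - u x) x = - pderiv i u x.
Proof.
move=> [cu du cdu [K [K1 K2]]].
have D i x : is_derive x (e i) (fun x => 1 - u x) (- pderiv i u x).
  refine (is_derive_eq (is_deriveB (is_derive_cst (1 : R) x (e i)) (is_derive_pderiv (du x i))) _).
  exact: sub0r.
have E i x : pderiv i (fun x => 1 - u x) x = - pderiv i u x by have [_] := D i x.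
have E' i : pderiv i (fun x => 1 - u x) = (fun x => - pderiv i u x) by apply/funext => x; exact: E.
split; last exact: E; split.
- by move=> x; apply: continuousB; [exact: cst_continuous|exact: cu].
- by move=> x i; have [] := D i x.
- by move=> i; rewrite E' => x; apply: continuousN; exact: cdu.
- have K0 : 0 <= K by apply: le_trans (K1 0).
  exists (1 + K); split=> [x|i x].
    by rewrite (le_trans (ler_normB _ _))// normr1 lerD2l.
  by rewrite E normrN (le_trans (K2 i x))// lerDr.
Qed.

Lemma Cc_infty0 (D : set V) : Cc_infty D (fun=> 0).
Proof.
have E : [set x : V | (0 : R) != 0] = set0 by apply/seteqP; split=> // x /=; rewrite eqxx.
split; last by rewrite E closure0.
- apply: (@smooth_coind _ _ [set f | f = fun=> 0]) => // _ ->; split.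
  + exact: cst_continuous.
  + by move=> x i; exact: derivable_cst.
  + by move=> i; apply/funext => x; exact: pderiv_cst.
- by rewrite E closure0; exact: compact0.
Qed.

Lemma Cc_inftyD (D : set V) phi psi : Cc_infty D phi -> Cc_infty D psi ->
  Cc_infty D (fun x => phi x + psi x).
Proof.
move=> [s1 c1 D1] [s2 c2 D2].
have sub : closure [set x | phi x + psi x != 0] `<=`
    closure [set x | phi x != 0] `|` closure [set x | psi x != 0].
  rewrite -closureU; apply: closureS => x /= H; apply: contrapT => /not_orP[].
  by move=> /negP/negPn/eqP phi0 /negP/negPn/eqP psi0; move: H; rewrite phi0 psi0 addr0 eqxx.
split; first exact: smoothD.
- by apply: subclosed_compact sub; [exact: closed_closure|exact: compactU].
- by move=> x /sub[/D1|/D2].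
Qed.

End cutoff.

Section patch.
Context (R : realType) (n : nat).
Notation X := (borel_rV R n).
Notation V := ('rV[R]_n).
Notation mu := (@borel_lebesgue R n).

(* Points of the closure of D near x are pushed inside D, together with a cube,
   by a small displacement along e. *)
Definition inward (D : set V) (x : V) (r : R) (e : V) (c t0 : R) :=
  forall (y z : V) (t : R), closure D y -> ball x r y -> 0 < t -> t < t0 ->
    (forall i, `|z ord0 i| <= t * c) -> D (y + t *: e + z).

(** The support of the mollified function lies in the sum of a compact part of the closure of [D],
    the vector [t e] and a closed cube. This sum is compact, and [inward] places it inside [D]. *)
Lemma moll_Cc_infty (D : set V) (x e : V) (r r' c t t0 C : R) k (v : V -> R) :
  bounded_set D -> mollifier C (- (t *: e)) (t * c) k -> 0 < t -> t < t0 ->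
  inward D x r e c t0 -> 0 < r ->
  mu.-integrable setT (EFin \o (v : X -> R)) -> r' < r ->
  (forall y, v y != 0 -> D y /\ ball x r' y) -> Cc_infty D (moll k v).
Proof.
move=> bD mk tpos tt0 HD r0 iv rr vs; have [sk _ ks _ _ _] := mk.
pose S : set V := closure D `&` [set y | forall i, `|y ord0 i - x ord0 i| <= r'].
have cS : compact S.
  rewrite /S setIC; apply: compact_closedI; first exact: compact_cube.
  exact: closed_closure.
pose Q : set V := [set z : V | forall i, `|z ord0 i - (0 : V) ord0 i| <= t * c].
pose h (yz : V * V) := yz.1 + t *: e + yz.2.
have ch : continuous h.
  move=> yz; apply: cvgD; last exact: cvg_snd.
  by apply: cvgD; [exact: cvg_fst|exact: cvg_cst].
have cSQ : compact (h @` (S `*` Q)).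
  apply: continuous_compact; first exact: continuous_subspaceT.
  by apply: compact_setX => //; exact: compact_cube.
have sub : closure [set y | moll k v y != 0] `<=` h @` (S `*` Q).
  rewrite [X in _ `<=` X](proj1 (closure_id _) (compact_closed (@norm_hausdorff _ _) cSQ)).
  apply: closureS => y /= ny; apply: contrapT => nh; move/negP: ny; apply; apply/eqP.
  apply: moll_eq0 => u ku; apply/eqP/negPn/negP => /vs[Du ru]; apply: nh.
  exists (u, y - u - t *: e); last first.
    by rewrite /h /= -[y - u - _]addrA -opprD [LHS]addrC subrK.
  split=> /=; first split; first exact: subset_closure.
    move=> i; move: (ru); rewrite ball_box; last by case: ru.
    by move=> /(_ i); rewrite /rV_coord distrC => /ltW.
  move=> i; have := ks _ i ku; rewrite !mxE opprK subr0 => /ltW.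
  by rewrite -[X in _ -> X <= _]normrN !opprD !opprK [- _ + _]addrC.
split.
- by apply: bsmooth_smooth; exact: moll_bsmooth.
- by apply: subclosed_compact sub => //; exact: closed_closure.
- move=> y /sub[[u z] [[Du ur] zc]] <-; rewrite /h /=; apply: (HD u z t) => //.
  - rewrite ball_box// => i; apply: le_lt_trans rr.
    by have := ur i; rewrite distrC.
  - by move=> i; have := zc i; rewrite mxE subr0.
Qed.

End patch.

Section core.
Context (R : realType) (n : nat).
Notation X := (borel_rV R n).
Notation V := ('rV[R]_n).
Notation mu := (@borel_lebesgue R n).
Variables (D : set V) (w b : X -> R) (p q A rho0 M Mb Cb kb : R).
Hypotheses (n0 : (0 < n)%N) (oD : open D) (bD : bounded_set D).
Hypotheses (mw : measurable_fun setT w) (w0 : forall x, 0 <= w x).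
Hypotheses (wM : forall x, D x -> w x <= M) (p1 : 1 <= p) (pq : p <= q) (q1 : 1 < q) (A0 : 0 < A).
Hypotheses (Doo : (mu (D : set X) < +oo)%E) (rho0_gt0 : 0 < rho0) (wA : cube_muckenhoupt D w q A rho0).
Hypotheses (mb : measurable_fun setT b) (b0 : forall x, 0 <= b x).
Hypotheses (bM : forall x, D x -> b x <= Mb) (Cb0 : 0 < Cb) (kb0 : 0 <= kb).
Hypothesis (bZ : forall (x y : V) (rho : R), D x -> D y -> 0 < rho ->
  (forall i, `|x ord0 i - y ord0 i| < rho) -> b x <= Cb * (b y + rho `^ kb)).
Hypothesis (q_le : q <= p + kb * q * Num.max 1 (p / n%:R)).
Notation indD := (\1_(D : set X) : X -> R).
Notation phase := (phase w b p q).
Implicit Types (u v phi : V -> R) (G : 'I_n -> V -> R).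

Let p0 : 0 < p. Proof. exact: lt_le_trans p1. Qed.

(** The source of the exponent beta = 1: the derivative falls on the kernel, whose gradient has L1
    norm of order [1 / a], against a bounded [v]. *)
Lemma gradient_moll_bound (C a B : R) (c : V) k v G i x : mollifier C c a k -> 0 < C -> 0 < a ->
  wdiff v G -> (forall x, `|v x| <= B) -> `|moll k (G i) x| <= B * C * 4 ^+ n / a.
Proof.
move=> mk C0 a0 wv vB; have [sk _ ks _ _ kd] := mk.
have [iv _ _] := wv; have /integrable_L1norm[mv _] := iv.
have B0 : 0 <= B by apply: le_trans (vB 0).
have a2 : 0 < a *+ 2 by rewrite mulrn_wgt0.
rewrite -(wdiff_moll i x wv sk); have [_ E] := moll_pderiv i x sk iv.
rewrite /pderiv E; have sdk := bsmoothN (bsmooth_pderiv i sk).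
have Cdk := bsmooth_C1b sdk; have [cdk _ _ [K [K1 _]]] := Cdk.
have md := measurable_reflect x cdk.
have id_ := integrable_bounded_mul md (fun y => K1 _) iv.
rewrite -lee_fin; apply: le_trans (normr_Rintegral_L1norm id_) _.
have mdk : measurable_fun setT (fun z : X => - pderiv i k z) by exact: continuous_borel.
apply: (@le_trans _ _ (B%:E * L1norm mu (fun z : X => - pderiv i k z)%R)%E).
  rewrite -(L1norm_shift (- x) mdk) -{1}(ger0_norm B0) -L1normZ//.
  apply: L1norm_le; [exact: measurable_funM|exact: measurable_funM|].
  by move=> y; rewrite !normrM mulrC ler_wpM2r// (ger0_norm B0).
rewrite -!mulrA EFinM; apply: lee_wpmul2l; first by rewrite lee_fin.
(* The derivative is shown to vanish off the doubled cube, whose volume [(4 a)^n] explains the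
   factor [4 ^+ n]. *)
have Hd z : ~ ball c (a *+ 2) z -> - pderiv i k z = 0.
  move=> nz; rewrite (@pderiv_near_cst _ _ _ 0) ?oppr0//.
  apply: filterS (nbhsx_ballx z a a0) => y zy.
  apply/eqP/negPn/negP => ky; apply: nz; rewrite mulr2n; apply: (@ball_triangle _ _ y).
    by rewrite ball_box// => j; rewrite distrC; exact: ks.
  exact: ball_sym.
apply: le_trans (L1norm_bounded_on (K := C * a ^- n / a) mdk _ Hd _) _.
- exact: measurable_ball_rV.
- by move=> z; rewrite normrN; exact: kd.
- rewrite [X in (_ * X <= _)%E](borel_lebesgue_ball c a2) -EFinM lee_fin.
  rewrite le_eqVlt; apply/orP; left; apply/eqP.
  have -> : a *+ 2 *+ 2 = 4 * a by lra.
  rewrite exprMn; have an0 : a ^+ n != 0 by rewrite gt_eqF// exprn_gt0.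
  have := mulVf an0; set v1 := a ^- n; set v2 := a ^+ n => E1.
  have -> : C * v1 / a * (4 ^+ n * v2) = C * (4 ^+ n * a^-1) * (v1 * v2) by lra.
  by rewrite E1 mulr1.
Qed.

(** The two regimes of the exponent condition meet here: the bound from [|v| <= B] is used for
    [p <= n] and the bound from the p-norm of the gradient otherwise. A single [t] serves all
    components. *)
Lemma patch_approx x e (r r' c t0 B : R) v G : wdiff v G -> (forall y, `|v y| <= B) ->
  inward D x r e c t0 -> 0 < r -> r' < r -> 0 < c -> 0 < t0 ->
  (forall y, v y != 0 -> D y /\ ball x r' y) -> (forall i y, ~ D y -> G i y = 0) ->
  (forall i, (L1norm mu (fun y : X => phase y (G i y)) < +oo)%E) ->
  forall eps : R, 0 < eps -> exists2 phi, Cc_infty D phi &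
    forall i, (L1norm mu (fun y : X => indD y * phase y (pderiv i phi y - G i y))%R <= eps%:E)%E.
Proof.
move=> wv vB inw r0 rr c0 t00 vs GD Goo eps e0; have [iv iG _] := wv.
have [C C0 moll_ex] := mollifier_exists R n.
pose L := \sum_i `|e ord0 i| + c.
have L0 : 0 < L by rewrite ltr_wpDl// sumr_ge0.
have eL i : `|e ord0 i| + c <= L by rewrite lerD2r (bigD1 i)//= lerDl sumr_ge0.
have B0 : 0 <= B by apply: le_trans (vB 0).
have gp i : (L1norm mu (fun x : X => `|G i x| `^ p)%R < +oo)%E.
  apply: le_lt_trans (Goo i); have /integrable_L1norm[mg _] := iG i; apply: L1norm_le.
  - by apply: (measurableT_comp (measurable_powR _)); exact: measurableT_comp.
  - exact: measurable_phase.
  - move=> y; rewrite (ger0_norm (powR_ge0 _ _)) (ger0_norm (phase_ge0 _ _ _ _ _ _))// lerDl.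
    by rewrite mulr_ge0// powR_ge0.
have H i : exists2 d : R, 0 < d & forall t k, 0 < t -> t < d ->
    mollifier C (- (t *: e)) (t * c) k ->
    (L1norm mu (fun x : X => indD x * phase x (moll k (G i) x - G i x))%R <= eps%:E)%E.
  have K00 : 0 <= B * C * 4 ^+ n / c by rewrite !mulr_ge0 ?invr_ge0 ?exprn_ge0// ltW.
  have [pn|pn] := leP (p / n%:R) 1.
    apply: (local_approx oD mw w0 wM p1 pq q1 A0 Doo wA mb b0 bM Cb0 bZ C0 c0 L0 eL rho0_gt0 (iG i) (GD i) (Goo i)
      (be := 1) (K := B * C * 4 ^+ n / c + 1)) => //.
    - by rewrite addr_ge0.
    - by move: q_le; rewrite max_l// mul1r mulr1; lra.
    - apply: (cut_bound_gradient (iG i) K00) => t k tpos mk y.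
      have tc0 : 0 < t * c by rewrite mulr_gt0.
      have := gradient_moll_bound i y mk C0 tc0 wv vB.
      by rewrite invfM [t^-1 * _]mulrC mulrA.
  have [K K0 HK] := cut_bound_Lp p1 e C0 c0 (iG i) (gp i).
  apply: (local_approx oD mw w0 wM p1 pq q1 A0 Doo wA mb b0 bM Cb0 bZ C0 c0 L0 eL rho0_gt0 (iG i) (GD i) (Goo i)
      (be := n%:R / p) (K := K)) => //.
  - have nR : 0 < n%:R :> R by rewrite ltr0n.
    have E : n%:R / p * (p / n%:R) = 1 :> R by rewrite mulrA mulfVK ?mulfV// gt_eqF.
    have np0 : 0 <= n%:R / p by rewrite divr_ge0// ltW.
    have := q_le; rewrite max_r ?(ltW pn)// -lerBlDl => /(ler_wpM2l np0).
    by rewrite [n%:R / p * (_ * (p / _))]mulrCA E mulr1.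
  - move=> j; exists 1 => // t k tpos _ mk; exact: HK.
have /choice[d Hd] : forall i, exists d : R, 0 < d /\ forall t k, 0 < t -> t < d ->
    mollifier C (- (t *: e)) (t * c) k ->
    (L1norm mu (fun x : X => indD x * phase x (moll k (G i) x - G i x))%R <= eps%:E)%E.
  by move=> i; have [d d0 Hd] := H i; exists d.
(* [1 / (2 S)] lies strictly below [t0] and all the thresholds [d i]. *)
pose S := t0^-1 + \sum_i (d i)^-1.
have di0 i : 0 < (d i)^-1 by rewrite invr_gt0; have [] := Hd i.
have S0 : 0 < S by rewrite ltr_wpDr ?invr_gt0// sumr_ge0// => i _; exact: ltW.
pose t := (2 * S)^-1; have t_gt0 : 0 < t by rewrite invr_gt0 mulr_gt0.
have tS (s : R) : 0 < s -> s^-1 <= S -> t < s.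
  move=> s0 sS; rewrite -[ltRHS]invrK ltf_pV2 ?posrE ?invr_gt0 ?mulr_gt0//.
  by apply: le_lt_trans sS _; rewrite mulr_natl mulr2n ltrDl.
have tt0 : t < t0 by apply: tS => //; rewrite lerDl sumr_ge0// => i _; exact: ltW.
have td i : t < d i.
  have [di _] := Hd i; apply: tS => //; rewrite /S (bigD1 i)//= addrCA lerDl.
  rewrite addr_ge0 ?invr_ge0 ?(ltW t00)// sumr_ge0// => j _; exact: ltW.
have [k mk] := moll_ex (- (t *: e)) (t * c) (mulr_gt0 t_gt0 c0).
exists (moll k v); first exact: (moll_Cc_infty bD mk t_gt0 tt0 inw r0 iv rr vs).
move=> i; have [_ Hi] := Hd i; have sk : bsmooth k by case: mk.
have := Hi t k t_gt0 (td i) mk; apply: le_trans; rewrite le_eqVlt; apply/orP; left; apply/eqP.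
by apply: eq_integral => y _; rewrite (wdiff_moll i y wv sk).
Qed.

(** After multiplication by a cutoff the gradient is [chi G] plus a term containing [v]. The latter
    is bounded and supported in the finite-measure set [D], so it has finite energy. *)
Lemma energy_mul_finite u g h (B : R) : measurable_fun setT (g : X -> R) -> measurable_fun setT (h : X -> R) ->
  measurable_fun setT (u : X -> R) ->
  (forall x, `|u x| <= 1) -> (forall x, `|h x| <= B) -> (forall x, ~ D x -> h x = 0) ->
  (L1norm mu (fun y : X => phase y (g y)) < +oo)%E ->
  (L1norm mu (fun y : X => phase y (u y * g y + h y)%R) < +oo)%E.
Proof.
move=> mg mh mu_ u1 hB hD goo; have B0 : 0 <= B by apply: le_trans (hB 0).
pose c := B `^ (p - 1) + `|M| * `|Mb| `^ q * B `^ (q - 1).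
have c0 : 0 <= c by rewrite addr_ge0 ?mulr_ge0 ?powR_ge0.
have K20 : 0 <= 2 `^ (q - 1) :> R by exact: powR_ge0.
have hi : mu.-integrable setT (EFin \o (h : X -> R)).
  by apply: (bounded_on_integrable mh _ hD hB) => //; exact: open_borel.
have /integrable_L1norm[_ hoo] := hi.
apply: (@le_lt_trans _ _ (L1norm mu (fun y : X => 2 `^ (q - 1) * phase y (g y))%R +
   L1norm mu (fun y : X => 2 `^ (q - 1) * c * h y)%R)%E).
  apply: L1norm_triangle.
  - by apply: measurable_funM => //; exact: measurable_phase.
  - exact: measurable_funM.
  - by apply: measurable_phase => //; apply: measurable_funD => //; exact: measurable_funM.
  - move=> y; have core (a F F1 c' h' : R) : 0 <= a -> 0 <= F1 -> 0 <= c' -> 0 <= F ->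
        F <= a * (F1 + c' * `|h'|) -> `|F| <= `|a * F1| + `|a * c' * h'|.
      move=> a0 F10 c'0 F0 H; rewrite (ger0_norm F0) normrM (ger0_norm a0) (ger0_norm F10).
      by rewrite !normrM (ger0_norm a0) (ger0_norm c'0) -mulrA -mulrDr.
    apply: core => //; try exact: phase_ge0.
    apply: le_trans (phase_add w0 p1 pq q1 b0 y (ler_normD _ _)) _.
    apply: ler_wpM2l => //; apply: lerD.
      by apply: phase_le => //; rewrite normrM ler_piMl.
    have [Dy|nDy] := pselect (D y); last by rewrite hD// phase0// normr0 mulr0.
      exact: (phase_bounded w0 wM p1 q1 b0 bM Dy (hB y)).
rewrite L1normZ; last exact: measurable_phase.
rewrite L1normZ//; apply: lte_add_pinfty; exact: lte_mul_pinfty.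
Qed.

Lemma L1norm_scale_add (a ee : R) (f g h : X -> R) : 0 <= a ->
  measurable_fun setT f -> measurable_fun setT g -> measurable_fun setT h ->
  (L1norm mu f <= ee%:E)%E -> (L1norm mu g <= ee%:E)%E ->
  (forall x, `|h x| <= `|a * f x| + `|a * g x|) -> (L1norm mu h <= (a * (ee + ee))%:E)%E.
Proof.
move=> a0 mf mg mh fe ge hfg.
apply: le_trans (L1norm_triangle mu _ _ mh hfg) _; [exact: measurable_funM..|].
rewrite !L1normZ// (ger0_norm a0) mulrDr EFinD !EFinM.
by apply: leeD; apply: lee_wpmul2l.
Qed.

(** Induction on the balls: [chi v] is handled by [patch_approx], and [(1 - chi) v] vanishes on the
    current ball, so it is covered by the remaining ones. The radii [rr], [2 rr], [3 rr] are those
    of the plateau of [chi], of its support and of the region that can be pushed inwards. *)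
Lemma finite_patch_approx (rr : V -> R) (s : seq V) :
  (forall z, z \in s -> [/\ 0 < rr z & exists e c t0, [/\ 0 < c, 0 < t0 & inward D z (rr z *+ 3) e c t0]]) ->
  forall v G (B : R), wdiff v G -> (forall y, `|v y| <= B) ->
  (forall y, ~ D y -> v y = 0) -> (forall i y, ~ D y -> G i y = 0) ->
  (forall i, (L1norm mu (fun y : X => phase y (G i y)) < +oo)%E) ->
  (forall y, (forall z, z \in s -> ~ ball z (rr z) y) -> v y = 0 /\ forall i, G i y = 0) ->
  forall eps : R, 0 < eps -> exists2 phi, Cc_infty D phi &
    forall i, (L1norm mu (fun y : X => indD y * phase y (pderiv i phi y - G i y))%R <= eps%:E)%E.
Proof.
elim: s => [|z s IH] Hs v G B wv vB vD GD Goo H eps e0.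
  exists (fun=> 0); first exact: Cc_infty0.
  move=> i; rewrite /L1norm integral0_eq ?lee_fin ?ltW// => y _.
  have [_ ->] := H y (fun z => ltac:(by [])); rewrite pderiv_cst subr0 phase0// mulr0 normr0//.
have [rz [e [c [t0 [c0 t00 inw]]]]] := Hs z (mem_head _ _).
have [chi [Cchi chi01 chi1 chi0]] := cutoff_exists z rz.
have [Cchi' dchi'] := C1b_onem Cchi.
have [_ _ _ [K [_ K2]]] := Cchi; have K0 : 0 <= K by apply: le_trans (K2 (Ordinal n0) 0).
have [mv mG] : measurable_fun setT (v : X -> R) /\ forall i, measurable_fun setT (G i : X -> R).
  have [iv iG _] := wv; split; first by have /integrable_L1norm[] := iv.
  by move=> i; have /integrable_L1norm[] := iG i.
have mchi := C1b_measurable Cchi; have mchi' := C1b_measurable Cchi'.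
have mdchi i := pderiv_measurable i Cchi; have mdchi'' i := pderiv_measurable i Cchi'.
have chiN y : `|chi y| <= 1 by have /andP[c1 c2] := chi01 y; rewrite ger0_norm.
have chiN' y : `|1 - chi y| <= 1.
  by have /andP[c1 c2] := chi01 y; rewrite ger0_norm ?subr_ge0// gerBl.
have w1 := wdiffM wv Cchi; have w2 := wdiffM wv Cchi'.
have b1 y : `|chi y * v y| <= B by rewrite normrM (le_trans _ (vB y))// ler_piMl.
have b2 y : `|(1 - chi y) * v y| <= B by rewrite normrM (le_trans _ (vB y))// ler_piMl.
(* On the plateau the gradient of the remainder vanishes together with the remainder, as the
   induction hypothesis demands. *)
have dchi1 i y : ball z (rr z) y -> pderiv i chi y = 0.
  move=> zy; apply: (@pderiv_near_cst _ _ _ 1).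
  by apply: filterS chi1 _; apply: open_nbhs_nbhs; split => //; exact: ball_open.
have hB i y : `|pderiv i chi y * v y| <= K * B by rewrite normrM ler_pM.
have hB' i y : `|pderiv i (fun x => 1 - chi x) y * v y| <= K * B.
  by rewrite dchi' mulNr normrN.
have g1oo i : (L1norm mu (fun y : X => phase y (chi y * G i y + pderiv i chi y * v y)%R) < +oo)%E.
  apply: (energy_mul_finite (mG i) _ mchi chiN (hB i) _ (Goo i)); first exact: measurable_funM.
  by move=> y /vD ->; rewrite mulr0.
have g2oo i : (L1norm mu (fun y : X => phase y ((1 - chi y) * G i y + pderiv i (fun x => 1 - chi x) y * v y)%R) < +oo)%E.
  apply: (energy_mul_finite (mG i) _ mchi' chiN' (hB' i) _ (Goo i)); first exact: measurable_funM.
  by move=> y /vD ->; rewrite mulr0.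
have K20 : 0 < 2 `^ (q - 1) :> R by rewrite powR_gt0.
pose ee := eps / 2 / 2 `^ (q - 1); have ee0 : 0 < ee by rewrite !divr_gt0.
have [phi1 C1 H1] : exists2 phi, Cc_infty D phi & forall i, (L1norm mu (fun y : X => indD y *
    phase y (pderiv i phi y - (chi y * G i y + pderiv i chi y * v y)))%R <= ee%:E)%E.
  refine (@patch_approx z e (rr z *+ 3) (rr z *+ 2) c t0 B _ _ w1 b1 inw _ _ c0 t00 _ _ g1oo ee ee0).
  - by rewrite mulrn_wgt0.
  - by rewrite [ltRHS]mulrS ltrDr.
  - move=> y; rewrite mulf_eq0 negb_or => /andP[cy vy]; split.
      by apply: contrapT => /vD /eqP; exact/negP.
    by apply: contrapT => /chi0 /eqP; exact/negP.
  - by move=> i y nDy; rewrite GD// vD// !mulr0 addr0.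
have [phi2 C2 H2] : exists2 phi, Cc_infty D phi & forall i, (L1norm mu (fun y : X => indD y *
    phase y (pderiv i phi y - ((1 - chi y) * G i y + pderiv i (fun x => 1 - chi x) y * v y)))%R <= ee%:E)%E.
  refine (IH _ _ _ _ w2 b2 _ _ g2oo _ ee ee0).
  - by move=> z' z's; apply: Hs; rewrite inE z's orbT.
  - by move=> y /vD ->; rewrite mulr0.
  - by move=> i y nDy; rewrite GD// vD// !mulr0 addr0.
  - move=> y ys; have [zy|nzy] := pselect (ball z (rr z) y).
      rewrite chi1// subrr mul0r; split=> // i.
      by rewrite dchi' dchi1// mul0r oppr0 mul0r addr0.
    have [-> G0] : v y = 0 /\ forall i, G i y = 0.
      by apply: H => z'; rewrite inE => /predU1P[->|/ys].
    by rewrite mulr0; split=> // i; rewrite G0 !mulr0 addr0.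
exists (fun y => phi1 y + phi2 y); first exact: Cc_inftyD.
move=> i; have Cp1 := Cc_infty_C1b C1; have Cp2 := Cc_infty_C1b C2.
have mp1 := pderiv_measurable i Cp1; have mp2 := pderiv_measurable i Cp2.
have dE y : pderiv i (fun y => phi1 y + phi2 y) y = pderiv i phi1 y + pderiv i phi2 y.
  have [_ d1 _ _] := Cp1; have [_ d2 _ _] := Cp2.
  exact: (deriveD (d1 y i) (d2 y i)).
have mf1 : measurable_fun setT (fun y : X => indD y *
    phase y (pderiv i phi1 y - (chi y * G i y + pderiv i chi y * v y))).
  apply: measurable_funM; first by apply: measurable_indic; exact: open_borel.
  apply: measurable_phase => //; apply: measurable_funB => //.
  by apply: measurable_funD; exact: measurable_funM.
have mf2 : measurable_fun setT (fun y : X => indD y *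
    phase y (pderiv i phi2 y - ((1 - chi y) * G i y + pderiv i (fun x => 1 - chi x) y * v y))).
  apply: measurable_funM; first by apply: measurable_indic; exact: open_borel.
  apply: measurable_phase => //; apply: measurable_funB => //.
  by apply: measurable_funD; exact: measurable_funM.
have mphi : measurable_fun setT (fun y : X => indD y *
    phase y (pderiv i (fun y => phi1 y + phi2 y) y - G i y)).
  apply: measurable_funM; first by apply: measurable_indic; exact: open_borel.
  apply: measurable_phase => //; apply: measurable_funB => //.
  rewrite (_ : pderiv i _ = (fun y => pderiv i phi1 y + pderiv i phi2 y)); last by apply/funext.
  exact: measurable_funD.
have -> : eps = 2 `^ (q - 1) * (ee + ee).
  have E : 2 `^ (q - 1) * ee = eps / 2 by rewrite /ee mulrC divfK// gt_eqF.
  by rewrite mulrDr E -splitr.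
refine (L1norm_scale_add (ltW K20) mf1 mf2 mphi (H1 i) (H2 i) _).
- move=> y; have core (i0 a F F1 F2 : R) : 0 <= i0 -> 0 <= a -> 0 <= F -> 0 <= F1 -> 0 <= F2 ->
      F <= a * (F1 + F2) -> `|i0 * F| <= `|a * (i0 * F1)| + `|a * (i0 * F2)|.
    move=> i00 a0 F0 F10 F20 H'; rewrite !ger0_norm ?mulr_ge0//.
    by have := ler_wpM2l i00 H'; rewrite mulrDr; lra.
  apply: core; try exact: phase_ge0.
  + by rewrite indicE.
  + exact: ltW.
  apply: phase_add => //; rewrite dE; apply: le_trans (ler_normD _ _).
  rewrite le_eqVlt; apply/orP; left; apply/eqP; congr (`|_|); rewrite dchi'; lra.
Qed.

End core.

Section euclidean_norm.
Context (R : realType) (n : nat).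
Implicit Types (x y : 'rV[R]_n).

Lemma enorm_ge0 x : 0 <= enorm x.
Proof. exact: sqrtr_ge0. Qed.

Lemma enorm_sqr x : enorm x ^+ 2 = \sum_i x ord0 i ^+ 2.
Proof. by rewrite sqr_sqrtr// sumr_ge0// => i _; exact: sqr_ge0. Qed.

Lemma coord_le_enorm x i : `|x ord0 i| <= enorm x.
Proof.
rewrite -(ler_pXn2r (n := 2)) ?nnegrE ?enorm_ge0// enorm_sqr real_normK ?num_real//.
by rewrite (bigD1 i)//= lerDl sumr_ge0// => j _; exact: sqr_ge0.
Qed.

Lemma enorm_le_sum x : enorm x <= \sum_i `|x ord0 i|.
Proof.
have H (s : seq 'I_n) : \sum_(i <- s) x ord0 i ^+ 2 <= (\sum_(i <- s) `|x ord0 i|) ^+ 2.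
  elim: s => [|i s IH]; first by rewrite !big_nil expr0n.
  rewrite !big_cons sqrrD real_normK ?num_real// -addrA lerD2l (le_trans IH)// lerDr.
  by rewrite mulrn_wge0// mulr_ge0// sumr_ge0.
rewrite -(ler_pXn2r (n := 2)) ?nnegrE ?enorm_ge0 ?sumr_ge0// enorm_sqr; exact: H.
Qed.

(** Dividing by [n.+1] rather than [n] gives a strict inequality and stays meaningful for
    [n = 0]. *)
Lemma ball_eball x (r : R) : 0 < r -> ball x (r / n.+1%:R) `<=` eball x r.
Proof.
move=> r0 y; have rn : 0 < r / n.+1%:R by rewrite divr_gt0.
rewrite ball_box// => H; rewrite /eball /=; apply: le_lt_trans (enorm_le_sum _) _.
apply: (@le_lt_trans _ _ (\sum_(i < n) (r / n.+1%:R))).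
  by apply: ler_sum => i _; have := H i; rewrite !mxE distrC => /ltW.
rewrite sumr_const card_ord -[X in X < _]mulr_natr -mulrA gtr_pMr//.
by rewrite mulrC ltr_pdivrMr// mul1r ltr_nat.
Qed.

Lemma eball_ball x (r : R) : 0 < r -> eball x r `<=` ball x r.
Proof.
move=> r0 y; rewrite /eball /= ball_box// => H i; apply: le_lt_trans H.
by have := coord_le_enorm (y - x) i; rewrite !mxE distrC.
Qed.

End euclidean_norm.

(** * Pushing a Lipschitz domain into itself *)

Section geometry.
Context (R : realType) (n : nat).
Notation V := ('rV[R]_n).
Implicit Types (D : set V) (x e : V) (r c t : R).

(** A point of the closure is replaced by a nearby point of [D]; the displacement is charged to half
    of the radius and half of the cube. *)
Lemma inward_closure D x e r c t0 : 0 < r -> 0 < c ->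
  (forall (y z : V) t, D y -> ball x r y -> 0 < t -> t < t0 ->
    (forall i, `|z ord0 i| <= t * c) -> D (y + t *: e + z)) ->
  inward D x (r / 2) e (c / 2) t0.
Proof.
move=> r0 c0 H y z t cy xy tpos tt0 zc.
pose d := Num.min (r / 2) (t * (c / 2)); have d0 : 0 < d by rewrite lt_min !divr_gt0 ?mulr_gt0 ?divr_gt0.
have [y' [Dy' yy']] := cy _ (nbhsx_ballx y d d0).
have -> : y + t *: e + z = y' + t *: e + (z + (y - y')).
  rewrite [z + _]addrC addrA; congr (_ + z).
  by rewrite [RHS]addrAC [y' + _]addrC subrK.
apply: H => //.
  rewrite [r]splitr; apply: ball_triangle xy _; apply: le_ball yy'.
  by rewrite ge_min lexx.
move=> i; rewrite !mxE (le_trans (ler_normD _ _))// [c]splitr mulrDr lerD//.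
move: yy'; rewrite ball_box// => /(_ i); rewrite /rV_coord => /ltW /le_trans; apply.
by rewrite ge_min lexx orbT.
Qed.

Lemma inward_interior D x : open D -> D x ->
  exists r e c t0, [/\ 0 < r, 0 < c, 0 < t0 & inward D x r e c t0].
Proof.
move=> oD Dx; have /nbhs_ballP[r /= r0 rD] := open_nbhs_nbhs (conj oD Dx).
have r2 : 0 < r / 2 by rewrite divr_gt0.
exists (r / 2 / 2), 0, (1 / 2), (r / 2); split; [by rewrite divr_gt0|by []|by []|].
apply: inward_closure => // y z t _ xy tpos tr zc; apply: rD.
rewrite scaler0 addr0 [r]splitr; apply: ball_triangle xy _; rewrite ball_box// => i.
rewrite /rV_coord mxE opprD addrA subrr sub0r normrN; apply: le_lt_trans (zc i) _.
by rewrite mulr1.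
Qed.

(** The direction [e] is the vertical one in the rotated coordinates. Moving by [t e] raises the
    height by [t], while a perturbation of size [t c] changes the height and the graph by at most
    [(K + 1) t c S] together. *)
Lemma inward_lipschitz D : open D -> lipschitz_domain D -> forall x, closure D x ->
  exists r e c t0, [/\ 0 < r, 0 < c, 0 < t0 & inward D x r e c t0].
Proof.
move=> oD LD x cDx; have [Dx|nDx] := pselect (D x); first exact: inward_interior.
have [|r [Q [i [g [r0 QQ Lg DE]]]]] := LD x; first by split => //; rewrite (interior_id D).1.
have [K K0 HK] : exists2 K : R, 0 < K & forall a b, `|g a - g b| <= K * `|a - b|.
  case: Lg => K [Kr HK]; exists (`|K| + 1); first by rewrite ltr_wpDl.
  move=> a b; apply: (HK (`|K| + 1) _ (a, b)) => //.
  by rewrite (le_lt_trans (ler_norm _))// ltrDl.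
pose S := \sum_j \sum_k `|Q j k|; have S0 : 0 <= S by rewrite sumr_ge0// => j _; rewrite sumr_ge0.
(* [S] bounds the effect of the rotation on sup norms; this [c] keeps the total perturbation below
   [t]. *)
pose c := (2 * (K + 1) * (S + 1))^-1.
have K1 : 0 < K + 1 by rewrite addr_gt0.
have S1 : 0 < S + 1 by rewrite ltr_wpDl.
have c0 : 0 < c by rewrite invr_gt0 !mulr_gt0.
pose e : V := delta_mx ord0 i *m Q^T.
pose r1 := r / n.+1%:R; have r10 : 0 < r1 by rewrite divr_gt0.
have r12 : 0 < r1 / 2 by rewrite divr_gt0.
pose E := \sum_j `|e ord0 j| + c; have E0 : 0 < E by rewrite ltr_wpDl// sumr_ge0.
(* Keeps the displaced point in the cube of radius [r1], hence in the Euclidean ball where [D] is an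
   epigraph. *)
pose t0 := r1 / 2 / E; have t00 : 0 < t0 by rewrite !divr_gt0.
exists (r1 / 2 / 2), e, (c / 2), t0; split; [by rewrite divr_gt0|by rewrite divr_gt0|by []|].
apply: inward_closure => // y z t Dy xy tpos tt0 zc.
have eQ : e *m Q = delta_mx ord0 i.
  by rewrite -mulmxA (mulmx1C QQ) mulmx1.
clearbody e.
have zQ k : `|(z *m Q) ord0 k| <= t * c * S.
  rewrite mxE (le_trans (ler_norm_sum _ _ _))//.
  apply: (@le_trans _ _ (\sum_j (t * c) * `|Q j k|)).
    by apply: ler_sum => j _; rewrite normrM ler_wpM2r.
  rewrite -mulr_sumr ler_wpM2l ?mulr_ge0 ?(ltW c0) ?(ltW tpos)//.
  by apply: ler_sum => j _; rewrite (bigD1 k)//= lerDl sumr_ge0.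
have xy1 : ball x r1 y by apply: le_ball xy; rewrite ler_pdivrMr// ler_peMr// ?ltW//; lra.
have Dyg := (DE y (ball_eball r0 xy1)).1 Dy.
apply/(DE (y + t *: e + z)).
  apply: ball_eball => //; rewrite -/r1 [r1]splitr; apply: ball_triangle xy _.
  rewrite ball_box// => j; rewrite /rV_coord !mxE -addrA opprD addrA subrr sub0r normrN.
  apply: le_lt_trans (ler_normD _ _) _; rewrite normrM (gtr0_norm tpos).
  apply: (@le_lt_trans _ _ (t * E)); last by rewrite -ltr_pdivlMr.
  by rewrite /E mulrDr lerD// ler_wpM2l ?(ltW tpos)// (bigD1 j)//= lerDl sumr_ge0.
have TE : (y + t *: e + z - x) *m Q = (y - x) *m Q + t *: delta_mx ord0 i + z *m Q.
  by rewrite -eQ scalemxAl -!mulmxDl; congr (_ *m Q); rewrite addrAC [y + _ - x]addrAC.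
rewrite TE; set T := (y - x) *m Q in Dyg *; set Z := z *m Q in zQ *.
clearbody T Z; clear TE.
have colE : col' i (T + t *: delta_mx ord0 i + Z) = col' i T + col' i (Z).
  apply/rowP => j; rewrite !mxE eqxx eq_sym (negbTE (neq_lift _ _)) /= mulr0 addr0//.
have -> : (T + t *: delta_mx ord0 i + Z) ord0 i = T ord0 i + t + Z ord0 i.
  by rewrite !mxE !eqxx mulr1.
rewrite colE.
have gb : `|g (col' i T + col' i (Z)) - g (col' i T)| <= K * (t * c * S).
  apply: le_trans (HK _ _) _; rewrite ler_wpM2l ?(ltW K0)// addrAC subrr add0r.
  have tcS : 0 <= t * c * S by rewrite !mulr_ge0// ltW.
  rewrite [leLHS]mx_normrE; apply/bigmax_leP; split => // oj _.
  by rewrite mxE [oj.1]ord1; exact: zQ.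
have ctS : (K + 1) * (t * c * S) < t.
  have -> : (K + 1) * (t * c * S) = t * (c * ((K + 1) * S)) by lra.
  rewrite gtr_pMr// /c mulrC ltr_pdivrMr ?mulr_gt0// mul1r -mulrA.
  apply: (@lt_le_trans _ _ ((K + 1) * (S + 1))); first by rewrite ltr_pM2l// ltrDl.
  by rewrite ler_peMl// ?mulr_ge0// ?ltW//; lra.
have := zQ i; rewrite ler_norml => /andP[z1 z2].
move: gb; rewrite ler_norml => /andP[_ gb].
by move: Dyg ctS; lra.
Qed.

End geometry.

Section core_approx.
Context (R : realType) (n : nat).
Notation X := (borel_rV R n).
Notation V := ('rV[R]_n).
Notation mu := (@borel_lebesgue R n).
Variables (D : set V) (w b : X -> R) (p q A rho0 M Mb Cb kb : R).
Hypotheses (n0 : (0 < n)%N) (oD : open D) (bD : bounded_set D) (LD : lipschitz_domain D).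
Hypotheses (mw : measurable_fun setT w) (w0 : forall x, 0 <= w x).
Hypotheses (wM : forall x, D x -> w x <= M) (p1 : 1 <= p) (pq : p <= q) (q1 : 1 < q) (A0 : 0 < A).
Hypotheses (Doo : (mu (D : set X) < +oo)%E) (rho0_gt0 : 0 < rho0) (wA : cube_muckenhoupt D w q A rho0).
Hypotheses (mb : measurable_fun setT b) (b0 : forall x, 0 <= b x).
Hypotheses (bM : forall x, D x -> b x <= Mb) (Cb0 : 0 < Cb).
Hypothesis (bZ : forall (x y : V) (rho : R), D x -> D y -> 0 < rho ->
  (forall i, `|x ord0 i - y ord0 i| < rho) -> b x <= Cb * (b y + rho `^ kb)).
Hypothesis (q_le : q <= p + kb * q * Num.max 1 (p / n%:R)).

Lemma bounded_closure_compact (E : set V) : bounded_set E -> compact (closure E).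
Proof.
move=> bE; apply: bounded_closed_compact; last exact: closed_closure.
case: bE => K [Kr HK]; exists K; split => // M' KM x cx.
apply/ler_addgt0Pr => eps e0; have [y [Ey xy]] := cx _ (nbhsx_ballx x eps e0).
move: xy; rewrite -ball_normE /= => xy.
rewrite -[x](subrK y) (le_trans (ler_normD _ _))// addrC lerD//; first exact: HK.
exact: ltW.
Qed.

Lemma core_approx v (G : 'I_n -> V -> R) (B : R) : wdiff v G -> (forall y, `|v y| <= B) ->
  (forall y, ~ D y -> v y = 0) -> (forall i y, ~ D y -> G i y = 0) ->
  (forall i, (L1norm mu (fun y : X => phase w b p q y (G i y)) < +oo)%E) ->
  forall eps : R, 0 < eps -> exists2 phi, Cc_infty D phi &
    forall i, (L1norm mu (fun y : X => \1_(D : set X) y * phase w b p q y (pderiv i phi y - G i y))%R <= eps%:E)%E.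
Proof.
move=> wv vB vD GD Goo.
have /choice[rr Hrr] : forall x : V, exists r : R, closure D x ->
    0 < r /\ exists e c t0, [/\ 0 < c, 0 < t0 & inward D x (r *+ 3) e c t0].
  move=> x; have [cx|ncx] := pselect (closure D x); last by exists 0.
  have [r [e [c [t0 [r0 c0 t00 inw]]]]] := inward_lipschitz oD LD cx.
  (* A third of the available radius, leaving room for the plateau, the support of the cutoff and a
     margin. *)
  exists (r / 3) => _; split; first by rewrite divr_gt0.
  exists e, c, t0; split=> //; have -> : r / 3 *+ 3 = r by lra.
  exact: inw.
have cD := bounded_closure_compact bD; rewrite compact_cover in cD.
have [||F FD cov] := cD V (closure D) (fun x => ball x (rr x)).
- by move=> x /Hrr[r0 _]; exact: ball_open.
- by move=> x cx; exists x => //; apply: ballxx; have [] := Hrr x cx.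
move=> eps e0.
refine (@finite_patch_approx _ _ D w b p q A rho0 M Mb Cb kb n0 oD bD mw w0 wM
  p1 pq q1 A0 Doo rho0_gt0 wA mb b0 bM Cb0 bZ q_le rr (finmap.enum_fset F) _ v G B wv vB vD GD Goo _ eps e0).
- by move=> z zF; apply: Hrr; have := FD z zF; rewrite inE.
- move=> y Hy; have nDy : ~ D y.
    move=> Dy; have [z zF zy] := cov y (subset_closure Dy); exact: (Hy z).
  by split; [exact: vD|move=> i; exact: GD].
Qed.

End core_approx.

(** * Lebesgue measurable data and Borel representatives *)

Section completion.
Context d (T : measurableType d) (R : realType).
Variable mu : {measure set T -> \bar R}.
Notation cmu := (@completed_measure_extension _ T R mu).
Notation cT := (caratheodory_type (mu^*)%mu).

Lemma completed_borel (E : set T) : measurable E -> measurable (E : set cT).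
Proof. exact: caratheodory_measurable_mu_ext. Qed.

Lemma completed_borelE (E : set T) : measurable E -> cmu (E : set cT) = mu E.
Proof. by move=> mE; exact: measurable_mu_extE. Qed.

Lemma measurable_id_completed : measurable_fun setT (id : cT -> T).
Proof. by move=> _ Y mY; rewrite setTI; exact: completed_borel. Qed.

Lemma ge0_integral_completed (D : set T) (f : T -> \bar R) : measurable D ->
  measurable_fun D f -> (forall x, (0 <= f x)%E) ->
  (\int[cmu]_(x in (D : set cT)) f x = \int[mu]_(x in D) f x)%E.
Proof.
move=> mD mf f0.
transitivity (\int[pushforward cmu (id : cT -> T)]_(x in D) f x)%E.
  by rewrite (ge0_integral_pushforward measurable_id_completed cmu mD mf).
pose nu := measure_function_pushforward__canonical__measure_function_Measure
  cmu measurable_id_completed.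
apply: (@eq_measure_integral _ _ _ D mu nu f) => A mA _.
exact: completed_borelE.
Qed.

Lemma integral_completed (D : set T) (f : T -> \bar R) : measurable D ->
  measurable_fun D f -> (\int[cmu]_(x in (D : set cT)) f x = \int[mu]_(x in D) f x)%E.
Proof.
move=> mD mf; rewrite [LHS]integralE [RHS]integralE.
rewrite ge0_integral_completed//; last exact: measurable_funepos.
by rewrite ge0_integral_completed//; exact: measurable_funeneg.
Qed.

(** A measurable hull: the intersection of covers whose excess over the outer measure tends to 0. *)
Lemma outer_regular (E : set T) : ((mu^*)%mu E < +oo)%E ->
  exists F, [/\ measurable F, E `<=` F & mu F = (mu^*)%mu E].
Proof.
move=> Eoo.
have muE : (mu^*)%mu E \is a fin_num by rewrite ge0_fin_numE// mu_ext_ge0.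
have /choice[F HF] : forall k : nat, exists F : set T, [/\ measurable F, E `<=` F &
    (mu F <= (mu^*)%mu E + k.+1%:R^-1%:E)%E].
  move=> k; have k0 : (0 < k.+1%:R^-1 :> R)%R by rewrite invr_gt0.
  have [_ [B [mB EB] <-] HB] := lb_ereal_inf_adherent k0 muE.
  exists (\bigcup_m B m); split => //; first exact: bigcupT_measurable.
  apply: le_trans (ltW HB); apply: measure_sigma_subadditive => //.
  exact: bigcupT_measurable.
have mF : measurable (\bigcap_k F k) by apply: bigcapT_measurable => k; have [] := HF k.
have EF : E `<=` \bigcap_k F k by move=> x Ex k _; have [_ + _] := HF k; exact.
exists (\bigcap_k F k); split => //; apply/eqP; rewrite eq_le; apply/andP; split; last first.
  by rewrite -measurable_mu_extE//; exact: le_mu_ext.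
apply/lee_addgt0Pr => eps e0.
have [k ke] : exists k, (k.+1%:R^-1 <= eps)%R.
  exists (Num.truncn eps^-1); rewrite invf_ple ?posrE//.
  exact: ltW (truncnS_gt _).
have [mFk _ Fk] := HF k.
apply: (@le_trans _ _ (mu (F k))).
  by apply: le_measure; rewrite ?inE//; exact: bigcap_inf.
by apply: (le_trans Fk); rewrite leeD2l// lee_fin.
Qed.

Lemma null_bigcup (N : (set T)^nat) : (forall k, measurable (N k)) ->
  (forall k, mu (N k) = 0%E) -> mu (\bigcup_k N k) = 0%E.
Proof.
move=> mN N0; apply/eqP; rewrite eq_le measure_ge0 andbT.
rewrite -(@eseries0 R (fun k => mu (N k)) 0%N xpredT) => [|k _ _]; last exact: N0.
by apply: measure_sigma_subadditive => //; exact: bigcupT_measurable.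
Qed.

(** On each piece of finite measure, the hull exceeds the set by a set of outer measure zero, which
    has itself a Borel null hull. The pieces are then glued. *)
Lemma completed_ae_borel (E : set cT) : sigma_finite setT mu -> measurable E ->
  exists B N : set T, [/\ measurable B, measurable N, mu N = 0%E &
    forall x, ~ N x -> (E x <-> B x)].
Proof.
move=> [S ST HS] mE.
have /choice[BN HBN] : forall k : nat, exists BN : set T * set T,
    [/\ measurable BN.1, measurable BN.2, mu BN.2 = 0%E, E `&` S k `<=` BN.1 &
        BN.1 `\` (E `&` S k) `<=` BN.2].
  move=> k; have [mS Soo] := HS k; have mcS := completed_borel mS.
  have mES : measurable (E `&` S k : set cT) by exact: measurableI.
  have ESoo : ((mu^*)%mu (E `&` S k) < +oo)%E.
    apply: le_lt_trans Soo; rewrite -(measurable_mu_extE mu mS).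
    by apply: le_mu_ext; exact: subIsetr.
  have [F [mF EF muF]] := outer_regular ESoo.
  have FE0 : (mu^*)%mu (F `\` (E `&` S k)) = 0%E.
    have cF : cmu F = (mu^*)%mu (E `&` S k) by rewrite -muF; exact: completed_borelE.
    have H := @measureD _ cT _ cmu F (E `&` S k) (completed_borel mF) mES.
    have Foo : (cmu F < +oo)%E by rewrite cF.
    apply: (eq_trans (H Foo)); rewrite setIidr//.
    apply: (eq_trans (congr1 (fun z => (z - _)%E) cF)).
    by apply: subee; rewrite ge0_fin_numE//; exact: mu_ext_ge0.
  have [|N [mN FN muN]] := @outer_regular (F `\` (E `&` S k)); first by rewrite FE0.
  by exists (F, N); split => //=; rewrite muN.
exists (\bigcup_k (BN k).1), (\bigcup_k (BN k).2); split.
- by apply: bigcupT_measurable => k; have [] := HBN k.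
- by apply: bigcupT_measurable => k; have [] := HBN k.
- by apply: null_bigcup => k; have [] := HBN k.
- move=> x nN; split=> [Ex|[k _ Bx]].
    have [k _ Sx] : (\bigcup_k S k) x by rewrite -ST.
    by exists k => //; have [_ _ _ + _] := HBN k; apply.
  apply: contrapT => nEx; apply: nN; exists k => //; have [_ _ _ _] := HBN k; apply.
  by split => // -[].
Qed.

(** The superlevel sets at rational heights are replaced by Borel sets off one common null set;
    these countably many sets determine the function. Setting it to 0 elsewhere gives a
    representative already extended by zero. *)
Lemma borel_representative (D : set T) (f : T -> R) : sigma_finite setT mu -> measurable D ->
  measurable_fun (D : set cT) (f : cT -> R) ->
  exists g (N : set T), [/\ measurable_fun setT g, measurable N, mu N = 0%E,
    forall x, D x -> ~ N x -> g x = f x & forall x, ~ D x \/ N x -> g x = 0%R].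
Proof.
move=> sf mD mf.
pose r_ (k : nat) : rat := odflt 0 (unpickle k).
have /choice[BN HBN] : forall k : nat, exists BN : set T * set T,
    [/\ measurable BN.1, measurable BN.2, mu BN.2 = 0%E &
      forall x, ~ BN.2 x -> (D x /\ ratr (r_ k) < f x)%R <-> BN.1 x].
  move=> k; have [|B [N [mB mN N0 H]]] := @completed_ae_borel (D `&` [set x | ratr (r_ k) < f x]) sf.
    rewrite -preimage_itvoy; apply: mf; first exact: completed_borel.
    exact: measurable_itv.
  by exists (B, N); split => //= x nN; rewrite -H.
pose N := \bigcup_k (BN k).2.
have mN : measurable N by apply: bigcupT_measurable => k; have [] := HBN k.
have N0 : mu N = 0%E.
  by apply: null_bigcup => k; have [] := HBN k.
have mDN : measurable (D `\` N) by exact: measurableD.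
exists (f \_ (D `\` N)), N; split => //.
- apply/(measurable_restrictT f mDN) => _.
  apply: (measurability _ (RGenOInfty.measurableE R)) => //.
  move=> /= _ [_ [c ->] <-]; rewrite preimage_itvoy.
  rewrite [X in measurable X](_ : _ = \bigcup_k
    (if c < ratr (r_ k) then (D `\` N) `&` (BN k).1 else set0)).
    apply: bigcupT_measurable => k; case: ifP => // _.
    by apply: measurableI => //; have [] := HBN k.
  apply/seteqP; split=> x.
    move=> [[Dx Nx] /= cfx]; have [r] := rat_in_itvoo cfx; rewrite inE /= => /itvP h.
    exists (pickle r) => //; rewrite /r_ pickleK /= h; split => //.
    have [_ _ _ H] := HBN (pickle r); apply/H.
      by move=> Bx; apply: Nx; exists (pickle r).
    by rewrite /r_ pickleK /= h.
  move=> [k _]; case: ifP => // ck [[Dx Nx] Bx]; split => //=.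
  have [_ _ _ H] := HBN k; have [|_ kf] := (H x _).2 Bx.
    by move=> B2x; apply: Nx; exists k.
  exact: lt_trans kf.
- by move=> x Dx Nx; rewrite patchT// inE.
- by move=> x H; rewrite patchN// notin_setE => -[Dx Nx]; case: H.
Qed.

End completion.

Section almost_everywhere_transfer.
Context d (T : measurableType d) (R : realType).
Variable mu : {measure set T -> \bar R}.
Notation cmu := (@completed_measure_extension _ T R mu).
Notation cT := (caratheodory_type (mu^*)%mu).

(* Unlike the almost everywhere filter of the completed measure, the exceptional
   set is required to be measurable before completion. *)
Definition nae (D : set T) (P : T -> Prop) :=
  exists N, [/\ measurable N, mu N = 0%E & forall x, D x -> ~ N x -> P x].

Lemma nae_sub (D : set T) (P Q : T -> Prop) : nae D P -> (forall x, D x -> P x -> Q x) -> nae D Q.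
Proof. by move=> [N [mN N0 H]] PQ; exists N; split => // x Dx nNx; apply: PQ => //; exact: H. Qed.

Lemma nae_and (D : set T) (P Q : T -> Prop) : nae D P -> nae D Q -> nae D (fun x => P x /\ Q x).
Proof.
move=> [N [mN N0 H]] [N' [mN' N'0 H']]; exists (N `|` N'); split.
- exact: measurableU.
- by apply: null_set_setU.
- by move=> x Dx /not_orP[nN nN']; split; [exact: H|exact: H'].
Qed.

Lemma nae_all n (D : set T) (P : 'I_n -> T -> Prop) : (forall i, nae D (P i)) ->
  nae D (fun x => forall i, P i x).
Proof.
move=> /choice[N HN]; pose N' (k : nat) := if @insub _ _ 'I_n k is Some i then N i else set0.
have mN' k : measurable (N' k) by rewrite /N'; case: insubP => // i _ _; have [] := HN i.
exists (\bigcup_k N' k); split; first exact: bigcupT_measurable.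
  by apply: null_bigcup => // k; rewrite /N'; case: insubP => // i _ _; have [] := HN i.
move=> x Dx nN i; have [_ _] := HN i; apply => // Nx; apply: nN; exists i => //.
by rewrite /N' valK.
Qed.

Lemma nae_ae (D : set T) (P : T -> Prop) : nae D P <-> {ae cmu, forall x : cT, D x -> P x}.
Proof.
split=> [[N [mN N0 H]]|[A [mA A0 HA]]].
  exists N; split; [exact: completed_borel|by rewrite -N0; exact: completed_borelE|].
  by move=> x /=; apply: contra_notP => nNx Dx; exact: H.
have Aoo : ((mu^*)%mu A < +oo)%E by rewrite [X in (X < _)%E]A0.
have [N [mN AN muN]] := outer_regular Aoo.
exists N; split => //; first by rewrite muN; exact: A0.
by move=> x Dx nNx; apply: contrapT => nPx; apply: nNx; apply: AN; apply: HA => /= H; exact: nPx (H Dx).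
Qed.

Lemma nae_measurable (D : set T) (F g : T -> \bar R) : measurable D -> measurable_fun D g ->
  nae D (fun x => F x = g x) -> measurable_fun (D : set cT) (F : cT -> \bar R).
Proof.
move=> mD mg H; apply: (@ae_measurable_fun _ cT R cmu _ D (g : cT -> \bar R)).
- exact: measure_is_complete_caratheodory.
- by apply/nae_ae; apply: nae_sub H _ => x _ ->.
- move=> mcD Y mY; apply: completed_borel; exact: mg.
Qed.

Lemma nae_integral (D : set T) (F g : T -> \bar R) : measurable D -> measurable_fun D g ->
  nae D (fun x => F x = g x) -> (\int[cmu]_(x in (D : set cT)) F x = \int[mu]_(x in D) g x)%E.
Proof.
move=> mD mg H; rewrite -integral_completed//; apply: ae_eq_integral.
- exact: completed_borel.
- exact: nae_measurable H.
- by move=> mcD Y mY; apply: completed_borel; exact: mg.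
- exact/nae_ae.
Qed.

Lemma nae_integrable (D : set T) (F g : T -> \bar R) : measurable D -> measurable_fun D g ->
  nae D (fun x => F x = g x) -> cmu.-integrable (D : set cT) F <-> mu.-integrable D g.
Proof.
move=> mD mg H.
have E : (\int[cmu]_(x in (D : set cT)) `|F x| = \int[mu]_(x in D) `|g x|)%E.
  apply: nae_integral => //; first exact: measurableT_comp.
  by apply: nae_sub H _ => x _ ->.
split=> /integrableP[mf fi]; apply/integrableP; split => //.
- by rewrite -E.
- exact: nae_measurable H.
- by rewrite E.
Qed.

End almost_everywhere_transfer.

Section lebesgue_transfer.
Context (R : realType) (n : nat).
Notation X := (borel_rV R n).
Notation V := ('rV[R]_n).
Notation mu := (@borel_lebesgue R n).
Notation nae := (@nae _ X R mu).
Implicit Types (D : set V) (f : V -> R).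

Lemma borel_lebesgue_sfinite : sigma_finite setT mu.
Proof. exact: sigma_finiteT. Qed.

Lemma lebesgue_representative D f : open D -> lebesgue_measurable_fun D f ->
  exists g : V -> R, [/\ measurable_fun setT (g : X -> R), nae D (fun x => g x = f x) &
    forall x, ~ D x -> g x = 0].
Proof.
move=> oD mf.
have [g [N [mg mN N0 gf g0]]] := borel_representative borel_lebesgue_sfinite (open_borel oD) mf.
by exists g; split => // [|x nDx]; [exists N; split|apply: g0; left].
Qed.

Lemma lebesgue_integral_L1norm D (F : V -> \bar R) (g : V -> R) : open D ->
  measurable_fun setT (g : X -> R) -> (forall x, 0 <= g x) -> nae D (fun x => F x = (g x)%:E) ->
  (\int[lebesgue_rV R n]_(x in D) F x = L1norm mu (fun x : X => \1_(D : set X) x * g x)%R)%E.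
Proof.
move=> oD mg g0 H; have mD := open_borel oD.
have mgD : measurable_fun (D : set X) (EFin \o (g : X -> R)).
  by apply/measurable_EFinP; exact: measurable_funTS.
rewrite [LHS](nae_integral mD mgD H) integral_mkcond; apply: eq_integral => x _.
rewrite patchE indicE; case: (x \in _); last by rewrite mul0r normr0.
by rewrite mul1r ger0_norm.
Qed.

Lemma lebesgue_Rintegral D f (g : V -> R) : open D -> measurable_fun setT (g : X -> R) ->
  (forall x, ~ D x -> g x = 0) -> nae D (fun x => f x = g x) ->
  mu.-integrable setT (EFin \o (g : X -> R)) ->
  (\int[lebesgue_rV R n]_(x in D) (f x)%:E = (\int[mu]_x g x)%:E)%E.
Proof.
move=> oD mg g0 H ig; have mD := open_borel oD.
have mgD : measurable_fun (D : set X) (EFin \o (g : X -> R)).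
  by apply/measurable_EFinP; exact: measurable_funTS.
have H' : nae D (fun x => (f x)%:E = (EFin \o g) x) by apply: nae_sub H _ => x _ /= ->.
rewrite [LHS](nae_integral mD mgD H') integral_mkcond /Rintegral fineK; last exact: integrable_fin_num.
apply: eq_integral => x _; rewrite patchE; case: ifPn => // /negP nDx.
by rewrite g0// => Dx; apply: nDx; rewrite inE.
Qed.

Lemma lebesgue_integrable D f (g : V -> R) : open D -> measurable_fun setT (g : X -> R) ->
  (forall x, ~ D x -> g x = 0) -> nae D (fun x => f x = g x) ->
  (lebesgue_rV R n).-integrable D (EFin \o f) <-> mu.-integrable setT (EFin \o (g : X -> R)).
Proof.
move=> oD mg g0 H; have mD := open_borel oD.
have mgD : measurable_fun (D : set X) (EFin \o (g : X -> R)).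
  by apply/measurable_EFinP; exact: measurable_funTS.
have H' : nae D (fun x => (EFin \o f) x = (EFin \o g) x) by apply: nae_sub H _ => x _ /= ->.
apply: (iff_trans (nae_integrable mD mgD H')).
have gE : (EFin \o g : X -> \bar R) \_ (D : set X) = EFin \o g.
  apply/funext => x; rewrite patchE; case: ifPn => // /negP nDx.
  by rewrite /= g0// => Dx; apply: nDx; rewrite inE.
by rewrite -[in X in _ <-> X]gE; split=> /(integrable_mkcond _ mD).
Qed.

Lemma integrable_representative D f : open D -> (lebesgue_rV R n).-integrable D (EFin \o f) ->
  exists g : V -> R, [/\ mu.-integrable setT (EFin \o (g : X -> R)), nae D (fun x => g x = f x) &
    forall x, ~ D x -> g x = 0].
Proof.
move=> oD fi; have /integrableP[/measurable_EFinP mf _] := fi.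
have [g [mg gf g0]] := lebesgue_representative oD mf.
exists g; split => //; have H : nae D (fun x => f x = g x) by apply: nae_sub gf _ => x _ ->.
exact: (lebesgue_integrable oD mg g0 H).1 fi.
Qed.

End lebesgue_transfer.

(** * The Muckenhoupt condition: from Euclidean balls to cubes *)

Section muckenhoupt_borel.
Context (R : realType) (n : nat).
Notation X := (borel_rV R n).
Notation V := ('rV[R]_n).
Notation mu := (@borel_lebesgue R n).
Notation leb := (lebesgue_rV R n).
Notation nae := (@nae _ X R mu).

Lemma enorm_continuous : continuous (@enorm R n).
Proof.
move=> x; apply: continuous_comp; last exact: sqrt_continuous.
suff H (s : seq 'I_n) : continuous (fun y : V => \sum_(i <- s) y ord0 i ^+ 2) by exact: H.
elim: s => [|i s IH] y.
  by under eq_fun do rewrite big_nil; exact: cst_continuous.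
under eq_fun do rewrite big_cons expr2.
have ci : (fun z : V => z ord0 i) @ y --> y ord0 i by exact: coord_continuous.
exact: (cvgD (cvgM ci ci) (IH y)).
Qed.

Lemma open_eball (x : V) (r : R) : open (eball x r).
Proof.
rewrite (_ : eball x r = (fun y => enorm (y - x)) @^-1` [set t | t < r]).
  apply: open_comp; last exact: open_lt.
  move=> y _; apply: continuous_comp; last exact: enorm_continuous.
  by apply: continuousB; [exact: cvg_id|exact: cst_continuous].
by [].
Qed.

Lemma compact_uniform_ball (K U : set V) : compact K -> open U -> K `<=` U ->
  exists2 r : R, 0 < r & forall x, K x -> ball x r `<=` U.
Proof.
move=> /compact_near_coveringP cK oU KU.
have H : \forall r \near (0 : R)^'+, forall x, K x -> ball x r `<=` U.
  apply: (cK R (0 : R)^'+ (fun r x => ball x r `<=` U)) => x Kx.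
  have /nbhs_ballP[r /= r0 rU] := open_nbhs_nbhs (conj oU (KU x Kx)).
  have r2 : 0 < r / 2 by rewrite divr_gt0.
  exists (ball x (r / 2), [set t | t < r / 2]).
    by split => /=; [exact: nbhsx_ballx|exact: nbhs_right_lt].
  move=> [y t] [/= xy tr] z yz; apply: rU; rewrite [r]splitr.
  by apply: ball_triangle xy _; apply: le_ball yz; exact: ltW.
near (0 : R)^'+ => r; exists r; first by near: r; exact: nbhs_right_gt.
by near: r.
Unshelve. all: by end_near. Qed.

Lemma muckenhoupt_bound (q : R) (U : set V) (om : V -> R) : Muckenhoupt q U om ->
  exists2 S : R, 0 <= S & forall x rho, 0 < rho -> eball x rho `<=` U ->
    (ball_average x rho (EFin \o om) * (ball_average x rho (dual_weight q om)) `^ (q - 1) <= S%:E)%E.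
Proof.
move=> [_ _]; set E := (X in ereal_sup X) => Eoo.
exists (Num.max 0 (fine (ereal_sup E))); first by rewrite le_max lexx.
move=> x rho r0 rU; have : E (ball_average x rho (EFin \o om) * (ball_average x rho (dual_weight q om)) `^ (q - 1))%E.
  by exists x, rho.
move=> /(ereal_sup_ubound (S := E)) H; apply: (le_trans H).
case: (ereal_sup E) Eoo {H} => [r| |] //= _; last by rewrite leNye.
by rewrite lee_fin le_max lexx orbT.
Qed.

Variables (Omega U : set V) (q : R) (om : V -> R).
Hypotheses (oO : open Omega) (oU : open U) (OU : compactly_contained Omega U) (q1 : 1 < q).
Hypotheses (omA : Muckenhoupt q U om) (omM : ess_bounded Omega om).

(** Taking absolute values, and the minimum with [|M|] on [Omega], turns the bounds on [om] into
    pointwise ones without changing it outside a null subset of [U]. *)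
Lemma muckenhoupt_representative : exists (w : V -> R) (M : R),
  [/\ measurable_fun setT (w : X -> R), forall x, 0 <= w x, forall x, Omega x -> w x <= M &
      nae U (fun x => om x = w x)].
Proof.
have [mom om0 _] := omA; have [w0 [mw0 w0E _]] := lebesgue_representative oU mom.
have [M HM] := omM.
have {}HM : nae Omega (fun x => `|om x| <= M) by apply/nae_ae.
have mO : measurable_fun setT (\1_(Omega : set X) : X -> R).
  by apply: measurable_indic; exact: open_borel.
have mN : measurable_fun setT (fun x : X => `|w0 x|) by exact: measurableT_comp.
pose w x := (1 - \1_(Omega : set X) x) * `|w0 x| + \1_(Omega : set X) x * Num.min `|M| `|w0 x|.
exists w, `|M|; split.
- apply: measurable_funD; apply: measurable_funM => //; first exact: measurable_funB.
  exact: measurable_minr.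
- move=> x; rewrite /w indicE; case: (_ \in _); rewrite ?subrr ?subr0 ?mul0r ?mul1r ?add0r ?addr0// le_min !normr_ge0.
- move=> x Ox; rewrite /w indicE mem_set// subrr mul0r add0r mul1r ge_min lexx//.
- have HM' : nae U (fun x => Omega x -> `|om x| <= M).
    by have [N [mN' N0 H]] := HM; exists N; split => // x _ nNx Ox; exact: H.
  apply: nae_sub (nae_and w0E HM') _ => x Ux [E H]; rewrite /w E (ger0_norm (om0 x Ux)) indicE.
  have [Ox|nOx] := pselect (Omega x); last by rewrite memNset// subr0 mul1r mul0r addr0.
  rewrite mem_set// subrr mul0r add0r mul1r min_r//.
  have := H Ox; rewrite (ger0_norm (om0 x Ux)) => /le_trans; apply; exact: ler_norm.
Qed.

Lemma dual_weight_ge0 (w : V -> R) z : (0 <= dual_weight q w z)%E.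
Proof. by rewrite /dual_weight; case: ifP => // _; rewrite lee_fin powR_ge0. Qed.

Lemma measurable_dual_weight (w : X -> R) : measurable_fun setT w ->
  measurable_fun setT (dual_weight q w : X -> \bar R).
Proof.
move=> mw; apply: measurable_fun_ifT => //.
- exact: measurable_fun_eqr.
- by apply/measurable_EFinP; exact: (measurableT_comp (measurable_powR _)).
Qed.

(** A cube of radius [rho] lies in the Euclidean ball of radius [(n + 1) rho], which stays in [U]
    for small [rho] by compactness, and their measures are comparable. The part of the regularised
    weight coming from [eps] is estimated separately. *)
Lemma muckenhoupt_cube : exists (w : V -> R) (M A rho0 : R),
  [/\ measurable_fun setT (w : X -> R), forall x, 0 <= w x, forall x, Omega x -> w x <= M &
      nae U (fun x => om x = w x)] /\
  [/\ 0 < A, 0 < rho0 & cube_muckenhoupt Omega w q A rho0].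
Proof.
have [w [M [mw w0 wM wE]]] := muckenhoupt_representative.
have [S S0 HS] := muckenhoupt_bound omA.
have [cO OcU] := OU; have [r1 r10 Hr1] := compact_uniform_ball cO oU OcU.
have n1 : 0 < n.+1%:R :> R by rewrite ltr0n.
have q0 : 0 < q by apply: lt_trans q1.
(* The first term is for [w], with the ratio of the ball to [rho ^+ n]; the second is for the
   constant weight [eps]. *)
pose A := S * ((n.+1%:R *+ 2) ^+ n) `^ q + (2 ^+ n) `^ q.
exists w, M, A, (r1 / n.+1%:R); split => //; split.
- by rewrite ltr_wpDl ?powR_gt0 ?exprn_gt0// mulr_ge0// powR_ge0.
- by rewrite divr_gt0.
move=> eps x rho e0 e1 Ox rho_gt0 rho_lt.
pose rho' := n.+1%:R * rho; have rho'0 : 0 < rho' by rewrite mulr_gt0.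
pose B : set V := eball x rho'; have oB : open B := @open_eball x rho'.
have mB : measurable (B : set X) by exact: open_borel.
have cB : ball x rho `<=` B.
  have E : rho' / n.+1%:R = rho by rewrite /rho' mulrAC mulfV ?mul1r// gt_eqF.
  by have := @ball_eball _ _ x rho' rho'0; rewrite E.
have BU : B `<=` U.
  move=> y /(eball_ball rho'0) xy; apply: (Hr1 x (subset_closure Ox)).
  by apply: le_ball xy; rewrite /rho' mulrC -ler_pdivlMr// ltW.
have lebB : leb B = mu (B : set X) by exact: completed_borelE.
have muB1 : (mu (B : set X) <= ((rho' *+ 2) ^+ n)%:E)%E.
  rewrite -(borel_lebesgue_ball x rho'0); apply: le_measure; rewrite ?inE//.
    exact: measurable_ball_rV.
  exact: eball_ball.
have muB2 : (((rho *+ 2) ^+ n)%:E <= mu (B : set X))%E.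
  rewrite -(borel_lebesgue_ball x rho_gt0); apply: le_measure; rewrite ?inE//.
  exact: measurable_ball_rV.
have muBf : mu (B : set X) \is a fin_num.
  by rewrite ge0_fin_numE// (le_lt_trans muB1)// ltry.
pose m := fine (leb B); have mE : m%:E = mu (B : set X) by rewrite /m lebB fineK.
have m0 : 0 < m.
  by rewrite -lte_fin mE; apply: lt_le_trans muB2; rewrite lte_fin exprn_gt0// mulrn_wgt0.
have mle : m <= (rho' *+ 2) ^+ n by rewrite -lee_fin mE.
have wEB : nae B (fun z => om z = w z).
  by have [N [mN N0 H]] := wE; exists N; split => // z /BU Uz; exact: H.
set I2 := cube_int rho (dual_regular_weight Omega w q eps) x.
have I20 : 0 <= I2 by exact: cube_int_ge0.
pose I1 := cube_int rho (fun z => \1_(Omega : set X) z * w z) x.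
have I10 : 0 <= I1 by exact: cube_int_ge0.
have mO : measurable_fun setT (\1_(Omega : set X) : X -> R).
  by apply: measurable_indic; exact: open_borel.
have mi := measurable_cube_ind1 rho x.
have mOw : measurable_fun setT (fun z : X => \1_(Omega : set X) z * w z) by exact: measurable_funM.
have Owb z : `|\1_(Omega : set X) z * w z| <= `|M|.
  rewrite indicE; have [Oz|nOz] := pselect (Omega z); last by rewrite memNset// mul0r normr0.
  by rewrite mem_set// mul1r ger0_norm// (le_trans (wM z Oz))// ler_norm.
have I1E := cube_int_boundedE x rho_gt0 mOw Owb.
have md := measurable_dual_regular_weight q oO mw eps.
have db z := dual_regular_weight_le Omega w0 q1 z e0.
have I2E := cube_int_boundedE x rho_gt0 md db.
have ind_cube (z : X) : \1_(ball (0 : V) rho : set X) ((z : V) - x) = (1 : R) -> B z.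
  rewrite cube_indE// => /eqP; rewrite pnatr_eq1 eqb1 => /forallP H; apply: cB.
  by rewrite ball_box// => i; have := H i; rewrite !mxE /rV_coord distrC.
have ind01 (z : X) : \1_(ball (0 : V) rho : set X) ((z : V) - x) = (0 : R) \/
    \1_(ball (0 : V) rho : set X) ((z : V) - x) = (1 : R).
  by rewrite indicE; case: (_ \in _); [right|left].
have J1 : (I1%:E <= \int[leb]_(z in B) (EFin \o om) z)%E.
  rewrite (@lebesgue_integral_L1norm _ _ B (EFin \o om) w oB mw w0); last first.
    by apply: nae_sub wEB _ => z _ /= ->.
  rewrite -I1E; apply: L1norm_le.
  - exact: measurable_funM.
  - by apply: measurable_funM => //; apply: measurable_indic.
  - move=> z; have [->|h1] := ind01 z; first by rewrite mul0r normr0.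
    have iB : \1_(B : set X) z = 1 :> R by rewrite indicE mem_set//; exact: ind_cube.
    rewrite h1 iB !mul1r.
    by rewrite normrM ler_piMl// indicE; case: (_ \in _); rewrite ?normr1 ?normr0.
(* The regularised dual weight is below the true one, which is infinite where [w] vanishes. *)
have J2 : (I2%:E <= \int[leb]_(z in B) dual_weight q om z)%E.
  have mdw := measurable_dual_weight mw.
  rewrite [leRHS](@nae_integral _ _ _ mu B (dual_weight q om) (dual_weight q w)) => //; last 2 first.
  - exact: measurable_funTS.
  - by apply: nae_sub wEB _ => z _; rewrite /dual_weight => ->.
  rewrite -I2E integral_mkcond; apply: ge0_le_integral => //.
  - by apply: measurable_normE; exact: measurable_funM.
  - by apply/(measurable_restrictT _ _).1 => //; exact: measurable_funTS.
  - move=> z _; have [->|h1] := ind01 z.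
      by rewrite mul0r normr0 patchE; case: (z \in _) => //; exact: dual_weight_ge0.
    rewrite h1 mul1r patchE mem_set; last exact: ind_cube.
    rewrite /dual_weight; case: ifPn => [_|wz0]; first by rewrite leey.
    have wz : 0 < w z by rewrite lt_neqAle eq_sym wz0 w0.
    rewrite lee_fin /dual_regular_weight normrM [X in _ * X]ger0_norm ?powR_ge0//.
    apply: (@le_trans _ _ ((w z + eps) `^ (- (q - 1)^-1))).
      by rewrite ler_piMl ?powR_ge0// indicE; case: (_ \in _); rewrite ?normr1 ?normr0.
    have s0 : 0 <= (q - 1)^-1 by rewrite invr_ge0 subr_ge0 ltW.
    rewrite !powRN lef_pV2 ?posrE ?powR_gt0 ?addr_gt0//.
    by apply: ge0_ler_powR; rewrite ?nnegrE ?addr_ge0 ?lerDl ?(ltW e0).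
have mi0 : 0 <= m^-1 by rewrite invr_ge0 ltW.
have prod_le : m^-1 * I1 * (m^-1 * I2) `^ (q - 1) <= S.
  rewrite -lee_fin; apply: le_trans (HS x rho' rho'0 BU).
  rewrite EFinM -poweR_EFin; apply: lee_pmul.
  - by rewrite lee_fin mulr_ge0.
  - exact: poweR_ge0.
  - by rewrite EFinM; apply: lee_wpmul2l => //; rewrite lee_fin.
  - apply: gt0_ler_poweR; first by rewrite subr_ge0 ltW.
    + by rewrite in_itv /= leey andbT lee_fin mulr_ge0.
    + rewrite in_itv /= leey andbT mule_ge0//.
      by apply: integral_ge0 => z _; exact: dual_weight_ge0.
    + by rewrite EFinM; apply: lee_wpmul2l => //; rewrite lee_fin.
have step1 : I1 * I2 `^ (q - 1) <= S * m `^ q.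
  have E : m^-1 * I1 * (m^-1 * I2) `^ (q - 1) = I1 * I2 `^ (q - 1) * (m `^ q)^-1.
    rewrite powRM// -powR_inv1 ?(ltW m0)// -powRrM mulN1r.
    have -> : (m `^ q)^-1 = m `^ (-1) * m `^ (- (q - 1)).
      by rewrite -powRN -powRD ?(gt_eqF m0) ?implybT//; congr (_ `^ _); lra.
    lra.
  by rewrite E ler_pdivrMr ?powR_gt0// in prod_le.
pose c1 := (rho *+ 2) ^+ n; have c10 : 0 < c1 by rewrite exprn_gt0// mulrn_wgt0.
have I2le : I2 <= eps `^ (- (q - 1)^-1) * c1.
  by rewrite -lee_fin -I2E; exact: cube_int_le_vol.
(* The dual weight is at most [eps^(- 1 / (q - 1))], so its power [q - 1] cancels the factor
   [eps]. *)
have step2 : eps * c1 * I2 `^ (q - 1) <= c1 `^ q.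
  apply: (@le_trans _ _ (eps * c1 * (eps `^ (- (q - 1)^-1) * c1) `^ (q - 1))).
    rewrite ler_wpM2l ?mulr_ge0 ?(ltW e0) ?(ltW c10)//.
    by apply: ge0_ler_powR; rewrite ?nnegrE ?subr_ge0 ?mulr_ge0 ?powR_ge0 ?(ltW q1) ?(ltW c10).
  rewrite powRM ?powR_ge0 ?(ltW c10)// -powRrM mulNr mulVf ?subr_eq0 ?gt_eqF//.
  rewrite powR_inv1 ?(ltW e0)// mulrACA mulfV ?gt_eqF// mul1r (mulr_powRB1 (ltW c10) q0)//.
have cube_reg : cube_int rho (regular_weight Omega w eps) x <= I1 + eps * c1.
  have mr := measurable_regular_weight oO mw eps.
  have mOe : measurable_fun setT (fun z : X => \1_(Omega : set X) z * eps) by exact: measurable_funM.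
  have Oeb z : `|\1_(Omega : set X) z * eps| <= eps.
    by rewrite normrM (gtr0_norm e0) ler_piMl ?(ltW e0)// indicE; case: (_ \in _); rewrite ?normr1 ?normr0.
  have H := cube_int_boundedE x rho_gt0 mr (fun z => regular_weight_le w0 wM z e0).
  rewrite -lee_fin -H EFinD -I1E; apply: le_trans (leeD (lexx _) (cube_int_le_vol x rho_gt0 mOe Oeb)).
  apply: L1norm_triangle; [exact: measurable_funM..|] => z.
  by rewrite /regular_weight !mulrDr; exact: ler_normD.
apply: (@le_trans _ _ (S * m `^ q + c1 `^ q)).
  apply: le_trans (ler_wpM2r (powR_ge0 _ _) cube_reg) _.
  by rewrite mulrDl lerD.
have rn0 : 0 <= rho ^+ n by rewrite exprn_ge0// ltW.
rewrite /A mulrDl lerD//.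
  have n2 : 0 <= (n.+1%:R *+ 2) ^+ n :> R by rewrite exprn_ge0// mulrn_wge0.
  rewrite -mulrA -(powRM _ n2 rn0) ler_wpM2l//.
  apply: ge0_ler_powR; rewrite ?nnegrE ?(ltW q0) ?(ltW m0) ?mulr_ge0 ?exprn_ge0 ?mulrn_wge0//.
    exact: ltW.
  by rewrite -exprMn mulrnAl.
have n2 : 0 <= 2 ^+ n :> R by rewrite exprn_ge0.
by rewrite -(powRM _ n2 rn0) -exprMn mulr_natl.
Qed.

End muckenhoupt_borel.

(** * A measurable q-th root comparable to that of sigma *)

Section zclass_root.
Context (R : realType) (n : nat).
Notation X := (borel_rV R n).
Notation V := ('rV[R]_n).
Implicit Types (x y : V).

Lemma powR_superadd (s t q : R) : 0 <= s -> 0 <= t -> 1 <= q -> s `^ q + t `^ q <= (s + t) `^ q.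
Proof.
move=> s0 t0 q1; have q0 : 0 < q by apply: lt_le_trans q1.
have q1' : 0 <= q - 1 by rewrite subr_ge0.
have st0 : 0 <= s + t by rewrite addr_ge0.
rewrite -(mulr_powRB1 s0 q0) -(mulr_powRB1 t0 q0) -(mulr_powRB1 st0 q0) mulrDl.
by apply: lerD; apply: ler_wpM2l => //; apply: ge0_ler_powR; rewrite ?nnegrE ?lerDl ?lerDr.
Qed.

Lemma powR_inv_subadd (s t q : R) : 0 <= s -> 0 <= t -> 1 <= q ->
  (s + t) `^ q^-1 <= s `^ q^-1 + t `^ q^-1.
Proof.
move=> s0 t0 q1; have q0 : 0 < q by apply: lt_le_trans q1.
have rK (u : R) : 0 <= u -> (u `^ q^-1) `^ q = u.
  by move=> u0; rewrite -powRrM mulVf ?gt_eqF// powRr1.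
have := powR_superadd (powR_ge0 s q^-1) (powR_ge0 t q^-1) q1; rewrite !rK// => H.
have qi0 : 0 <= q^-1 by rewrite invr_ge0 ltW.
have := ge0_ler_powR qi0 _ _ H; rewrite !nnegrE addr_ge0// powR_ge0 => /(_ isT isT) /le_trans; apply.
by rewrite -powRrM mulfV ?gt_eqF// powRr1// addr_ge0// powR_ge0.
Qed.

Lemma measurable_open_ray (b : X -> R) :
  (forall c : R, open ([set x | b x < c] : set V)) -> measurable_fun setT b.
Proof.
move=> H mT; apply: (measurability _ (RGenInftyO.measurableE R)) => // _ [_ [c ->] <-].
rewrite setTI; apply: open_borel; rewrite (_ : _ @^-1` _ = [set x | b x < c]); first exact: H.
by apply/seteqP; split=> x /=; rewrite in_itv.
Qed.

Lemma open_powR_lt y (k c : R) : 0 < k -> open [set x | enorm (x - y) `^ k < c].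
Proof.
move=> k0; have [c0|c0] := ltP 0 c; last first.
  rewrite (_ : mkset _ = set0); first exact: open0.
  by apply/seteqP; split=> x //=; rewrite ltNge (le_trans c0)// powR_ge0.
have ck : (c `^ k^-1) `^ k = c by rewrite -powRrM mulVf ?gt_eqF// powRr1// ltW.
rewrite (_ : mkset _ = eball y (c `^ k^-1)); first exact: open_eball.
apply/seteqP; split=> x; rewrite /eball /=.
  move=> xc; rewrite ltNge; apply/negP => H; move: xc; rewrite ltNge => /negP; apply.
  by rewrite -[leLHS]ck; apply: ge0_ler_powR; rewrite ?nnegrE ?enorm_ge0 ?powR_ge0 ?(ltW k0).
by move=> H; rewrite -[ltRHS]ck; apply: gt0_ltr_powR => //; rewrite ?nnegrE ?enorm_ge0 ?powR_ge0.
Qed.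

(* The q-th root of sigma need not be measurable; the inf-convolution of it with
   C |.| ^ (kappa / q) is, and it is comparable to it. *)
Lemma Zclass_root (Omega : set V) (kappa q : R) (sigma : V -> R) : bounded_set Omega ->
  0 < kappa -> 1 < q -> Zclass kappa Omega sigma ->
  exists (b : V -> R) (Mb Cb c : R), [/\ measurable_fun setT (b : X -> R), forall x, 0 <= b x,
      forall x, Omega x -> b x <= Mb, 0 < Cb & 0 <= c] /\
    (forall (x y : V) (rho : R), Omega x -> Omega y -> 0 < rho ->
       (forall i, `|x ord0 i - y ord0 i| < rho) -> b x <= Cb * (b y + rho `^ (kappa / q))) /\
    (forall x, Omega x -> sigma x <= b x `^ q /\ b x `^ q <= c * sigma x).
Proof.
move=> bO k0 q1 [s0 [C HC]]; have q0 : 0 < q by apply: lt_trans q1.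
(* The infimum below needs a point of [Omega]; for the empty set constant data suffice. *)
have [[y0 Oy0]|O0] := pselect (exists y, Omega y); last first.
  have nO x : ~ Omega x by move=> Ox; apply: O0; exists x.
  exists (fun=> 0), 0, 1, 0; split; first by split.
  by split=> [x y rho /nO//|x /nO].
set kb := kappa / q; have kb0 : 0 < kb by rewrite divr_gt0.
(* [C] may vanish, whereas the root of the constant has to be positive. *)
pose C' := Num.max C 1; have C'1 : 1 <= C' by rewrite le_max lexx orbT.
pose S y := sigma y `^ q^-1; have S0 y : 0 <= S y by exact: powR_ge0.
have qi0 : 0 <= q^-1 by rewrite invr_ge0 ltW.
pose C1 := C' `^ q^-1; have C10 : 0 < C1 by rewrite powR_gt0// (lt_le_trans _ C'1).
have key x y : Omega x -> Omega y -> S x <= C1 * (S y + enorm (x - y) `^ kb).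
  move=> Ox Oy; have r0 : 0 <= sigma y + enorm (x - y) `^ kappa by rewrite addr_ge0 ?s0 ?powR_ge0.
  have C'0 : 0 <= C' by apply: le_trans C'1.
  apply: (@le_trans _ _ ((C' * (sigma y + enorm (x - y) `^ kappa)) `^ q^-1)).
    apply: ge0_ler_powR; rewrite ?nnegrE ?s0 ?mulr_ge0//.
    by apply: le_trans (HC _ _ Ox Oy) _; rewrite ler_wpM2r// le_max lexx.
  rewrite powRM// ler_wpM2l ?(ltW C10)//.
  apply: le_trans (powR_inv_subadd (s0 y Oy) (powR_ge0 _ _) (ltW q1)) _.
  by rewrite -powRrM lerD2l.
pose E x : set R := [set C1 * (S y + enorm (x - y) `^ kb) | y in Omega].
have lbE x : has_lbound (E x).
  by exists 0 => _ [y Oy <-]; rewrite mulr_ge0 ?(ltW C10)// addr_ge0// powR_ge0.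
have neE x : E x !=set0 by exists (C1 * (S y0 + enorm (x - y0) `^ kb)); exists y0.
pose b x := inf (E x).
have b0 x : 0 <= b x.
  apply: lb_le_inf; first exact: neE.
  by move=> _ [y Oy <-]; rewrite mulr_ge0 ?(ltW C10)// addr_ge0// powR_ge0.
have ble x y : Omega y -> b x <= C1 * (S y + enorm (x - y) `^ kb).
  by move=> Oy; apply: ge_inf; [exact: lbE|exists y].
have bS x : Omega x -> S x <= b x.
  by move=> Ox; apply: lb_le_inf; [exact: neE|move=> _ [y Oy <-]; exact: key].
have Sb x : Omega x -> b x <= C1 * S x.
  move=> Ox; apply: le_trans (ble x x Ox) _; rewrite subrr.
  have -> : enorm (0 : V) = 0.
    by rewrite /enorm big1 ?sqrtr0// => i _; rewrite mxE expr0n.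
  by rewrite powR0 ?gt_eqF// addr0.
have en_le (x y : V) (r : R) : (forall i, `|x ord0 i - y ord0 i| <= r) -> enorm (x - y) <= n%:R * r.
  move=> H; apply: le_trans (enorm_le_sum _) _.
  apply: (@le_trans _ _ (\sum_(i < n) r)); first by apply: ler_sum => i _; rewrite !mxE.
  by rewrite sumr_const card_ord mulr_natl.
have [r r0 Hr] : exists2 r : R, 0 <= r & forall x, Omega x -> enorm (x - y0) <= r.
  case: bO => K [Kr HK]; pose K' := `|K| + 1.
  have {}HK x : Omega x -> `|x| <= K' by apply: HK; rewrite (le_lt_trans (ler_norm _))// ltrDl.
  have K'0 : 0 <= K' by rewrite addr_ge0.
  exists (n%:R * (K' + K')); first by rewrite mulr_ge0// addr_ge0.
  move=> x Ox; apply: en_le => i; apply: le_trans (ler_normB _ _) _.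
  have cle (z : V) : `|z ord0 i| <= `|z|.
    by rewrite [leRHS]mx_normrE; apply: (le_bigmax _ (fun ij => `|z ij.1 ij.2|) (ord0, i)).
  by apply: lerD; apply: le_trans (cle _) _; exact: HK.
have C1q : C1 `^ q = C' by rewrite -powRrM mulVf ?gt_eqF// powRr1// (le_trans _ C'1).
(* One factor [C1] compares [b] with the root [S], the other is the constant of [key]; the power of
   [n + 1] converts sup distance into Euclidean distance. *)
exists b, (C1 * (S y0 + r `^ kb)), (C1 * C1 * ((n%:R + 1) `^ kb)), C'.
split; [split => //|split].
- apply: measurable_open_ray => c.
  (* A sublevel set of an infimum is the union of the sublevel sets, each of them open; hence [b] is
     measurable although [S] need not be. *)
  rewrite (_ : mkset _ = \bigcup_(y in Omega) [set x | C1 * (S y + enorm (x - y) `^ kb) < c]).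
    apply: bigcup_open => y Oy.
    rewrite (_ : mkset _ = [set x | enorm (x - y) `^ kb < c / C1 - S y]); first exact: open_powR_lt.
    by apply/seteqP; split=> x /=; rewrite ltrBrDl ltr_pdivlMr// mulrC.
  apply/seteqP; split=> x /=.
    by move=> /(inf_lt (neE x))[_ [y Oy <-] H]; exists y.
  by move=> [y Oy /=]; apply: le_lt_trans; exact: ble.
- move=> x Ox; apply: le_trans (ble x y0 Oy0) _.
  rewrite ler_wpM2l ?(ltW C10)// lerD2l.
  by apply: ge0_ler_powR; rewrite ?nnegrE ?enorm_ge0 ?(ltW kb0)// Hr.
- by rewrite !mulr_gt0// powR_gt0// ltr_wpDl.
- by apply: le_trans C'1.
- move=> x y rho Ox Oy rho0 xy; apply: le_trans (Sb x Ox) _.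
  rewrite -!mulrA ler_wpM2l ?(ltW C10)//; apply: le_trans (key x y Ox Oy) _.
  rewrite ler_wpM2l ?(ltW C10)//.
  have n1 : 0 <= n%:R + 1 :> R by rewrite addr_ge0.
  have n1k : 1 <= (n%:R + 1) `^ kb :> R.
    have E1 : 1 `^ kb = 1 :> R by rewrite powR1.
    by rewrite -[leLHS]E1; apply: ge0_ler_powR; rewrite ?nnegrE ?(ltW kb0)// lerDr.
  rewrite mulrDr lerD//.
    by apply: le_trans (bS y Oy) _; rewrite ler_peMl.
  rewrite -powRM ?(ltW rho0)//; apply: ge0_ler_powR; rewrite ?nnegrE ?enorm_ge0 ?(ltW kb0) ?mulr_ge0 ?(ltW rho0)//.
  apply: (@le_trans _ _ (n%:R * rho)); first by apply: en_le => i; exact: ltW (xy i).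
  by rewrite ler_wpM2r ?(ltW rho0)// lerDl.
- move=> x Ox; have Sq : S x `^ q = sigma x by rewrite -powRrM mulVf ?gt_eqF// powRr1// s0.
  split.
    by rewrite -Sq; apply: ge0_ler_powR; rewrite ?nnegrE ?(ltW q0)// bS.
  rewrite -Sq -C1q -powRM ?(ltW C10)//.
  by apply: ge0_ler_powR; rewrite ?nnegrE ?(ltW q0) ?mulr_ge0 ?(ltW C10)// Sb.
Qed.

End zclass_root.

(** * Weak gradients and the energy *)

Section weak_gradients.
Context (R : realType) (n : nat).
Notation X := (borel_rV R n).
Notation V := ('rV[R]_n).
Notation mu := (@borel_lebesgue R n).
Notation leb := (lebesgue_rV R n).
Notation nae := (@nae _ X R mu).
Variable D : set V.
Hypothesis oD : open D.
Implicit Types (u v phi : V -> R) (G : 'I_n -> V -> R).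

(** A weak gradient on [D] in terms of Borel functions on the whole space that vanish off [D], so
    that the tools for [borel_lebesgue] apply. *)
Definition borel_wgrad v G := [/\ mu.-integrable setT (EFin \o (v : X -> R)),
  forall i, mu.-integrable setT (EFin \o (G i : X -> R)),
  forall x, ~ D x -> v x = 0 /\ forall i, G i x = 0 &
  forall phi i, Cc_infty D phi ->
    \int[mu]_x (v x * pderiv i phi x) = - \int[mu]_x (G i x * phi x)].

Lemma L1norm_eq0_nae (f : X -> R) : measurable_fun setT f -> L1norm mu f = 0%E ->
  nae setT (fun x => f x = 0).
Proof.
move=> mf f0; have : ae_eq mu setT (EFin \o f) (cst 0%E).
  by apply/ae_eq_integral_abs => //; apply/measurable_EFinP.
move=> [N [mN N0 H]]; exists N; split => // x _ nNx.
by apply: contrapT => fx; apply: nNx; apply: H => /= /(_ I) [].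
Qed.

Lemma test_integrable (f : X -> R) phi : Cc_infty D phi -> mu.-integrable setT (EFin \o f) ->
  mu.-integrable setT (EFin \o (fun x : X => f x * phi x)) /\
  forall i, mu.-integrable setT (EFin \o (fun x : X => f x * pderiv i phi x)).
Proof.
move=> /Cc_infty_C1b Cphi fi; have [_ _ _ [K [K1 K2]]] := Cphi.
split=> [|i].
  apply: eq_integrable (integrable_bounded_mul (C1b_measurable Cphi) K1 fi) => // x _.
  by rewrite /= mulrC.
apply: eq_integrable (integrable_bounded_mul (pderiv_measurable i Cphi) (K2 i) fi) => // x _.
by rewrite /= mulrC.
Qed.

Lemma nae_Rintegral (f g : X -> R) : mu.-integrable setT (EFin \o f) ->
  mu.-integrable setT (EFin \o g) -> nae setT (fun x => f x = g x) ->
  \int[mu]_x f x = \int[mu]_x g x.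
Proof.
move=> /integrableP[mf _] /integrableP[mg _] [N [mN N0 H]]; congr fine.
apply: ae_eq_integral => //; exists N; split => // x /= nfg.
by apply: contrapT => nNx; apply: nfg => _; congr EFin; exact: H.
Qed.

Lemma borel_wgrad_unique v v' G G' : borel_wgrad v G -> borel_wgrad v' G' ->
  nae D (fun x => v x = v' x) -> nae D (fun x => forall i, G i x = G' i x).
Proof.
move=> [iv iG z H] [iv' iG' z' H'] vv; apply: nae_all => i.
have vv' : nae setT (fun x => v x = v' x).
  have [N [mN N0 E]] := vv; exists N; split => // x _ nNx.
  have [Dx|nDx] := pselect (D x); first exact: E.
  by have [-> _] := z _ nDx; have [-> _] := z' _ nDx.
have iGG := integrable_subr (iG i) (iG' i).
have E : L1norm mu (fun x : X => (G i x - G' i x) * \1_(D : set X) x) = 0%E.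
  apply: (integral_mul_Cc_infty_eq0 oD iGG) => phi Cphi.
  have [j1 j2] := test_integrable Cphi (iG i); have [j1' j2'] := test_integrable Cphi (iG' i).
  have [k1 k2] := test_integrable Cphi iv; have [k1' k2'] := test_integrable Cphi iv'.
  transitivity (\int[mu]_x (G i x * phi x) - \int[mu]_x (G' i x * phi x)).
    by rewrite -RintegralB//; apply: eq_Rintegral => x _; rewrite mulrBl.
  have := H phi i Cphi; have := H' phi i Cphi.
  have -> : \int[mu]_x (v x * pderiv i phi x) = \int[mu]_x (v' x * pderiv i phi x).
    by apply: nae_Rintegral => //; apply: nae_sub vv' _ => x _ ->.
  by move=> -> /oppr_inj ->; rewrite subrr.
have /integrable_L1norm[mGG _] := iGG.
have [|N [mN N0 HN]] := L1norm_eq0_nae _ E.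
  by apply: measurable_funM => //; apply: measurable_indic; exact: open_borel.
exists N; split => // x Dx nNx; have := HN x I nNx.
by rewrite indicE mem_set// mulr1 => /eqP; rewrite subr_eq0 => /eqP.
Qed.

Lemma borel_wgradD v v' G G' : borel_wgrad v G -> borel_wgrad v' G' ->
  borel_wgrad (fun x => v x + v' x) (fun i x => G i x + G' i x).
Proof.
move=> [iv iG z H] [iv' iG' z' H']; split.
- exact: integrable_addr.
- by move=> i; exact: integrable_addr.
- move=> x nDx; have [-> E] := z x nDx; have [-> E'] := z' x nDx.
  by rewrite addr0; split=> // i; rewrite E E' addr0.
- move=> phi i Cphi.
  have [j1 j2] := test_integrable Cphi (iG i); have [j1' j2'] := test_integrable Cphi (iG' i).
  have [k1 k2] := test_integrable Cphi iv; have [k1' k2'] := test_integrable Cphi iv'.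
  transitivity (\int[mu]_x (v x * pderiv i phi x) + \int[mu]_x (v' x * pderiv i phi x)).
    by rewrite -RintegralD//; apply: eq_Rintegral => x _; rewrite mulrDl.
  rewrite H// H'// -opprD -RintegralD//; congr (- _).
  by apply: eq_Rintegral => x _; rewrite mulrDl.
Qed.

Lemma borel_wgradN v G : borel_wgrad v G -> borel_wgrad (fun x => - v x) (fun i x => - G i x).
Proof.
move=> [iv iG z H].
have iN (f : X -> R) : mu.-integrable setT (EFin \o f) -> mu.-integrable setT (EFin \o (fun x => - f x)).
  by move=> fi; apply: eq_integrable (integrable_mulr (-1) fi) => // x _; rewrite /= mulN1r.
have RN (f : X -> R) : mu.-integrable setT (EFin \o f) -> \int[mu]_x (- f x) = - \int[mu]_x f x.
  move=> fi; rewrite -mulN1r -RintegralZl//; apply: eq_Rintegral => x _; by rewrite mulN1r.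
split.
- exact: iN.
- by move=> i; exact: iN.
- by move=> x nDx; have [-> E] := z x nDx; rewrite oppr0; split=> // i; rewrite E oppr0.
- move=> phi i Cphi; have [j1 _] := test_integrable Cphi (iG i); have [_ k2] := test_integrable Cphi iv.
  rewrite (@eq_Rintegral _ _ _ _ _ (fun x : X => - (v x * pderiv i phi x))); last by move=> x _; rewrite mulNr.
  rewrite RN// H// -RN//; congr (- _); apply: eq_Rintegral => x _; by rewrite mulNr.
Qed.

Lemma Cc_infty_outside phi x : Cc_infty D phi -> ~ D x -> phi x = 0 /\ forall i, pderiv i phi x = 0.
Proof.
move=> [_ _ sD] nDx; have nx : ~ closure [set x | phi x != 0] x by move=> /sD.
have ou : open (~` closure [set x | phi x != 0]) by apply: closed_openC; exact: closed_closure.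
have z y : ~ closure [set x | phi x != 0] y -> phi y = 0.
  by move=> ny; apply/eqP/negPn/negP => py; apply: ny; exact: subset_closure.
split; first exact: z.
move=> i; apply: (@pderiv_near_cst _ _ _ 0); near=> y; apply: z.
by near: y; exact: open_nbhs_nbhs.
Unshelve. all: by end_near. Qed.

Lemma Cc_infty_bsupp phi : Cc_infty D phi -> bsupp phi.
Proof.
move=> [_ /compact_bounded[K [Kr HK]] _]; pose r := `|K| + 2.
exists r; first by rewrite ltr_wpDl.
move=> x nx; apply/eqP/negPn/negP => px; apply: nx.
rewrite -ball_normE /= sub0r normrN; apply: (@le_lt_trans _ _ (`|K| + 1)).
  apply: HK; first by rewrite (le_lt_trans (ler_norm _))// ltrDl.
  exact: subset_closure.
by rewrite ltrD2l ltr1n.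
Qed.

Lemma borel_wgrad_Cc_infty phi : Cc_infty D phi -> borel_wgrad phi (fun i => pderiv i phi).
Proof.
move=> Cphi; have C1 := Cc_infty_C1b Cphi; have bphi := Cc_infty_bsupp Cphi; split.
- exact: C1b_integrable.
- by move=> i; exact: pderiv_integrable.
- by move=> x /(Cc_infty_outside Cphi).
- by move=> psi i /Cc_infty_C1b Cpsi; exact: Rintegral_by_parts.
Qed.

(** [wgrad] is a choice among all weak gradients and can only be identified almost everywhere; this
    ties it to a Borel gradient. *)
Definition grad_rep u v G := [/\ borel_wgrad v G, nae D (fun x => v x = u x) &
  nae D (fun x => wgrad D u x = \row_i G i x)].

Lemma weak_gradient_rep u g : (lebesgue_rV R n).-integrable D (EFin \o u) ->
  weak_gradient D u g -> exists v G, [/\ borel_wgrad v G, nae D (fun x => v x = u x) &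
    nae D (fun x => g x = \row_i G i x)].
Proof.
move=> iu [ig H].
have [v [iv vu v0]] := integrable_representative oD iu.
have /choice[G HG] : forall i, exists Gi : V -> R, [/\ mu.-integrable setT (EFin \o (Gi : X -> R)),
    nae D (fun x => Gi x = g x ord0 i) & forall x, ~ D x -> Gi x = 0].
  move=> i; exact: (@integrable_representative _ _ D (fun x => g x ord0 i) oD (ig i)).
exists v, G; split => //.
- split => //.
  + by move=> i; have [] := HG i.
  + by move=> x nDx; split; [exact: v0|move=> i; have [_ _] := HG i; apply].
  + move=> phi i Cphi; have [iGi Gig Gi0] := HG i.
    have [k1 k2] := test_integrable Cphi iv; have [j1 j2] := test_integrable Cphi iGi.
    have /integrable_L1norm[mk2 _] := k2 i; have /integrable_L1norm[mj1 _] := j1.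
    have := H phi i Cphi.
    rewrite (@lebesgue_Rintegral _ _ D (fun x => u x * pderiv i phi x) (fun x => v x * pderiv i phi x))//; last 2 first.
    * by move=> x /v0 ->; rewrite mul0r.
    * by apply: nae_sub vu _ => x _ ->.
    rewrite (@lebesgue_Rintegral _ _ D (fun x => g x ord0 i * phi x) (fun x => G i x * phi x))//; last 2 first.
    * by move=> x /Gi0 ->; rewrite mul0r.
    * by apply: nae_sub Gig _ => x _ ->.
    by rewrite -EFinN => -[].
- have : nae D (fun x => forall i, G i x = g x ord0 i) by apply: nae_all => i; have [] := HG i.
  by move=> Hn; apply: nae_sub Hn _ => x _ E; apply/rowP => i; rewrite mxE E.
Qed.

Lemma grad_rep_exists u : W11 D u -> exists v G, grad_rep u v G.
Proof. by move=> [iu /xgetPex H]; have [v [G [? ? ?]]] := weak_gradient_rep iu (H (fun=> 0)); exists v, G. Qed.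

(** Any Borel weak gradient of a representative represents the chosen one: both satisfy the same
    identities, and uniqueness applies. *)
Lemma borel_wgrad_W11 u v G : borel_wgrad v G -> nae D (fun x => v x = u x) ->
  W11 D u /\ grad_rep u v G.
Proof.
move=> bvG vu; have [iv iG z H] := bvG; have /integrable_L1norm[mv _] := iv.
have uv : nae D (fun x => u x = v x) by apply: nae_sub vu _ => x _ ->.
have W : W11 D u.
  split; first by apply/(lebesgue_integrable oD mv _ uv) => // x /z[].
  exists (fun x => \row_i G i x); split.
    move=> i; have /integrable_L1norm[mGi _] := iG i.
    apply/(@lebesgue_integrable _ _ D (fun x => (\row_i G i x) ord0 i) (G i) oD mGi) => //.
    - by move=> x /z[].
    - by exists set0; split => // x _ _; rewrite mxE.
  move=> phi i Cphi.
  have [k1 k2] := test_integrable Cphi iv; have [j1 j2] := test_integrable Cphi (iG i).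
  have /integrable_L1norm[mk2 _] := k2 i; have /integrable_L1norm[mj1 _] := j1.
  rewrite (@lebesgue_Rintegral _ _ D (fun x => u x * pderiv i phi x) (fun x => v x * pderiv i phi x))//; last 2 first.
  - by move=> x /z[-> _]; rewrite mul0r.
  - by apply: nae_sub uv _ => x _ ->.
  rewrite (@lebesgue_Rintegral _ _ D (fun x => (\row_i G i x) ord0 i * phi x) (fun x => G i x * phi x))//; last 2 first.
  - by move=> x /z[_ ->]; rewrite mul0r.
  - by exists set0; split => // x _ _; rewrite mxE.
  by rewrite H// EFinN.
split => //; have [v' [G' [bvG' vu' gG']]] := grad_rep_exists W.
split => //; have E : nae D (fun x => v' x = v x).
  by apply: nae_sub (nae_and vu' vu) _ => x _ [-> ->].
have U := borel_wgrad_unique bvG' bvG E.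
apply: nae_sub (nae_and gG' U) _ => x _ [-> GG]; apply/rowP => i; rewrite !mxE; exact: GG.
Qed.

End weak_gradients.

Section energy_representation.
Context (R : realType) (n : nat).
Notation X := (borel_rV R n).
Notation V := ('rV[R]_n).
Notation mu := (@borel_lebesgue R n).
Notation leb := (lebesgue_rV R n).
Notation nae := (@nae _ X R mu).
Implicit Types (u v phi : V -> R) (G H : 'I_n -> V -> R).

Lemma enormD (x y : V) : enorm (x + y) <= enorm x + enorm y.
Proof.
pose a := enorm x; pose b := enorm y; pose S := \sum_i x ord0 i * y ord0 i.
have a0 : 0 <= a by exact: enorm_ge0.
have b0 : 0 <= b by exact: enorm_ge0.
(* Cauchy-Schwarz, by summing [2 a b x_i y_i <= b^2 x_i^2 + a^2 y_i^2] and dividing by [a b]; the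
   degenerate cases come first. *)
have cs : S <= a * b.
  have [az|an0] := eqVneq a 0.
    rewrite /S big1 ?mulr_ge0// => i _.
    have := coord_le_enorm x i; rewrite -/a az normr_le0 => /eqP ->; by rewrite mul0r.
  have [bz|bn0] := eqVneq b 0.
    rewrite /S big1 ?mulr_ge0// => i _.
    have := coord_le_enorm y i; rewrite -/b bz normr_le0 => /eqP ->; by rewrite mulr0.
  have ab0 : 0 < a * b by rewrite mulr_gt0// lt_neqAle eq_sym ?an0 ?bn0.
  have : (a * b) * S * 2 <= (a * b) * (a * b) * 2.
    have -> : (a * b) * (a * b) * 2 = b ^+ 2 * a ^+ 2 + a ^+ 2 * b ^+ 2 by rewrite !expr2; lra.
    rewrite {2}/a {3}/b !enorm_sqr /S !mulr_sumr mulr_suml -big_split/=.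
    apply: ler_sum => i _; have := sqr_ge0 (b * x ord0 i - a * y ord0 i).
    by rewrite -!enorm_sqr -/a -/b !expr2; lra.
  by rewrite ler_pM2r// ler_pM2l.
rewrite -(ler_pXn2r (n := 2)) ?nnegrE ?addr_ge0 ?enorm_ge0// enorm_sqr -/a -/b.
have -> : \sum_i (x + y) ord0 i ^+ 2 = a ^+ 2 + S * 2 + b ^+ 2.
  rewrite /a /b !enorm_sqr /S mulr_suml -!big_split/=; apply: eq_bigr => i _.
  by rewrite mxE !expr2; lra.
by rewrite !expr2; lra.
Qed.

Definition gnorm G (x : V) : R := enorm (\row_i G i x).

Lemma gnorm_ge0 G x : 0 <= gnorm G x. Proof. exact: enorm_ge0. Qed.

Lemma gnormD G H x : gnorm (fun i y => G i y + H i y) x <= gnorm G x + gnorm H x.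
Proof.
rewrite /gnorm (_ : \row_i (G i x + H i x) = \row_i G i x + \row_i H i x); first exact: enormD.
by apply/rowP => i; rewrite !mxE.
Qed.

Lemma le_gnorm G i x : `|G i x| <= gnorm G x.
Proof. by have := coord_le_enorm (\row_i G i x) i; rewrite mxE. Qed.

Lemma gnorm_le_sum G x : gnorm G x <= \sum_i `|G i x|.
Proof.
apply: le_trans (enorm_le_sum _) _; apply: ler_sum => i _; by rewrite mxE.
Qed.

Lemma gnorm0 G x : (forall i, G i x = 0) -> gnorm G x = 0.
Proof.
move=> G0; apply/eqP; rewrite eq_le gnorm_ge0 andbT (le_trans (gnorm_le_sum _ _))//.
by rewrite big1// => i _; rewrite G0 normr0.
Qed.

Lemma measurable_gnorm G : (forall i, measurable_fun setT (G i : X -> R)) ->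
  measurable_fun setT (gnorm G : X -> R).
Proof.
move=> mG; apply: (measurableT_comp (continuous_measurable_fun (@sqrt_continuous R))).
apply: measurable_sum => i.
rewrite (_ : (fun x => _) = (fun x : X => G i x ^+ 2)); last by apply/funext => x; rewrite mxE.
exact: measurable_funX.
Qed.

Variable D : set V.
Hypothesis oD : open D.
Notation indD := (\1_(D : set X) : X -> R).

Lemma W11_norm_rep u v G : grad_rep D u v G ->
  W11_norm D u = (L1norm mu (v : X -> R) + L1norm mu (gnorm G : X -> R))%E.
Proof.
move=> [[iv iG z _] vu gG].
have /integrable_L1norm[mv _] := iv.
have mG i : measurable_fun setT (G i : X -> R) by have /integrable_L1norm[] := iG i.
have H (f : X -> R) : (forall x, ~ D x -> f x = 0) ->
    L1norm mu (fun x : X => indD x * f x) = L1norm mu f.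
  move=> f0; apply: eq_integral => x _; rewrite indicE.
  have [Dx|nDx] := pselect (D x); first by rewrite mem_set// mul1r.
  by rewrite memNset// f0// mul0r.
congr (_ + _)%E.
- have -> : L1norm mu (v : X -> R) = L1norm mu (fun x : X => indD x * `|v x|).
    rewrite H; last by move=> x /z[-> _]; rewrite normr0.
    by apply: eq_integral => x _; rewrite normr_id.
  apply: lebesgue_integral_L1norm => //; first exact: measurableT_comp.
  by apply: nae_sub vu _ => x _ ->.
- rewrite -H; last by move=> x /z[_ G0]; exact: gnorm0.
  apply: lebesgue_integral_L1norm => //; first exact: measurable_gnorm.
    by move=> x; exact: gnorm_ge0.
  by apply: nae_sub gG _ => x _ ->.
Qed.

Lemma Cc_infty_W11_0 phi : Cc_infty D phi -> W11_0 D phi.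
Proof.
move=> Cphi; have bphi := borel_wgrad_Cc_infty Cphi.
have refl f : nae D (fun x => f x = f x :> R) by exists set0; split.
split; first by have [] := borel_wgrad_W11 oD bphi (refl phi).
move=> eps e0; exists phi => //.
have [_ /W11_norm_rep ->] := borel_wgrad_W11 oD (borel_wgradD bphi (borel_wgradN bphi)) (refl (phi \- phi)).
have Z (f : X -> R) : (forall x, f x = 0) -> L1norm mu f = 0%E.
  by move=> f0; rewrite /L1norm integral0_eq// => x _; rewrite f0 normr0.
rewrite !Z ?adde0 ?lte_fin// => x; last by rewrite subrr.
by apply: gnorm0 => i; rewrite subrr.
Qed.

(** Functions in [Cc_infty D] integrate by parts against every [C1b] function, wherever its support
    is, and both sides of the identity are continuous in the W11 norm. *)
Lemma W11_0_wdiff u v G : W11_0 D u -> grad_rep D u v G -> wdiff v G.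
Proof.
move=> [_ app] [bv vu gG]; have [iv iG z _] := bv; split => // phi i Cphi.
have [_ _ _ [K [K1 K2]]] := Cphi; have K0 : 0 <= K by apply: le_trans (K1 0).
have mphi := C1b_measurable Cphi; have mdphi := pderiv_measurable i Cphi.
apply/eqP; rewrite -subr_eq0 opprK -normr_le0; apply/ler_addgt0Pr => e e0; rewrite add0r.
have e1 : 0 < e / (K + K + 1) by rewrite divr_gt0// ltr_wpDl// addr_ge0.
have [psi Cpsi] := app _ e1.
have bpsi := borel_wgrad_Cc_infty Cpsi; have bw := borel_wgradD bv (borel_wgradN bpsi).
have vw : nae D (fun x => v x + - psi x = (u \- psi) x) by apply: nae_sub vu _ => x _ ->.
have [_ /W11_norm_rep ->] := borel_wgrad_W11 oD bw vw.
have [iw iH _ _] := bw; have [ip ipd _ _] := bpsi.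
set w := (fun x => v x + - psi x) in iw *; set H := (fun i x => G i x + - pderiv i psi x) in iH *.
move=> /ltW small.
have swap (f : X -> R) g : \int[mu]_x (f x * g x) = \int[mu]_x (g x * f x).
  by apply: eq_Rintegral => x _; rewrite mulrC.
have bdd (f : V -> R) (g : X -> R) : measurable_fun setT (f : X -> R) -> (forall x, `|f x| <= K) ->
   mu.-integrable setT (EFin \o g) -> mu.-integrable setT (EFin \o (fun x => g x * f x)).
  by move=> mf fK ig; apply: eq_integrable (integrable_bounded_mul mf fK ig) => // x _; rewrite /= mulrC.
have Ev : \int[mu]_x (v x * pderiv i phi x) =
    \int[mu]_x (w x * pderiv i phi x) + \int[mu]_x (psi x * pderiv i phi x).
  rewrite -RintegralD//; [|exact: bdd..].
  by apply: eq_Rintegral => x _; rewrite /w -mulrDl subrK.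
have EG : \int[mu]_x (G i x * phi x) =
    \int[mu]_x (H i x * phi x) + \int[mu]_x (pderiv i psi x * phi x).
  rewrite -RintegralD//; [|exact: (bdd _ _ mphi K1 (iH i))|exact: (bdd _ _ mphi K1 (ipd i))].
  by apply: eq_Rintegral => x _; rewrite /H -mulrDl subrK.
rewrite Ev EG (Rintegral_by_parts i (Cc_infty_C1b Cpsi) (Cc_infty_bsupp Cpsi) Cphi).
rewrite [X in `|X|](_ : _ = \int[mu]_x (w x * pderiv i phi x) + \int[mu]_x (H i x * phi x)); last by lra.
apply: le_trans (ler_normD _ _) _.
have B1 : `|\int[mu]_x (w x * pderiv i phi x)| <= K * (e / (K + K + 1)).
  rewrite swap; apply: le_trans (normr_Rintegral_mul mdphi (K2 i) iw) _; rewrite ler_wpM2l//.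
  have /integrable_L1norm[_ woo] := iw.
  rewrite -lee_fin fineK ?ge0_fin_numE ?L1norm_ge0//; apply: le_trans small.
  by rewrite leeDl// L1norm_ge0.
have B2 : `|\int[mu]_x (H i x * phi x)| <= K * (e / (K + K + 1)).
  rewrite swap; apply: le_trans (normr_Rintegral_mul mphi K1 (iH i)) _; rewrite ler_wpM2l//.
  have /integrable_L1norm[mHi Hoo] := iH i.
  have mH j : measurable_fun setT (H j : X -> R) by have /integrable_L1norm[] := iH j.
  rewrite -lee_fin fineK ?ge0_fin_numE ?L1norm_ge0//; apply: le_trans small.
  apply: le_trans (leeDr _ (L1norm_ge0 _ _)); apply: L1norm_le => //; first exact: measurable_gnorm.
  by move=> x; rewrite (ger0_norm (gnorm_ge0 H x)); exact: le_gnorm.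
apply: le_trans (lerD B1 B2) _.
rewrite -mulrDl mulrA ler_pdivrMr ?ltr_wpDl ?addr_ge0// mulrC ler_pM2l//.
by rewrite lerDl.
Qed.

End energy_representation.

(** * Removing the boundedness of v *)

Section unbounded_approx.
Context (R : realType) (n : nat).
Notation X := (borel_rV R n).
Notation V := ('rV[R]_n).
Notation mu := (@borel_lebesgue R n).
Variables (D : set V) (w b : X -> R) (p q A rho0 M Mb Cb kb : R).
Hypotheses (n0 : (0 < n)%N) (oD : open D) (bD : bounded_set D) (LD : lipschitz_domain D).
Hypotheses (mw : measurable_fun setT w) (w0 : forall x, 0 <= w x).
Hypotheses (wM : forall x, D x -> w x <= M) (p1 : 1 <= p) (pq : p <= q) (q1 : 1 < q) (A0 : 0 < A).
Hypotheses (rho0_gt0 : 0 < rho0) (wA : cube_muckenhoupt D w q A rho0).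
Hypotheses (mb : measurable_fun setT b) (b0 : forall x, 0 <= b x).
Hypotheses (bM : forall x, D x -> b x <= Mb) (Cb0 : 0 < Cb).
Hypothesis (bZ : forall (x y : V) (rho : R), D x -> D y -> 0 < rho ->
  (forall i, `|x ord0 i - y ord0 i| < rho) -> b x <= Cb * (b y + rho `^ kb)).
Hypothesis (q_le : q <= p + kb * q * Num.max 1 (p / n%:R)).
Notation indD := (\1_(D : set X) : X -> R).
Notation phase := (phase w b p q).

Let q0 : 0 < q. Proof. exact: lt_trans q1. Qed.
Let p0 : 0 < p. Proof. exact: lt_le_trans p1. Qed.

Lemma bounded_set_ball : exists2 r : R, 0 < r & forall x, ~ ball 0 r x -> ~ D x.
Proof.
case: bD => K [Kr HK]; exists (`|K| + 2); first by rewrite ltr_wpDl.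
move=> x nx Dx; apply: nx; rewrite -ball_normE /= sub0r normrN.
apply: (@le_lt_trans _ _ (`|K| + 1)); last by rewrite ltrD2l ltr1n.
by apply: (HK (`|K| + 1)) => //; rewrite (le_lt_trans (ler_norm _))// ltrDl.
Qed.

Lemma bounded_set_lty : (mu (D : set X) < +oo)%E.
Proof.
have [r r0 H] := bounded_set_ball; apply: (@le_lt_trans _ _ (mu (ball (0 : V) r : set X))).
  apply: le_measure; rewrite ?inE; [exact: open_borel|exact: measurable_ball_rV|].
  by move=> x Dx; apply: contrapT => /H.
by rewrite borel_lebesgue_ball// ltry.
Qed.

Lemma phase_scale x (t s : R) : 0 <= t <= 1 -> phase x (t * s) <= t * phase x s.
Proof.
move=> /andP[t0 t1]; rewrite /phase normrM (ger0_norm t0) mulrDr.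
have tr (r : R) : 1 <= r -> t `^ r <= t.
  move=> r1; have [->|tn0] := eqVneq t 0; first by rewrite powR0// gt_eqF// (lt_le_trans _ r1).
  rewrite -[leRHS]powRr1//; apply: ger_powR => //.
  by rewrite t1 andbT lt_neqAle eq_sym tn0.
apply: lerD; first by rewrite powRM// ler_wpM2r ?powR_ge0// tr.
have -> : b x * (t * `|s|) = t * (b x * `|s|) by rewrite mulrCA.
rewrite powRM ?mulr_ge0//; have := powR_ge0 (b x * `|s|) q.
have core (a y z : R) : 0 <= a -> y <= t -> 0 <= z -> a * (y * z) <= t * (a * z).
  by move=> a0 yt z0; rewrite [leRHS]mulrCA ler_wpM2l// ler_wpM2r.
by apply: core => //; apply: tr; exact: ltW.
Qed.

(** The gradient of [k sin (v / k)] differs from [G] by the factor [cos (v / k) - 1], which is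
    bounded and tends to 0 pointwise; the energy of [2 G] is the integrable majorant. *)
Lemma unbounded_approx v (G : 'I_n -> V -> R) : wdiff v G ->
  (forall y, ~ D y -> v y = 0) -> (forall i y, ~ D y -> G i y = 0) ->
  (forall i, (L1norm mu (fun y : X => phase y (G i y)) < +oo)%E) ->
  forall eps : R, 0 < eps -> exists2 phi, Cc_infty D phi &
    forall i, (L1norm mu (fun y : X => indD y * phase y (pderiv i phi y - G i y))%R <= eps%:E)%E.
Proof.
move=> wv vD GD Goo eps e0; have [iv iG _] := wv.
have mG i : measurable_fun setT (G i : X -> R) by have /integrable_L1norm[] := iG i.
have /integrable_L1norm[mv _] := iv.
have bv : bsupp v by have [r r0 H] := bounded_set_ball; exists r => // x /H; exact: vD.
pose K2 : R := 2 `^ (q - 1); have K20 : 0 < K2 by rewrite powR_gt0.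
pose e1 := eps / (K2 + K2); have e10 : 0 < e1 by rewrite divr_gt0// addr_gt0.
pose Gk (k : nat) i x := cos (v x / k.+1%:R) * G i x.
have mGk k i : measurable_fun setT (Gk k i : X -> R).
  apply: measurable_funM => //; apply: (measurableT_comp (continuous_measurable_fun (@continuous_cos R))).
  exact: measurable_funM.
(* Half of the distance of the cosine to 1 lies between 0 and 1, so [phase_scale] can pull it out of
   the integrand as a linear factor. *)
pose th (k : nat) x := `|cos (v x / k.+1%:R) - 1| / 2.
have th01 k x : 0 <= th k x <= 1.
  rewrite /th divr_ge0//= ler_pdivrMr// mul1r; apply: le_trans (ler_normB _ _) _.
  by rewrite normr1 -[leRHS]/(1 + 1) lerD2r cos_max.
have GkE k i x : phase x (Gk k i x - G i x) <= th k x * phase x (2 * G i x).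
  apply: le_trans (phase_scale x (2 * G i x) (th01 k x)).
  apply: phase_le => //; rewrite /Gk -{2}[G i x]mul1r -mulrBl.
  have core (c g : R) : `|c * g| <= `| `|c| / 2 * (2 * g)|.
    rewrite (_ : `|c| / 2 * (2 * g) = `|c| * g); last by lra.
    by rewrite !normrM normr_id.
  exact: core.
have [k Hk] : exists k, forall i, (L1norm mu (fun y : X => phase y (Gk k i y - G i y)%R) <= e1%:E)%E.
  have : \forall k \near \oo, forall i : 'I_n, (L1norm mu (fun y : X => phase y (Gk k i y - G i y)%R) <= e1%:E)%E.
    apply: filter_forall => i.
    apply: (@dominated_L1norm_near _ _ _ mu _ (fun y => K2 * (phase y (G i y) + phase y (G i y)))) => //.
    - move=> k; apply: measurable_phase => //; exact: measurable_funB.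
    - apply: integrable_mulr; have iph : mu.-integrable setT (EFin \o (fun y : X => phase y (G i y))).
        by apply/integrable_L1norm; split; [exact: measurable_phase|exact: Goo].
      exact: integrable_addr.
    - move=> k x; rewrite ger0_norm ?phase_ge0//; apply: le_trans (GkE k i x) _.
      have /andP[_ t1] := th01 k x.
      apply: (@le_trans _ _ (phase x (2 * G i x))); first by rewrite ler_piMl// phase_ge0.
      apply: phase_add => //; rewrite normrM ger0_norm//.
      by rewrite -[X in X <= _]/((1 + 1) * `|G i x|) mulrDl mul1r.
    - move=> x; have cv : (fun k : nat => `|v x| / 2 * phase x (2 * G i x) * k.+1%:R^-1) @ \oo --> (0 : R).
        rewrite -[X in _ --> X](mulr0 (`|v x| / 2 * phase x (2 * G i x))).
        exact: (cvgM (cvg_cst _) (@cvg_harmonic R)).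
      apply: (squeeze_cvgr _ (cvg_cst 0) cv); near=> k.
      rewrite phase_ge0//=; apply: le_trans (GkE k i x) _.
      have -> : `|v x| / 2 * phase x (2 * G i x) / k.+1%:R = `|v x| / k.+1%:R / 2 * phase x (2 * G i x).
        have core (c d f : R) : c / 2 * f * d = c * d / 2 * f by lra.
        exact: core.
      rewrite ler_wpM2r ?phase_ge0//.
      rewrite /th ler_wpM2r//; rewrite -[X in _ - X](cos0 R).
      apply: le_trans (cos_lipschitz _ _) _; rewrite subr0 normrM (@ger0_norm _ (k.+1%:R^-1))// invr_ge0.
  by move=> [k _ Hk]; exists k; apply: Hk => /=.
have k0 : 0 < k.+1%:R :> R by rewrite ltr0n.
have wk := wdiff_sin k0 wv bv.
have Gkoo i : (L1norm mu (fun y : X => phase y (Gk k i y)) < +oo)%E.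
  apply: le_lt_trans (Goo i); apply: L1norm_le; [exact: measurable_phase..|].
  move=> x; rewrite !ger0_norm ?phase_ge0//; apply: phase_le => //.
  by rewrite normrM ler_piMl// cos_max.
have vkD y : ~ D y -> k.+1%:R * sin (v y / k.+1%:R) = 0 by move=> /vD ->; rewrite mul0r sin0 mulr0.
have GkD i y : ~ D y -> cos (v y / k.+1%:R) * G i y = 0 by move=> /GD ->; rewrite mulr0.
have vkB y : `|k.+1%:R * sin (v y / k.+1%:R)| <= k.+1%:R.
  by rewrite normrM (ger0_norm (ltW k0)) ler_piMr ?sin_max// ltW.
have [phi Cphi Hphi] := core_approx n0 oD bD LD mw w0 wM p1 pq q1 A0 bounded_set_lty rho0_gt0 wA mb b0 bM Cb0 bZ q_le
  wk vkB vkD GkD Gkoo e10.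
exists phi => // i.
have mpd : measurable_fun setT (pderiv i phi : X -> R) by apply: pderiv_measurable; exact: Cc_infty_C1b Cphi.
have mD : measurable_fun setT indD by apply: measurable_indic; exact: open_borel.
have -> : eps = K2 * (e1 + e1).
  rewrite -[LHS](divfK (lt0r_neq0 (addr_gt0 K20 K20))) -/e1; lra.
apply: (@L1norm_scale_add R n K2 e1 (fun y : X => indD y * phase y (pderiv i phi y - Gk k i y))
  (fun y : X => phase y (Gk k i y - G i y))) => //; first exact: ltW.
- by apply: measurable_funM => //; apply: measurable_phase => //; exact: measurable_funB.
- by apply: measurable_phase => //; exact: measurable_funB.
- by apply: measurable_funM => //; apply: measurable_phase => //; exact: measurable_funB.
- move=> x; have tri : phase x (pderiv i phi x - G i x) <=
      K2 * (phase x (pderiv i phi x - Gk k i x) + phase x (Gk k i x - G i x)).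
    by apply: (phase_add w0 p1 pq q1 b0); rewrite -[X in `|X|](subrKA (Gk k i x)) ler_normD.
  have core (a c d k2 : R) : 0 <= a -> 0 <= c -> 0 <= d -> 0 < k2 -> a <= k2 * (c + d) -> forall z : bool,
     `|z%:R * a| <= `|k2 * (z%:R * c)| + `|k2 * d|.
    move=> a0 c0 d0 k20 H [].
      by rewrite !mul1r (ger0_norm a0) !ger0_norm ?mulr_ge0 ?(ltW k20)// -mulrDr.
    by rewrite !mul0r normr0 addr_ge0.
  by rewrite indicE; apply: core => //; exact: phase_ge0.
Unshelve. all: by end_near. Qed.
End unbounded_approx.

(** * Recovery sequences *)

Section recovery.
Context (R : realType) (n : nat).
Notation X := (borel_rV R n).
Notation V := ('rV[R]_n).
Notation mu := (@borel_lebesgue R n).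
Variables (D : set V) (w b abar : X -> R) (p q A rho0 M Mb Cb kb c : R).
Hypotheses (n0 : (0 < n)%N) (oD : open D) (bD : bounded_set D) (LD : lipschitz_domain D).
Hypotheses (mw : measurable_fun setT w) (w0 : forall x, 0 <= w x).
Hypotheses (wM : forall x, D x -> w x <= M) (p1 : 1 <= p) (pq : p <= q) (q1 : 1 < q) (A0 : 0 < A).
Hypotheses (rho0_gt0 : 0 < rho0) (wA : cube_muckenhoupt D w q A rho0).
Hypotheses (mb : measurable_fun setT b) (b0 : forall x, 0 <= b x).
Hypotheses (bM : forall x, D x -> b x <= Mb) (Cb0 : 0 < Cb).
Hypothesis (bZ : forall (x y : V) (rho : R), D x -> D y -> 0 < rho ->
  (forall i, `|x ord0 i - y ord0 i| < rho) -> b x <= Cb * (b y + rho `^ kb)).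
Hypothesis (q_le : q <= p + kb * q * Num.max 1 (p / n%:R)).
Hypotheses (mat : measurable_fun setT abar) (at0 : forall x, 0 <= abar x) (c1 : 1 <= c).
Hypotheses (at_le : forall x, abar x <= w x * b x `^ q) (le_at : forall x, w x * b x `^ q <= c * abar x).
Notation indD := (\1_(D : set X) : X -> R).
Notation wphase := (phase w b p q).
Notation phase1 := (phase abar (fun=> 1) p q).
Implicit Types (G H : 'I_n -> V -> R).

Let q0 : 0 < q. Proof. exact: lt_trans q1. Qed.
Let p0 : 0 < p. Proof. exact: lt_le_trans p1. Qed.

Lemma phase1_ge0 x s : 0 <= phase1 x s. Proof. exact: phase_ge0. Qed.

Lemma phase_le_phase1 x s : wphase x s <= c * phase1 x s.
Proof.
rewrite /phase mulrDr; apply: lerD; first by rewrite ler_peMl ?powR_ge0.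
by rewrite powRM// mul1r !mulrA ler_wpM2r ?powR_ge0.
Qed.

Lemma phase1_le_phase x s : phase1 x s <= wphase x s.
Proof.
by rewrite /phase lerD2l mul1r powRM// mulrA ler_wpM2r ?powR_ge0.
Qed.

Lemma phase_sum x (I : Type) (r : seq I) (f : I -> R) :
  wphase x (\sum_(i <- r) `|f i|) <= (2 `^ (q - 1)) ^+ size r * \sum_(i <- r) wphase x (f i).
Proof.
have K1 : 1 <= 2 `^ (q - 1) :> R by rewrite -[leLHS](powRr0 (2 : R)) ler_powR ?subr_ge0 ?(ltW q1)//; lra.
have K0 : 0 <= 2 `^ (q - 1) :> R by exact: powR_ge0.
set K : R := 2 `^ (q - 1) in K0 K1 *.
elim: r => [|i r IH]; first by rewrite !big_nil mulr0 phase0.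
rewrite !big_cons /= exprS; set S := \sum_(j <- r) `|f j| in IH *.
have tri : wphase x (`|f i| + S) <= K * (wphase x (f i) + wphase x S).
  by apply: (phase_add w0 p1 pq q1 b0); rewrite (le_trans (ler_normD _ _))// normr_id.
apply: le_trans tri _; have P0 : 0 <= wphase x (f i) by exact: phase_ge0.
set T := \sum_(j <- r) wphase x (f j) in IH *.
have Km : 1 <= K ^+ size r by exact: exprn_ege1.
rewrite -mulrA ler_wpM2l// mulrDr lerD//.
by rewrite ler_peMl// phase_ge0.
Qed.

(** With [b = 1] and weight [abar], [phase] is the original integrand; the approximation uses the
    comparable [wphase]. *)
Definition total_energy G := L1norm mu (fun x : X => indD x * phase1 x (gnorm G x)).

Let mD : measurable_fun setT indD.
Proof. by apply: measurable_indic; exact: open_borel. Qed.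

Lemma measurable_total_energy G : (forall i, measurable_fun setT (G i : X -> R)) ->
  measurable_fun setT (fun x : X => indD x * phase1 x (gnorm G x)).
Proof.
move=> mG; apply: measurable_funM => //; apply: measurable_phase => //.
exact: measurable_gnorm.
Qed.

Lemma total_energy_ge0 G x : 0 <= indD x * phase1 x (gnorm G x).
Proof. by rewrite mulr_ge0// phase1_ge0. Qed.

Lemma gnormN G x : gnorm (fun i y => - G i y) x = gnorm G x.
Proof. by congr Num.sqrt; apply: eq_bigr => i _; rewrite !mxE sqrrN. Qed.

Lemma L1norm_sum (I : Type) (r : seq I) (f : I -> X -> R) : (forall i, measurable_fun setT (f i)) ->
  (L1norm mu (fun x => \sum_(i <- r) f i x)%R <= \sum_(i <- r) L1norm mu (f i))%E.
Proof.
move=> mf; elim: r => [|i r IH].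
  rewrite big_nil /L1norm integral0_eq// => x _; by rewrite big_nil normr0.
rewrite big_cons; apply: le_trans (leeD2l _ IH); apply: L1norm_triangle => //.
- exact: measurable_sum.
- exact: measurable_sum.
- by move=> x; rewrite big_cons ler_normD.
Qed.

(** The Euclidean norm is at most the sum of the components, and each added component costs one
    factor of the quasi-triangle inequality. *)
Lemma total_energy_le_sum H (e : R) : (forall i, measurable_fun setT (H i : X -> R)) ->
  (forall i, (L1norm mu (fun x : X => indD x * wphase x (H i x))%R <= e%:E)%E) ->
  (total_energy H <= ((2 `^ (q - 1)) ^+ n * (e *+ n))%:E)%E.
Proof.
move=> mH He; set K : R := (2 `^ (q - 1)) ^+ n.
have K0 : 0 <= K by rewrite exprn_ge0 ?powR_ge0.
have mf i : measurable_fun setT (fun x : X => indD x * wphase x (H i x)).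
  by apply: measurable_funM => //; exact: measurable_phase.
apply: (@le_trans _ _ (L1norm mu (fun x : X => K * \sum_i (indD x * wphase x (H i x))))).
  apply: L1norm_le.
  - exact: measurable_total_energy.
  - by apply: measurable_funM => //; exact: measurable_sum.
  - move=> x; have S0 : 0 <= \sum_i (indD x * wphase x (H i x)).
      by apply: sumr_ge0 => i _; rewrite mulr_ge0// phase_ge0.
    rewrite (ger0_norm (total_energy_ge0 H x)) (ger0_norm (mulr_ge0 K0 S0)).
    rewrite -mulr_sumr mulrCA ler_wpM2l//.
    apply: le_trans (phase1_le_phase _ _) _.
    have := phase_sum x (index_enum 'I_n) (fun i => H i x).
    rewrite -[size _]/(size (index_enum 'I_n)) (_ : size (index_enum 'I_n) = n); last first.
      by rewrite -[LHS]/(size (Finite.enum _)) -enumT size_enum_ord.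
    apply: le_trans; apply: phase_le => //; rewrite (ger0_norm (gnorm_ge0 H x)).
    by apply: le_trans (gnorm_le_sum H x) _; exact: ler_norm.
rewrite L1normZ; last exact: measurable_sum.
rewrite (ger0_norm K0) EFinM lee_wpmul2l ?lee_fin//.
apply: le_trans (L1norm_sum _ mf) _.
apply: (@le_trans _ _ (\sum_(i < n) e%:E)%E); first by apply: lee_sum => i _; exact: He.
by rewrite sumEFin sumr_const card_ord.
Qed.

(** Convexity is applied to the original integrand, so the leading factor stays near 1;
    comparability constants only multiply the error, which can be made arbitrarily small. *)
Lemma recovery v G0 G : (forall i, measurable_fun setT (G0 i : X -> R)) -> wdiff v G ->
  (forall y, ~ D y -> v y = 0) -> (forall i y, ~ D y -> G i y = 0) ->
  (total_energy G0 < +oo)%E -> (total_energy (fun i y => G0 i y + G i y)%R < +oo)%E ->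
  forall tau : R, 0 < tau -> exists2 phi, Cc_infty D phi &
    (total_energy (fun i y => G0 i y + pderiv i phi y)%R <=
     (1 + tau)%:E * total_energy (fun i y => G0 i y + G i y)%R + tau%:E)%E.
Proof.
move=> mG0 wv vD GD E0 E1 tau tau0; have [iv iG _] := wv.
have mG i : measurable_fun setT (G i : X -> R) by have /integrable_L1norm[] := iG i.
pose G1 i y := G0 i y + G i y.
have mG1 i : measurable_fun setT (G1 i : X -> R) by exact: measurable_funD.
pose K : R := 2 `^ (q - 1); have K0 : 0 < K by rewrite powR_gt0.
have w10 : forall x : X, 0 <= (fun=> 1) x :> R by [].
(* [G] is the difference of the fields [G1] and [G0], both of finite energy. *)
have Goo i : (L1norm mu (fun y : X => wphase y (G i y)) < +oo)%E.
  pose F x := indD x * phase1 x (gnorm G1 x) + indD x * phase1 x (gnorm G0 x).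
  have iF : mu.-integrable setT (EFin \o (fun x => c * K * F x)).
    have i1 : mu.-integrable setT (EFin \o (fun x : X => indD x * phase1 x (gnorm G1 x))).
      by apply: (integrable_L1norm mu _).2; split; [exact: measurable_total_energy|exact: E1].
    have i0 : mu.-integrable setT (EFin \o (fun x : X => indD x * phase1 x (gnorm G0 x))).
      by apply: (integrable_L1norm mu _).2; split; [exact: measurable_total_energy|exact: E0].
    exact: (integrable_mulr (c * K) (integrable_addr i1 i0)).
  have /integrable_L1norm[mF Foo] := iF; apply: le_lt_trans Foo.
  apply: L1norm_le => //; first exact: measurable_phase.
  move=> x; have F0 : 0 <= c * K * F x.
    by rewrite mulr_ge0 ?addr_ge0 ?total_energy_ge0// mulr_ge0 ?(ltW K0)// (le_trans _ c1).
  rewrite (ger0_norm F0) ger0_norm; last exact: phase_ge0.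
  have [Dx|nDx] := pselect (D x); last by rewrite GD// phase0.
  have iD : indD x = 1 by rewrite indicE mem_set.
  rewrite /F iD !mul1r.
  have gle : gnorm G x <= gnorm G1 x + gnorm G0 x.
    rewrite -(gnormN G0); have := gnormD G1 (fun i y => - G0 i y) x; apply: le_trans.
    by rewrite /gnorm le_eqVlt; apply/orP; left; apply/eqP; congr enorm;
      apply/rowP => j; rewrite !mxE /G1 addrC addKr.
  apply: le_trans (phase_le_phase1 _ _) _; rewrite -mulrA ler_wpM2l ?(le_trans _ c1)//.
  apply: (phase_add at0 p1 pq q1 w10).
  rewrite (ger0_norm (gnorm_ge0 G1 x)) (ger0_norm (gnorm_ge0 G0 x)).
  by apply: le_trans gle; exact: le_gnorm.
have q10 : 0 < q - 1 by rewrite subr_gt0.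
have t1 : 0 < 1 + tau by rewrite addr_gt0.
(* Solves [(1 - l)^(1 - q) = 1 + tau]. *)
pose l : R := 1 - (1 + tau) `^ (- (q - 1)^-1).
have onel : 1 - l = (1 + tau) `^ (- (q - 1)^-1) by rewrite opprB addrC subrK.
have l01 : 0 < l < 1.
  rewrite /l subr_gt0 ltrBlDr ltrDl powR_gt0// andbT.
  rewrite powRN invf_lt1 ?powR_gt0//; have E : 1 `^ (q - 1)^-1 = 1 :> R by rewrite powR1.
  by rewrite -[ltLHS]E; apply: gt0_ltr_powR; rewrite ?invr_gt0 ?nnegrE ?(ltW t1)// ltrDl.
have el : (1 - l) `^ (1 - q) = 1 + tau.
  rewrite onel -powRrM -[1 - q]opprB mulrNN mulVf ?gt_eqF// powRr1// ltW//.
have /andP[l0 _] := l01.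
pose L : R := l `^ (1 - q); have L0 : 0 < L by rewrite powR_gt0.
(* Total amplification of the error in one component: [K ^+ n * n%:R] from collecting components,
   [L] from convexity. *)
pose N : R := L * (K ^+ n * n%:R).
have N0 : 0 < N by rewrite !mulr_gt0 ?exprn_gt0// ltr0n.
pose eps := tau / N; have eps0 : 0 < eps by rewrite divr_gt0.
have [phi Cphi Hphi] := unbounded_approx n0 oD bD LD mw w0 wM p1 pq q1 A0 rho0_gt0 wA mb b0 bM Cb0 bZ q_le
  wv vD GD Goo eps0.
exists phi => //.
have mpd i : measurable_fun setT (pderiv i phi : X -> R) by apply: pderiv_measurable; exact: Cc_infty_C1b Cphi.
pose H i y := pderiv i phi y - G i y; pose G2 i y := G0 i y + pderiv i phi y.
have mH i : measurable_fun setT (H i : X -> R) by exact: measurable_funB.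
have mG2 i : measurable_fun setT (G2 i : X -> R) by exact: measurable_funD.
have EH := total_energy_le_sum mH Hphi.
have m1 := measurable_total_energy mG1; have mh := measurable_total_energy mH.
apply: (@le_trans _ _ (L1norm mu (fun x : X => (1 + tau) * (indD x * phase1 x (gnorm G1 x)))%R +
    L1norm mu (fun x : X => L * (indD x * phase1 x (gnorm H x)))%R)%E).
  have m1t := measurable_funM (measurable_cst (1 + tau)) m1.
  have mhL := measurable_funM (measurable_cst L) mh.
  apply: (L1norm_triangle mu m1t mhL (measurable_total_energy mG2)).
  move=> x.
  have gle : gnorm G2 x <= gnorm G1 x + gnorm H x.
    have := gnormD G1 H x; apply: le_trans.
    by rewrite /gnorm le_eqVlt; apply/orP; left; apply/eqP; congr enorm;
      apply/rowP => j; rewrite !mxE /G1 /H /G2 addrACA subrr addr0.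
  have := phase_split at0 p1 pq q1 w10 x l01 (_ : `|gnorm G2 x| <= `|gnorm G1 x| + `|gnorm H x|).
  rewrite (ger0_norm (gnorm_ge0 G1 x)) (ger0_norm (gnorm_ge0 G2 x)) (ger0_norm (gnorm_ge0 H x)).
  move=> /(_ gle); rewrite el -/L.
  have core (i r s t y z : R) : 0 <= i -> 0 <= r -> 0 <= t -> 0 <= y -> 0 <= s -> 0 <= z ->
      y <= r * s + t * z -> `|i * y| <= `|r * (i * s)| + `|t * (i * z)|.
    move=> i0 r0 t0 y0 s0 z0 h; rewrite !ger0_norm ?mulr_ge0//.
    by rewrite !(mulrCA _ i) -mulrDr ler_wpM2l.
  by apply: core; rewrite ?(ltW t1) ?(ltW L0) ?phase1_ge0.
have LZ (r : R) (f : X -> R) : 0 <= r -> measurable_fun setT f ->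
    (L1norm mu (fun x => r * f x)%R <= r%:E * L1norm mu f)%E.
  by move=> r0 mf; rewrite L1normZ// ger0_norm.
apply: leeD; first exact: LZ (ltW t1) m1.
apply: le_trans (LZ _ _ (ltW L0) mh) _.
apply: (@le_trans _ _ (L%:E * ((K ^+ n * (eps *+ n))%:E))%E).
  by rewrite lee_wpmul2l ?lee_fin ?(ltW L0).
rewrite -EFinM lee_fin -mulr_natr.
have -> : L * (K ^+ n * (eps * n%:R)) = eps * N.
  by rewrite /N [RHS]mulrCA; congr (L * _); rewrite [RHS]mulrCA.
by rewrite divfK// gt_eqF.
Qed.

End recovery.

Section main.
Context (R : realType) (n : nat).
Notation X := (borel_rV R n).
Notation V := ('rV[R]_n).
Notation mu := (@borel_lebesgue R n).
Notation nae := (@nae _ X R mu).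
Implicit Types (D : set V).

Lemma nae_subset D D' (P : X -> Prop) : D' `<=` D -> nae D P -> nae D' P.
Proof. by move=> sD [N [mN N0 H]]; exists N; split => // x /sD; exact: H. Qed.

(* The clamped representative satisfies the comparison with t everywhere. *)
Lemma comparable_representative D (a t : V -> R) (c : R) : open D -> 1 <= c ->
  measurable_fun setT (t : X -> R) -> (forall x, 0 <= t x) -> lebesgue_measurable_fun D a ->
  nae D (fun x => a x <= t x /\ t x <= c * a x) ->
  exists abar : V -> R, [/\ measurable_fun setT (abar : X -> R), forall x, 0 <= abar x,
    nae D (fun x => a x = abar x), forall x, abar x <= t x & forall x, t x <= c * abar x].
Proof.
move=> oD c1 mt t0 ma at_t; have c0 : 0 < c by apply: lt_le_trans c1.
have [g [mg ga _]] := lebesgue_representative oD ma.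
have tc x : t x / c <= t x by rewrite ler_pdivrMr// ler_peMr.
pose h x := Num.min (t x) (Num.max (g x) (t x / c)).
have hc x : t x / c <= h x by rewrite /h le_min tc le_max lexx orbT.
exists h; split.
- apply: measurable_minr => //; apply: measurable_maxr => //.
  exact: measurable_funM.
- by move=> x; apply: le_trans (hc x); rewrite divr_ge0// ltW.
- apply: nae_sub (nae_and ga at_t) _ => x _ [E [h1 h2]].
  rewrite /h E max_l ?min_r//.
  by rewrite ler_pdivrMr// mulrC.
- by move=> x; rewrite /h ge_min lexx.
- by move=> x; rewrite mulrC -ler_pdivrMr.
Qed.

Lemma energy_rep D (p q : R) (a abar u v : V -> R) (G : 'I_n -> V -> R) : open D ->
  measurable_fun setT (abar : X -> R) -> (forall x, 0 <= abar x) -> nae D (fun x => a x = abar x) ->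
  grad_rep D u v G -> energy p q a D u = total_energy D abar p q G.
Proof.
move=> oD mat at0 aE [[iv iG z _] _ gG].
have mG i : measurable_fun setT (G i : X -> R) by have /integrable_L1norm[] := iG i.
apply: lebesgue_integral_L1norm => //.
- by apply: measurable_phase => //; exact: measurable_gnorm.
- by move=> x; exact: phase_ge0.
- apply: nae_sub (nae_and aE gG) _ => x _ [-> ->].
  by rewrite /phase (ger0_norm (gnorm_ge0 G x)) mul1r.
Qed.

End main.

Theorem theorem2 (R : realType) (N : nat) (N_gt0 : (0 < N)%N)
    (Omega U : set 'rV[R]_N)
    (Omega_open : open Omega) (Omega_bounded : bounded_set Omega)
    (Omega_lipschitz : lipschitz_domain Omega)
    (U_open : open U) (Omega_U : compactly_contained Omega U)
    (kappa p q : R) (kappa_gt0 : 0 < kappa)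
    (p_ge1 : 1 <= p) (p_le_q : p <= q)
    (q_le : q <= p + kappa * Num.max 1 (p / N%:R)) (q_gt1 : 1 < q)
    (a sigma omega : 'rV[R]_N -> R)
    (a_ge0 : forall x, Omega x -> 0 <= a x)
    (a_measurable : lebesgue_measurable_fun Omega a)
    (a_eq : forall x, Omega x -> a x = sigma x * omega x)
    (sigma_Z : Zclass kappa Omega sigma)
    (omega_A : Muckenhoupt q U omega)
    (omega_bounded : ess_bounded Omega omega)
    (u0 : 'rV[R]_N -> R) (u0_W11 : W11 Omega u0)
    (u0_energy : (energy p q a Omega u0 < +oo)%E) :
  ereal_inf [set energy p q a Omega (u0 \+ v) | v in W11_0 Omega] =
  ereal_inf [set energy p q a Omega (u0 \+ phi) | phi in Cc_infty Omega].
Proof.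
have q0 : 0 < q by apply: lt_trans q_gt1.
have OU : Omega `<=` U by move=> x Ox; have [_] := Omega_U; apply; exact: subset_closure.
have [w [M [A [rho0 [[mw w0 wM wE] [A0 rho00 wA]]]]]] :=
  muckenhoupt_cube Omega_open U_open Omega_U q_gt1 omega_A omega_bounded.
have [b [Mb [Cb [c [[mb b0 bM Cb0 c0] [bZ bs]]]]]] :=
  Zclass_root Omega_bounded kappa_gt0 q_gt1 sigma_Z.
have mt : measurable_fun setT (fun x : borel_rV R N => w x * b x `^ q).
  by apply: measurable_funM => //; exact: (measurableT_comp (measurable_powR _)).
have t0 x : 0 <= w x * b x `^ q by rewrite mulr_ge0 ?powR_ge0.
(* [c] is only known to be nonnegative, while clamping between [t / c] and [t] requires a constant
   at least 1. *)
have c1 : 1 <= c + 1 by rewrite lerDr.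
have [|abar [mat at0 aE at1 at2]] := comparable_representative Omega_open c1 mt t0 a_measurable.
  apply: nae_sub (nae_subset OU wE) _ => x Ox E; have [s1 s2] := bs x Ox.
  rewrite (a_eq x Ox) E; split; first by rewrite mulrC ler_wpM2l.
  have h : w x * b x `^ q <= w x * (c * sigma x) by rewrite ler_wpM2l.
  have h' : 0 <= sigma x * w x by rewrite -E -(a_eq x Ox) a_ge0.
  apply: le_trans h _; lra.
(* [b] has exponent [kappa / q], so after taking the q-th power the gap is governed by [kappa]
   again. *)
have kq : kappa / q * q = kappa by rewrite divfK// gt_eqF.
rewrite -kq in q_le.
have [v0 [G0 rep0]] := grad_rep_exists Omega_open u0_W11.
have [bv0 v0u _] := rep0.
have ErepD (v v' : 'rV[R]_N -> R) G : borel_wgrad Omega v G -> nae (@borel_lebesgue R N) Omega (fun x => v x = v' x) ->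
    energy p q a Omega (u0 \+ v') = total_energy Omega abar p q (fun i y => G0 i y + G i y).
  move=> bv vv; have vE : nae (@borel_lebesgue R N) Omega (fun x => v0 x + v x = (u0 \+ v') x).
    by apply: nae_sub (nae_and v0u vv) _ => x _ [/= -> ->].
  have [_ rep] := borel_wgrad_W11 Omega_open (borel_wgradD bv0 bv) vE.
  exact: (energy_rep p q Omega_open mat at0 aE rep).
apply/eqP; rewrite eq_le; apply/andP; split.
  apply: le_ereal_inf_tmp => _ [phi Cphi <-]; apply: ereal_inf_lbound.
  by exists phi => //; exact: Cc_infty_W11_0.
apply: le_ereal_inf_tmp => _ [v Wv <-].
have [v1 [G repv]] := grad_rep_exists Omega_open Wv.1.
have wv := W11_0_wdiff Omega_open Wv repv; have [bv vv _] := repv.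
have Ev := ErepD _ _ _ bv vv.
have [Eoo|] := ltP (energy p q a Omega (u0 \+ v)) +oo%E; last by rewrite leye_eq => /eqP ->; rewrite leey.
have mG0 i : measurable_fun setT (G0 i : borel_rV R N -> R).
  by have [_ iG0 _ _] := bv0; have /integrable_L1norm[] := iG0 i.
have [_ _ z _] := bv.
have E0oo : (total_energy Omega abar p q G0 < +oo)%E.
  by rewrite -(energy_rep p q Omega_open mat at0 aE rep0).
have E1oo := Eoo; rewrite Ev in E1oo.
have E1_0 : (0 <= energy p q a Omega (u0 \+ v)%R)%E by rewrite Ev L1norm_ge0.
have Efin : energy p q a Omega (u0 \+ v) \is a fin_num by rewrite ge0_fin_numE.
set r := fine (energy p q a Omega (u0 \+ v)).
have r0 : 0 <= r by exact: fine_ge0.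
have r1 : 0 < r + 1 by rewrite ltr_wpDl.
apply/lee_addgt0Pr => e e0.
(* With this value, [tau * r + tau] is exactly [e]. *)
have tau0 : 0 < e / (r + 1) by rewrite divr_gt0.
have [phi Cphi Hphi] := recovery N_gt0 Omega_open Omega_bounded Omega_lipschitz mw w0 wM p_ge1 p_le_q q_gt1 A0
  rho00 wA mb b0 bM Cb0 bZ q_le mat at0 c1 at1 at2 mG0 wv (fun y nOy => (z y nOy).1) (fun i y nOy => (z y nOy).2 i)
  E0oo E1oo tau0.
apply: (@le_trans _ _ (energy p q a Omega (u0 \+ phi))).
  by apply: ereal_inf_lbound; exists phi.
rewrite (ErepD _ _ _ (borel_wgrad_Cc_infty Cphi)); last by exists set0; split.
apply: le_trans Hphi _; rewrite -Ev -(fineK Efin) -/r -EFinM -!EFinD lee_fin.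
by rewrite mulrDl mul1r -addrA lerD2l -[X in _ * _ + X]mulr1 -mulrDr divfK ?gt_eqF.
Qed.
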